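(* Let $\mathbf g\in C^2(\mathcal U,\mathbb R^m)$ and let $\mathbf u$ be an entropy solution of $\partial_t\mathbf u+\partial_x\mathbf g(\mathbf u)=0$ on $(0,T)\times\mathbb T$, $\mathbf u(0,\cdot)=\mathbf u_0$ (periodic boundary conditions). Let $\hat{\mathbf u}^{st}$ be the space-time reconstruction of a fully discrete DG scheme $\{\mathbf u_h^n\}_{n=0}^N$. Provided $\mathbf u$ takes only values in $\mathfrak K$, for $n=0,\dots,N$ the error between $\mathbf u_h^n$ and $\mathbf u(t_n,\cdot)$ satisfies $$\|\mathbf u(t_n,\cdot)-\mathbf u_h^n\|_{L_2(\mathbb T)}^2\le 2\|\hat{\mathbf u}^{st}(t_n,\cdot)-\mathbf u_h^n\|_{L_2(\mathbb T)}^2+2C_{\underline\eta}^{-1}\Big(\|\mathbf R^{st}\|_{L_2((0,t_n)\times\mathbb T)}^2+C_{\overline\eta}\|\mathbf u_0-\hat{\mathbf u}^{st}(0,\cdot)\|_{L_2(\mathbb T)}^2\Big)\exp\Big(\int_0^{t_n}\frac{C_{\overline\eta}C_{\overline{\mathbf g}}\|\partial_x\hat{\mathbf u}^{st}(s,\cdot)\|_{L_\infty(\mathbb T)}+C_{\overline\eta}^2}{C_{\underline\eta}}\,ds\Big),$$ where $\mathbf R^{st}:=\partial_t\hat{\mathbf u}^{st}+\partial_x\mathbf g(\hat{\mathbf u}^{st})$.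
   Context: Conservation law: $\mathcal U\subset\mathbb R^m$ open, $\mathbb T$ the flat one-dimensional torus ($[-1,1]$ with endpoints identified), $\mathbf g\in C^2(\mathcal U,\mathbb R^m)$, $\mathbf u_0:\mathbb T\to\mathcal U$. There is a strictly convex entropy $\eta$ with entropy flux $Q$, i.e. $\eta,Q\in C^1(\mathcal U,\mathbb R)$ with $(\mathrm D\eta)\mathrm D\mathbf g=\mathrm DQ$. An entropy solution is a weak solution $\mathbf u\in L_\infty((0,T)\times\mathbb T,\mathcal U)$ that weakly satisfies $\partial_t\eta(\mathbf u)+\partial_xQ(\mathbf u)\le0$. DG scheme: decompositions $-1=x_0<\dots<x_M=1$ (with $x_0,x_M$ identified) and $0=t_0<\dots<t_N=T$; $h$ is the maximal spatial mesh size. $\mathbb V_q^s$ is the space of functions $[x_0,x_M]\to\mathbb R^m$ whose restriction to each $(x_{i-1},x_i)$ is a polynomial of degree $\le q$; $\mathbf w(x_i^\pm)$ are one-sided limits, $[\![\psi]\!]_i:=\psi(x_i^-)-\psi(x_i^+)$. The semi-discrete scheme is $\partial_t\mathbf u_h=-\boldsymbol f(\mathbf u_h)$ with $\boldsymbol f:\mathbb V_q^s\to\mathbb V_q^s$ defined by $$\int_{\mathbb T}\boldsymbol f(\mathbf v_h)\cdot\boldsymbol\psi\,dx=-\sum_{i=1}^M\int_{x_{i-1}}^{x_i}\mathbf g(\mathbf v_h)\cdot\partial_x\boldsymbol\psi\,dx+\sum_{i=0}^{M-1}\mathbf G(\mathbf v_h(x_i^-),\mathbf v_h(x_i^+))\cdot[\![\boldsymbol\psi]\!]_i\quad\forall\mathbf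 v_h,\boldsymbol\psi\in\mathbb V_q^s,$$ and $\mathbf u_h^0,\dots,\mathbf u_h^N\in\mathbb V_q^s$ are the values at $t_0,\dots,t_N$ computed by a single- or multi-step time discretization of order $r$ of this ODE. Numerical flux $\mathbf G$: there is a locally Lipschitz $\mathbf w:\mathcal U\times\mathcal U\to\mathcal U$ such that for every compact $K\subset\mathcal U$ there is $C_w(K)>0$ with $|\mathbf w(\mathbf a,\mathbf b)-\mathbf a|+|\mathbf w(\mathbf a,\mathbf b)-\mathbf b|\le C_w(K)|\mathbf a-\mathbf b|$ for $\mathbf a,\mathbf b\in K$, and $\mathbf G$ is of one of the types: (i) $\mathbf G(\mathbf a,\mathbf b)=\mathbf g(\mathbf w(\mathbf a,\mathbf b))$; (ii) $\mathbf G(\mathbf a,\mathbf b)=\mathbf g(\mathbf w(\mathbf a,\mathbf b))-\mu(\mathbf a,\mathbf b;h)h^\nu(\mathbf b-\mathbf a)$ for some $\nu\in\mathbb N_0$ and a matrix-valued $\mu$ such that for every compact $K\subset\mathcal U$ there is $\mu_K>0$ with $|\mu(\mathbf a,\mathbf b;h)|\le\mu_K(1+|\mathbf b-\mathbf a|/h)$ on $K\times K$ for $h$ small enough. Temporal reconstruction $\hat{\mathbf u}^t$: continuous and piecewise polynomial of degree $\le r$ in time with values in $\mathbb V_q^s$. For parameters $(p,d,\sigma)\in\mathbb N_0^3$ with $r=(d+2)(p+1)+\sigma+1$, on $[t_n,t_{n+1}]$, $n\ge p$, it is the Hermite interpolation polynomial $\hat{\mathbf u}^n$ with $\partial_t^k\hat{\mathbf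 u}^n(t_j)=F_k(\mathbf u_h^j)$ for $k=0,\dots,d+1$, $j=n-p,\dots,n$, and $\partial_t^k\hat{\mathbf u}^n(t_{n+1})=F_k(\mathbf u_h^{n+1})$ for $k=0,\dots,\sigma+1$. Here $F_k(\mathbf v)$ is the expression for the $k$-th time derivative of a solution of $\partial_t\mathbf v=F(\mathbf v):=-\boldsymbol f(\mathbf v)$ in terms of $F$ and its derivatives ($F_0(\mathbf v)=\mathbf v$, $F_1=F$, $F_2=\mathrm DF\,F$, ...). On the start-up interval $[t_0,t_p]$ it is defined in an analogous way from the data of the first time steps. Space-time reconstruction $\hat{\mathbf u}^{st}$: for each $t$, $\hat{\mathbf u}^{st}(t,\cdot)\in\mathbb V_{q+1}^s$ is determined by $\int_{\mathbb T}(\hat{\mathbf u}^{st}-\hat{\mathbf u}^t)(t,\cdot)\cdot\boldsymbol\psi\,dx=0$ for all $\boldsymbol\psi\in\mathbb V_{q-1}^s$ and $\hat{\mathbf u}^{st}(t,x_k^\pm)=\mathbf w(\hat{\mathbf u}^t(t,x_k^-),\hat{\mathbf u}^t(t,x_k^+))$ for all $k$. Standing assumption and constants: $\mathfrak K\subset\mathcal U$ is compact and convex with $\hat{\mathbf u}^t(t,x)\in\mathfrak K$ for all $(t,x)\in[0,T]\times\mathbb T$. The constants $0<C_{\overline{\mathbf g}}<\infty$, $0<C_{\underline\eta}<C_{\overline\eta}<\infty$ are such that $|\mathbf v^T\mathrm H\mathbf g(\mathbf y)\mathbf v|\le C_{\overline{\mathbf g}}|\mathbf v|^2$ and $C_{\underline\eta}|\mathbf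 v|^2\le\mathbf v^T\mathrm H\eta(\mathbf y)\mathbf v\le C_{\overline\eta}|\mathbf v|^2$ for all $\mathbf v\in\mathbb R^m$, $\mathbf y\in\mathfrak K$, where $\mathrm H$ denotes Hessians ($\mathrm H\mathbf g$ collects the Hessians of the components of $\mathbf g$, so $\mathbf v^T\mathrm H\mathbf g\,\mathbf v\in\mathbb R^m$) and $|\cdot|$ is the Euclidean norm; in particular $\eta$ is taken twice continuously differentiable with such bounds.
   Formalization: The space-time reconstruction is also assumed to take values in 𝔎 (the text assumes this only for the temporal reconstruction); otherwise it may overshoot and leave 𝒰, so that g of it and the residual R^st are undefined. *)

(* Defs.v *)
From HB Require Import structures.
From mathcomp Require Import all_boot all_order all_algebra.
From mathcomp Require Import all_classical all_reals all_analysis.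

Set Implicit Arguments.
Unset Strict Implicit.
Unset Printing Implicit Defensive.

Import Order.TTheory GRing.Theory Num.Theory.
Import numFieldNormedType.Exports.

Local Open Scope classical_set_scope.
Local Open Scope ring_scope.

Notation leb := (@lebesgue_measure _).

(* The library norm on matrices is the max norm; [enorm] is the Euclidean one. *)
Definition dot (R : realType) (m : nat) (a b : 'cV[R]_m) : R :=
  \sum_(i < m) a i ord0 * b i ord0.

Definition enorm (R : realType) (m : nat) (a : 'cV[R]_m) : R :=
  Num.sqrt (dot a a).

Definition qform (R : realType) (m : nat) (A : 'M[R]_m) (v : 'cV[R]_m) : R :=
  (v^T *m A *m v) ord0 ord0.

(* C^k on an open set A: all iterated directional derivatives of order at most
   k exist and are continuous on A. *)
Fixpoint Ck (R : realType) (E W : normedModType R) (k : nat) (A : set E)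
    (f : E -> W) : Prop :=
  (forall y, A y -> {for y, continuous f}) /\
  if k is k'.+1 then
    forall v, (forall y, A y -> derivable f y v) /\ Ck k' A ('D_v f)
  else True.

Definition hessian (R : realType) (m : nat) (f : 'cV[R]_m -> R) (y : 'cV[R]_m) :
    'M[R]_m :=
  \matrix_(i < m, j < m)
    'D_(delta_mx i ord0) ('D_(delta_mx j ord0) f) y.

(* v^T (H g) v, componentwise *)
Definition vec_hessian_form (R : realType) (m : nat) (g : 'cV[R]_m -> 'cV[R]_m)
    (y v : 'cV[R]_m) : 'cV[R]_m :=
  \col_(i < m) qform (hessian (fun z => g z i ord0) y) v.

(* U need not be convex: strict convexity is required along the segments that
   lie in U. *)
Definition strictly_convex_on (R : realType) (m : nat) (U : set 'cV[R]_m)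
    (eta : 'cV[R]_m -> R) : Prop :=
  forall a b : 'cV[R]_m, a != b ->
    (forall s : R, 0 <= s <= 1 -> U (s *: a + (1 - s) *: b)) ->
    forall s : R, 0 < s < 1 ->
      eta (s *: a + (1 - s) *: b) < s * eta a + (1 - s) * eta b.

Definition entropy_pair (R : realType) (m : nat) (U : set 'cV[R]_m)
    (g : 'cV[R]_m -> 'cV[R]_m) (eta Q : 'cV[R]_m -> R) : Prop :=
  [/\ Ck 1 U eta, Ck 1 U Q, strictly_convex_on U eta &
      forall y, U y -> forall v, 'd eta y ('d g y v) = 'd Q y v].

(* Fundamental domain of the torus; functions on the torus are functions on R
   of which only the values on [-1, 1] matter, almost everywhere. *)
Definition torus (R : realType) : set R := `[(-1 : R), 1].
Arguments torus : clear implicits.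

Definition spacetime (R : realType) (T : R) : set (R * R) :=
  `]0, T[ `*` torus R.

(* L_p norm over D of an R^m-valued function *)
Definition Lnorm_on d (X : measurableType d) (R : realType) (m : nat)
    (mu : {measure set X -> \bar R}) (p : \bar R) (D : set X)
    (w : X -> 'cV[R]_m) : \bar R :=
  Lnorm mu p ((fun z => (enorm (w z))%:E) \_ D).

(* Test functions in C_c^oo([0, T) x torus), as 2-periodic functions of x;
   arguments are ordered (t, x). *)
Definition test_function (R : realType) (W : normedModType R) (T : R)
    (phi : R * R -> W) : Prop :=
  [/\ forall k, Ck k setT phi,
      forall s y, phi (s, y + 2) = phi (s, y) &
      exists2 T', T' < T & forall s y, T' <= s -> phi (s, y) = 0].

Definition dt (R : realType) (W : normedModType R) (phi : R * R -> W) :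
    R * R -> W := 'D_((1, 0) : R * R) phi.

Definition dx (R : realType) (W : normedModType R) (phi : R * R -> W) :
    R * R -> W := 'D_((0, 1) : R * R) phi.

Definition weak_solution (R : realType) (m : nat) (T : R)
    (g : 'cV[R]_m -> 'cV[R]_m) (u0 : R -> 'cV[R]_m) (u : R -> R -> 'cV[R]_m) :
    Prop :=
  forall phi : R * R -> 'cV[R]_m, test_function T phi ->
    \int[(leb \x leb)%E]_(p in spacetime T)
      (dot (u p.1 p.2) (dt phi p) + dot (g (u p.1 p.2)) (dx phi p))
    + \int[leb]_(y in torus R) dot (u0 y) (phi (0, y)) = 0.

(* As usual, the weak form of the entropy inequality involves the initial
   datum. *)
Definition weak_entropy_inequality (R : realType) (m : nat) (T : R)
    (eta Q : 'cV[R]_m -> R) (u0 : R -> 'cV[R]_m) (u : R -> R -> 'cV[R]_m) :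
    Prop :=
  forall phi : R * R -> R, test_function T phi -> (forall p, 0 <= phi p) ->
    0 <= \int[(leb \x leb)%E]_(p in spacetime T)
           (eta (u p.1 p.2) * dt phi p + Q (u p.1 p.2) * dx phi p)
         + \int[leb]_(y in torus R) (eta (u0 y) * phi (0, y)).

(* u lies in C([0, T]; L_oo(torus)) for the weak-* topology.  A bounded weak
   solution has exactly one such representative (up to null sets of the torus
   for each time); it is the one for which the values u(t, .) make sense. *)
Definition weakstar_continuous (R : realType) (m : nat) (T : R)
    (u : R -> R -> 'cV[R]_m) : Prop :=
  (forall s, 0 <= s <= T ->
    (forall i, measurable_fun (torus R) (fun y => u s y i ord0)) /\
    exists B : R, {ae leb, forall y, torus R y -> enorm (u s y) <= B}) /\
  forall phi : R -> 'cV[R]_m,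
    (forall i, leb.-integrable (torus R) (fun y => (phi y i ord0)%:E)) ->
    {within `[0, T], continuous
      (fun s => \int[leb]_(y in torus R) dot (u s y) (phi y))}.

Definition entropy_solution (R : realType) (m : nat) (T : R)
    (U : set 'cV[R]_m) (g : 'cV[R]_m -> 'cV[R]_m) (eta Q : 'cV[R]_m -> R)
    (u0 : R -> 'cV[R]_m) (u : R -> R -> 'cV[R]_m) : Prop :=
  [/\ (forall i, measurable_fun (spacetime T)
                   (fun p : R * R => u p.1 p.2 i ord0)) /\
      weakstar_continuous T u,
      exists B : R, {ae (leb \x leb)%E, forall p : R * R,
        spacetime T p -> U (u p.1 p.2) /\ enorm (u p.1 p.2) <= B},
      weak_solution T g u0 u &
      weak_entropy_inequality T eta Q u0 u].

Definition grid (R : realType) (a b : R) (M : nat) (x : nat -> R) : Prop :=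
  [/\ x 0%N = a, x M = b & forall i, (i < M)%N -> x i < x i.+1].

Definition mesh_size (R : realType) (M : nat) (x : nat -> R) : R :=
  \big[Num.max/0]_(i < M) (x i.+1 - x i).

Definition in_cells (R : realType) (M : nat) (x : nat -> R) (y : R) : Prop :=
  exists2 i, (i < M)%N & x i < y < x i.+1.

(* Piecewise polynomials of degree < n: V_q^s is [pwpoly M x q.+1], and
   V_{-1}^s = {0}.  Values at the nodes x_i are irrelevant throughout. *)
Definition pwpoly (R : realType) (m M : nat) (x : nat -> R) (n : nat)
    (w : R -> 'cV[R]_m) : Prop :=
  forall i, (i < M)%N -> forall j : 'I_m, exists2 P : {poly R},
    (size P <= n)%N & forall y, x i < y < x i.+1 -> w y j ord0 = P.[y].

(* One-sided limits at the nodes x_k, k < M, where x_0 and x_M are identified. *)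
Definition trace_left (R : realType) (m M : nat) (x : nat -> R)
    (w : R -> 'cV[R]_m) (k : nat) : 'cV[R]_m :=
  lim (w y @[y --> (x (if k == 0%N then M else k))^'-]).

Definition trace_right (R : realType) (m : nat) (x : nat -> R)
    (w : R -> 'cV[R]_m) (k : nat) : 'cV[R]_m :=
  lim (w y @[y --> (x k)^'+]).

Definition jump (R : realType) (m M : nat) (x : nat -> R)
    (w : R -> 'cV[R]_m) (k : nat) : 'cV[R]_m :=
  trace_left M x w k - trace_right x w k.

Definition has_values_in (R : realType) (m M : nat) (x : nat -> R)
    (U : set 'cV[R]_m) (w : R -> 'cV[R]_m) : Prop :=
  (forall y, in_cells M x y -> U (w y)) /\
  forall k, (k < M)%N -> U (trace_left M x w k) /\ U (trace_right x w k).

(* The condition on the intermediate state w of the numerical flux *)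
Definition intermediate_state (R : realType) (m : nat) (U : set 'cV[R]_m)
    (w : 'cV[R]_m -> 'cV[R]_m -> 'cV[R]_m) : Prop :=
  [/\ forall a b, U a -> U b -> U (w a b),
      forall p, (U `*` U) p -> exists2 B, nbhs p B &
        [lipschitz w z.1 z.2 | z in B `&` (U `*` U)] &
      forall K, compact K -> K `<=` U -> exists2 C : R, 0 < C &
        forall a b, K a -> K b ->
          enorm (w a b - a) + enorm (w a b - b) <= C * enorm (a - b)].

(* |mu(a, b; h)| is the max norm of the matrix; as the constant mu_K is
   existential, the choice of matrix norm is immaterial. *)
Definition numerical_flux (R : realType) (m : nat) (U : set 'cV[R]_m)
    (g : 'cV[R]_m -> 'cV[R]_m) (w : 'cV[R]_m -> 'cV[R]_m -> 'cV[R]_m) (h : R)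
    (G : 'cV[R]_m -> 'cV[R]_m -> 'cV[R]_m) : Prop :=
  (forall a b, U a -> U b -> G a b = g (w a b)) \/
  exists (nu : nat) (mu : 'cV[R]_m -> 'cV[R]_m -> R -> 'M[R]_m),
    (forall K, compact K -> K `<=` U -> exists2 muK : R, 0 < muK &
      exists2 h0 : R, 0 < h0 & forall h', 0 < h' < h0 ->
        forall a b, K a -> K b ->
          `|mu a b h'| <= muK * (1 + enorm (b - a) / h')) /\
    forall a b, U a -> U b ->
      G a b = g (w a b) - h ^+ nu *: (mu a b h *m (b - a)).

(* f is the spatial DG operator; its values are characterised (up to values at
   nodes) on the elements of V_q^s with values in U, where g and G are
   meaningful. *)
Definition dg_operator (R : realType) (m M : nat) (x : nat -> R) (q : nat)
    (U : set 'cV[R]_m) (g : 'cV[R]_m -> 'cV[R]_m)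
    (G : 'cV[R]_m -> 'cV[R]_m -> 'cV[R]_m)
    (f : (R -> 'cV[R]_m) -> R -> 'cV[R]_m) : Prop :=
  forall v, pwpoly M x q.+1 v -> has_values_in M x U v ->
    pwpoly M x q.+1 (f v) /\
    forall psi, pwpoly M x q.+1 psi ->
      \int[leb]_(y in torus R) dot (f v y) (psi y) =
      - (\sum_(i < M) \int[leb]_(y in `]x i, x i.+1[)
           dot (g (v y)) (derive1 psi y))
      + \sum_(i < M) dot (G (trace_left M x v i) (trace_right x v i))
                         (jump M x psi i).

(* An L-step method for v' = F(v): [Psi] maps L+1 consecutive times and the L
   values at the first L of them to the value at the last one (for implicit
   methods, it is the solution map).  It has order r if its local truncation
   error on C^{r+1} solutions is O(tau^{r+1}), on grids of step at most tau and
   with bounded step ratios. *)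
Definition time_stepping_order (R : realType) (m M : nat) (x : nat -> R)
    (q : nat) (U : set 'cV[R]_m) (F : (R -> 'cV[R]_m) -> R -> 'cV[R]_m)
    (r L : nat)
    (Psi : ('I_L.+1 -> R) -> ('I_L -> R -> 'cV[R]_m) -> R -> 'cV[R]_m) : Prop :=
  forall (a b : R) (v : R -> R -> 'cV[R]_m),
    (forall s, a < s < b ->
       pwpoly M x q.+1 (v s) /\ has_values_in M x U (v s)) ->
    (forall y, in_cells M x y -> Ck r.+1 `]a, b[ (fun s => v s y)) ->
    (forall s y, a < s < b -> in_cells M x y ->
       derive1 (fun s' => v s' y) s = F (v s) y) ->
    forall a' b' kappa : R, a < a' -> b' < b -> 1 <= kappa ->
      exists C : R, exists2 tau0 : R, 0 < tau0 &
        forall (tau : R) (s : nat -> R), 0 < tau < tau0 ->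
          (forall i, (i <= L)%N -> a' <= s i <= b') ->
          (forall i, (i < L)%N -> tau / kappa <= s i.+1 - s i <= tau) ->
          forall y, in_cells M x y ->
            enorm (v (s L) y - Psi (fun i => s i) (fun i => v (s i)) y)
              <= C * tau ^+ r.+1.

Definition computed_by (R : realType) (m M : nat) (x : nat -> R) (q : nat)
    (N : nat) (t : nat -> R) (L : nat)
    (Psi : ('I_L.+1 -> R) -> ('I_L -> R -> 'cV[R]_m) -> R -> 'cV[R]_m)
    (uh : nat -> R -> 'cV[R]_m) : Prop :=
  (forall n, (n <= N)%N -> pwpoly M x q.+1 (uh n)) /\
  forall n, (n + L <= N)%N -> forall y, in_cells M x y ->
    uh (n + L)%N y = Psi (fun i => t (n + i)%N) (fun i => uh (n + i)%N) y.

(* F_0(v) = v and F_{k+1}(v) = DF_k(v) F(v), the directional derivative being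
   taken pointwise in space (V_q^s has finite dimension). *)
Fixpoint time_derivative (R : realType) (m : nat)
    (F : (R -> 'cV[R]_m) -> R -> 'cV[R]_m) (k : nat) (v : R -> 'cV[R]_m) :
    R -> 'cV[R]_m :=
  if k is k'.+1 then
    fun y => derive1 (fun s : R =>
                time_derivative F k' (fun z => v z + s *: F v z) y) 0
  else v.

(* polynomial in time of degree < l with coefficients c *)
Definition time_poly (R : realType) (m : nat) (c : nat -> R -> 'cV[R]_m)
    (l : nat) (s y : R) : 'cV[R]_m :=
  \sum_(k < l) s ^+ k *: c k y.

(* The polynomial in time of degree < l = sum of the multiplicities, with
   values in V_q^s, that matches F_k(u_h^j) at t_j for k < mult j. *)
Definition hermite_interpolant (R : realType) (m M : nat) (x : nat -> R)
    (q : nat) (N : nat) (t : nat -> R)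
    (F : (R -> 'cV[R]_m) -> R -> 'cV[R]_m) (uh : nat -> R -> 'cV[R]_m)
    (mult : nat -> nat) (P : R -> R -> 'cV[R]_m) : Prop :=
  (exists2 c : nat -> R -> 'cV[R]_m,
     forall k, pwpoly M x q.+1 (c k) &
     forall s y, in_cells M x y ->
       P s y = time_poly c (\sum_(j < N.+1) mult j) s y) /\
  forall j k y, (j <= N)%N -> (k < mult j)%N -> in_cells M x y ->
    derive1n k (fun s => P s y) (t j) = time_derivative F k (uh j) y.

Definition hermite_mult (p d sigma n j : nat) : nat :=
  if (n - p <= j <= n)%N then d.+2 else if j == n.+1 then sigma.+2 else 0%N.

(* On the start-up intervals (n < p) the multiplicities are not prescribed: any
   Hermite interpolation of degree at most r of data of the first steps that
   interpolates at both ends of the interval is allowed. *)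
Definition startup_mult (p r n : nat) (N : nat) (mult : nat -> nat) : Prop :=
  [/\ (0 < mult n)%N, (0 < mult n.+1)%N,
      forall j, (p.+1 < j)%N -> mult j = 0%N &
      (\sum_(j < N.+1) mult j <= r.+1)%N].

(* Continuity in time follows, as each P interpolates u_h at both ends. *)
Definition temporal_reconstruction (R : realType) (m M : nat) (x : nat -> R)
    (q : nat) (N : nat) (t : nat -> R)
    (F : (R -> 'cV[R]_m) -> R -> 'cV[R]_m) (uh : nat -> R -> 'cV[R]_m)
    (p d sigma r : nat) (ut : R -> R -> 'cV[R]_m) : Prop :=
  forall n, (n < N)%N -> exists mult P,
    [/\ if (p <= n)%N then mult = hermite_mult p d sigma n
        else startup_mult p r n N mult,
        hermite_interpolant M x q N t F uh mult P &
        forall s y, t n <= s <= t n.+1 -> in_cells M x y -> ut s y = P s y].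

Definition spacetime_reconstruction (R : realType) (m M : nat) (x : nat -> R)
    (q : nat) (T : R) (w : 'cV[R]_m -> 'cV[R]_m -> 'cV[R]_m)
    (ut ust : R -> R -> 'cV[R]_m) : Prop :=
  forall s, 0 <= s <= T ->
    [/\ pwpoly M x q.+2 (ust s),
        forall psi, pwpoly M x q psi ->
          \int[leb]_(y in torus R) dot (ust s y - ut s y) (psi y) = 0 &
        forall k, (k < M)%N ->
          let wk := w (trace_left M x (ut s) k) (trace_right x (ut s) k) in
          trace_left M x (ust s) k = wk /\ trace_right x (ust s) k = wk].

Definition residual (R : realType) (m : nat) (g : 'cV[R]_m -> 'cV[R]_m)
    (ust : R -> R -> 'cV[R]_m) (p : R * R) : 'cV[R]_m :=
  derive1 (fun s => ust s p.2) p.1 + derive1 (fun y => g (ust p.1 y)) p.2.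

(* Main.v *)
Require Import Defs.
From HB Require Import structures.
From mathcomp Require Import all_boot all_order all_algebra.
From mathcomp Require Import all_classical all_reals all_analysis.
From mathcomp Require Import ring lra zify.
From mathcomp Require Import measurable_realfun ess_sup_inf.

Import Order.TTheory GRing.Theory Num.Theory.
Import numFieldNormedType.Exports.

Local Open Scope classical_set_scope.
Local Open Scope ring_scope.

(** The proof is a relative entropy argument that compares the entropy solution
    [u] with the space-time reconstruction [v = ust].  The reconstruction is
    Lipschitz and periodic and solves the conservation law up to the residual,
    so that the entropy variables of [v] are admissible test functions in the
    weak formulation for [u].

    Pointwise algebra.  Since the Hessian of the entropy symmetrizes the system
    ([entropy_symmetrizer]), the terms of first order in [u - v] cancel in the
    time derivative of the relative entropy
    [eta u - eta v - D eta v (u - v)]; what remains is the residual against the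
    difference, and the quadratic remainder of the flux times the slope of [v]
    ([entropy_dissipation]).  Young's inequality turns this into half of
    [|R|^2] plus half of [(Chi^2 + Chi Cg |v_y|) |u - v|^2].  By Taylor's
    formula the relative entropy lies between [Clo / 2] and [Chi / 2] times the
    square of the distance ([entropy_relative_bounds]), which absorbs all the
    factors one half and gives the constants of the theorem.

    Integration in time.  The entropy inequality bounds the entropy of [u] at
    almost all times by that of the initial datum ([entropy_decrease]).  Adding
    to this bound the terms of the relative entropy that are affine in [u]
    gives a function [Et] that is Lipschitz in time; it dominates the relative
    entropy, hence the distance, at almost all times.  Its increments are
    computed from the conservation law ([increment]), and at almost every time
    its derivative satisfies the inequality above ([Et_derive]).  Gronwall's
    inequality ([gronwall]) bounds [Et], and weak lower semicontinuity of the
    distance carries the bound over to all times, in particular to the time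
    steps ([dist2_le]).

    The entropy solution.  Its regularity in time is weak-* continuity.
    Projecting on the compact convex set of states yields a representative with
    values in this set at all times ([values_in_K], [representative]).  The
    weak formulation is tested with products of a smooth function of time and a
    smooth function of space.  Evaluated at time zero, it shows that the initial
    datum is the value of the representative ([initial_value]); at other times,
    a du Bois-Reymond argument extends it to the Lipschitz test functions that
    are used ([weak_at_lipschitz]).

    The reconstruction.  On each cell it is a polynomial in space determined by
    moments of the temporal reconstruction and by the intermediate states at
    the two nodes ([coefficients_from_moments]).  These data are Lipschitz in
    time, hence so are the coefficients; and the two traces at a node are the
    same intermediate state, hence the function is continuous and periodic
    ([reconstruction_coefficients]).  Lipschitz functions of time are integrals
    of their almost everywhere derivatives ([lipschitz_ftc]), which gives a
    meaning to the residual. *)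

Set Implicit Arguments.
Unset Strict Implicit.
Unset Printing Implicit Defensive.

(** * Bounded measurable functions and their integrals *)

(** Bounded measurable functions are stable under all the operations of the
    proof and integrable on sets of finite measure, so that every integrability
    condition reduces to [bm]. *)
Definition bm (R : realType) d (X : measurableType d) (f : X -> R) : Prop :=
  measurable_fun setT f /\ exists C : R, forall x, `|f x| <= C.

Lemma ae_imp (R : realType) d (X : measurableType d)
    (mu : {measure set X -> \bar R}) (P Q : X -> Prop) :
  {ae mu, forall x, P x} -> (forall x, P x -> Q x) -> {ae mu, forall x, Q x}.
Proof. by move=> h PQ; exact: (@filterS _ _ (ae_filter_ringOfSetsType mu) _ _ PQ h). Qed.

Lemma ae_and (R : realType) d (X : measurableType d)
    (mu : {measure set X -> \bar R}) (P Q : X -> Prop) :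
  {ae mu, forall x, P x} -> {ae mu, forall x, Q x} ->
  {ae mu, forall x, P x /\ Q x}.
Proof. by move=> hP hQ; apply: filterI => //; exact: ae_filter_ringOfSetsType. Qed.

Section bm_closure.
Context (R : realType) d (X : measurableType d).
Implicit Types f g : X -> R.

Lemma bm_cst c : bm (fun _ : X => c : R).
Proof. by split; [exact: measurable_cst|exists `|c|]. Qed.

Lemma bmD f g : bm f -> bm g -> bm (fun x => f x + g x).
Proof.
move=> [mf [C fC]] [mg [D gD]]; split; first exact: measurable_funD.
by exists (C + D) => x; rewrite (le_trans (ler_normD _ _))// lerD.
Qed.

Lemma bmN f : bm f -> bm (fun x => - f x).
Proof.
by move=> [mf [C fC]]; split; [exact: measurableT_comp|exists C => x; rewrite normrN].
Qed.

Lemma bmB f g : bm f -> bm g -> bm (fun x => f x - g x).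
Proof. by move=> bf /bmN; exact: bmD. Qed.

Lemma bmM f g : bm f -> bm g -> bm (fun x => f x * g x).
Proof.
move=> [mf [C fC]] [mg [D gD]]; split; first exact: measurable_funM.
by exists (C * D) => x; rewrite normrM ler_pM.
Qed.

Lemma bm_sum (I : Type) (r : seq I) (P : pred I) (F : I -> X -> R) :
  (forall i, bm (F i)) -> bm (fun x => \sum_(i <- r | P i) F i x).
Proof.
move=> bF; elim: r => [|i r IH].
  by under eq_fun do rewrite big_nil; exact: bm_cst.
under eq_fun do rewrite big_cons.
by case: (P i) => //; exact: bmD.
Qed.

Lemma bm_norm f : bm f -> bm (fun x => `|f x|).
Proof.
by move=> [mf [C fC]]; split; [exact: measurableT_comp|
  exists C => x; rewrite normr_id].
Qed.

Lemma bm_comp d' (Y : measurableType d') (h : Y -> X) f :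
  bm f -> measurable_fun setT h -> bm (f \o h).
Proof.
by move=> [mf [C fC]] mh; split; [exact: measurableT_comp|exists C => x /=].
Qed.

Lemma bm_indic (A : set X) : measurable A -> bm (\1_A : X -> R).
Proof.
move=> mA; split; first exact: measurable_indic.
exists 1 => x; rewrite indicE; case: (x \in A); rewrite ?normr1 ?normr0//.
Qed.

Lemma bm_if (A : set X) f g : measurable A -> bm f -> bm g ->
  bm (fun x => if x \in A then f x else g x).
Proof.
move=> mA bf bg.
rewrite (_ : (fun x => _) =
    (fun x => \1_A x * f x + (1 - \1_A x) * g x)).
  by apply: bmD; apply: bmM => //; [exact: bm_indic|
    apply: bmB; [exact: bm_cst|exact: bm_indic]].
by apply/funext => x; rewrite indicE; case: (x \in A) => /=; ring.
Qed.

Lemma bm_integrable (mu : {measure set X -> \bar R}) D f :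
  measurable D -> (mu D < +oo)%E -> bm f -> mu.-integrable D (EFin \o f).
Proof.
move=> mD muD [mf [C fC]]; apply: measurable_bounded_integrable => //.
  exact: measurable_funTS.
exists C; split; first exact: num_real.
by move=> M CM x _ /=; rewrite (le_trans (fC x))// ltW.
Qed.

End bm_closure.

Section Int.
Context (R : realType).
Local Notation mu := (@lebesgue_measure R).
Implicit Types (f g : R -> R) (a b c : R).

Definition Int a b f : R := \int[mu]_(x in `[a, b]) f x.

Lemma leb_itv_lty a b : (mu `[a, b]%classic < +oo)%E.
Proof. by rewrite lebesgue_measure_itv/=; case: ifP => // _; rewrite ltry. Qed.

Lemma bm_integrable_itv a b f : bm f -> mu.-integrable `[a, b] (EFin \o f).
Proof. by move=> bf; apply: bm_integrable => //; exact: leb_itv_lty. Qed.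

Lemma leb_itvoc_lty a b : (mu `]a, b]%classic < +oo)%E.
Proof. by rewrite lebesgue_measure_itv/=; case: ifP => // _; rewrite ltry. Qed.

Lemma ae_neq b : {ae mu, forall t, t <> b}.
Proof.
exists [set b]; split; [exact: measurable_set1|exact: lebesgue_measure_set1|].
by move=> t /= /contrapT.
Qed.

Lemma IntD a b f g : bm f -> bm g ->
  Int a b (fun x => f x + g x) = Int a b f + Int a b g.
Proof. by move=> bf bg; apply: RintegralD => //; exact: bm_integrable_itv. Qed.

Lemma IntB a b f g : bm f -> bm g ->
  Int a b (fun x => f x - g x) = Int a b f - Int a b g.
Proof. by move=> bf bg; apply: RintegralB => //; exact: bm_integrable_itv. Qed.

Lemma IntZ a b c f : bm f -> Int a b (fun x => c * f x) = c * Int a b f.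
Proof. by move=> bf; apply: RintegralZl => //; exact: bm_integrable_itv. Qed.

Lemma IntN a b f : bm f -> Int a b (fun x => - f x) = - Int a b f.
Proof.
move=> bf; rewrite -mulN1r -IntZ//; apply: eq_Rintegral => x _.
by rewrite mulN1r.
Qed.

Lemma Int_cst a b c : a <= b -> Int a b (fun=> c) = c * (b - a).
Proof.
move=> ab; rewrite /Int Rintegral_cst//= lebesgue_measure_itv/= lte_fin.
move: ab; rewrite le_eqVlt => /predU1P[->|->]//=.
by rewrite ltxx subrr.
Qed.

Lemma Int_sum a b (I : Type) (r : seq I) (F : I -> R -> R) :
  a <= b -> (forall i, bm (F i)) ->
  Int a b (fun x => \sum_(i <- r) F i x) = \sum_(i <- r) Int a b (F i).
Proof.
move=> ab bF; elim: r => [|i r IH].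
  rewrite big_nil (_ : (fun x => _) = fun=> 0) ?Int_cst ?mul0r//.
  by apply/funext => x; rewrite big_nil.
rewrite big_cons -IH -IntD//; last exact: bm_sum.
by congr (Int _ _ _); apply/funext => x; rewrite big_cons.
Qed.

Lemma Int_le a b f g : bm f -> bm g -> (forall x, a <= x <= b -> f x <= g x) ->
  Int a b f <= Int a b g.
Proof.
move=> bf bg fg; apply: le_Rintegral => //; exact: bm_integrable_itv.
Qed.

Lemma eq_Int a b f g : (forall x, a <= x <= b -> f x = g x) ->
  Int a b f = Int a b g.
Proof.
by move=> fg; apply: eq_Rintegral => x; rewrite inE/= in_itv/=; exact: fg.
Qed.

Lemma Int_ge0 a b f : (forall x, a <= x <= b -> 0 <= f x) -> 0 <= Int a b f.
Proof.
by move=> f0; apply: Rintegral_ge0 => x /=; rewrite in_itv/=; exact: f0.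
Qed.

Lemma le_abs_Int a b f : bm f -> `|Int a b f| <= Int a b (fun x => `|f x|).
Proof. by move=> bf; apply: le_normr_Rintegral => //; exact: bm_integrable_itv. Qed.

Lemma Int_bound a b C f : a <= b -> bm f -> (forall x, a <= x <= b -> `|f x| <= C) ->
  `|Int a b f| <= C * (b - a).
Proof.
move=> ab bf fC; rewrite (le_trans (le_abs_Int _ _ bf))//.
by rewrite -Int_cst//; apply: Int_le => //; [exact: bm_norm|exact: bm_cst].
Qed.

Lemma Int_xx a f : Int a a f = 0.
Proof. by rewrite /Int set_itv1 Rintegral_set1. Qed.

Lemma Int_chasles a b c f : bm f -> a <= b -> b <= c ->
  Int a c f = Int a b f + Int b c f.
Proof.
move=> bf ab bc.
have := @Rintegral_itvB R f (BLeft a) (BRight c) b (bm_integrable_itv a c bf).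
rewrite !bnd_simp => /(_ ab bc) h.
have i : mu.-integrable `]b, c] (EFin \o f).
  apply: (integrableS _ _ _ (bm_integrable_itv b c bf)) => //.
  exact: subset_itv_oc_cc.
by rewrite /Int -(Rintegral_itv_obnd_cbnd i) -h addrC subrK.
Qed.

Lemma ae_eq_Int a b f g : bm f -> bm g ->
  {ae mu, forall x, a <= x <= b -> f x = g x} -> Int a b f = Int a b g.
Proof.
move=> [mf _] [mg _] fg; congr fine; apply: ae_eq_integral => //.
- by apply/measurable_EFinP; exact: measurable_funTS.
- by apply/measurable_EFinP; exact: measurable_funTS.
- by apply: (ae_imp fg) => x h; rewrite /= in_itv/= => /h ->.
Qed.

Lemma ae_le_Int a b f g : bm f -> bm g ->
  {ae mu, forall x, a <= x <= b -> f x <= g x} -> Int a b f <= Int a b g.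
Proof.
move=> bf bg fg.
have bh : bm (fun x => Num.max (f x) (g x)).
  split; first by apply: measurable_maxr; [case: bf|case: bg].
  case: bf bg => [_ [C fC]] [_ [D gD]]; exists (Num.max C D) => x.
  rewrite /Num.max; case: ifP => _; rewrite le_max ?fC ?gD ?orbT//.
rewrite (_ : Int a b g = Int a b (fun x => Num.max (f x) (g x))).
  by apply: Int_le => // x _; rewrite le_max lexx.
apply: ae_eq_Int => //; apply: (ae_imp fg) => x h /h {}fg.
by rewrite max_r.
Qed.

Lemma Int_dct a b C f (F : nat -> R -> R) : bm f -> (forall n, bm (F n)) ->
  (forall n x, a <= x <= b -> `|F n x| <= C) ->
  {ae mu, forall x, a <= x <= b -> F ^~ x @ \oo --> f x} ->
  (fun n => Int a b (F n)) @ \oo --> Int a b f.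
Proof.
move=> bf bF FC Ff.
have [||||||] := @dominated_convergence _ _ R mu `[a, b]%classic _
  (fun n => EFin \o F n) (EFin \o f) (cst C%:E); first exact: measurable_itv.
- by move=> n; apply/measurable_EFinP; apply: measurable_funTS; case: (bF n).
- by apply/measurable_EFinP; apply: measurable_funTS; case: bf.
- apply: (ae_imp Ff) => x h; rewrite /= in_itv/= => /h Fx.
  by apply: cvg_EFin => //; exact: nearW.
- exact: (bm_integrable_itv a b (@bm_cst R _ _ C)).
- by apply: aeW => x n; rewrite /= in_itv/= => /FC; rewrite lee_fin.
move=> i _ h.
have := fine_cvg; move=> /(_ R nat \oo _ (fun n => \int[mu]_(x in `[a, b]) (F n x)%:E)%E (Int a b f)).
apply.
by rewrite /Int /Rintegral fineK//; exact: integrable_fin_num i.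
Qed.

End Int.

Section Fubini_bm.
Context (R : realType).
Local Notation mu := (@lebesgue_measure R).
Implicit Types (F : R * R -> R) (a b c d s y : R).

Lemma bm_slice1 F s : bm F -> bm (fun y => F (s, y)).
Proof. by move=> bF; apply: (bm_comp bF); exact: measurable_pair1. Qed.

Lemma bm_slice2 F y : bm F -> bm (fun s => F (s, y)).
Proof. by move=> bF; apply: (bm_comp bF); exact: measurable_pair2. Qed.

Lemma bm_fst (f : R -> R) : bm f -> bm (fun p : R * R => f p.1).
Proof. by move=> bf; apply: (bm_comp bf); exact: measurable_fst. Qed.

Lemma bm_snd (f : R -> R) : bm f -> bm (fun p : R * R => f p.2).
Proof. by move=> bf; apply: (bm_comp bf); exact: measurable_snd. Qed.

Lemma bm_swap F : bm F -> bm (fun p : R * R => F (p.2, p.1)).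
Proof.
by move=> bF; apply: (bm_comp bF); apply/measurable_fun_pairP; split;
  [exact: measurable_snd|exact: measurable_fst].
Qed.

Lemma lebX_lty (A B : set R) : measurable A -> measurable B ->
  (mu A < +oo)%E -> (mu B < +oo)%E -> ((mu \x mu)%E (A `*` B) < +oo)%E.
Proof.
move=> mA mB A1 B1; rewrite product_measure1E//.
by rewrite lte_mul_pinfty// ge0_fin_numE.
Qed.

Lemma Rintegral_prod F (A B : set R) : measurable A -> measurable B ->
  (mu A < +oo)%E -> (mu B < +oo)%E -> bm F ->
  \int[(mu \x mu)%E]_(p in A `*` B) F p =
  \int[mu]_(s in A) \int[mu]_(y in B) F (s, y).
Proof.
move=> mA mB A1 B1 bF.
have mAB : measurable (A `*` B) by exact: measurableX.
pose F' : R * R -> \bar R := (EFin \o F) \_ (A `*` B).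
have iF' : (mu \x mu)%E.-integrable setT F'.
  by apply/integrable_restrict => //; rewrite setTI;
    apply: bm_integrable => //; exact: lebX_lty.
rewrite /Rintegral integral_mkcond -(integral12_prod_meas1 iF').
rewrite [in RHS]integral_mkcond; congr fine; apply: eq_integral => s _.
rewrite /fubini_F patchE; case: ifPn => sA.
  rewrite fineK; last first.
    apply: integrable_fin_num => //.
    exact: (@bm_integrable _ _ _ mu _ _ mB B1 (bm_slice1 s bF)).
  rewrite [RHS]integral_mkcond; apply: eq_integral => y _.
  rewrite /F' !patchE in_setX sA/=.
  by case: ifP.
rewrite (_ : (fun y => F' (s, y)) = cst 0%E) ?integral0//.
by apply/funext => y; rewrite /F' patchE in_setX (negbTE sA).
Qed.

Lemma Rintegral_prod2 F (A B : set R) : measurable A -> measurable B ->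
  (mu A < +oo)%E -> (mu B < +oo)%E -> bm F ->
  \int[(mu \x mu)%E]_(p in A `*` B) F p =
  \int[mu]_(y in B) \int[mu]_(s in A) F (s, y).
Proof.
move=> mA mB A1 B1 bF.
have mAB : measurable (A `*` B) by exact: measurableX.
pose F' : R * R -> \bar R := (EFin \o F) \_ (A `*` B).
have iF' : (mu \x mu)%E.-integrable setT F'.
  by apply/integrable_restrict => //; rewrite setTI;
    apply: bm_integrable => //; exact: lebX_lty.
rewrite /Rintegral integral_mkcond -(integral21_prod_meas1 iF').
rewrite [in RHS]integral_mkcond; congr fine; apply: eq_integral => y _.
rewrite /fubini_G patchE; case: ifPn => yB.
  rewrite fineK; last first.
    apply: integrable_fin_num => //.
    exact: (@bm_integrable _ _ _ mu _ _ mA A1 (bm_slice2 y bF)).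
  rewrite [RHS]integral_mkcond; apply: eq_integral => s _.
  rewrite /F' !patchE in_setX yB andbT/=.
  by case: ifP.
rewrite (_ : (fun s => F' (s, y)) = cst 0%E) ?integral0//.
by apply/funext => s; rewrite /F' patchE in_setX (negbTE yB) andbF.
Qed.

Lemma bm_Int F c d : c <= d -> bm F -> bm (fun s => Int c d (fun y => F (s, y))).
Proof.
move=> cd bF; have [mF [C FC]] := bF; split; last first.
  exists (C * (d - c)) => s; apply: Int_bound => //; exact: bm_slice1.
pose G (p : R * R) : R := (F p + C) * \1_`[c, d] p.2.
have bG : bm G.
  apply: bmM; first by apply: bmD => //; exact: bm_cst.
  by apply: (bm_snd (f := \1_`[c, d])); apply: bm_indic; exact: measurable_itv.
have G0 p : (0 <= (G p)%:E)%E.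
  rewrite lee_fin mulr_ge0// ?indicE//.
  by have := FC p; rewrite ler_norml => /andP[]; rewrite -subr_ge0 opprK.
have mG : measurable_fun setT (EFin \o G) by apply/measurable_EFinP; case: bG.
have := @measurable_fun_fubini_tonelli_F _ _ _ _ R mu (EFin \o G) mG G0.
move=> /(measurableT_comp (fine_measurable measurableT)) h.
rewrite (_ : (fun s => _) = (fun s => fine (fubini_F mu (EFin \o G) s) - C * (d - c))).
  by apply: measurable_funB => //; exact: measurable_cst.
apply/funext => s; rewrite -Int_cst//.
have bFs := bm_slice1 s bF.
rewrite (_ : fine _ = Int c d (fun y => F (s, y) + C)).
  by rewrite -IntB; [apply: eq_Int => y _; rewrite addrK|
    apply: bmD => //; exact: bm_cst|exact: bm_cst].
rewrite /Int /Rintegral integral_mkcond; congr fine; apply: eq_integral => y _.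
rewrite /G /= patchE indicE; case: ifPn => yc; first by rewrite mulr1.
by rewrite mulr0.
Qed.

Lemma Int_fubini F a b c d : a <= b -> c <= d -> bm F ->
  Int a b (fun s => Int c d (fun y => F (s, y))) =
  Int c d (fun y => Int a b (fun s => F (s, y))).
Proof.
move=> ab cd bF; rewrite /Int.
rewrite -Rintegral_prod ?leb_itv_lty//.
by rewrite -Rintegral_prod2 ?leb_itv_lty.
Qed.

End Fubini_bm.

(** * Lipschitz functions of one variable *)

Lemma is_derive_near_eq (R : realType) (f g : R -> R) (x d : R) :
  (\forall z \near x, g z = f z) -> is_derive x 1 g d -> is_derive x 1 f d.
Proof. by move=> N; apply: near_eq_is_derive => //; exact: oner_neq0. Qed.

Lemma is_derive_addc (R : realType) (f : R -> R) (x d c : R) :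
  is_derive x 1 f d -> is_derive x 1 (fun z => f z + c) d.
Proof. by move=> fd; rewrite -[d]addr0; apply: is_deriveD. Qed.

Section real_derivatives.
Context (R : realType).
Implicit Types (f g : R -> R) (x df dg c : R).

Lemma is_derive_mul f g x df dg : is_derive x 1 f df -> is_derive x 1 g dg ->
  is_derive x 1 (fun z => f z * g z) (df * g x + f x * dg).
Proof.
move=> fD gD; have := is_deriveM fD gD; rewrite /GRing.scale/= => D.
by apply: is_derive_eq; rewrite addrC mulrC.
Qed.

Lemma is_derive_add f g x df dg : is_derive x 1 f df -> is_derive x 1 g dg ->
  is_derive x 1 (fun z => f z + g z) (df + dg).
Proof. exact: is_deriveD. Qed.

Lemma is_derive_opp f x df : is_derive x 1 f df ->
  is_derive x 1 (fun z => - f z) (- df).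
Proof. exact: is_deriveN. Qed.

Lemma is_derive_constl f x df c : is_derive x 1 f df ->
  is_derive x 1 (fun z => c * f z) (c * df).
Proof. exact: is_deriveZ. Qed.

Lemma is_derive_pow f x df n : is_derive x 1 f df ->
  is_derive x 1 (fun z => f z ^+ n) (n%:R * f x ^+ n.-1 * df).
Proof.
move=> fD; elim: n => [|n IH].
  rewrite !mul0r (_ : (fun z => _) = cst 1); first exact: is_derive_cst.
  by apply/funext => z; rewrite expr0.
rewrite (_ : (fun z => _) = (fun z => f z * f z ^+ n)); last first.
  by apply/funext => z; rewrite exprS.
have D := is_derive_mul fD IH.
rewrite (_ : n.+1%:R * f x ^+ n.+1.-1 * df =
  df * f x ^+ n + f x * (n%:R * f x ^+ n.-1 * df))//=.
case: n {IH D} => [|n] /=; first by rewrite expr0; ring.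
by rewrite !exprS -!natr1; ring.
Qed.

Lemma is_derive_chain f g x df dg : is_derive (g x) 1 f df ->
  is_derive x 1 g dg -> is_derive x 1 (fun z => f (g z)) (df * dg).
Proof. exact: is_derive1_comp. Qed.

Lemma is_derive_lineP (V W : normedModType R) (f : V -> W) (a v : V) (df : W) :
  is_derive a v f df <-> is_derive (0 : R) 1 (fun h => f (h *: v + a)) df.
Proof.
have E : (fun h : R => h^-1 *: ((f \o shift a) (h *: v) - f a)) =
    (fun h : R => h^-1 *: (((fun h => f (h *: v + a)) \o shift 0) (h *: 1)
      - f ((0 : R) *: v + a))).
  by apply/funext => h /=; rewrite addr0 scale0r add0r /GRing.scale/= mulr1.
by split=> -[fD fE]; split; move: fD fE; rewrite /derivable /derive ?E -?E.
Qed.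

End real_derivatives.

Section contraction_ftc.
Context (R : realType).
Local Notation mu := (@lebesgue_measure R).
Variable F : R -> R.
Hypothesis F_nd : forall x y, x <= y -> F x <= F y.
Hypothesis F_contr : forall x y, x <= y -> F y - F x <= y - x.

Let F_cont : continuous F.
Proof.
move=> x; apply/cvgrPdist_le => e e0; near=> y.
have xy : `|x - y| <= e by near: y; apply: cvgr_dist_le => //; exact: cvg_id.
apply: le_trans xy; have [h|/ltW h] := leP x y.
- have h1 := F_contr h; have h2 := F_nd h; rewrite distrC (distrC x).
  by rewrite !ger0_norm ?subr_ge0.
- have h1 := F_contr h; have h2 := F_nd h.
  by rewrite !ger0_norm ?subr_ge0.
Unshelve. all: by end_near. Qed.

Let G x := x - F x.

HB.instance Definition _ := isCumulative.Build R _ R F F_nd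
  (right_continuousW F_cont).

Let G_nd x y : x <= y -> G x <= G y.
Proof. by move=> xy; have := F_contr xy; rewrite /G; lra. Qed.

Let G_cont : continuous G.
Proof. by move=> x; apply: cvgB; [exact: cvg_id|exact: F_cont]. Qed.

HB.instance Definition _ := isCumulative.Build R _ R G G_nd
  (right_continuousW G_cont).

Let lsE (f : cumulative R R) a b : a <= b ->
  lebesgue_stieltjes_measure f `]a, b]%classic = (f b - f a)%:E.
Proof.
move=> ab; rewrite /lebesgue_stieltjes_measure /measure_extension.
by rewrite measurable_mu_extE/=; [rewrite wlength_itv_bnd|exact: is_ocitv].
Qed.

Let nu : {measure set (measurableTypeR R) -> \bar R} :=
  lebesgue_stieltjes_measure (F : cumulative R R).
Let nu' : {measure set (measurableTypeR R) -> \bar R} :=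
  lebesgue_stieltjes_measure (G : cumulative R R).

Let nuE a b : a <= b -> nu `]a, b]%classic = (F b - F a)%:E.
Proof. exact: lsE. Qed.

Let leb_split (A : set R) : measurable A -> mu A = (nu A + nu' A)%E.
Proof.
move=> mA; rewrite -(@measure_addE _ _ _ nu nu').
apply: lebesgue_measure_unique => // X [[a b] _ <-].
rewrite /= /msum 2!big_ord_recl/= big_ord0 adde0.
have [ab|ba] := leP a b; last by rewrite set_itv_ge ?measure0 ?adde0// bnd_simp -leNgt ltW.
rewrite /nu /nu' !lsE// lebesgue_measure_itv/= lte_fin -EFinD.
move: ab; rewrite le_eqVlt => /predU1P[->|->]; last by congr EFin; rewrite /G/=; ring.
by rewrite ltxx /G/=; congr EFin; ring.
Qed.

(** Lebesgue measure is the sum of the Stieltjes measures of [F] and of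
    [x - F x], so that the former is absolutely continuous; its Radon-Nikodym
    density is the derivative of [F] at its Lebesgue points. *)
Lemma contraction_ftc (a b : R) : a < b -> exists h : R -> R,
  [/\ measurable_fun setT h, mu.-integrable setT (EFin \o h),
      forall x, a <= x <= b -> F x = F a + \int[mu]_(t in `]a, x]) h t &
      {ae mu, forall x, a < x < b -> is_derive x 1 F (h x)}].
Proof.
move=> ab.
have mab : measurable (`]a, b]%classic : set (measurableTypeR R)) by exact: measurable_itv.
have nufin : (nu `]a, b]%classic < +oo)%E by rewrite nuE ?ltW// ltry.
pose nur : {finite_measure set (measurableTypeR R) -> \bar R} := mfrestr mab nufin.
have dom : nur `<< mu.
  apply/null_content_dominatesP => A mA A0.
  rewrite /nur /mfrestr/= /mrestr.
  have mAab : measurable (A `&` `]a, b]) by exact: measurableI.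
  have : mu (A `&` `]a, b]) = 0%E.
    by apply/eqP; rewrite eq_le measure_ge0 andbT -A0; apply: le_measure; rewrite ?inE//.
  rewrite leb_split// => /eqP.
  by rewrite padde_eq0 ?measure_ge0// => /andP[/eqP].
have [d [d0 dfin di dE]] := radon_nikodym_sigma_finite dom.
pose h := fine \o d.
have hE : EFin \o h = d by apply/funext => x /=; rewrite /h/= fineK.
have ih : mu.-integrable setT (EFin \o h) by rewrite hE.
have mh : measurable_fun setT h by apply/measurable_EFinP; exact: measurable_int ih.
have FE x : a <= x <= b -> F x = F a + \int[mu]_(t in `]a, x]) h t.
  move=> /andP[ax xb]; apply/eqP; rewrite addrC -subr_eq; apply/eqP.
  have mx : measurable (`]a, x]%classic : set R) by exact: measurable_itv.
  have : nur `]a, x]%classic = (F x - F a)%:E.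
    rewrite (_ : nur _ = nu (`]a, x] `&` `]a, b])%classic)// setIidl ?nuE//.
    by apply: subset_itvl; rewrite bnd_simp.
  by rewrite (dE _ mx) -hE /Rintegral => ->.
exists h; split => //.
have lh : locally_integrable setT h.
  split => //; first exact: openT.
  move=> K _ cK; have mK : measurable K by exact: compact_measurable.
  have := @integrableS _ _ _ mu _ _ _ measurableT mK (@subsetT _ K) ih.
  by move=> /integrableP[].
have := @FTC1 R h (BRight a).
have ihy y : mu.-integrable `]a, y] (EFin \o h).
  by apply: (@integrableS _ _ _ mu _ _ _ measurableT _ (@subsetT _ _) ih).
move=> /(_ ihy lh) D.
apply: (ae_imp D) => x + /andP[ax xb].
move=> H; have /H[Dx Ex] : (BRight a < BRight x)%E by rewrite lte_fin.
set Phi := (fun z => \int[mu]_(t in `]a, z]) h t) in Dx Ex.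
have DPhi : is_derive x 1 Phi (h x) by rewrite -Ex derive1E; exact/derivableP.
have N : \forall z \near x, Phi z + F a = F z.
  near=> z; rewrite (FE z) 1?addrC//.
  apply/andP; split; apply: ltW; near: z; [exact: lt_nbhsr|exact: lt_nbhsl].
by apply: (is_derive_near_eq N); exact: is_derive_addc.
Unshelve. all: by end_near. Qed.

End contraction_ftc.

Section lipschitz_ftc.
Context (R : realType).
Local Notation mu := (@lebesgue_measure R).

Let cl (a b x : R) := Num.max a (Num.min x b).

Let clE (a b x : R) : a <= x <= b -> cl a b x = x.
Proof. by move=> /andP[ax xb]; rewrite /cl min_l// max_r. Qed.

Let cl_in (a b x : R) : a <= b -> a <= cl a b x <= b.
Proof. by move=> ab; rewrite /cl le_max lexx/= ge_max ab ge_min lexx orbT. Qed.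

Let cl_contr (a b x y : R) : a < b -> x <= y ->
  cl a b x <= cl a b y /\ cl a b y - cl a b x <= y - x.
Proof.
move=> ab xy; rewrite /cl /Num.max /Num.min.
have [xb|xb] := ltP x b; have [yb|yb] := ltP y b.
- by have [ax|ax] := ltP a x; have [ay|ay] := ltP a y; split; lra.
- by rewrite (_ : (a < b) = true)//; have [ax|ax] := ltP a x; split; lra.
- by have [ay|ay] := ltP a y; split; lra.
- by split; rewrite ?subrr ?subr_ge0.
Qed.

Lemma is_derive_cvg_seq (f : R -> R) (x d : R) : is_derive x 1 f d ->
  (fun n => (f (x + n.+1%:R^-1) - f x) * n.+1%:R) @ \oo --> d.
Proof.
move=> [fD <-].
have h : (n.+1%:R^-1 : R) @[n --> \oo] --> 0^'.
  move=> A A0; have : \forall n \near \oo, (n.+1%:R^-1 : R) != 0 -> A n.+1%:R^-1.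
    exact: (@cvg_harmonic R _ A0).
  by apply: filterS => n; apply; rewrite invr_eq0 pnatr_eq0.
have := cvg_comp _ _ h fD; apply: cvg_trans; apply: near_eq_cvg.
by apply: nearW => n; rewrite /= invrK /GRing.scale/= mulr1 mulrC (addrC x).
Qed.

(** The function [(f x + L x) / (2 L)] is monotone and a contraction. Its density
    is truncated so as to be bounded everywhere; this only changes a null set,
    since a derivative of [f] is bounded by [L]. *)
Lemma lipschitz_ftc (a b L : R) (f : R -> R) : a < b -> 0 < L ->
  (forall x y, a <= x <= b -> a <= y <= b -> `|f x - f y| <= L * `|x - y|) ->
  exists h : R -> R,
  [/\ bm h, forall x, `|h x| <= L,
      forall x, a <= x <= b -> f x = f a + Int a x h &
      {ae mu, forall x, a < x < b -> is_derive x 1 f (h x)}].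
Proof.
move=> ab L0 fL.
have L2 : 0 < 2 * L by rewrite mulr_gt0.
pose F x := (f (cl a b x) + L * cl a b x) / (2 * L).
have key x y : x <= y -> `|f (cl a b y) - f (cl a b x)| <= L * (cl a b y - cl a b x).
  move=> xy; have [c1 c2] := cl_contr ab xy.
  have := fL _ _ (cl_in y (ltW ab)) (cl_in x (ltW ab)).
  by rewrite (ger0_norm (x := cl a b y - _)) ?subr_ge0.
have Fnd x y : x <= y -> F x <= F y.
  move=> /key; rewrite ler_norml => /andP[h _].
  by rewrite /F ler_pM2r ?invr_gt0//; lra.
have Fcontr x y : x <= y -> F y - F x <= y - x.
  move=> xy; have [c1 c2] := cl_contr ab xy.
  have := key _ _ xy; rewrite ler_norml => /andP[_ h].
  rewrite /F -mulrBl ler_pdivrMr//.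
  have := ler_wpM2l (ltW L0) c2; lra.
have [h [mh ih Fh Dh]] := contraction_ftc Fnd Fcontr ab.
have fF x : a <= x <= b -> f x = 2 * L * F x - L * x.
  move=> xab; rewrite /F clE//; field.
  by rewrite gt_eqF.
have Df : {ae mu, forall x, a < x < b -> is_derive x 1 f (2 * L * h x - L)}.
  apply: (ae_imp Dh) => x hx xab.
  have N : \forall z \near x, 2 * L * F z - L * z = f z.
    near=> z; rewrite fF//.
    apply/andP; split; apply: ltW; near: z; [apply: lt_nbhsr|apply: lt_nbhsl];
      by case/andP: xab.
  apply: (is_derive_near_eq N).
  have hx' := hx xab.
  have -> : 2 * L * h x - L = (2 * L) *: h x - L *: 1 by rewrite /GRing.scale/=; ring.
  exact: is_deriveB.
have Lf x : a < x < b -> forall d, is_derive x 1 f d -> `|d| <= L.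
  move=> xab d /is_derive_cvg_seq dc.
  have nc : `|(f (x + n.+1%:R^-1) - f x) * n.+1%:R| @[n --> \oo] --> `|d|.
    exact: cvg_norm dc.
  have [ax xb] := andP xab.
  apply: (ler_cvg_to nc (cvg_cst L)); near=> n.
  rewrite normrM (ger0_norm (x := _%:R))// -ler_pdivlMr ?ltr0n//.
  have n0 : 0 < n.+1%:R^-1 :> R by rewrite invr_gt0.
  have := fL (x + n.+1%:R^-1) x; rewrite (addrAC x) subrr add0r (gtr0_norm n0); apply.
    rewrite (le_trans (ltW ax)) ?lerDl ?ltW//= -ltrBrDl; near: n.
    have bx : 0 < b - x by rewrite subr_gt0.
    exact: (near_infty_natSinv_lt (PosNum bx)).
  by rewrite !ltW.
pose k x := if `|2 * L * h x - L| <= L then 2 * L * h x - L else 0.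
have kL x : `|k x| <= L by rewrite /k; case: ifP => // _; rewrite normr0 ltW.
have mk : measurable_fun setT k.
  have mw : measurable_fun setT (fun x => 2 * L * h x - L).
    by apply: measurable_funB; [exact: measurable_funM|exact: measurable_cst].
  apply: measurable_fun_ifT => //.
  by apply: measurable_fun_ler; [exact: measurableT_comp|exact: measurable_cst].
have Dk : {ae mu, forall x, a < x < b -> 2 * L * h x - L = k x}.
  by apply: (ae_imp Df) => x /[swap] xab /(_ xab)/(Lf _ xab) h1; rewrite /k h1.
have bk : bm k by split => //; exists L.
exists k; split => //; last first.
  by apply: (ae_imp (ae_and Df Dk)) => x [h1 h2] xab; rewrite -h2//; exact: h1.
move=> x /andP[ax xb].
have mx : measurable (`]a, x]%classic : set R) by exact: measurable_itv.
have iL : mu.-integrable `]a, x] (EFin \o cst L).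
  apply: (@bm_integrable _ _ _ mu) => //; last exact: bm_cst.
  exact: leb_itvoc_lty.
have ihx := @integrableS _ _ _ mu _ _ _ measurableT mx (@subsetT _ _) ih.
rewrite fF ?ax// (fF a) ?lexx ?ltW// Fh ?ax//.
have -> : Int a x k = \int[mu]_(t in `]a, x]) (2 * L * h t - L).
  have ik := bm_integrable_itv a x bk.
  rewrite /Int -Rintegral_itv_obnd_cbnd; last first.
    by apply: (integrableS _ _ _ ik) => //; exact: subset_itv_oc_cc.
  congr fine; apply: ae_eq_integral => //.
  - by apply/measurable_EFinP; exact: measurable_funTS.
  - apply/measurable_EFinP/measurable_funTS.
    by apply: measurable_funB; [exact: measurable_funM|exact: measurable_cst].
  - have Nb := @ae_neq R b.
    apply: (ae_imp (ae_and Dk Nb)) => t [h1 h2] /=; rewrite in_itv/= => /andP[at' tx].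
    rewrite h1// at'/= lt_neqAle (le_trans tx xb) andbT; exact/eqP.
have i2 : mu.-integrable `]a, x] (EFin \o (fun t => 2 * L * h t)).
  exact: (@integrableZl _ _ _ mu _ mx (2 * L) (EFin \o h) ihx).
rewrite RintegralB// RintegralZl// Rintegral_cst//= lebesgue_measure_itv/= lte_fin.
move: ax; rewrite le_eqVlt => /predU1P[->|->/=]; last by ring.
by rewrite ltxx/= set_itvoc0 Rintegral_set0; ring.
Unshelve. all: by end_near. Qed.

End lipschitz_ftc.

(** * Smooth test functions *)

Section smooth.
Context (R : realType).
Implicit Types (X Y D : nat -> R -> R) (x y s : R).

(** A smooth function is encoded together with all its derivatives: the [n]-th
    component is the derivative of order [n]. *)
Definition tower D : Prop := forall n x, is_derive x 1 (D n) (D n.+1 x).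

Lemma tower_continuous D n : tower D -> continuous (D n).
Proof.
move=> tD x; apply: differentiable_continuous; apply/derivable1_diffP.
by case: (tD n x).
Qed.

Lemma is_derive_scale_r (V W : normedModType R) (k : V -> R) (w : W) (a v : V)
  (dk : R) : is_derive a v k dk -> is_derive a v (fun p => k p *: w) (dk *: w).
Proof.
move=> [kD <-].
have h : h^-1 *: (((fun p => k p *: w) \o shift a) (h *: v) - k a *: w)
    @[h --> 0^'] --> 'D_v k a *: w.
  rewrite (_ : (fun h => _) =
      (fun h => (h^-1 *: ((k \o shift a) (h *: v) - k a)) *: w)).
    by apply: cvgZr_tmp; exact: kD.
  by apply/funext => h; rewrite /= -scalerBl scalerA.
by split; [apply/cvg_ex; eexists; exact: h|apply/cvg_lim].
Qed.

Section tensor.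
Variables X Y : nat -> R -> R.
Hypotheses (tX : tower X) (tY : tower Y).

(** Linear combinations of tensor products of derivatives of X and Y; this
    class is stable under directional derivatives. *)
Definition tens (l : seq (R * nat * nat)) (p : R * R) : R :=
  \sum_(c <- l) c.1.1 * (X c.1.2 p.1 * Y c.2 p.2).

Fixpoint dtens (v : R * R) (l : seq (R * nat * nat)) : seq (R * nat * nat) :=
  if l is (c, n, m) :: l' then
    (v.1 * c, n.+1, m) :: (v.2 * c, n, m.+1) :: dtens v l'
  else [::].

Lemma tens_derive l (p v : R * R) : is_derive p v (tens l) (tens (dtens v l) p).
Proof.
elim: l => [|[[c n] m] l IH].
  rewrite (_ : tens [::] = cst 0).
    exact: is_derive_cst.
  by apply/funext => z; rewrite /tens big_nil.
rewrite (_ : tens ((c, n, m) :: l) =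
    (fun z => c * (X n z.1 * Y m z.2)) + tens l); last first.
  by apply/funext => z; rewrite /tens big_cons.
rewrite (_ : tens (dtens v ((c, n, m) :: l)) p =
   c * (v.1 * X n.+1 p.1 * Y m p.2 + X n p.1 * (v.2 * Y m.+1 p.2))
     + tens (dtens v l) p); last first.
  by rewrite /= /tens !big_cons/=; ring.
apply: is_deriveD => {IH}.
have H : is_derive (0 : R) 1 (fun h => c * (X n (h * v.1 + p.1) * Y m (h * v.2 + p.2)))
    (c * (v.1 * X n.+1 p.1 * Y m p.2 + X n p.1 * (v.2 * Y m.+1 p.2))).
  have a (q r : R) : is_derive (0 : R) 1 (fun h : R => h * q + r) q.
    apply: is_derive_addc.
    rewrite (_ : (fun h => _) = (fun h : R => h *: (q : R^o))).
      by rewrite -[X in is_derive _ _ _ X]scale1r; exact: is_derive_scale_r.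
    exact/funext.
  have a0 (q r : R) : 0 * q + r = r by rewrite mul0r add0r.
  have b1 : is_derive (0 : R) 1 (X n \o (fun h => h * v.1 + p.1)) (X n.+1 p.1 * v.1).
    by apply: is_derive1_comp; rewrite a0; exact: tX.
  have b2 : is_derive (0 : R) 1 (Y m \o (fun h => h * v.2 + p.2)) (Y m.+1 p.2 * v.2).
    by apply: is_derive1_comp; rewrite a0; exact: tY.
  have := is_derive_constl c (is_derive_mul b1 b2); rewrite /= !a0 => D.
  by apply: is_derive_eq; ring.
exact/is_derive_lineP.
Qed.

Lemma tens_continuous l : continuous (tens l).
Proof.
elim: l => [|[[c n] m] l IH] p.
  rewrite (_ : tens [::] = cst 0); first exact: cvg_cst.
  by apply/funext => z; rewrite /tens big_nil.
rewrite (_ : tens ((c, n, m) :: l) =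
    (fun z => c * (X n z.1 * Y m z.2) + tens l z)); last first.
  by apply/funext => z; rewrite /tens big_cons.
apply: cvgD; last exact: IH.
apply: cvgM; first exact: cvg_cst.
apply: cvgM.
  by apply: (@continuous_comp _ _ _ fst (X n)); [exact: cvg_fst|exact: tower_continuous].
by apply: (@continuous_comp _ _ _ snd (Y m)); [exact: cvg_snd|exact: tower_continuous].
Qed.

Lemma Ck_tens (W : normedModType R) (w : W) k l :
  Ck k setT (fun p => tens l p *: w).
Proof.
elim: k l => [|k IH] l; (split; first by move=> p _;
    apply: cvgZr_tmp; exact: tens_continuous) => //.
move=> v; have D p := is_derive_scale_r w (tens_derive l p v).
split; first by move=> p _; case: (D p).
rewrite (_ : 'D_v _ = fun p => tens (dtens v l) p *: w)//.
by apply/funext => p; case: (D p).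
Qed.

Lemma tensor_dt (W : normedModType R) (w : W) p :
  dt (fun p : R * R => (X 0%N p.1 * Y 0%N p.2) *: w) p = (X 1%N p.1 * Y 0%N p.2) *: w.
Proof.
have := is_derive_scale_r w (tens_derive [:: (1, 0%N, 0%N)] p (1, 0)).
rewrite (_ : (fun p => _) = (fun p : R * R => (X 0%N p.1 * Y 0%N p.2) *: w)).
  move=> [_]; rewrite /dt => ->.
  by rewrite /tens/= !big_cons big_nil/=; congr (_ *: _); ring.
by apply/funext => z; rewrite /tens big_cons big_nil mul1r addr0.
Qed.

Lemma tensor_dx (W : normedModType R) (w : W) p :
  dx (fun p : R * R => (X 0%N p.1 * Y 0%N p.2) *: w) p = (X 0%N p.1 * Y 1%N p.2) *: w.
Proof.
have := is_derive_scale_r w (tens_derive [:: (1, 0%N, 0%N)] p (0, 1)).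
rewrite (_ : (fun p => _) = (fun p : R * R => (X 0%N p.1 * Y 0%N p.2) *: w)).
  move=> [_]; rewrite /dx => ->.
  by rewrite /tens/= !big_cons big_nil/=; congr (_ *: _); ring.
by apply/funext => z; rewrite /tens big_cons big_nil mul1r addr0.
Qed.

Lemma tensor_test_function (W : normedModType R) (w : W) (T T' : R) :
  (forall y, Y 0%N (y + 2) = Y 0%N y) -> T' < T ->
  (forall s, T' <= s -> X 0%N s = 0) ->
  test_function T (fun p : R * R => (X 0%N p.1 * Y 0%N p.2) *: w).
Proof.
move=> Yper T'T X0; split.
- move=> k; have := Ck_tens w k [:: (1, 0%N, 0%N)].
  rewrite (_ : (fun p => _) = (fun p : R * R => (X 0%N p.1 * Y 0%N p.2) *: w))//.
  by apply/funext => z; rewrite /tens big_cons big_nil mul1r addr0.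
- by move=> s y /=; rewrite Yper.
- by exists T' => // s y /= /X0 ->; rewrite mul0r scale0r.
Qed.

End tensor.

Section bump.

(** Derivatives of exp(-1/w) are of the form P w^(-n) exp(-1/w), where
    w = x (1 - x), on the unit interval. *)
Let w : {poly R} := 'X * (1 - 'X).

Let bumpf (P : {poly R}) (n : nat) (x : R) : R :=
  if 0 < x < 1 then P.[x] * (w.[x]^-1 ^+ n * expR (- w.[x]^-1)) else 0.

Let step (q : {poly R} * nat) : {poly R} * nat :=
  (q.1^`() * w ^+ 2 - (q.2%:R *: (q.1 * w * w^`())) + q.1 * w^`(), q.2.+2).

Let wE x : w.[x] = x * (1 - x).
Proof. by rewrite /w hornerM hornerD hornerN hornerX hornerC. Qed.

Let w_gt0 x : 0 < x < 1 -> 0 < w.[x].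
Proof. by move=> /andP[x0 x1]; rewrite wE mulr_gt0// subr_gt0. Qed.

Let pow_exp_le k (z : R) : 0 <= z -> z ^+ k * expR (- z) <= k%:R ^+ k.
Proof.
move=> z0; case: k => [|k]; first by rewrite !expr0 mul1r -expR0 ler_expR oppr_le0.
have k0 : 0 < k.+1%:R :> R by rewrite ltr0n.
have h : z / k.+1%:R <= expR (z / k.+1%:R).
  by apply: le_trans (expR_ge1Dx _); rewrite lerDr.
have : (z / k.+1%:R) ^+ k.+1 <= expR (z / k.+1%:R) ^+ k.+1.
  by rewrite lerXn2r// nnegrE ?expR_ge0// divr_ge0// ltW.
rewrite -expRM_natl (mulrC _%:R) divfK ?gt_eqF// expr_div_n ler_pdivrMr ?exprn_gt0//.
move=> H; rewrite expRN ler_pdivrMr ?expR_gt0//.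
by rewrite mulrC.
Qed.

Let bumpf_bound P n : exists2 C : R, 0 <= C & forall x, `|bumpf P n x| <= C * w.[x] ^+ 2.
Proof.
have Pc : continuous (fun x => `|P.[x]|).
  by move=> x; apply: cvg_norm; exact: continuous_horner.
have [c _ cP] := @EVT_max R (fun x => `|P.[x]|) 0 1 ler01
  (continuous_subspaceT Pc).
exists (`|P.[c]| * n.+2%:R ^+ n.+2); first by rewrite mulr_ge0// exprn_ge0.
move=> x; rewrite /bumpf; case: ifPn => [x01|_]; last first.
  by rewrite normr0 mulr_ge0 ?sqr_ge0// mulr_ge0// exprn_ge0.
have wx := w_gt0 x01.
rewrite normrM -mulrA ler_pM//; first by apply: cP; rewrite in_itv/= !ltW; case/andP: x01.
rewrite ger0_norm ?mulr_ge0 ?expR_ge0 ?exprn_ge0 ?invr_ge0 ?(ltW wx)//.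
have := @pow_exp_le n.+2 w.[x]^-1; rewrite invr_ge0 ltW// => /(_ erefl) H.
rewrite -ler_pdivrMr ?exprn_gt0// (le_trans _ H)//.
by rewrite le_eqVlt; apply/orP; left; apply/eqP; rewrite -exprVn !exprSr; ring.
Qed.

Let bumpf_derive0 P n x : ~~ (0 < x < 1) -> is_derive x 1 (bumpf P n) 0.
Proof.
move=> nx; have [C C0 bC] := bumpf_bound P n.
have fx : bumpf P n x = 0 by rewrite /bumpf (negbTE nx).
have wb h : `|bumpf P n (h + x)| <= C * h ^+ 2.
  have [hx|hx] := boolP (0 < h + x < 1); last first.
    by rewrite /bumpf (negbTE hx) normr0 mulr_ge0// sqr_ge0.
  apply: (le_trans (bC _)); rewrite ler_wpM2l// -[leRHS]real_normK ?num_real//.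
  rewrite lerXn2r ?nnegrE// ?(ltW (w_gt0 hx))//.
  rewrite wE; move: hx nx => /andP[h1 h2]; rewrite negb_and -!leNgt => /orP[x0|x1].
    rewrite (@le_trans _ _ (h + x))//.
      by rewrite ler_piMr// ltW// ltrBlDr ltrDl.
    by rewrite (@le_trans _ _ h)// ?ler_norm// gerDl.
  rewrite (@le_trans _ _ (1 - (h + x)))//.
    by rewrite ler_piMl// ?subr_ge0 ltW.
  by rewrite (@le_trans _ _ (- h))// ?ler_normr ?lexx ?orbT//; lra.
have C1 : 0 < C + 1 by rewrite ltr_wpDl.
have H : h^-1 *: ((bumpf P n \o shift x) h%:A - bumpf P n x) @[h --> 0^'] --> (0 : R).
  apply/cvgrPdist_le => e e0; near=> h.
  rewrite fx subr0 sub0r normrN /GRing.scale/= mulr1 normrM normfV.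
  have h0 : h != 0 by near: h; exact: nbhs_dnbhs_neq.
  rewrite mulrC ler_pdivrMr ?normr_gt0// (le_trans (wb h))//.
  rewrite -real_normK ?num_real// expr2 mulrA ler_pM2r ?normr_gt0//.
  rewrite (@le_trans _ _ ((C + 1) * `|h|))//.
    by rewrite ler_wpM2r// lerDl.
  rewrite -ler_pdivlMl// mulrC; near: h.
  by apply: dnbhs0_le; rewrite divr_gt0.
by split; [apply/cvg_ex; eexists; exact: H|apply/cvg_lim].
Unshelve. all: by end_near. Qed.

Let stepE P n x : (step (P, n)).1.[x] =
  P^`().[x] * w.[x] ^+ 2 - n%:R * (P.[x] * w.[x] * w^`().[x]) + P.[x] * w^`().[x].
Proof. by rewrite /step !hornerE; ring. Qed.

Let bumpf_derive P n x :
  is_derive x 1 (bumpf P n) (bumpf (step (P, n)).1 (step (P, n)).2 x).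
Proof.
have [x01|nx] := boolP (0 < x < 1); last first.
  by rewrite {2}/bumpf (negbTE nx); exact: bumpf_derive0.
have wx := w_gt0 x01; have wn0 : w.[x] != 0 by rewrite gt_eqF.
have [x0 x1] := andP x01.
pose f z := P.[z] * (w.[z]^-1 ^+ n * expR (- w.[z]^-1)).
have N : \forall z \near x, f z = bumpf P n z.
  near=> z; rewrite /bumpf; have -> //: 0 < z < 1.
  by apply/andP; split; near: z; [exact: lt_nbhsr|exact: lt_nbhsl].
apply: (is_derive_near_eq N).
have wD := is_derive_poly w x.
have iD := is_deriveV wn0 wD.
have eD : is_derive x 1 (expR \o (fun z => - w.[z]^-1)) _ :=
  is_derive1_comp (is_derive_expR _) (is_deriveN iD).
have pD := is_derive_pow n iD.
have := is_derive_mul (is_derive_poly P x) (is_derive_mul pD eD).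
rewrite /GRing.scale/= => D; apply: is_derive_eq.
have -> : (- (fun y => w.[y]^-1)) x = - w.[x]^-1 by [].
rewrite (_ : bumpf _ _ x = (step (P, n)).1.[x] *
  (w.[x]^-1 ^+ n.+2 * expR (- w.[x]^-1))); last by rewrite /bumpf x01.
rewrite stepE.
move: wn0 => {D pD eD iD wD}; set W := w.[x]; set W' := _.[x] => Wn0.
set e := expR _; case: (n) => [|k]; first by rewrite expr0 !exprSr expr0; field.
rewrite -natr1 !(exprSr W^-1) /=; set A := W^-1 ^+ k; rewrite !exprSr expr0 mul1r.
by field.
Unshelve. all: by end_near. Qed.

Definition bump_tower (n : nat) : R -> R :=
  let q := iter n step (1, 0%N) in bumpf q.1 q.2.

Lemma bump_towerP : tower bump_tower.
Proof.
move=> n x; rewrite /bump_tower /= ; case: (iter n step _) => P k.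
exact: bumpf_derive.
Qed.

Lemma bump_tower_out n x : ~~ (0 < x < 1) -> bump_tower n x = 0.
Proof. by move=> nx; rewrite /bump_tower /= /bumpf (negbTE nx). Qed.

Lemma bump_tower0E x : 0 < x < 1 -> bump_tower 0 x = expR (- (x * (1 - x))^-1).
Proof.
by move=> h; rewrite /bump_tower /= /bumpf h hornerC wE expr0 !mul1r.
Qed.

End bump.

End smooth.

Section steps.
Context (R : realType).
Local Notation mu := (@lebesgue_measure R).
Implicit Types (f : R -> R) (t s y e : R).

Lemma Int_zero a b f : (forall x, a <= x <= b -> f x = 0) -> Int a b f = 0.
Proof.
move=> f0; rewrite (@eq_Int _ _ _ _ (fun=> 0))//.
by rewrite /Int Rintegral_cst//= mul0r.
Qed.

Lemma bm_continuous_bounded f (C : R) : continuous f -> (forall x, `|f x| <= C) ->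
  bm f.
Proof. by move=> cf fC; split; [exact: continuous_measurable_fun|exists C]. Qed.

Lemma Int_derive f (a x : R) : bm f -> continuous f -> a < x ->
  is_derive x 1 (fun y => Int a y f) (f x).
Proof.
move=> bf cf ax.
have x1 : x < x + 1 by rewrite ltrDl.
have [] := continuous_FTC1_closed x1 (bm_integrable_itv a (x + 1) bf) ax (cf x).
rewrite derive1E -/(Int a); set F := (fun y => Int a y f) => D E.
by split; [exact: D|exact: E].
Qed.

Let bump0_bound (x : R) : 0 <= bump_tower 0 x <= 1.
Proof.
have [x01|/bump_tower_out ->] := boolP (0 < x < 1); last by rewrite lexx ler01.
rewrite bump_tower0E// expR_ge0/= -[leRHS]expR0 ler_expR oppr_le0 invr_ge0.
by case/andP: x01 => x0 x1; rewrite mulr_ge0 ?subr_ge0 ?ltW.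
Qed.

Let affine_bump t e (n : nat) s := bump_tower n ((s - t) / e) / e ^+ n.

Let affine_bump_tower t e : tower (affine_bump t e).
Proof.
move=> n s; rewrite /affine_bump.
have D1 : is_derive s 1 (fun s => (s - t) / e) e^-1.
  rewrite (_ : (fun s => _) = (fun s => e^-1 * s + - (t / e))).
    apply: is_derive_addc; rewrite -[X in is_derive _ _ _ X]mulr1.
    by apply: is_derive_constl; exact: is_derive_id.
  by apply/funext => z; rewrite mulrBl mulrC.
have D2 := @is_derive_chain _ (bump_tower n) (fun s => (s - t) / e) _ _ _
  (bump_towerP n ((s - t) / e)) D1.
have := is_derive_constl (e ^+ n)^-1 D2.
rewrite (_ : (fun z => _) = (fun s => bump_tower n ((s - t) / e) / e ^+ n)).
  by move=> D; apply: is_derive_eq; rewrite exprS invfM; ring.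
by apply/funext => z; rewrite mulrC.
Qed.

(** On the middle half of its support, the bump is bounded below, so that its
    integral is comparable to the length of the support. *)
Lemma smooth_step : exists2 C : R, 0 < C & forall t e, 0 < e ->
  exists X : nat -> R -> R,
  [/\ tower X, forall n s, s <= t -> X n s = 0,
      forall n s, t + e <= s -> X n s = (n == 0%N)%:R,
      forall s, 0 <= X 0%N s <= 1 &
      (forall s, 0 <= X 1%N s <= C / e) /\ Int t (t + e) (X 1%N) = 1].
Proof.
(* [x * (1 - x) >= 3 / 16] for [1 / 4 <= x <= 3 / 4]. *)
pose c0 : R := expR (- (16 / 3)).
have c00 : 0 < c0 by rewrite expR_gt0.
exists (2 / c0) => [|t e e0]; first by rewrite divr_gt0.
pose B := affine_bump t e.
have tB : tower B by exact: affine_bump_tower.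
have B01 s : 0 <= B 0%N s <= 1 by rewrite /B /affine_bump expr0 divr1.
have B0n s : `|B 0%N s| <= 1 by have /andP[h1 h2] := B01 s; rewrite ger0_norm.
have bB : bm (B 0%N) by apply: bm_continuous_bounded B0n; exact: tower_continuous.
have Bl n s : s <= t -> B n s = 0.
  move=> st; rewrite /B /affine_bump bump_tower_out ?mul0r// negb_and -!leNgt.
  by rewrite pmulr_lle0 ?invr_gt0// subr_le0 st.
have Br n s : t + e <= s -> B n s = 0.
  move=> st; rewrite /B /affine_bump bump_tower_out ?mul0r// negb_and -!leNgt.
  by rewrite ler_pdivlMr// mul1r lerBrDl st orbT.
pose J := Int t (t + e) (B 0%N).
have Jge : c0 * (e / 2) <= J.
  have h1 : t <= t + e / 4 by lra.
  have h2 : t + e / 4 <= t + 3 * e / 4 by lra.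
  have h3 : t + 3 * e / 4 <= t + e by lra.
  rewrite /J (Int_chasles bB h1 (le_trans h2 h3)) (Int_chasles bB h2 h3).
  rewrite (@le_trans _ _ (Int (t + e / 4) (t + 3 * e / 4) (fun=> c0)))//.
    by rewrite Int_cst// le_eqVlt; apply/orP; left; apply/eqP; field.
  rewrite (@le_trans _ _ (Int (t + e / 4) (t + 3 * e / 4) (B 0%N)))//.
    apply: Int_le => //; first exact: bm_cst.
    move=> s /andP[s1 s2]; rewrite /B /affine_bump expr0 divr1.
    have z1 : 1 / 4 <= (s - t) / e by rewrite ler_pdivlMr//; lra.
    have z2 : (s - t) / e <= 3 / 4 by rewrite ler_pdivrMr//; lra.
    move: z1 z2; set z := (s - t) / e => z1 z2.
    rewrite bump_tower0E; last by apply/andP; split; lra.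
    rewrite ler_expR lerN2.
    have w0 : 3 / 16 <= z * (1 - z) by nra.
    have : (z * (1 - z))^-1 <= (3 / 16)^-1 by rewrite lef_pV2 ?posrE//; lra.
    by rewrite invf_div.
  rewrite addrCA lerDl addr_ge0// Int_ge0// => s _; by case/andP: (B01 s).
have J0 : 0 < J by rewrite (lt_le_trans _ Jge)// mulr_gt0// divr_gt0.
have A0 s : s <= t -> Int (t - 1) s (B 0%N) = 0.
  by move=> st; apply: Int_zero => z /andP[_ zs]; rewrite Bl// (le_trans zs).
have At s : t <= s -> Int (t - 1) s (B 0%N) = Int t s (B 0%N).
  by move=> ts; rewrite (@Int_chasles _ _ t)// ?A0 ?add0r// lerBlDr lerDl.
pose X n s := J^-1 * (if n is n'.+1 then B n' s else Int (t - 1) s (B 0%N)).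
have X1E s : X 1%N s = J^-1 * B 0%N s by [].
exists X; split.
- move=> [|n] s; last by apply: is_derive_constl; exact: tB.
  apply: is_derive_constl.
  have [ts|st] := ltP (t - 1) s.
    by apply: Int_derive => //; exact: tower_continuous.
  have N : \forall z \near s, cst 0 z = Int (t - 1) z (B 0%N).
    near=> z; rewrite A0// ltW//; near: z; apply: lt_nbhsl.
    by rewrite (le_lt_trans st)// ltrBlDr ltrDl.
  rewrite Bl; last by rewrite (le_trans st)// lerBlDr lerDl.
  by apply: (is_derive_near_eq N); exact: is_derive_cst.
- by move=> [|n] s st; rewrite /X ?A0// ?Bl// mulr0.
- move=> [|n] s ts; last by rewrite /X Br// mulr0.
  have ts' : t <= s by rewrite (le_trans _ ts)// lerDl ltW.
  rewrite /X At// (@Int_chasles _ _ (t + e))// ?lerDl ?(ltW e0)// -/J.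
  rewrite (@Int_zero (t + e) s); last by move=> z /andP[/Br].
  by rewrite addr0 mulVf// gt_eqF.
- move=> s; rewrite /X; have [st|/ltW ts] := leP s t; first by rewrite A0// mulr0 lexx ler01.
  rewrite At// mulr_ge0 ?invr_ge0 ?(ltW J0)//=; last first.
    by apply: Int_ge0 => z _; case/andP: (B01 z).
  rewrite ler_pdivrMl// mulr1 /J.
  have [se|/ltW es] := leP s (t + e).
    rewrite [leRHS](Int_chasles bB ts se) lerDl.
    by apply: Int_ge0 => z _; case/andP: (B01 z).
  rewrite (@Int_chasles _ _ (t + e))// ?lerDl ?(ltW e0)//.
  by rewrite (@Int_zero (t + e))// ?addr0// => z /andP[/Br].
- split.
    move=> s; rewrite X1E; have /andP[h1 h2] := B01 s.
    rewrite mulr_ge0 ?invr_ge0 ?(ltW J0)//= (@le_trans _ _ J^-1)//.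
      by rewrite ler_piMr// invr_ge0 ltW.
    rewrite -[leRHS]invrK lef_pV2 ?posrE ?invr_gt0 ?divr_gt0//.
    by rewrite (le_trans _ Jge)// le_eqVlt; apply/orP; left; apply/eqP; field; rewrite !gt_eqF.
  by rewrite /X (IntZ _ _ J^-1 bB) mulVf// gt_eqF.
Unshelve. all: by end_near. Qed.

Lemma tower_bm (Y : nat -> R -> R) n (C : R) : tower Y ->
  (forall x, `|Y n x| <= C) -> bm (Y n).
Proof. by move=> tY; apply: bm_continuous_bounded; exact: tower_continuous. Qed.

(** As [Y] vanishes near the end points of the fundamental domain, its periodic
    extension is smooth there. *)
Lemma periodization (Y : nat -> R -> R) (d : R) : tower Y -> 0 < d ->
  (forall n y, ~~ (-1 + d < y < 1 - d) -> Y n y = 0) ->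
  exists Z : nat -> R -> R,
  [/\ tower Z, forall y, Z 0%N (y + 2) = Z 0%N y &
      forall n y, -1 <= y <= 1 -> Z n y = Y n y].
Proof.
move=> tY d0 Y0.
pose k y : int := Num.floor ((y + 1) / 2).
pose Z n y := Y n (y - 2 * (k y)%:~R).
have kP y : -1 + 2 * (k y)%:~R <= y < 1 + 2 * (k y)%:~R.
  have /andP[] := floor_itv ((y + 1) / 2); rewrite -/(k y) intrD => h1 h2.
  by apply/andP; split; lra.
have kE y (j : int) : -1 + 2 * j%:~R <= y < 1 + 2 * j%:~R -> k y = j.
  move=> /andP[h1 h2]; apply: floor_def; rewrite intrD; apply/andP; split; lra.
exists Z; split.
- move=> n y; have /andP[] := kP y; rewrite le_eqVlt => /predU1P[yk _|yl yr].
    have N : \forall z \near y, cst 0 z = Z n z.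
      near=> z; rewrite /Z Y0//; apply/negP => /andP[z1 z2].
      have zd : `|y - z| < d by near: z; apply: cvgr_dist_lt => //; exact: cvg_id.
      move: zd; rewrite ltr_distl => /andP[z3 z4].
      have /andP[k1 k2] := kP z.
      have : (k z)%:~R < (k y)%:~R + 1 :> R by lra.
      have : (k y)%:~R - 1 < (k z)%:~R :> R by lra.
      rewrite -[1]/(1%:~R) -intrB -intrD !ltr_int => l1 l2.
      have kzy : k z = k y by lia.
      move: z1 z2; rewrite kzy => z1 z2; lra.
    rewrite (_ : Z n.+1 y = 0); last by rewrite /Z Y0//; apply/negP => /andP[z1 _]; lra.
    by apply: (is_derive_near_eq N); exact: is_derive_cst.
  have N : \forall z \near y, Y n (z - 2 * (k y)%:~R) = Z n z.
    near=> z; rewrite /Z (kE z (k y))//; apply/andP; split.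
      by apply: ltW; near: z; exact: lt_nbhsr.
    by near: z; exact: lt_nbhsl.
  apply: (is_derive_near_eq N).
  have D1 : is_derive y 1 (fun z => z + - (2 * (k y)%:~R)) 1.
    by apply: is_derive_addc; exact: is_derive_id.
  have := @is_derive_chain _ (Y n) (fun z => z + - (2 * (k y)%:~R)) _ _ _
    (tY n (y - 2 * (k y)%:~R)) D1.
  by rewrite mulr1.
- move=> y; rewrite /Z (kE (y + 2) (k y + 1)).
    by rewrite intrD; congr (Y _ _); ring.
  by have /andP[h1 h2] := kP y; rewrite intrD; apply/andP; split; lra.
- move=> n y /andP[h1 h2]; rewrite /Z; move: h2; rewrite le_eqVlt => /predU1P[->|h2].
    rewrite (kE 1 1%:Z); last by apply/andP; split; lra.
    by rewrite !Y0//; apply/negP => /andP[]; lra.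
  by rewrite (kE y 0%:Z) ?mulr0 ?subr0//; apply/andP; split; lra.
Unshelve. all: by end_near. Qed.

Lemma bm_lebesgue_pt f : bm f -> {ae mu, forall x, lebesgue_pt f x}.
Proof.
move=> bf; apply: lebesgue_differentiation; split; [by case: bf|exact: openT|].
move=> K _ cK; have mK : measurable K by exact: compact_measurable.
have := @bm_integrable _ _ _ mu K f mK (compact_finite_measure cK) bf.
by move=> /integrableP[].
Qed.

(** The kernels are dominated by multiples of the uniform kernel on the ball of
    radius [2 / (n + 1)] around [t], to which the definition of a Lebesgue point
    applies. *)
Lemma lebesgue_pt_cvg f t (C : R) (th : nat -> R -> R) : lebesgue_pt f t ->
  bm f -> (forall n, bm (th n)) ->
  (forall n s, 0 <= th n s <= C * n.+1%:R) ->
  (forall n, Int t (t + n.+1%:R^-1) (th n) = 1) ->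
  Int t (t + n.+1%:R^-1) (fun s => th n s * f s) @[n --> \oo] --> f t.
Proof.
move=> lf bf bth thC th1.
pose r n : R := 2 * n.+1%:R^-1.
have r0 n : 0 < r n by rewrite mulr_gt0.
have n1 n : 0 < n.+1%:R^-1 :> R by rewrite invr_gt0.
have C0 : 0 <= C.
  have /andP[a b] := thC 0%N 0; have := le_trans a b.
  by rewrite mulr1.
have bfc : bm (fun s => `|f s - f t|).
  by apply: bm_norm; apply: bmB => //; exact: bm_cst.
have rn : r n @[n --> \oo] --> 0^'+.
  move=> A A0.
  have h : r n @[n --> \oo] --> (0 : R).
    rewrite -[X in _ --> X](mulr0 (2 : R)); apply: cvgM; first exact: cvg_cst.
    exact: cvg_harmonic.
  have : \forall n \near \oo, 0 < r n -> A (r n) by exact: (h _ A0).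
  by apply: filterS => n; apply.
have key n : `|f t - Int t (t + n.+1%:R^-1) (fun s => th n s * f s)|
    <= 4 * C * fine (davg f t (r n)).
  have tn : t <= t + n.+1%:R^-1 by rewrite lerDl ltW.
  have -> : f t - Int t (t + n.+1%:R^-1) (fun s => th n s * f s) =
     - Int t (t + n.+1%:R^-1) (fun s => th n s * (f s - f t)).
    have -> : Int t (t + n.+1%:R^-1) (fun s => th n s * (f s - f t)) =
       Int t (t + n.+1%:R^-1) (fun s => th n s * f s)
       - Int t (t + n.+1%:R^-1) (fun s => f t * th n s).
      rewrite -IntB; [|exact: bmM|by apply: bmM => //; exact: bm_cst].
      by apply: eq_Int => s _; ring.
    by rewrite IntZ// th1; ring.
  rewrite normrN.
  apply: (le_trans (le_abs_Int _ _ _)); first by apply: bmM => //; apply: bmB => //; exact: bm_cst.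
  apply: (@le_trans _ _ (Int t (t + n.+1%:R^-1) (fun s => C * n.+1%:R * `|f s - f t|))).
    apply: Int_le.
    - by apply: bm_norm; apply: bmM => //; apply: bmB => //; exact: bm_cst.
    - by apply: bmM => //; exact: bm_cst.
    - move=> s _; have /andP[h1 h2] := thC n s.
      by rewrite normrM (ger0_norm h1) ler_wpM2r.
  rewrite IntZ//.
  have sub : `[t, t + n.+1%:R^-1]%classic `<=` ball t (r n).
    move=> s /=; rewrite in_itv/= => /andP[h1 h2]; rewrite /ball/= ltr_norml.
    move: (n1 n) h2; rewrite /r; set a := n.+1%:R^-1 => a0 h2.
    by apply/andP; split; lra.
  have mb : measurable (ball t (r n)) by exact: measurable_ball.
  have lb : mu (ball t (r n)) = (r n *+ 2)%:E by rewrite lebesgue_measure_ball// ltW.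
  have ib : mu.-integrable (ball t (r n)) (EFin \o (fun s => `|f s - f t|)).
    have lby : (mu (ball t (r n)) < +oo)%E by rewrite lb ltry.
    exact: (@bm_integrable _ _ _ mu _ _ mb lby bfc).
  have E : fine (davg f t (r n)) =
      (r n *+ 2)^-1 * \int[mu]_(s in ball t (r n)) `|f s - f t|.
    rewrite /davg /iavg lb fineM//; last 2 first.
    - by rewrite inver gt_eqF// mulrn_wgt0.
    - by apply: integrable_fin_num => //; exact: ib.
    by rewrite inver gt_eqF ?mulrn_wgt0.
  have le : Int t (t + n.+1%:R^-1) (fun s => `|f s - f t|) <=
      \int[mu]_(s in ball t (r n)) `|f s - f t|.
    rewrite /Int /Rintegral fine_le//.
    - by apply: integrable_fin_num => //; exact: bm_integrable_itv bfc.
    - by apply: integrable_fin_num => //; exact: ib.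
    - apply: ge0_subset_integral => //.
      by apply/measurable_EFinP; apply: measurable_funTS; case: bfc.
  rewrite E (le_trans (ler_wpM2l _ le))//; first by rewrite mulr_ge0.
  rewrite le_eqVlt; apply/orP; left; apply/eqP.
  have nn : n.+1%:R != 0 :> R by rewrite pnatr_eq0.
  set I := (X in _ * X = _); rewrite -/I /r -mulr_natr.
  by move: nn; set a := n.+1%:R => nn; field.
have dn : fine (davg f t (r n)) @[n --> \oo] --> (0 : R).
  have := cvg_comp _ _ rn lf; move=> /fine_cvgP[_].
  exact.
apply/cvgrPdist_le => e e0.
have d4 : 4 * C * fine (davg f t (r n)) @[n --> \oo] --> (0 : R).
  by rewrite -[X in _ --> X](mulr0 (4 * C)); apply: cvgM => //; exact: cvg_cst.
near=> n; rewrite (le_trans (key n))//.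
near: n; exact: (cvgr_le _ d4).
Unshelve. all: by end_near. Qed.

End steps.

(** * Calculus in several variables *)

Section vectors.
Context (R : realType) (m : nat).
Implicit Types (a b v : 'cV[R]_m).

Definition basisv (j : 'I_m) : 'cV[R]_m := delta_mx j ord0.

Lemma cV_basis v : v = \sum_j v j ord0 *: basisv j.
Proof.
apply/matrixP => i k; rewrite summxE (bigD1 i)//= !mxE ord1 !eqxx/= mulr1.
rewrite big1 ?addr0// => j ji; rewrite !mxE eq_sym (negbTE ji)/= mulr0//.
Qed.

Lemma coord_le_norm v i : `|v i ord0| <= `|v|.
Proof.
rewrite [`|v|]/Num.norm/= mx_normrE.
by apply: (le_bigmax (0 : R) (fun ij => `|v ij.1 ij.2|) (i, ord0)).
Qed.

Lemma norm_le_coord v (c : R) : 0 <= c -> (forall i, `|v i ord0| <= c) -> `|v| <= c.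
Proof.
move=> c0 vc; rewrite [`|v|]/Num.norm/= mx_normrE; apply: bigmax_le => //.
by move=> [i j] _ /=; rewrite ord1.
Qed.

Lemma dotC a b : dot a b = dot b a.
Proof. by apply: eq_bigr => i _; rewrite mulrC. Qed.

Lemma dotDl a b v : dot (a + b) v = dot a v + dot b v.
Proof. by rewrite /dot -big_split; apply: eq_bigr => i _; rewrite mxE mulrDl. Qed.

Lemma dotNl a b : dot (- a) b = - dot a b.
Proof. by rewrite /dot -sumrN; apply: eq_bigr => i _; rewrite mxE mulNr. Qed.

Lemma dotBl a b v : dot (a - b) v = dot a v - dot b v.
Proof. by rewrite dotDl dotNl. Qed.

Lemma dotBr a b v : dot v (a - b) = dot v a - dot v b.
Proof. by rewrite dotC dotBl !(dotC v). Qed.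

Lemma dotZl (c : R) a b : dot (c *: a) b = c * dot a b.
Proof. by rewrite /dot mulr_sumr; apply: eq_bigr => i _; rewrite mxE mulrA. Qed.

Lemma dot_ge0 v : 0 <= dot v v.
Proof. by apply: sumr_ge0 => i _; rewrite -expr2 sqr_ge0. Qed.

Lemma dot_basis v j : dot v (basisv j) = v j ord0.
Proof.
rewrite /dot (bigD1 j)//= !mxE !eqxx mulr1 big1 ?addr0// => i ij.
by rewrite !mxE (negbTE ij) mulr0.
Qed.

Lemma enorm_ge0 v : 0 <= enorm v.
Proof. exact: sqrtr_ge0. Qed.

Lemma enorm_sqr v : enorm v ^+ 2 = dot v v.
Proof. by rewrite sqr_sqrtr// dot_ge0. Qed.

Lemma dot_eq0 v : dot v v = 0 -> v = 0.
Proof.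
move=> /eqP; rewrite psumr_eq0; last by move=> i _; rewrite -expr2 sqr_ge0.
move=> /allP h; apply/matrixP => i j; rewrite ord1 mxE.
by apply/eqP; have := h i; rewrite mem_index_enum -expr2 sqrf_eq0; apply.
Qed.

Lemma enormN v : enorm (- v) = enorm v.
Proof. by rewrite /enorm dotNl dotC dotNl opprK. Qed.

Lemma coord_le_enorm v i : `|v i ord0| <= enorm v.
Proof.
rewrite -sqrtr_sqr ler_wsqrtr// /dot (bigD1 i)//= expr2 lerDl.
by apply: sumr_ge0 => j _; rewrite -expr2 sqr_ge0.
Qed.

Lemma norm_le_enorm v : `|v| <= enorm v.
Proof. by apply: norm_le_coord; [exact: enorm_ge0|exact: coord_le_enorm]. Qed.

Lemma enorm_le_norm v : enorm v <= m%:R * `|v|.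
Proof.
rewrite -(@ler_pXn2r _ 2)// ?nnegrE ?enorm_ge0// ?mulr_ge0// enorm_sqr.
apply: (@le_trans _ _ (\sum_(i < m) `|v| ^+ 2)).
  apply: ler_sum => i _; rewrite -expr2 -real_normK ?num_real//.
  by rewrite lerXn2r ?nnegrE// coord_le_norm.
rewrite sumr_const card_ord -[X in X <= _]mulr_natl exprMn.
apply: ler_wpM2r; first exact: sqr_ge0.
by rewrite -natrX ler_nat; case: (m) => // k; rewrite leq_pmulr.
Qed.

Definition bform (H : 'M[R]_m) a b : R :=
  \sum_i \sum_j H i j * a i ord0 * b j ord0.

Lemma qformE H v : qform H v = bform H v v.
Proof.
rewrite /qform /bform mxE exchange_big/=; apply: eq_bigr => j _.
rewrite mxE mulr_suml; apply: eq_bigr => i _.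
by rewrite !mxE; ring.
Qed.

Lemma bformC (H : 'M[R]_m) a b : (forall i j, H i j = H j i) -> bform H a b = bform H b a.
Proof.
move=> HC; rewrite /bform exchange_big/=; apply: eq_bigr => j _; apply: eq_bigr => i _.
by rewrite HC; ring.
Qed.

Lemma bformDl H a b v : bform H (a + b) v = bform H a v + bform H b v.
Proof.
rewrite /bform -big_split; apply: eq_bigr => i _; rewrite -big_split.
by apply: eq_bigr => j _; rewrite mxE /=; ring.
Qed.

Lemma bformDr H a b v : bform H v (a + b) = bform H v a + bform H v b.
Proof.
rewrite /bform -big_split; apply: eq_bigr => i _; rewrite -big_split.
by apply: eq_bigr => j _; rewrite mxE /=; ring.
Qed.

Lemma bformZl H (c : R) a b : bform H (c *: a) b = c * bform H a b.
Proof.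
rewrite /bform mulr_sumr; apply: eq_bigr => i _; rewrite mulr_sumr.
by apply: eq_bigr => j _; rewrite mxE; ring.
Qed.

Lemma bformZr H (c : R) a b : bform H a (c *: b) = c * bform H a b.
Proof.
rewrite /bform mulr_sumr; apply: eq_bigr => i _; rewrite mulr_sumr.
by apply: eq_bigr => j _; rewrite mxE; ring.
Qed.

Lemma enorm0P v : enorm v = 0 -> v = 0.
Proof. by move=> v0; apply: dot_eq0; rewrite -enorm_sqr v0 expr0n. Qed.

(** The Cauchy-Schwarz inequality for a positive form, followed by the bound of
    this form by [C] times the Euclidean one. *)
Lemma bform_le (H : 'M[R]_m) (C : R) a b : (forall i j, H i j = H j i) ->
  (forall v, 0 <= bform H v v <= C * enorm v ^+ 2) ->
  bform H a b <= C * (enorm a * enorm b).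
Proof.
move=> HC Hb.
have [a0|a0] := eqVneq (enorm a) 0.
  by rewrite a0 (enorm0P a0) -(scale0r 0) bformZl !mul0r mulr0.
have [b0|b0] := eqVneq (enorm b) 0.
  by rewrite b0 (enorm0P b0) -(scale0r 0) bformZr mul0r !mulr0.
have pa : 0 < enorm a by rewrite lt_neqAle eq_sym a0 enorm_ge0.
have pb : 0 < enorm b by rewrite lt_neqAle eq_sym b0 enorm_ge0.
have := Hb (enorm b *: a + (- enorm a) *: b) => /andP[+ _].
rewrite !(bformDl, bformDr, bformZl, bformZr) (bformC b a HC).
have /andP[_ ha] := Hb a; have /andP[_ hb] := Hb b => h.
have h1 : enorm b ^+ 2 * bform H a a <= enorm b ^+ 2 * (C * enorm a ^+ 2).
  by rewrite ler_wpM2l// sqr_ge0.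
have h2 : enorm a ^+ 2 * bform H b b <= enorm a ^+ 2 * (C * enorm b ^+ 2).
  by rewrite ler_wpM2l// sqr_ge0.
have pab : 0 < enorm a * enorm b by rewrite mulr_gt0.
rewrite -(ler_pM2l pab); nra.
Qed.

Lemma dot_le a b : dot a b <= enorm a * enorm b.
Proof.
have E u v : dot u v = bform 1%:M u v.
  rewrite /dot /bform; apply: eq_bigr => i _.
  rewrite (bigD1 i)//= mxE eqxx mul1r big1 ?addr0// => j ji.
  by rewrite mxE eq_sym (negbTE ji) !mul0r.
rewrite -[leRHS]mul1r E; apply: bform_le.
  by move=> i j; rewrite !mxE eq_sym.
by move=> v; rewrite -E mul1r enorm_sqr dot_ge0 lexx.
Qed.

Lemma dotDr a b v : dot v (a + b) = dot v a + dot v b.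
Proof. by rewrite dotC dotDl !(dotC v). Qed.

Lemma ler_enormD a b : enorm (a + b) <= enorm a + enorm b.
Proof.
rewrite -(@ler_pXn2r _ 2)// ?nnegrE ?addr_ge0 ?enorm_ge0//.
rewrite enorm_sqr dotDl !dotDr sqrrD !enorm_sqr (dotC b a).
have := dot_le a b; lra.
Qed.

End vectors.

Section C1.
Context (R : realType).

Lemma line_derive (V W : normedModType R) (f : V -> W) (p v : V) (s : R) :
  derivable f (p + s *: v) v ->
  is_derive s 1 (fun z : R => f (p + z *: v)) ('D_v f (p + s *: v)).
Proof.
move=> /derivableP /is_derive_lineP D; apply/is_derive_lineP.
rewrite (_ : (fun h : R => _) = (fun h : R => f (h *: v + (p + s *: v))))//.
apply/funext => h; congr f.
by rewrite [in LHS]scalerDl /GRing.scale/= mulr1 addrCA.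
Qed.

Lemma MVT_cc (f df : R -> R) (a b : R) : a <= b ->
  (forall x, a <= x <= b -> is_derive x 1 f (df x)) ->
  exists2 c, a <= c <= b & f b - f a = df c * (b - a).
Proof.
move=> ab D; have [||c cab E] := @MVT_segment R f df a b ab.
- by move=> x; rewrite in_itv/= => /andP[ax xb]; apply: D; rewrite !ltW.
- apply: derivable_within_continuous => x; rewrite in_itv/= => xab.
  by case: (D x xab).
by exists c => //; move: cab; rewrite in_itv.
Qed.

Context (m : nat).
Local Notation V := 'cV[R]_m.
Implicit Types (U : set V) (f : V -> R) (y v : V).

Definition gradlin (d : 'I_m -> R) v : R := \sum_j v j ord0 * d j.

Let gradlin_is_linear d : linear (gradlin d).
Proof.
move=> c u v; rewrite /gradlin scaler_sumr -big_split; apply: eq_bigr => j _.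
by rewrite !mxE mulrDl -mulrA.
Qed.
HB.instance Definition _ d := GRing.isLinear.Build R V R _ (gradlin d)
  (gradlin_is_linear d).

Let gradlin_continuous d : continuous (gradlin d).
Proof.
rewrite /gradlin; elim: (index_enum _) => [|j l IH] v.
  rewrite (_ : (fun v : V => \sum_(j <- [::]) v j ord0 * d j) = cst (0 : R)).
    exact: cst_continuous.
  by apply/funext => z; rewrite big_nil.
rewrite (_ : (fun v => _) =
    (fun v : V => v j ord0 * d j + \sum_(k <- l) v k ord0 * d k)).
  have C1 : continuous_at v (fun v : V => v j ord0 * d j).
    apply: (@continuous_comp _ _ _ (fun v : V => v j ord0) (fun z : R => z * d j) v).
      exact: coord_continuous.
    exact: mulrr_continuous.
  exact: (cvgD C1 (IH v)).
by apply/funext => z; rewrite big_cons.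
Qed.

Lemma Ck_continuous k U f y : Ck k U f -> U y -> {for y, continuous f}.
Proof. by case: k => [|k] [+ _] => /[apply]. Qed.

Lemma Ck_le (E W : normedModType R) k l (U : set E) (f : E -> W) : (l <= k)%N ->
  Ck k U f -> Ck l U f.
Proof.
elim: k l f => [|k IH] [|l] f //= lk [cf H]; split => // v.
by have [d Dk] := H v; split => //; exact: IH.
Qed.

(** Telescoping along the coordinate directions and the mean value theorem
    reduce the first-order expansion to the continuity of the partial
    derivatives. *)
Lemma Ck1_expansion U f y : open U -> Ck 1 U f -> U y ->
  forall e : R, 0 < e -> \forall h \near (0 : V),
    `|f (h + y) - f y - gradlin (fun j => 'D_(basisv R j) f y) h| <= e * `|h|.
Proof.
move=> oU [_ fD] Uy e e0.
have m1 : 0 < m.+1%:R :> R by rewrite ltr0n.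
have near_good : \forall z \near y, U z /\
    forall j, `|'D_(basisv R j) f z - 'D_(basisv R j) f y| <= e / m.+1%:R.
  apply: filterI; first exact: open_nbhs_nbhs.
  apply: (@filter_forall V 'I_m (fun j z =>
    `|'D_(basisv R j) f z - 'D_(basisv R j) f y| <= e / m.+1%:R) (nbhs y) _) => k; have [_ [ck _]] := fD (basisv R k).
  have em : 0 < e / m.+1%:R by rewrite divr_gt0.
  have /cvgrPdist_le/(_ _ em) := ck _ Uy; apply: filterS => z.
  by rewrite distrC.
have [r /= r0 br] : exists2 r : R, 0 < r & ball y r `<=` [set z | U z /\
    forall j, `|'D_(basisv R j) f z - 'D_(basisv R j) f y| <= e / m.+1%:R].
  by move/nbhs_ballP: near_good.
near=> h.
have hr : `|h| < r by near: h; apply/nbhs_ballP; exists r => // z; rewrite -ball_normE /= sub0r normrN.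
pose part (k : nat) : V := \sum_(j < m | (j < k)%N) h j ord0 *: basisv R j.
have partE k i : part k i ord0 = if (i < k)%N then h i ord0 else 0.
  rewrite /part summxE; case: ifPn => ik.
    rewrite (bigD1 i)//= !mxE !eqxx mulr1 big1 ?addr0// => j /andP[_ ji].
    by rewrite !mxE eq_sym (negbTE ji) mulr0.
  rewrite big1// => j jk; rewrite !mxE eqxx andbT.
  by case: eqP => [ij|_]; [move: ik; rewrite ij jk|rewrite mulr0].
have part0 : part 0%N = 0.
  by apply/matrixP => i j; rewrite ord1 partE mxE.
have partm : part m = h.
  by apply/matrixP => i j; rewrite ord1 partE ltn_ord.
have stepE (k : 'I_m) : part k.+1 = part k + h k ord0 *: basisv R k.
  apply/matrixP => i j; rewrite ord1 !mxE !partE ltnS eqxx andbT.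
  case: (ltngtP i k) => [ik|ik|/val_inj ->]; last by rewrite eqxx mulr1 add0r.
    by rewrite (_ : (i == k) = false) ?mulr0 ?addr0//; apply/negP => /eqP ik'; rewrite ik' ltnn in ik.
  by rewrite (_ : (i == k) = false) ?mulr0 ?addr0//; apply/negP => /eqP ik'; rewrite ik' ltnn in ik.
have tele : f (h + y) - f y = \sum_(k < m) (f (part k.+1 + y) - f (part k + y)).
  rewrite -(big_mkord xpredT (fun k => f (part k.+1 + y) - f (part k + y))).
  by rewrite telescope_sumr// part0 partm add0r.
rewrite tele /gradlin -sumrB.
apply: (@le_trans _ _ (\sum_(k < m) (e / m.+1%:R) * `|h|)); last first.
  rewrite sumr_const card_ord -[_ *+ _]mulr_natl mulrA ler_wpM2r//.
  rewrite mulrCA ler_piMr ?(ltW e0)// ler_pdivrMr// mul1r ler_nat//.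
apply: (le_trans (ler_norm_sum _ _ _)); apply: ler_sum => k _.
pose phi (s : R) := f (part k + y + (s * h k ord0) *: basisv R k).
have inball (s : R) : 0 <= s <= 1 -> ball y r (part k + y + (s * h k ord0) *: basisv R k).
  move=> /andP[s0 s1]; rewrite -ball_normE/=.
  rewrite (_ : y - _ = - (part k + (s * h k ord0) *: basisv R k)); last first.
    by apply/matrixP => i j; rewrite !mxE; ring.
  rewrite normrN (le_lt_trans _ hr)//.
  apply: norm_le_coord => // i; rewrite !mxE partE eqxx andbT.
  case: (ltngtP i k) => [ik|ik|/val_inj ->].
  - rewrite (_ : (i == k) = false) ?mulr0 ?addr0 ?coord_le_norm//.
    by apply/negP => /eqP ik'; rewrite ik' ltnn in ik.
  - rewrite (_ : (i == k) = false) ?mulr0 ?addr0 ?normr0//.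
    by apply/negP => /eqP ik'; rewrite ik' ltnn in ik.
  - rewrite eqxx mulr1 add0r normrM (ger0_norm s0).
    by rewrite (le_trans _ (coord_le_norm h k))// ler_piMl.
have D (s : R) : 0 <= s <= 1 -> is_derive s 1 phi
    ('D_(basisv R k) f (part k + y + (s * h k ord0) *: basisv R k) * h k ord0).
  move=> s01; have [Us _] := br _ (inball s s01).
  have [+ _] := fD (basisv R k); move=> /(_ _ Us) /line_derive D1.
  have D2 : is_derive s 1 (fun s => s * h k ord0) (h k ord0).
    have := is_derive_mul (is_derive_id s 1) (is_derive_cst (h k ord0) s 1).
    by rewrite mulr0 addr0 mul1r.
  exact: (@is_derive_chain _ (fun z => f (part k + y + z *: basisv R k))
    (fun s => s * h k ord0) _ _ _ D1 D2).
have [c c01 E] := MVT_cc ler01 D.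
have [_ /(_ k) bk] := br _ (inball c c01).
have -> : f (part k.+1 + y) - f (part k + y) = phi 1 - phi 0.
  by rewrite /phi mul1r mul0r scale0r addr0 stepE addrAC.
rewrite E subr0 mulr1 (mulrC (h k ord0)) -mulrBl normrM ler_pM//.
exact: coord_le_norm.
Unshelve. all: by end_near. Qed.

Lemma Ck1_differentiable U f y : open U -> Ck 1 U f -> U y ->
  differentiable f y /\ forall v, 'd f y v = gradlin (fun j => 'D_(basisv R j) f y) v.
Proof.
move=> oU fC Uy; set L := gradlin _.
have E : f \o shift y = cst (f y) + L +o_ (0 : V) id.
  apply/eqaddoP => e e0; have := Ck1_expansion oU fC Uy e0; apply: filterS => h /=.
  by rewrite !fctE opprD addrA.
have Lc : continuous L by exact: gradlin_continuous.
have dE : 'd f y = L :> (V -> R) := diff_unique Lc E.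
split; last by move=> v; rewrite dE.
by apply/diff_locallyP; rewrite dE.
Qed.

Lemma Ck1_derive U f y v : open U -> Ck 1 U f -> U y ->
  'D_v f y = gradlin (fun j => 'D_(basisv R j) f y) v.
Proof.
move=> oU fC Uy; have [fd dE] := Ck1_differentiable oU fC Uy.
by rewrite deriveE.
Qed.

(** The curve is only differentiated at one point and coordinatewise, as is
    provided by the almost everywhere derivatives of Lipschitz functions. *)
Lemma Ck1_curve U f (c : R -> V) (dc : V) (x : R) : open U -> Ck 1 U f -> U (c x) ->
  (forall j, is_derive x 1 (fun s => c s j ord0) (dc j ord0)) ->
  is_derive x 1 (fun s => f (c s))
    (\sum_j dc j ord0 * 'D_(basisv R j) f (c x)).
Proof.
move=> oU fC Uc cD; have [fd dE] := Ck1_differentiable oU fC Uc.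
have cder : derivable c x 1.
  by apply/derivable_mxP => i j; rewrite ord1; case: (cD i).
have cE : 'D_1 c x = dc.
  rewrite derive_mx//; apply/matrixP => i j; rewrite mxE ord1.
  by case: (cD i).
have cd : differentiable c x by apply/derivable1_diffP.
have fcd : differentiable (f \o c) x by exact: differentiable_comp.
split; first exact/derivable1_diffP.
rewrite -[LHS]/('D_1 (f \o c) x) (deriveE _ fcd) diff_comp//= dE -(deriveE _ cd) cE.
by [].
Qed.

Lemma Ck_ext k U f f' : open U -> (forall y, U y -> f y = f' y) -> Ck k U f -> Ck k U f'.
Proof.
move=> oU; elim: k f f' => [|k IH] f f' ff' [cf H].
  split => // y Uy; have N : \near y, f y = f' y.
    by near=> z; apply: ff'; near: z; exact: open_nbhs_nbhs.
  rewrite /prop_for /continuous_at -(ff' _ Uy).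
  apply: cvg_trans; last exact: cf.
  exact: near_eq_cvg N.
have N y : U y -> \near y, f y = f' y.
  by move=> Uy; near=> z; apply: ff'; near: z; exact: open_nbhs_nbhs.
split.
  move=> y Uy; rewrite /prop_for /continuous_at -(ff' _ Uy).
  apply: cvg_trans; last exact: cf.
  exact: near_eq_cvg (N y Uy).
move=> v; have [fd fk] := H v; split.
  by move=> y Uy; apply: near_eq_derivable (N y Uy) _; exact: fd.
by apply: (IH _ _ _ fk) => y Uy; apply: near_eq_derive; exact: N.
Unshelve. all: by end_near. Qed.

Lemma Ck_coord n k U (g : V -> 'cV[R]_n) j : open U -> Ck k U g ->
  Ck k U (fun y => g y j ord0).
Proof.
move=> oU; elim: k g => [|k IH] g [cg H].
  by split => // y Uy; apply: (@continuous_comp _ _ _ g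
    (fun z : 'cV[R]_n => z j ord0) y (cg y Uy)); exact: coord_continuous.
split.
  by move=> y Uy; apply: (@continuous_comp _ _ _ g
    (fun z : 'cV[R]_n => z j ord0) y (cg y Uy)); exact: coord_continuous.
move=> v; have [gd gk] := H v; split.
  by move=> y Uy; have /derivable_mxP := gd y Uy; exact.
apply: (Ck_ext oU _ (IH _ gk)) => y Uy.
by rewrite derive_mx ?mxE//; exact: gd.
Qed.

Lemma Ck_diff_coord n U (g : V -> 'cV[R]_n) y v j : open U -> Ck 1 U g -> U y ->
  ('d g y v) j ord0 = gradlin (fun k => 'D_(basisv R k) (fun z => g z j ord0) y) v.
Proof.
move=> oU gC Uy.
have gd : differentiable g y.
  rewrite (_ : g = \sum_(j < n) (fun z => g z j ord0 *: basisv R j)); last first.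
    apply/funext => z; rewrite [LHS]cV_basis.
    by elim/big_ind2 : _ => // f1 z1 f2 z2 -> ->.
  apply: differentiable_sum => i; apply: differentiableZl.
  by have [] := Ck1_differentiable oU (Ck_coord i oU gC) Uy.
rewrite -deriveE// derive_mx; last by apply: diff_derivable.
by rewrite mxE (Ck1_derive v oU (Ck_coord j oU gC) Uy).
Qed.

End C1.

Section C2.
Context (R : realType) (m : nat).
Local Notation V := 'cV[R]_m.
Local Notation "''d_' j" := (fun f : V -> R => 'D_(basisv R j) f) (at level 10, j at level 8).
Implicit Types (U : set V) (f : V -> R) (y v a b : V).

Lemma hessianE f y i j : hessian f y i j = 'D_(basisv R i) ('D_(basisv R j) f) y.
Proof. by rewrite mxE. Qed.

Lemma Ck_partial k U f j : Ck k.+1 U f -> Ck k U ('D_(basisv R j) f).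
Proof. by move=> [_ /(_ (basisv R j))[]]. Qed.

(** The second difference quotient in two directions is a mixed derivative at
    an intermediate point. *)
Let second_difference f y (v w : V) (h : R) (U : set V) : 0 < h -> Ck 2 U f ->
  (forall s t, 0 <= s <= h -> 0 <= t <= h -> U (y + s *: v + t *: w)) ->
  exists st : R * R, [/\ 0 <= st.1 <= h, 0 <= st.2 <= h &
    f (y + h *: v + h *: w) - f (y + h *: v) - f (y + h *: w) + f y =
    h ^+ 2 * 'D_w ('D_v f) (y + st.1 *: v + st.2 *: w)].
Proof.
move=> h0 fC inU; have hh : 0 <= h <= h by rewrite lexx (ltW h0).
have h00 : 0 <= (0 : R) <= h by rewrite lexx (ltW h0).
have [_ H] := fC; have [fd [_ H1]] := H v; have [fdd _] := H1 w.
pose G s := f (y + s *: v + h *: w) - f (y + s *: v).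
have GD s : 0 <= s <= h ->
    is_derive s 1 G ('D_v f (y + s *: v + h *: w) - 'D_v f (y + s *: v)).
  move=> sh; apply: is_deriveB.
    have d1 : derivable f ((y + h *: w) + s *: v) v.
      by rewrite addrAC; apply: fd; exact: inU.
    have := line_derive d1; rewrite (addrAC y).
    by rewrite (_ : (fun z : R => f (y + h *: w + z *: v)) = (fun z : R => f (y + z *: v + h *: w)))//;
      apply/funext => z; rewrite addrAC.
  by apply: line_derive; apply: fd; have := inU s 0 sh h00; rewrite scale0r addr0.
have [s sh Es] := MVT_cc (ltW h0) GD.
have FD t : 0 <= t <= h -> is_derive t 1 (fun t : R => 'D_v f (y + s *: v + t *: w))
    ('D_w ('D_v f) (y + s *: v + t *: w)).
  by move=> th; apply: line_derive; apply: fdd; exact: inU.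
have [t th Et] := MVT_cc (ltW h0) FD.
exists (s, t); split => //=.
have -> : f (y + h *: v + h *: w) - f (y + h *: v) - f (y + h *: w) + f y = G h - G 0.
  by rewrite /G scale0r addr0; ring.
by move: Et Es; rewrite !scale0r !addr0 !subr0 => -> ->; ring.
Qed.

Let same_quotient (A B C D d d' h : R) : A - B - C + D = h * d ->
  A - C - B + D = h * d' -> h != 0 -> d = d'.
Proof. by move=> E1 E2 h0; apply: (mulfI h0); rewrite -E1 -E2; ring. Qed.

Let close_values (a b c d e : R) : c = d -> `|a - c| <= e / 2 -> `|b - d| <= e / 2 ->
  `|b - a| <= e.
Proof.
move=> -> h1 h2; rewrite (_ : b - a = (b - d) - (a - d)); last by ring.
by rewrite (le_trans (ler_normB _ _))// [leRHS](splitr e) lerD.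
Qed.

Let is_derive_sub (p q : R -> R) (dp dq s : R) : is_derive s 1 p dp ->
  is_derive s 1 q dq -> is_derive s 1 (fun s => p s - q s) (dp - dq).
Proof. by move=> Dp Dq; exact: is_derive_add Dp (is_derive_opp Dq). Qed.

Let near_two U y (d1 d2 : V -> R) (e : R) : 0 < e -> open U -> U y ->
  {for y, continuous d1} -> {for y, continuous d2} ->
  exists2 r : R, 0 < r & forall z, ball y r z ->
    [/\ U z, `|d1 y - d1 z| <= e & `|d2 y - d2 z| <= e].
Proof.
move=> e0 oU Uy /cvgrPdist_le/(_ _ e0) N1 /cvgrPdist_le/(_ _ e0) N2.
have N0 : \forall z \near y, U z by exact: open_nbhs_nbhs.
have [r /= r0 br] : exists2 r : R, 0 < r & ball y r `<=` (U `&` ([set z | `|d1 y - d1 z| <= e]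
    `&` [set z | `|d2 y - d2 z| <= e])).
  by apply/nbhs_ballP; exact: filterI N0 (filterI N1 N2).
by exists r => // z /br [Uz [h1 h2]].
Qed.

(** Schwarz's theorem: the second difference quotient is symmetric in the two
    directions, and both mixed derivatives are its limits by continuity. *)
Lemma hessian_sym U f y i j : open U -> Ck 2 U f -> U y ->
  hessian f y i j = hessian f y j i.
Proof.
move=> oU fC Uy; rewrite !hessianE; set v := basisv R i; set w := basisv R j.
have [_ H] := fC.
have [_ [_ /(_ w)[_ [c1 _]]]] := H v; have [_ [_ /(_ v)[_ [c2 _]]]] := H w.
apply/eqP; rewrite -subr_eq0 -normr_eq0; apply/eqP/le_anti; rewrite normr_ge0 andbT.
apply/ler_addgt0Pr => e e0; rewrite add0r.
have e2 : 0 < e / 2 by rewrite divr_gt0.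
have [r r0 br] := near_two e2 oU Uy (c1 _ Uy) (c2 _ Uy).
pose h := r / 3.
have h0 : 0 < h by rewrite divr_gt0.
have bv (k : 'I_m) : `|basisv R k| <= 1.
  by apply: norm_le_coord => // l; rewrite !mxE; case: (_ && _);
    rewrite ?normr1 ?normr0.
have inb (p q : V) s t : `|p| <= 1 -> `|q| <= 1 -> 0 <= s <= h -> 0 <= t <= h ->
    ball y r (y + s *: p + t *: q).
  move=> p1 q1 /andP[s0 sh] /andP[t0 th].
  rewrite -ball_normE/= (_ : y - _ = - (s *: p + t *: q)); last first.
    by rewrite -addrA opprD addrA subrr add0r.
  rewrite normrN (le_lt_trans (ler_normD _ _))// !normrZ (ger0_norm s0) (ger0_norm t0).
  have : s * `|p| <= h by rewrite -[leRHS]mulr1 ler_pM.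
  have : t * `|q| <= h by rewrite -[leRHS]mulr1 ler_pM.
  by move: r0; rewrite /h; lra.
have [[s1 t1] [/= a1 b1 E1]] := @second_difference f y v w h U h0 fC
  (fun s t hs ht => let: And3 Us _ _ := br _ (inb v w s t (bv _) (bv _) hs ht) in Us).
have [[s2 t2] [/= a2 b2 E2]] := @second_difference f y w v h U h0 fC
  (fun s t hs ht => let: And3 Us _ _ := br _ (inb w v s t (bv _) (bv _) hs ht) in Us).
have [_ d1 _] := br _ (inb v w s1 t1 (bv _) (bv _) a1 b1).
have [_ _ d2] := br _ (inb w v s2 t2 (bv _) (bv _) a2 b2).
have EE : 'D_w ('D_v f) (y + s1 *: v + t1 *: w) = 'D_v ('D_w f) (y + s2 *: w + t2 *: v).
  have hn : h ^+ 2 != 0 by rewrite expf_neq0// gt_eqF.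
  by rewrite (addrAC y (h *: v)) in E1; exact: same_quotient E1 E2 hn.
exact: close_values EE d1 d2.
Qed.

Let MVT_oo (f df : R -> R) (a b : R) : a < b ->
  (forall x, a <= x <= b -> is_derive x 1 f (df x)) ->
  exists2 c, a < c < b & f b - f a = df c * (b - a).
Proof.
move=> ab D; have [||c cab E] := @MVT R f df a b ab.
- by move=> x; rewrite in_itv/= => /andP[ax xb]; apply: D; rewrite !ltW.
- apply: derivable_within_continuous => x; rewrite in_itv/= => xab.
  by case: (D x xab).
by exists c => //; move: cab; rewrite in_itv.
Qed.

Lemma segment_derive U f a v (s : R) : open U -> Ck 1 U f -> U (a + s *: v) ->
  is_derive s 1 (fun s : R => f (a + s *: v))
    (\sum_j v j ord0 * 'D_(basisv R j) f (a + s *: v)).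
Proof.
move=> oU fC Us; rewrite -[X in is_derive _ _ _ X]/(gradlin _ v).
rewrite -(Ck1_derive v oU fC Us); apply: line_derive.
by have [_ /(_ v)[+ _]] := fC; exact.
Qed.

(** The mean value theorem is applied twice to the remainder along the segment,
    corrected by the multiple of [s ^+ 2] that makes it vanish at [s = 1]. *)
Lemma taylor2 U f a b : open U -> Ck 2 U f ->
  (forall s : R, 0 <= s <= 1 -> U (a + s *: (b - a))) ->
  exists2 s : R, 0 <= s <= 1 &
    f b - f a - \sum_j (b - a) j ord0 * 'D_(basisv R j) f a =
    2^-1 * qform (hessian f (a + s *: (b - a))) (b - a).
Proof.
move=> oU fC inU; set v := b - a.
pose phi (s : R) := f (a + s *: v).
pose dphi (s : R) := \sum_j v j ord0 * 'D_(basisv R j) f (a + s *: v).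
pose ddphi (s : R) := qform (hessian f (a + s *: v)) v.
have D1 (s : R) : 0 <= s <= 1 -> is_derive s 1 phi (dphi s).
  by move=> /inU Us; exact: segment_derive oU (@Ck_le R V R 2 1 _ _ isT fC) Us.
have D2 (s : R) : 0 <= s <= 1 -> is_derive s 1 dphi (ddphi s).
  move=> /inU Us; rewrite /ddphi qformE /bform exchange_big/=.
  pose h j := (fun s : R => v j ord0 * 'D_(basisv R j) f (a + s *: v)).
  rewrite (_ : dphi = \sum_(j < m) h j); last first.
    by apply/funext => z; rewrite /dphi fct_sumE.
  apply: is_derive_sum => j.
  rewrite (_ : \sum_(i < m) _ = v j ord0 * \sum_i v i ord0 *
      'D_(basisv R i) ('D_(basisv R j) f) (a + s *: v)); last first.
    by rewrite mulr_sumr; apply: eq_bigr => i _; rewrite hessianE; ring.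
  apply: is_derive_constl; apply: segment_derive Us => //.
  exact: Ck_partial.
pose K := phi 1 - phi 0 - dphi 0.
pose psi s := phi s - phi 0 - dphi 0 * s - K * s ^+ 2.
have DK (s : R) : is_derive s 1 (fun s => K * s ^+ 2) (K * (2 * s)).
  have := is_derive_constl K (is_derive_pow 2 (is_derive_id s 1)).
  by rewrite /= expr1 mulr1.
have Did (s : R) : is_derive s 1 (fun s => dphi 0 * s) (dphi 0).
  by have := is_derive_constl (dphi 0) (is_derive_id s 1); rewrite mulr1.
have D3 (s : R) : 0 <= s <= 1 -> is_derive s 1 psi (dphi s - dphi 0 - 2 * K * s).
  move=> s01; rewrite (_ : 2 * K * s = K * (2 * s)); last by ring.
  have := is_derive_sub (is_derive_sub (is_derive_sub (D1 s s01)
    (is_derive_cst (phi 0) s 1)) (Did s)) (DK s).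
  by rewrite subr0.
have [s1 /andP[s1p s1l] E1] := MVT_oo ltr01 D3.
have P1 : psi 1 - psi 0 = 0.
  by rewrite /psi /K expr1n expr0n/=; ring.
have D4 (s : R) : 0 <= s <= s1 ->
    is_derive s 1 (fun s => dphi s - dphi 0 - 2 * K * s) (ddphi s - 2 * K).
  move=> /andP[s0 ss1].
  have s01 : 0 <= s <= 1 by rewrite s0 (le_trans ss1)// ltW.
  have Dl := is_derive_constl (2 * K) (is_derive_id s 1).
  have := is_derive_sub (is_derive_sub (D2 s s01) (is_derive_cst (dphi 0) s 1)) Dl.
  by rewrite subr0 mulr1.
have [s2 /andP[s20 s2s1] E2] := MVT_cc (ltW s1p) D4.
have h1 : dphi s1 - dphi 0 - 2 * K * s1 = 0.
  by move: E1; rewrite P1 subr0 mulr1 => <-.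
have E : f b - f a - \sum_j v j ord0 * 'D_(basisv R j) f a = K.
  rewrite /K /phi /dphi scale1r; congr (f _ - f _ - _).
  - by rewrite /v addrC subrK.
  - by rewrite scale0r addr0.
  - by apply: eq_bigr => j _; rewrite scale0r addr0.
exists s2; first by rewrite s20 (le_trans s2s1)//; exact: ltW.
rewrite E -/v -/(ddphi s2).
move: E2; rewrite h1 subrr mulr0 !subr0 => /esym/eqP.
by rewrite mulf_eq0 (gt_eqF s1p) orbF subr_eq0 => /eqP ->; field.
Qed.

Lemma compact_bounded_on (K : set V) (f : V -> R) : compact K ->
  (forall y, K y -> {for y, continuous f}) -> exists C : R, forall y, K y -> `|f y| <= C.
Proof.
move=> cK fc.
have : compact (f @` K).
  apply: continuous_compact => //; apply: continuous_in_subspaceT => y.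
  by rewrite inE; exact: fc.
move=> /compact_bounded [M [_ MH]]; exists (M + 1) => y Ky.
by apply: (MH (M + 1)); [rewrite ltrDl|exists y].
Qed.

End C2.

(** * Entropy pairs and quadratic bounds on a convex set of states *)

Section states.
Context (R : realType) (m : nat).
Local Notation V := 'cV[R]_m.
Implicit Types (U K : set V) (f eta Q : V -> R) (g : V -> V) (y v a b : V).

Definition partial f (j : 'I_m) y : R := 'D_(basisv R j) f y.

Definition convexK K := forall a b, K a -> K b ->
  forall s : R, 0 <= s <= 1 -> K (a + s *: (b - a)).

Lemma convexKE K : convex_set (K : set (convex_lmodType 'cV[R]_m)) -> convexK K.
Proof.
move=> cK a b Ka Kb s /andP[s0 s1].
have /set_mem := cK b a (Itv01 s0 s1) (mem_set Kb) (mem_set Ka).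
rewrite /conv/= (_ : s *: b + _ = a + s *: (b - a))//.
by rewrite /unstable.onem scalerBl scale1r scalerBr addrCA.
Qed.

(** The partial derivatives are bounded on [K] by compactness, and the mean
    value theorem applies along segments by convexity. *)
Lemma lipschitz_on_convex U K f : open U -> Ck 1 U f -> compact K -> convexK K ->
  K `<=` U -> exists2 L : R, 0 < L & forall a b, K a -> K b -> `|f b - f a| <= L * enorm (b - a).
Proof.
move=> oU fC cK vK KU.
have bd j : exists C : R, forall y, K y -> `|partial f j y| <= C.
  apply: compact_bounded_on => // y Ky.
  have [_ /(_ (basisv R j))[_ [c _]]] := fC; exact: c (KU _ Ky).
pose C j := sval (cid (bd j)).
have CP j y : K y -> `|partial f j y| <= C j by exact: (svalP (cid (bd j))).
exists (1 + \sum_j `|C j|); first by rewrite ltr_pwDl// sumr_ge0.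
move=> a b Ka Kb.
have D (s : R) : 0 <= s <= 1 -> is_derive s 1 (fun s : R => f (a + s *: (b - a)))
    (\sum_j (b - a) j ord0 * partial f j (a + s *: (b - a))).
  by move=> s01; apply: segment_derive oU fC _; exact: KU (vK _ _ Ka Kb _ s01).
have [c c01] := MVT_cc ler01 D.
rewrite subr0 mulr1 scale1r scale0r addr0 (addrC a (b - a)) subrK => ->.
rewrite mulrDl mul1r (le_trans (ler_norm_sum _ _ _))//.
apply: (@le_trans _ _ ((\sum_j `|C j|) * enorm (b - a))); last first.
  by rewrite lerDr enorm_ge0.
rewrite mulr_suml; apply: ler_sum => j _; rewrite normrM mulrC ler_pM//.
  by rewrite (le_trans (CP _ _ (vK _ _ Ka Kb _ c01)))// ler_norm.
exact: coord_le_enorm.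
Qed.

Lemma partial_entropy_flux U g eta Q y k : open U -> Ck 1 U g -> Ck 1 U eta -> Ck 1 U Q ->
  (forall y, U y -> forall v, 'd eta y ('d g y v) = 'd Q y v) -> U y ->
  partial Q k y = \sum_j partial (fun z => g z j ord0) k y * partial eta j y.
Proof.
move=> oU gC eC QC pr Uy; have := pr _ Uy (basisv R k).
have [_ ->] := Ck1_differentiable oU eC Uy.
have [_ ->] := Ck1_differentiable oU QC Uy.
have gb (d : 'I_m -> R) l : gradlin d (basisv R l) = d l.
  rewrite /gradlin (bigD1 l)//= !mxE !eqxx mul1r big1 ?addr0// => j jl.
  by rewrite !mxE (negbTE jl) mul0r.
rewrite gb /partial => <-; rewrite /gradlin; apply: eq_bigr => j _.
by rewrite (Ck_diff_coord _ _ oU gC Uy) gb.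
Qed.

Lemma Ck1_intro U f : open U -> (forall y, U y -> {for y, continuous f}) ->
  (forall v, exists df : V -> R, forall y, U y ->
     is_derive y v f (df y) /\ {for y, continuous df}) -> Ck 1 U f.
Proof.
move=> oU fc H; split => // v; have [df D] := H v; split.
  by move=> y /D[[]].
apply: (@Ck_ext R m 0 U df) => //.
- by move=> y /D[[_ ->]].
- by split => // y /D[].
Qed.

Lemma Ck1_mul U f h : open U -> Ck 1 U f -> Ck 1 U h -> Ck 1 U (f * h).
Proof.
move=> oU [fc fD] [hc hD]; apply: Ck1_intro => //.
  by move=> y Uy; exact: cvgM (fc y Uy) (hc y Uy).
move=> v; have [fd [fdc _]] := fD v; have [hd [hdc _]] := hD v.
exists (fun y => f y * 'D_v h y + h y * 'D_v f y) => y Uy; split.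
  have Df : is_derive y v f ('D_v f y) by apply/derivableP; exact: fd.
  have Dh : is_derive y v h ('D_v h y) by apply/derivableP; exact: hd.
  exact: is_deriveM.
exact: cvgD (cvgM (fc y Uy) (hdc y Uy)) (cvgM (hc y Uy) (fdc y Uy)).
Qed.

Lemma derive_lincomb (c : R) f h y v : derivable f y v -> derivable h y v ->
  is_derive y v (fun z => c * f z + h z) (c * 'D_v f y + 'D_v h y).
Proof.
move=> /derivableP Df /derivableP Dh.
exact: is_deriveD (is_deriveZ c Df) Dh.
Qed.

Lemma Ck_lincomb k U (c : R) f h : open U -> Ck k U f -> Ck k U h ->
  Ck k U (fun z => c * f z + h z).
Proof.
move=> oU; elim: k f h => [|k IH] f h [fc fD] [hc hD]; split.
- by move=> y Uy; exact: cvgD (cvgM (cvg_cst c) (fc y Uy)) (hc y Uy).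
- by [].
- by move=> y Uy; exact: cvgD (cvgM (cvg_cst c) (fc y Uy)) (hc y Uy).
move=> v; have [fd fdc] := fD v; have [hd hdc] := hD v; split.
  by move=> y Uy; have [] := derive_lincomb c (fd _ Uy) (hd _ Uy).
apply: Ck_ext oU _ (IH _ _ fdc hdc) => y Uy.
by have [_ ->] := derive_lincomb c (fd _ Uy) (hd _ Uy).
Qed.

Lemma hessian_lincomb U (c : R) f h y i j : open U -> Ck 2 U f -> Ck 2 U h -> U y ->
  hessian (fun z => c * f z + h z) y i j = c * hessian f y i j + hessian h y i j.
Proof.
move=> oU fC hC Uy.
have [_ /(_ (basisv R j))[fd [_ /(_ (basisv R i))[fdd _]]]] := fC.
have [_ /(_ (basisv R j))[hd [_ /(_ (basisv R i))[hdd _]]]] := hC.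
have [_ E] := derive_lincomb c (fdd _ Uy) (hdd _ Uy).
apply: (eq_trans (hessianE _ y i j)).
apply: (eq_trans _ (eq_trans E _)); last first.
  by congr (c * _ + _); apply/esym; exact: hessianE.
apply: near_eq_derive; near=> z.
have Uz : U z by near: z; exact: open_nbhs_nbhs.
by have [_ ->] := derive_lincomb c (fd _ Uz) (hd _ Uz).
Unshelve. all: by end_near. Qed.

Lemma Ck1_cst U (c : R) : open U -> Ck 1 U (cst c : V -> R).
Proof.
move=> oU; apply: Ck1_intro => //; first by move=> y _; exact: cst_continuous.
move=> v; exists (cst 0) => y _; split; [exact: is_derive_cst|exact: cst_continuous].
Qed.

Lemma Ck1_sum U (I : Type) (r : seq I) (F : I -> V -> R) : open U ->
  (forall i, Ck 1 U (F i)) -> Ck 1 U (\sum_(i <- r) F i).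
Proof.
move=> oU FC; elim/big_rec : _ => [|i f _ fC]; first exact: Ck1_cst.
rewrite (_ : F i + f = fun z => 1 * F i z + f z); first exact: (Ck_lincomb 1 oU (FC i) fC).
by apply/funext => z; rewrite mul1r.
Qed.

Let cancel_add (a b c d : R) : a + b = c + d -> a = c -> b = d.
Proof. by move=> E ac; move: E; rewrite ac => /addrI. Qed.

Let product_rule_swap (a b c d : R) : a *: b + c *: d = d * c + a * b.
Proof. by rewrite addrC /GRing.scale/= (mulrC c). Qed.

(** The Hessian of the entropy symmetrizes the system: differentiating
    [partial Q k = \sum_j partial g_j k * partial eta j] in the direction [i],
    the terms with second derivatives of [g] and [Q] are symmetric in [i] and
    [k]. *)
Lemma entropy_symmetrizer U g eta Q y i k : open U -> Ck 2 U g -> Ck 2 U eta -> Ck 1 U Q ->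
  (forall y, U y -> forall v, 'd eta y ('d g y v) = 'd Q y v) -> U y ->
  \sum_j hessian eta y i j * partial (fun z => g z j ord0) k y =
  \sum_j hessian eta y k j * partial (fun z => g z j ord0) i y.
Proof.
move=> oU gC eC QC pr Uy.
have gC1 := @Ck_le R V V 2 1 _ _ isT gC.
have eC1 := @Ck_le R V R 2 1 _ _ isT eC.
pose dQ k z := \sum_j partial (fun z => g z j ord0) k z * partial eta j z.
have gj j : Ck 2 U (fun z => g z j ord0) by exact: Ck_coord.
have dQD i' k' z : U z -> is_derive z (basisv R i') (dQ k') (\sum_j
    (hessian (fun z => g z j ord0) z i' k' * partial eta j z
    + partial (fun z => g z j ord0) k' z * hessian eta z i' j)).
  move=> Uz; rewrite (_ : dQ k' = \sum_j (partial (fun z => g z j ord0) k' * partial eta j)); last first.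
    by apply/funext => x; rewrite /dQ fct_sumE.
  apply: is_derive_sum => j.
  have [_ /(_ (basisv R i'))[dg _]] := Ck_partial k' (gj j).
  have [_ /(_ (basisv R i'))[de _]] := Ck_partial j eC.
  have Dg := derivableP (dg z Uz); have De := derivableP (de z Uz).
  have DD := is_deriveM Dg De.
  apply: (is_derive_eq DD).
  have E1 := hessianE (fun z => g z j ord0) z i' k'.
  have E2 := hessianE eta z i' j.
  apply: (eq_trans (product_rule_swap _ _ _ _)).
  by apply: congr2; [apply: congr2; [exact: esym E1|] | apply: congr2; [|exact: esym E2]].
have QC2 : Ck 2 U Q.
  have [Qc QD] := QC; split; first exact: Qc.
  move=> v; have [Qd _] := QD v; split; first exact: Qd.
  apply: (@Ck_ext R m 1 U (\sum_k (cst (v k ord0) * dQ k)) _ oU).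
    move=> z Uz; rewrite (Ck1_derive v oU QC Uz) fct_sumE /gradlin.
    apply: eq_bigr => l _ /=; congr (_ * _).
    exact: esym (partial_entropy_flux _ oU gC1 eC1 QC pr Uz).
  apply: Ck1_sum (oU) _ => l; apply: Ck1_mul (oU) _ _; first exact: Ck1_cst.
  rewrite (_ : dQ l = \sum_j (partial (fun z => g z j ord0) l * partial eta j)); last first.
    by apply/funext => x; rewrite /dQ fct_sumE.
  apply: Ck1_sum (oU) _ => j; apply: Ck1_mul (oU) _ _.
    exact: Ck_partial (gj j).
  exact: Ck_partial eC.
have E i' k' : hessian Q y i' k' = \sum_j
    (hessian (fun z => g z j ord0) y i' k' * partial eta j y
    + partial (fun z => g z j ord0) k' y * hessian eta y i' j).
  have [_ Ed] := dQD i' k' y Uy; rewrite -Ed.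
  apply: (eq_trans (hessianE Q y i' k')); apply: near_eq_derive.
  near=> z; apply: partial_entropy_flux gC1 eC1 QC pr _ => //.
  by near: z; exact: open_nbhs_nbhs.
have EE := eq_trans (esym (E i k)) (eq_trans (hessian_sym i k oU QC2 Uy) (E k i)).
rewrite !big_split/= in EE.
have S : \sum_j hessian (fun z => g z j ord0) y i k * partial eta j y =
    \sum_j hessian (fun z => g z j ord0) y k i * partial eta j y.
  by apply: eq_bigr => j _; congr (_ * _); exact: hessian_sym i k oU (gj j) Uy.
have {}EE := cancel_add EE S.
apply: eq_trans (eq_trans _ EE) _; apply: eq_bigr => j _; exact: mulrC.
Unshelve. all: by end_near. Qed.

Section quadratic.
Context U K f (C c : R).
Hypotheses (oU : open U) (fC : Ck 2 U f) (vK : convexK K) (KU : K `<=` U).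

(** The first-order Taylor remainder at [a]; for an entropy, this is the
    relative entropy of [b] with respect to [a]. *)
Definition relative f a b : R := f b - f a - \sum_j (b - a) j ord0 * partial f j a.

Lemma relative_taylor a b : K a -> K b -> exists2 z, K z &
  relative f a b = 2^-1 * qform (hessian f z) (b - a).
Proof.
move=> Ka Kb; have [s s01 E] := taylor2 oU fC (fun s hs => KU (vK Ka Kb hs)).
by exists (a + s *: (b - a)) => //; exact: vK.
Qed.

Lemma relative_le a b : (forall v y, K y -> qform (hessian f y) v <= C * enorm v ^+ 2) ->
  K a -> K b -> relative f a b <= 2^-1 * (C * enorm (b - a) ^+ 2).
Proof.
move=> H Ka Kb; have [z Kz ->] := relative_taylor Ka Kb.
by rewrite ler_wpM2l//; exact: H.
Qed.

Lemma relative_ge a b : (forall v y, K y -> c * enorm v ^+ 2 <= qform (hessian f y) v) ->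
  K a -> K b -> 2^-1 * (c * enorm (b - a) ^+ 2) <= relative f a b.
Proof.
move=> H Ka Kb; have [z Kz ->] := relative_taylor Ka Kb.
by rewrite ler_wpM2l//; exact: H.
Qed.
End quadratic.

Let bform_lincomb (H : 'M[R]_m) (Hk : 'I_m -> 'M[R]_m) (r : 'I_m -> R) a b :
  (forall i j, H i j = \sum_k r k * Hk k i j) ->
  bform H a b = \sum_k r k * bform (Hk k) a b.
Proof.
move=> HE; rewrite /bform.
under [RHS]eq_bigr => k _ do rewrite mulr_sumr.
rewrite [RHS]exchange_big; apply: eq_bigr => i _.
under [RHS]eq_bigr => k _ do rewrite mulr_sumr.
rewrite [RHS]exchange_big; apply: eq_bigr => j _.
by rewrite HE !mulr_suml; apply: eq_bigr => k _; rewrite !mulrA.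
Qed.

(** The bound for vector fields follows from the scalar one, applied to the
    component of [g] in the direction of the relative flux itself. *)
Lemma relative_vec_le U K g (C : R) a b : open U -> Ck 2 U g -> convexK K -> K `<=` U ->
  0 <= C -> (forall v y, K y -> enorm (vec_hessian_form g y v) <= C * enorm v ^+ 2) ->
  K a -> K b ->
  enorm (\col_i relative (fun z => g z i ord0) a b) <= 2^-1 * (C * enorm (b - a) ^+ 2).
Proof.
move=> oU gC vK KU C0 H Ka Kb; set r := \col_i _; set v := b - a.
have [r0|r0] := eqVneq (enorm r) 0.
  by rewrite r0 mulr_ge0// mulr_ge0// sqr_ge0.
pose G (s : seq 'I_m) z := \sum_(i <- s) r i ord0 * g z i ord0.
have gj j : Ck 2 U (fun z => g z j ord0) by exact: Ck_coord.
have [GC GH] : Ck 2 U (G (index_enum _)) /\ forall y i j, U y ->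
    hessian (G (index_enum _)) y i j =
    \sum_k r k ord0 * hessian (fun z => g z k ord0) y i j.
  elim: (index_enum _) => [|k s [IC IH]].
    have -> : G [::] = cst 0 by apply/funext => z; rewrite /G big_nil.
    split.
      split; first by move=> y _; exact: cst_continuous.
      move=> w; split; first by move=> y _; exact: derivable_cst.
      by rewrite (_ : 'D_w _ = cst 0); [exact: Ck1_cst|apply/funext => z; rewrite derive_cst].
    move=> y i j _; rewrite big_nil; apply: (eq_trans (hessianE _ _ _ _)).
    rewrite (_ : 'D_(basisv R j) _ = cst (0 : R)) ?derive_cst//.
    by apply/funext => z; rewrite derive_cst.
  have -> : G (k :: s) = fun z => r k ord0 * g z k ord0 + G s z.
    by apply/funext => z; rewrite /G big_cons.
  split; first exact: (Ck_lincomb _ oU (gj k) IC).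
  move=> y i j Uy; rewrite big_cons -IH//.
  exact: (hessian_lincomb _ _ _ oU (gj k) IC Uy).
have GD y w : U y -> 'D_w (G (index_enum _)) y = \sum_k r k ord0 * 'D_w (fun z => g z k ord0) y.
  move=> Uy.
  have D : is_derive y w (\sum_k (fun z => r k ord0 * g z k ord0))
      (\sum_k r k ord0 * 'D_w (fun z => g z k ord0) y).
    apply: is_derive_sum => k.
    have [_ /(_ w)[/(_ _ Uy) /derivableP gd _]] := gj k.
    exact: is_deriveZ.
  have [_ <-] := D; congr ('D_w _ y).
  by apply/funext => z; rewrite fct_sumE.
have rel : relative (G (index_enum _)) a b = enorm r ^+ 2.
  have S : \sum_j v j ord0 * partial (G (index_enum _)) j a =
      \sum_k r k ord0 * \sum_j v j ord0 * partial (fun z => g z k ord0) j a.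
    rewrite (eq_bigr (fun j => \sum_k (r k ord0 * (v j ord0 * partial (fun z => g z k ord0) j a)))); last first.
      move=> j _; rewrite /partial (GD _ _ (KU _ Ka)) mulr_sumr; apply: eq_bigr => k _; exact: mulrCA.
    by rewrite exchange_big/=; apply: eq_bigr => k _; rewrite mulr_sumr.
  rewrite enorm_sqr /relative S /G /dot -!sumrB; apply: eq_bigr => k _.
  rewrite -!mulrBr; congr (_ * _).
  by rewrite /r mxE.
have [z Kz] := relative_taylor oU GC vK KU Ka Kb.
rewrite rel -/v => E.
have QE : qform (hessian (G (index_enum _)) z) v = dot r (vec_hessian_form g z v).
  rewrite qformE (bform_lincomb _ _ (fun i j => GH z i j (KU _ Kz))) /dot.
  by apply: eq_bigr => k _; rewrite /vec_hessian_form mxE qformE.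
have rp : 0 < enorm r by rewrite lt_neqAle eq_sym r0 enorm_ge0.
rewrite -(ler_pM2l rp) -expr2 E QE.
rewrite mulrCA ler_wpM2l// (le_trans (dot_le _ _))// ler_wpM2l ?enorm_ge0//.
exact: H.
Qed.

End states.

(** * Measurability and integrals of compositions *)

Section measurable_composition.
Context (R : realType) (m : nat) d (X : measurableType d).
Local Notation V := 'cV[R]_m.

(** A composition with a function that is only known to be continuous on the
    range: the inner function is discretized on the grid of mesh [1 / n], so
    that it takes countably many values. *)
Lemma measurable_comp_continuous (F : X -> V) (h : V -> R) :
  (forall i, measurable_fun setT (fun x => F x i ord0)) ->
  (forall x, {for F x, continuous h}) -> measurable_fun setT (fun x => h (F x)).
Proof.
move=> mF hc.
pose z n x : 'cV[int]_m := \col_i Num.floor (n.+1%:R * F x i ord0).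
pose c n (k : 'cV[int]_m) : V := \col_i ((k i ord0)%:~R / n.+1%:R).
apply: (@measurable_fun_cvg _ _ _ _ (fun n x => h (c n (z n x)))) => [n|x _].
  move=> _ B mB; rewrite setTI.
  rewrite (_ : _ @^-1` B = \bigcup_(k : 'cV[int]_m)
      (if `[< B (h (c n k)) >] then [set x | z n x = k] else set0)); last first.
    apply/seteqP; split => [x /= Bx|x [k _]].
      by exists (z n x) => //; rewrite asboolT.
    by case: asboolP => // Bk /= E; rewrite E.
  apply: countable_bigcupT_measurable; first exact: countableP.
  move=> k; case: asboolP => // _.
  rewrite (_ : [set x | _] = \bigcap_(i in [set: 'I_m])
     ((fun x => n.+1%:R * F x i ord0) @^-1` `[(k i ord0)%:~R, (k i ord0 + 1)%:~R[)); last first.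
    apply/seteqP; split => [x /= <- i _|x /= H].
      by rewrite mxE /= in_itv/= floor_itv.
    apply/matrixP => i j; rewrite ord1 mxE; apply: floor_def.
    by have := H i I; rewrite /= in_itv.
  apply: fin_bigcap_measurable => // i _.
  rewrite -[X in measurable X]setTI; apply: (measurable_funM _ (mF i)) => //.
have cF : c n (z n x) @[n --> \oo] --> F x.
  apply/cvgrPdist_le => e e0; near=> n.
  apply: norm_le_coord => [|i]; first exact: ltW.
  rewrite !mxE; have n0 : 0 < n.+1%:R :> R by rewrite ltr0n.
  have /andP[] := floor_itv (n.+1%:R * F x i ord0 : R).
  set k := Num.floor _; rewrite intrD => k1 k2.
  have -> : F x i ord0 - k%:~R / n.+1%:R = (n.+1%:R * F x i ord0 - k%:~R) / n.+1%:R.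
    by field; rewrite lt0r_neq0.
  rewrite normrM ger0_norm ?subr_ge0// gtr0_norm ?invr_gt0//.
  rewrite (@le_trans _ _ (1 / n.+1%:R))// ?ler_wpM2r ?invr_ge0 ?(ltW n0)//.
    by rewrite lerBlDl ltW.
  rewrite mul1r; near: n.
  have := near_infty_natSinv_lt (PosNum e0); apply: filterS => k' /=; exact: ltW.
exact: (cvg_comp _ _ cF (hc x)).
Unshelve. all: by end_near. Qed.

End measurable_composition.

Section ae_equal.
Import HBNNSimple.
Context (R : realType) d (X : measurableType d) (mu : {measure set X -> \bar R}).
Local Open Scope ereal_scope.

Let ge0_ae_le (D : set X) (f g : X -> \bar R) : measurable D ->
  (forall x, 0 <= f x) -> (forall x, 0 <= g x) ->
  {ae mu, forall x, D x -> f x = g x} -> \int[mu]_(x in D) f x <= \int[mu]_(x in D) g x.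
Proof.
move=> mD f0 g0 [N [mN N0 subN]].
rewrite !ge0_integralE//; apply: ge_ereal_sup => _ [h /= hf <-].
have mNC : measurable (~` N) by exact: measurableC.
pose h' := mul_nnsfun h (indic_nnsfun R mNC).
have -> : sintegral mu h = sintegral mu h'.
  rewrite -!integralT_nnsfun; apply: ge0_ae_eq_integral => //.
  - by apply/measurable_EFinP; exact: measurable_funP.
  - by apply/measurable_EFinP; exact: measurable_funP.
  - by move=> x _; rewrite lee_fin.
  - by move=> x _; rewrite lee_fin.
  exists N; split => // x /= H; apply/not_notP => nN; apply: H => _.
  by rewrite /h' /= mindicE mem_set// mulr1.
apply: ereal_sup_ubound; exists h' => //= x.
rewrite mindicE; have [xN|xN] := pselect (N x).
  by rewrite memNset ?mulr0//= /patch; case: ifP.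
rewrite mem_set// mulr1 (le_trans (hf x))// /patch; case: ifPn => // /set_mem Dx.
have [->//|fg] := eqVneq (f x) (g x).
by exfalso; apply: xN; apply: subN => /= /(_ Dx) E; rewrite E eqxx in fg.
Qed.

(** The integrands of the weak formulation involve [g (u)], which may fail to be
    measurable on the null set where [u] leaves the domain of [g]. As integrals
    of nonnegative functions are suprema over simple functions, null sets can
    still be removed: multiply the simple functions by an indicator. *)
Lemma ae_eq_integral_gen (D : set X) (f g : X -> \bar R) : measurable D ->
  {ae mu, forall x, D x -> f x = g x} -> \int[mu]_(x in D) f x = \int[mu]_(x in D) g x.
Proof.
move=> mD fg; rewrite integralE [RHS]integralE.
have gf : {ae mu, forall x, D x -> g x = f x}.
  exact: (@ae_imp _ _ _ mu (fun x => D x -> f x = g x) (fun x => D x -> g x = f x) fg (fun x H Dx => esym (H Dx))).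
by congr (_ - _); apply/eqP; rewrite eq_le; apply/andP; split; apply: ge0_ae_le => //;
  [apply: (@ae_imp _ _ _ mu _ _ fg)|apply: (@ae_imp _ _ _ mu _ _ gf)
  |apply: (@ae_imp _ _ _ mu _ _ fg)|apply: (@ae_imp _ _ _ mu _ _ gf)] => x H Dx;
  rewrite ?funeposE ?funenegE H.
Qed.

Lemma ae_eq_Rintegral_gen (D : set X) (f g : X -> R) : measurable D ->
  {ae mu, forall x, D x -> f x = g x} ->
  Rintegral mu D f = Rintegral mu D g.
Proof.
move=> mD fg; rewrite /Rintegral; congr fine; apply: ae_eq_integral_gen => //.
exact: (@ae_imp _ _ _ mu _ _ fg (fun x H Dx => congr1 EFin (H Dx))).
Qed.

End ae_equal.

(** * One-dimensional test function arguments *)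

Section tests.
Context (R : realType).
Local Notation mu := (@lebesgue_measure R).
Implicit Types (f g h D : R -> R).

Lemma measurable_torus : measurable (torus R).
Proof. exact: measurable_itv. Qed.

Lemma mem_torus y : (y \in torus R) = (-1 <= y <= 1).
Proof. by apply/idP/idP; rewrite inE /torus /= in_itv. Qed.
#[local] Hint Resolve measurable_torus : core.

(** Continuity on a closed interval, in the form in which it is used: only the
    values inside the interval matter. *)
Definition cont_on (a b : R) f := forall t, a <= t <= b -> forall e : R, 0 < e ->
  exists2 d : R, 0 < d & forall s, a <= s <= b -> `|s - t| < d -> `|f s - f t| <= e.

Lemma ae_dense (P : R -> Prop) (a b : R) : {ae mu, forall s, P s} -> a < b ->
  exists2 s, a < s < b & P s.
Proof.
move=> [N [mN N0 subN]] ab; apply: contrapT => H.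
have : (mu `]a, b[ <= mu N)%E.
  apply: le_measure; rewrite ?inE// => s /= sab; apply: subN => /= Ps.
  by apply: H; exists s => //; move: sab; rewrite in_itv.
rewrite N0 lebesgue_measure_itv/= lte_fin ab -EFinB lee_fin.
by rewrite leNgt subr_gt0 ab.
Qed.

(** A set of full measure is dense. *)
Lemma cont_on_ae_ge0 a b f : a < b -> cont_on a b f ->
  {ae mu, forall s, a < s < b -> 0 <= f s} -> forall t, a <= t <= b -> 0 <= f t.
Proof.
move=> ab cf f0 t tab; rewrite leNgt; apply/negP => ft.
have e0 : 0 < - f t / 2 by rewrite divr_gt0// oppr_gt0.
have [d d0 H] := cf t tab _ e0.
have lr : Num.max a (t - d) < Num.min b (t + d).
  rewrite lt_min !gt_max ab/=; case/andP: tab => ta tb.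
  by apply/and3P; split; lra.
have [s] := ae_dense f0 lr.
rewrite gt_max lt_min => /andP[/andP[s1 s2] /andP[s3 s4]] fs.
have /fs fs0 : a < s < b by rewrite s1.
have : `|f s - f t| <= - f t / 2.
  by apply: H; [rewrite !ltW|rewrite ltr_distl s2].
by rewrite ler_norml => /andP[_]; lra.
Qed.

Lemma cont_on_sub a b f g : cont_on a b f -> cont_on a b g ->
  cont_on a b (fun s => f s - g s).
Proof.
move=> cf cg t tab e e0; have e2 : 0 < e / 2 by rewrite divr_gt0.
have [d1 d10 H1] := cf t tab _ e2; have [d2 d20 H2] := cg t tab _ e2.
exists (Num.min d1 d2) => [|s sab]; first by rewrite lt_min d10.
rewrite lt_min => /andP[s1 s2].
rewrite (_ : _ - _ = (f s - f t) - (g s - g t)); last by ring.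
by rewrite (le_trans (ler_normB _ _))// (splitr e) lerD ?H1 ?H2.
Qed.

Lemma cont_on_lip a b (L : R) f :
  (forall s t, a <= s <= b -> a <= t <= b -> `|f s - f t| <= L * `|s - t|) ->
  cont_on a b f.
Proof.
move=> H t tab e e0; have L0 : 0 < `|L| + 1 by rewrite ltr_wpDl.
exists (e / (`|L| + 1)) => [|s sab st]; first by rewrite divr_gt0.
rewrite (le_trans (H _ _ sab tab))//.
rewrite (@le_trans _ _ ((`|L| + 1) * `|s - t|))//.
  by rewrite ler_wpM2r// (le_trans (ler_norm _))// lerDl.
by rewrite mulrC -ler_pdivlMr// ltW.
Qed.

Lemma bm_step (t : R) : bm (fun y : R => (t < y)%R%:R : R).
Proof.
rewrite (_ : (fun x => _) = \1_(`]t, +oo[ : set R)); first exact: bm_indic.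
apply/funext => x; rewrite indicE; congr (_%:R); congr nat_of_bool.
by apply/idP/idP; rewrite inE/= in_itv/= andbT.
Qed.

(** Smooth approximations of the indicator of times after [t]: they are the
    primitives of bumps supported between [t] and [t + 1 / (n + 1)]. *)
Lemma step_family : exists2 C : R, 0 < C & exists X : R -> nat -> nat -> R -> R,
  forall t n, [/\ tower (X t n), forall k s, s <= t -> X t n k s = 0,
    forall k s, t + n.+1%:R^-1 <= s -> X t n k s = (k == 0%N)%:R,
    forall s, 0 <= X t n 0%N s <= 1 &
    (forall s, 0 <= X t n 1%N s <= C * n.+1%:R) /\
    Int t (t + n.+1%:R^-1) (X t n 1%N) = 1].
Proof.
have [C C0 H] := smooth_step R; exists C => //.
have n0 n : 0 < n.+1%:R^-1 :> R by rewrite invr_gt0 ltr0n.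
exists (fun t n => sval (cid (H t _ (n0 n)))) => t n.
case: (cid (H t _ (n0 n))) => X [/= tX X0 X1 X01 [X1b XI]]; split => //; split => //.
by move=> s; have := X1b s; rewrite invrK.
Qed.

Section with_steps.
Context (C : R) (X : R -> nat -> nat -> R -> R).
Hypothesis C0 : 0 < C.
Hypothesis XP : forall t n, [/\ tower (X t n), forall k s, s <= t -> X t n k s = 0,
    forall k s, t + n.+1%:R^-1 <= s -> X t n k s = (k == 0%N)%:R,
    forall s, 0 <= X t n 0%N s <= 1 &
    (forall s, 0 <= X t n 1%N s <= C * n.+1%:R) /\
    Int t (t + n.+1%:R^-1) (X t n 1%N) = 1].

Let bm0 t n : bm (X t n 0%N).
Proof.
have [tX _ _ H _] := XP t n; apply: (@tower_bm _ (X t n) 0%N 1 tX) => s.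
by have /andP[h1 h2] := H s; rewrite ger0_norm.
Qed.

Let bm1 t n : bm (X t n 1%N).
Proof.
have [tX _ _ _ [H _]] := XP t n; apply: (@tower_bm _ (X t n) 1%N (C * n.+1%:R) tX) => s.
by have /andP[h1 h2] := H s; rewrite ger0_norm.
Qed.

Let le1 t n s : `|X t n 0%N s| <= 1.
Proof. by have [_ _ _ /(_ s) /andP[h1 h2] _] := XP t n; rewrite ger0_norm. Qed.

Let cvg0 t s : X t n 0%N s @[n --> \oo] --> ((t < s)%R%:R : R).
Proof.
have [ts|st] := ltP t s; last first.
  apply: cvg_near_cst; near=> n; have [_ -> //] := XP t n.
have e0 : 0 < s - t by rewrite subr_gt0.
apply: cvg_near_cst; near=> n; have [_ _ -> //] := XP t n.
have : n.+1%:R^-1 < s - t by near: n; exact: (near_infty_natSinv_lt (PosNum e0)).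
by rewrite -lerBrDl => /ltW.
Unshelve. all: by end_near. Qed.

Let near_lt (t b : R) : t < b -> \forall n \near \oo, t + n.+1%:R^-1 < b.
Proof.
move=> tb; have e0 : 0 < b - t by rewrite subr_gt0.
near=> n; rewrite -ltrBrDl; near: n; exact: (near_infty_natSinv_lt (PosNum e0)).
Unshelve. all: by end_near. Qed.

Let Int_theta a b t n f : a <= t -> t + n.+1%:R^-1 <= b -> bm f ->
  Int a b (fun s => f s * X t n 1%N s) =
  Int t (t + n.+1%:R^-1) (fun s => X t n 1%N s * f s).
Proof.
move=> at_ tb bf; have [_ X0 X1 _ _] := XP t n.
have n0 : 0 < n.+1%:R^-1 :> R by rewrite invr_gt0 ltr0n.
have bb : bm (fun s => f s * X t n 1%N s) by exact: bmM.
rewrite (Int_chasles bb at_); last by rewrite (le_trans _ tb)// lerDl ltW.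
rewrite (Int_chasles bb _ tb); last by rewrite lerDl ltW.
rewrite (@Int_zero _ a t); last first.
  by move=> s /andP[_ st]; rewrite X0// mulr0.
rewrite (@Int_zero _ (t + _) b); last first.
  by move=> s /andP[ts _]; rewrite X1// mulr0.
by rewrite add0r addr0; apply: eq_Int => s _; rewrite mulrC.
Qed.

Section time.
Context (T : R) (A B A0 : R -> R) (c0 : R).
Hypotheses (T0 : 0 < T) (bA : bm A) (bB : bm B).

Let cutoff t n k s : R := if k is 0%N then 1 - X t n 0%N s else - X t n k s.

Let cutoff_tower t n : tower (cutoff t n).
Proof.
have [tX _ _ _ _] := XP t n; case=> [|k] s /=; last exact: is_derive_opp (tX k.+1 s).
rewrite -[- X t n 1%N s]add0r.
exact: is_derive_add (is_derive_cst _ _ _) (is_derive_opp (tX 0%N s)).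
Qed.

(** A weak derivative in time determines the continuous representative: test
    with a smooth cutoff at time [t]. *)
Lemma weak_time_derivative : cont_on 0 T A0 ->
  {ae mu, forall s, 0 <= s <= T -> A s = A0 s} ->
  (forall Xt, tower Xt -> (exists2 T', T' < T & forall s, T' <= s -> Xt 0%N s = 0) ->
    Int 0 T (fun s => A s * Xt 1%N s) + Int 0 T (fun s => B s * Xt 0%N s)
      + c0 * Xt 0%N 0 = 0) ->
  forall t, 0 <= t <= T -> A0 t - c0 = Int 0 t B.
Proof.
move=> cA AA0 W.
suff lt_case t : 0 <= t < T -> A0 t - c0 - Int 0 t B = 0.
  move=> t tT.
  have [CB CBP] : exists C', forall x, `|B x| <= C' by case: bB.
  have cF : cont_on 0 T (fun t => (A0 t - c0) - Int 0 t B).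
    apply: cont_on_sub.
      apply: cont_on_sub => //; apply: (@cont_on_lip _ _ 0) => s t' _ _.
      by rewrite subrr normr0 mul0r.
    apply: (@cont_on_lip _ _ CB) => s s'; wlog ss' : s s' / s <= s'.
      move=> H h1 h2; have [/H|/ltW /H] := leP s s'; first exact.
      by rewrite distrC (distrC s); exact.
    move=> /andP[s0 _] /andP[_ _].
    rewrite (Int_chasles bB s0 ss') opprD addNKr normrN distrC (ger0_norm (x := s' - s)) ?subr_ge0//.
    by apply: Int_bound.
  have e1 : 0 <= A0 t - c0 - Int 0 t B.
    apply: (cont_on_ae_ge0 T0 cF) tT; apply: aeW => s /andP[s0 sT].
    by rewrite lt_case// (ltW s0).
  have e2 : 0 <= 0 - (A0 t - c0 - Int 0 t B).
    apply: (cont_on_ae_ge0 T0 (cont_on_sub (f := fun=> 0) _ cF)) tT.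
      by move=> s _ e e0; exists 1 => // s' _ _; rewrite subrr normr0 ltW.
    by apply: aeW => s /andP[s0 sT]; rewrite lt_case ?subrr// (ltW s0).
  by apply/eqP; rewrite -subr_eq0; apply/eqP/le_anti; rewrite e1 andbT; move: e2; rewrite sub0r oppr_ge0.
move=> /andP[t0 tT].
have lim1 : Int 0 T (fun s => A s * X t n 1%N s) @[n --> \oo] --> A0 t.
  apply/cvgrPdist_le => e e0.
  have [d d0 Hd] := cA t (introT andP (conj t0 (ltW tT))) _ e0.
  have td : t < t + d by rewrite ltrDl.
  have [N1 _ HN1] := near_lt tT; have [N2 _ HN2] := near_lt td.
  exists (maxn N1 N2) => // n /=; rewrite geq_max => /andP[n1 n2].
  have tnT := HN1 n n1; have tnd := HN2 n n2.
  have n0 : 0 < n.+1%:R^-1 :> R by rewrite invr_gt0 ltr0n.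
  rewrite Int_theta ?(ltW tnT)//.
  have [_ _ _ _ [X1b XI]] := XP t n.
  have -> : A0 t = Int t (t + n.+1%:R^-1) (fun s => A0 t * X t n 1%N s).
    by rewrite (IntZ _ _ _ (bm1 t n)) XI mulr1.
  have bb : bm (fun s => A0 t * X t n 1%N s) by exact: bmM (bm_cst _ _) (bm1 t n).
  rewrite -IntB//; last exact: bmM.
  have bb2 : bm (fun s => A0 t * X t n 1%N s - X t n 1%N s * A s).
    by apply: bmB => //; exact: bmM.
  rewrite (le_trans (le_abs_Int _ _ bb2))//.
  apply: (@le_trans _ _ (Int t (t + n.+1%:R^-1) (fun s => e * X t n 1%N s))); last first.
    by rewrite (IntZ _ _ _ (bm1 t n)) XI mulr1.
  apply: ae_le_Int; [exact: bm_norm|by apply: bmM => //; exact: bm_cst|].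
  apply: (ae_imp AA0) => s H /andP[ts st].
  have s0T : 0 <= s <= T by rewrite (le_trans t0 ts) (le_trans st (ltW tnT)).
  have /andP[x0 _] := X1b s.
  rewrite H// (mulrC _ (A0 s)) -mulrBl normrM (ger0_norm x0) ler_wpM2r//.
  rewrite distrC; apply: Hd => //; rewrite ger0_norm ?subr_ge0// ltrBlDl.
  exact: le_lt_trans st tnd.
have lim2 : Int 0 T (fun s => B s * cutoff t n 0%N s) @[n --> \oo] --> Int 0 t B.
  have [CB CBP] : exists C', forall x, `|B x| <= C' by case: bB.
  have -> : Int 0 t B = Int 0 T (fun s => B s * (1 - (t < s)%R%:R)).
    have bb : bm (fun s => B s * (1 - (t < s)%R%:R)).
      apply: bmM => //; apply: bmB; first exact: bm_cst.
      exact: bm_step.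
    rewrite (Int_chasles bb t0 (ltW tT)) [X in _ + X](_ : _ = 0) ?addr0.
      by apply: eq_Int => s /andP[_ st]; rewrite ltNge st/= subr0 mulr1.
    rewrite (@ae_eq_Int _ t T _ (fun=> 0) bb (bm_cst _ _)) ?Int_cst ?mul0r ?(ltW tT)//.
    apply: (ae_imp (ae_neq t)) => s st /andP[ts _].
    by rewrite lt_neqAle ts andbT eq_sym; move/eqP: st => ->; rewrite subrr mulr0.
  apply: (@Int_dct _ _ _ (CB * 2)).
  - apply: bmM => //; apply: bmB; first exact: bm_cst.
    exact: bm_step.
  - by move=> n; apply: bmM => //; apply: bmB => //; exact: bm_cst.
  - move=> n s _; rewrite normrM ler_pM//= (le_trans (ler_normB _ _))// normr1.
    by rewrite -[leRHS]/(1 + 1) lerD2l.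
  - apply: aeW => s _; apply: cvgM; first exact: cvg_cst.
    by apply: cvgB; [exact: cvg_cst|exact: cvg0].
have lim3 : (- Int 0 T (fun s => A s * X t n 1%N s)
    + Int 0 T (fun s => B s * cutoff t n 0%N s) + c0) @[n --> \oo] --> - A0 t + Int 0 t B + c0.
  by apply: cvgD; [apply: cvgD => //; exact: cvgN|exact: cvg_cst].
have : - A0 t + Int 0 t B + c0 = 0.
  apply: (cvg_unique _ lim3); first exact: norm_hausdorff.
  apply: cvg_near_cst; near=> n.
  have tnT : t + n.+1%:R^-1 < T by near: n; exact: near_lt.
  have Hv : exists2 T', T' < T & forall s, T' <= s -> cutoff t n 0%N s = 0.
    exists (t + n.+1%:R^-1) => // s ts; have [_ _ X1 _ _] := XP t n.
    by rewrite /= X1// subrr.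
  have E := W _ (cutoff_tower t n) Hv; rewrite -[RHS]E.
  have [_ X0 _ _ _] := XP t n.
  rewrite /= X0// subr0 mulr1; congr (_ + _ + _).
  rewrite -IntN; last exact: bmM.
  by apply: eq_Int => s _; rewrite mulrN.
by move=> E; lra.
Unshelve. all: by end_near. Qed.

(** Test with cutoffs that decrease from 1 to 0 just after a Lebesgue point of
    [A]: their derivatives average [A] there. *)
Lemma weak_time_decrease :
  (forall Xt, tower Xt -> (forall s, 0 <= Xt 0%N s) ->
    (exists2 T', T' < T & forall s, T' <= s -> Xt 0%N s = 0) ->
    0 <= Int 0 T (fun s => A s * Xt 1%N s) + c0 * Xt 0%N 0) ->
  {ae mu, forall t, 0 < t < T -> A t <= c0}.
Proof.
move=> W; apply: (ae_imp (bm_lebesgue_pt bA)) => t tL /andP[t0 tT].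
have lim1 : Int 0 T (fun s => A s * X t n 1%N s) @[n --> \oo] --> A t.
  have L := lebesgue_pt_cvg tL bA (bm1 t)
    (fun n => let: And5 _ _ _ _ H := XP t n in H.1)
    (fun n => let: And5 _ _ _ _ H := XP t n in H.2).
  apply: cvg_trans L; apply: near_eq_cvg; near=> n.
  rewrite Int_theta// ?(ltW t0)// ltW//.
  by near: n; exact: near_lt.
have lim2 : c0 - Int 0 T (fun s => A s * X t n 1%N s) @[n --> \oo] --> c0 - A t.
  by apply: cvgB => //; exact: cvg_cst.
rewrite -subr_ge0 -(cvg_lim (@norm_hausdorff _ _) lim2); apply: limr_ge.
  by apply/cvg_ex; exists (c0 - A t).
near=> n.
have tnT : t + n.+1%:R^-1 < T by near: n; exact: near_lt.
have [_ X0 X1 X01 _] := XP t n.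
have := W _ (cutoff_tower t n); rewrite /= X0 ?(ltW t0)// subr0 mulr1.
rewrite (_ : Int 0 T (fun s => A s * - _) = - Int 0 T (fun s => A s * X t n 1%N s)); last first.
  rewrite -IntN; last exact: bmM.
  by apply: eq_Int => s _; rewrite mulrN.
rewrite addrC; apply.
  by move=> s; have /andP[_ h] := X01 s; rewrite subr_ge0.
by exists (t + n.+1%:R^-1) => // s ts; rewrite X1// subrr.
Unshelve. all: by end_near. Qed.

End time.

Definition periodic_tower (Y : nat -> R -> R) := tower Y /\ forall y, Y 0%N (y + 2) = Y 0%N y.

Let interval_tower y1 y2 n : -1 < y1 -> y1 < y2 -> y2 + n.+1%:R^-1 < 1 ->
  exists2 Y, periodic_tower Y & forall k y, -1 <= y <= 1 -> Y k y = X y1 n k y - X y2 n k y.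
Proof.
move=> y1l y12 y2l.
have [tX1 X10 X11 _ _] := XP y1 n; have [tX2 X20 X21 _ _] := XP y2 n.
have n0 : 0 < n.+1%:R^-1 :> R by rewrite invr_gt0 ltr0n.
set e : R := n.+1%:R^-1 in y2l X11 X21 n0 *.
pose W k y := X y1 n k y - X y2 n k y.
have tW : tower W by move=> k y; exact: is_derive_add (tX1 k y) (is_derive_opp (tX2 k y)).
pose d := Num.min (y1 + 1) (1 - (y2 + e)).
have d0 : 0 < d by rewrite lt_min; apply/andP; split; lra.
have dl : d <= y1 + 1 by rewrite ge_min lexx.
have dr : d <= 1 - (y2 + e) by rewrite ge_min lexx orbT.
have [Z [tZ Zp ZW]] : exists Z : nat -> R -> R,
    [/\ tower Z, forall y, Z 0%N (y + 2) = Z 0%N y &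
      forall n y, -1 <= y <= 1 -> Z n y = W n y].
  apply: (periodization tW d0) => k y; rewrite negb_and -!leNgt => /orP[h|h].
    by rewrite /W X10 ?X20 ?subrr//; [lra|lra].
  have e1 : y1 + e <= y by lra.
  have e2 : y2 + e <= y by lra.
  by rewrite /W X11 ?X21 ?subrr.
by exists Z.
Qed.

Section space.
Context (D G : R -> R).
Hypotheses (bD : bm D) (bG : bm G).

Let lim_step y1 y2 f : bm f -> Int (-1) 1 (fun y => f y * (X y1 n 0%N y - X y2 n 0%N y))
  @[n --> \oo] --> Int (-1) 1 (fun y => f y * ((y1 < y)%R%:R - (y2 < y)%R%:R)).
Proof.
move=> bf; have [Cf CfP] : exists C', forall x, `|f x| <= C' by case: bf.
have bi := bm_step.
apply: (@Int_dct _ _ _ (Cf * 2)).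
- by apply: bmM => //; exact: bmB.
- by move=> n; apply: bmM => //; exact: bmB.
- move=> n s _; rewrite normrM ler_pM// (le_trans (ler_normB _ _))//.
  by rewrite -[leRHS]/(1 + 1) lerD.
- apply: aeW => s _; apply: cvgM; first exact: cvg_cst.
  by apply: cvgB; exact: cvg0.
Qed.

Let Int_step y1 y2 f : bm f -> -1 <= y1 -> y1 <= y2 -> y2 <= 1 ->
  Int (-1) 1 (fun y => f y * ((y1 < y)%R%:R - (y2 < y)%R%:R)) = Int y1 y2 f.
Proof.
move=> bf a1 a12 a2.
have bi := bm_step.
have bb : bm (fun y => f y * ((y1 < y)%R%:R - (y2 < y)%R%:R)).
  by apply: bmM => //; exact: bmB.
rewrite (Int_chasles bb a1 (le_trans a12 a2)) (Int_chasles bb a12 a2).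
rewrite (@Int_zero _ (-1) y1) ?add0r; last first.
  move=> y /andP[_ h]; rewrite !ltNge h (le_trans h a12)/= subrr mulr0//.
rewrite (_ : Int y2 1 _ = 0) ?addr0; last first.
  rewrite (@ae_eq_Int _ _ _ _ (fun=> 0)) ?Int_cst ?mul0r//; first exact: bm_cst.
  apply: (ae_imp (ae_neq y2)) => y /eqP yn /andP[h _].
  have y2y : y2 < y by rewrite lt_neqAle eq_sym yn.
  by rewrite y2y (le_lt_trans a12 y2y) subrr mulr0.
apply: ae_eq_Int => //; apply: (ae_imp (ae_neq y1)) => y /eqP yn /andP[h h2].
by rewrite (ltNge y2) h2 lt_neqAle h eq_sym yn/= subr0 mulr1.
Qed.

Let Int_cut_le y f : bm f -> -1 <= y <= 1 ->
  Int (-1) 1 (fun z => f z * (z <= y)%R%:R) = Int (-1) y f.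
Proof.
move=> bf /andP[y0 y1].
have be : bm (fun z : R => (z <= y)%R%:R : R).
  rewrite (_ : (fun z => _) = fun z : R => 1 - (y < z)%R%:R).
    by apply: bmB; [exact: bm_cst|exact: bm_step].
  by apply/funext => z; rewrite leNgt; case: (y < z); rewrite ?subrr ?subr0.
rewrite (Int_chasles (bmM bf be) y0 y1) [X in _ + X](_ : _ = 0) ?addr0.
  by apply: eq_Int => z /andP[_ ->]; rewrite mulr1.
rewrite (@ae_eq_Int _ _ _ _ (fun=> 0)) ?Int_cst ?mul0r//; [exact: bmM|exact: bm_cst|].
apply: (ae_imp (ae_neq y)) => z /eqP zn /andP[h _].
by rewrite (le_eqVlt z) (negbTE zn) ltNge h mulr0.
Qed.

Let Int_cut_ge z f : bm f -> -1 <= z <= 1 ->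
  Int (-1) 1 (fun y => f y * (z <= y)%R%:R) = Int z 1 f.
Proof.
move=> bf /andP[z0 z1].
have be : bm (fun y : R => (z <= y)%R%:R : R).
  rewrite (_ : (fun y => _) = fun y : R => \1_(`[z, +oo[%classic) y).
    exact: bm_indic.
  apply/funext => y; rewrite indicE; congr (_%:R); congr nat_of_bool.
  by apply/idP/idP; rewrite inE/= in_itv/= andbT.
rewrite (Int_chasles (bmM bf be) z0 z1) [X in X + _](_ : _ = 0) ?add0r.
  by apply: eq_Int => y /andP[-> _]; rewrite mulr1.
rewrite (@ae_eq_Int _ _ _ _ (fun=> 0)) ?Int_cst ?mul0r//; [exact: bmM|exact: bm_cst|].
apply: (ae_imp (ae_neq z)) => y /eqP zn /andP[_ h].
by rewrite (le_eqVlt z) eq_sym (negbTE zn) ltNge h mulr0.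
Qed.

Lemma Int_by_parts f h : bm f -> bm h ->
  Int (-1) 1 (fun y => f y * Int (-1) y h) = Int (-1) 1 (fun z => h z * Int z 1 f).
Proof.
move=> bf bh; have m11 : -1 <= 1 :> R by lra.
have bi : bm (fun p : R * R => (p.2 <= p.1)%R%:R : R).
  rewrite (_ : (fun p => _) = \1_([set p : R * R | p.2 <= p.1])).
    apply: bm_indic; rewrite -[X in measurable X]setTI.
    exact: measurable_fun_le measurableT measurable_snd measurable_fst.
  by apply/funext => p; rewrite indicE; congr (_%:R); congr nat_of_bool;
    apply/idP/idP; rewrite inE.
have bF : bm (fun p : R * R => f p.1 * (h p.2 * (p.2 <= p.1)%R%:R)).
  by apply: bmM; [exact: bm_fst|apply: bmM => //; exact: bm_snd].
rewrite (@eq_Int _ _ _ _ (fun y => Int (-1) 1 (fun z => f y * (h z * (z <= y)%R%:R)))); last first.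
  move=> y yI; rewrite IntZ; last first.
    apply: bmM => //; exact: (bm_slice1 y bi).
  by rewrite Int_cut_le.
rewrite (Int_fubini m11 m11 bF); apply: eq_Int => z zI /=.
rewrite -(Int_cut_ge bf zI) -(IntZ _ _ _ (bmM bf (bm_slice2 z bi))).
by apply: eq_Int => y _; ring.
Qed.

Hypothesis weak : forall Y, periodic_tower Y ->
  Int (-1) 1 (fun y => D y * Y 0%N y) = Int (-1) 1 (fun y => G y * Y 1%N y).

Let weak_interval y1 y2 : lebesgue_pt G y1 -> lebesgue_pt G y2 ->
  -1 < y1 -> y1 < y2 -> y2 < 1 -> Int y1 y2 D = G y1 - G y2.
Proof.
move=> L1 L2 a1 a12 a2.
have lim y : lebesgue_pt G y -> -1 < y -> y < 1 ->
    Int (-1) 1 (fun z => G z * X y n 1%N z) @[n --> \oo] --> G y.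
  move=> L h1 h2.
  have L' := lebesgue_pt_cvg L bG (bm1 y)
    (fun n => let: And5 _ _ _ _ H := XP y n in H.1)
    (fun n => let: And5 _ _ _ _ H := XP y n in H.2).
  apply: cvg_trans L'; apply: near_eq_cvg; near=> n.
  rewrite Int_theta// ?(ltW h1)// ltW//.
  by near: n; exact: near_lt.
have lim1 := @lim_step y1 y2 _ bD.
rewrite (Int_step bD (ltW a1) (ltW a12) (ltW a2)) in lim1.
apply: (cvg_unique _ lim1); first exact: norm_hausdorff.
have lim2 : (Int (-1) 1 (fun z => G z * X y1 n 1%N z) -
    Int (-1) 1 (fun z => G z * X y2 n 1%N z)) @[n --> \oo] --> G y1 - G y2.
  by apply: cvgB; apply: lim => //; [exact: lt_trans a2|exact: lt_trans a12].
apply: cvg_trans lim2; apply: near_eq_cvg; near=> n.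
have n2 : y2 + n.+1%:R^-1 < 1 by near: n; exact: near_lt.
have [Y pY YE] := interval_tower a1 a12 n2.
rewrite -IntB; [|exact: bmM|exact: bmM].
transitivity (Int (-1) 1 (fun y => G y * Y 1%N y)).
  by apply: eq_Int => y yI; rewrite YE// mulrBr.
by rewrite -weak//; apply: eq_Int => y yI; rewrite YE.
Unshelve. all: by end_near. Qed.

Let weak_mean : Int (-1) 1 D = 0.
Proof.
have tY : periodic_tower (fun k (_ : R) => (k == 0%N)%:R : R).
  by split => // k y; exact: is_derive_cst.
have := weak tY; rewrite /= (@eq_Int _ _ _ _ D); last by move=> y _; rewrite mulr1.
by move=> ->; apply: Int_zero => y _; rewrite mulr0.
Qed.

(** Du Bois-Reymond: a weak identity against smooth periodic functions makes
    [G] absolutely continuous with derivative [- D], hence holds for all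
    Lipschitz periodic functions. *)
Lemma weak_lipschitz h c : bm h -> Int (-1) 1 h = 0 ->
  Int (-1) 1 (fun y => D y * (c + Int (-1) y h)) = Int (-1) 1 (fun y => G y * h y).
Proof.
move=> bh h0; have m11 : -1 < 1 :> R by lra.
have LG := bm_lebesgue_pt bG.
have [y0 /andP[y00 y01] L0] := ae_dense LG m11.
pose P y := Int (-1) y D.
have PE : {ae mu, forall y, -1 <= y <= 1 -> G y = (G y0 + P y0) - P y}.
  apply: (ae_imp (ae_and LG (ae_and (ae_neq (-1)) (ae_neq 1)))) => y [Ly [/eqP n1 /eqP n2]] /andP[y1 y2].
  have {}y1 : -1 < y by rewrite lt_neqAle eq_sym n1.
  have {}y2 : y < 1 by rewrite lt_neqAle n2.
  have [y0y|yy0|<-] := ltgtP y0 y; last by rewrite addrK.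
    have := weak_interval L0 Ly y00 y0y y2.
    by rewrite /P (Int_chasles bD (ltW y00) (ltW y0y)) => ->; ring.
  have := weak_interval Ly L0 y1 yy0 y01.
  by rewrite /P (Int_chasles bD (ltW y1) (ltW yy0)) => ->; ring.
pose Q y := Int (-1) 1 (fun z => D z * (z <= y)%R%:R).
have bi : bm (fun p : R * R => (p.2 <= p.1)%R%:R : R).
  rewrite (_ : (fun p => _) = \1_([set p : R * R | p.2 <= p.1])).
    apply: bm_indic; rewrite -[X in measurable X]setTI.
    exact: measurable_fun_le measurableT measurable_snd measurable_fst.
  by apply/funext => p; rewrite indicE; congr (_%:R); congr nat_of_bool;
    apply/idP/idP; rewrite inE.
have bQ : bm Q.
  have := @bm_Int R (fun p : R * R => D p.2 * (p.2 <= p.1)%R%:R) (-1) 1 (ltW m11).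
  by apply; apply: bmM => //; exact: bm_snd.
have QP y : -1 <= y <= 1 -> Q y = P y by move=> yI; rewrite /Q Int_cut_le.
pose H y := Int (-1) 1 (fun z => h z * (z <= y)%R%:R).
have bH : bm H.
  have := @bm_Int R (fun p : R * R => h p.2 * (p.2 <= p.1)%R%:R) (-1) 1 (ltW m11).
  by apply; apply: bmM => //; exact: bm_snd.
have HP y : -1 <= y <= 1 -> H y = Int (-1) y h by move=> yI; rewrite /H Int_cut_le.
transitivity (Int (-1) 1 (fun y => c * D y + D y * H y)).
  by apply: eq_Int => y yI; rewrite HP//; ring.
rewrite IntD; [|by apply: bmM => //; exact: bm_cst|exact: bmM].
rewrite IntZ// weak_mean mulr0 add0r.
transitivity (Int (-1) 1 (fun y => D y * Int (-1) y h)).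
  by apply: eq_Int => y yI; rewrite HP.
rewrite Int_by_parts//.
transitivity (Int (-1) 1 (fun z => (G y0 + P y0) * h z - h z * Q z)); last first.
  apply: ae_eq_Int.
  - by apply: bmB; [apply: bmM => //; exact: bm_cst|exact: bmM].
  - exact: bmM.
  by apply: (ae_imp PE) => y E yI; rewrite E// QP//; ring.
rewrite IntB; [|by apply: bmM => //; exact: bm_cst|exact: bmM].
rewrite IntZ// h0 mulr0 sub0r -IntN; last exact: bmM.
apply: eq_Int => z zI; rewrite QP//.
have /andP[z0 z1] := zI.
have := Int_chasles bD z0 z1; rewrite weak_mean -/(P z) => E.
by rewrite (_ : Int z 1 D = - P z) ?mulrN//; apply/eqP; rewrite -addr_eq0 addrC -E.
Qed.

End space.

Lemma interval_null f : mu.-integrable (torus R) (EFin \o f) ->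
  (forall y1 y2, -1 < y1 -> y1 < y2 -> y2 < 1 -> Int y1 y2 f = 0) ->
  {ae mu, forall y, -1 < y < 1 -> f y = 0}.
Proof.
move=> intf f0.
have locf : locally_integrable setT (f \_ (torus R)).
  exact: integrable_locally_restrict.
apply: (ae_imp (lebesgue_differentiation locf)) => x Lx /andP[x0 x1].
pose a := (x - 1) / 2; have ax : a < x by rewrite /a; lra.
have a1 : -1 < a by rewrite /a; lra.
have fE y1 y2 : -1 < y1 -> y1 < y2 -> y2 < 1 -> Int y1 y2 (f \_ (torus R)) = 0.
  move=> h1 h12 h2; rewrite -(f0 _ _ h1 h12 h2); apply: eq_Int => y /andP[u v].
  by rewrite patchE mem_torus; case: ifPn => //; rewrite negb_and -!ltNge; lra.
have intf1 : mu.-integrable `[a, 1] (EFin \o (f \_ (torus R))).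
  apply: (@eq_integrable _ _ _ mu `[a, 1]%classic _ (EFin \o f)) => //.
    move=> y; rewrite inE/= in_itv/= => /andP[u v]; by rewrite patchE mem_torus v andbT (le_trans (ltW a1) u).
  apply: (@integrableS _ _ _ mu (torus R)) => // y; rewrite /= in_itv/= => /andP[u v].
  by apply/set_mem; rewrite mem_torus v andbT (le_trans (ltW a1) u).
have [_] := FTC1_lebesgue_pt x1 intf1 ax Lx.
rewrite patchE mem_torus (ltW x0) (ltW x1)/= => <-; rewrite derive1E.
have N : \forall y \near x, cst (0 : R) y = Int a y (f \_ (torus R)).
  near=> y; apply/esym; apply: fE => //; near: y.
    exact: lt_nbhsr.
  exact: lt_nbhsl.
by have [_] := is_derive_near_eq N (is_derive_cst (0 : R) x 1).
Unshelve. all: by end_near. Qed.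

(** Differences of smooth steps approximate the indicators of intervals, and
    an integrable function whose integrals over intervals vanish is zero at its
    Lebesgue points. *)
Lemma weak_equal f g : mu.-integrable (torus R) (EFin \o f) -> bm g ->
  (forall Y, periodic_tower Y -> \int[mu]_(y in torus R) (f y * Y 0%N y) =
    Int (-1) 1 (fun y => g y * Y 0%N y)) ->
  {ae mu, forall y, -1 < y < 1 -> f y = g y}.
Proof.
move=> intf bg E.
have intg : mu.-integrable (torus R) (EFin \o g) by exact: bm_integrable_itv.
pose D y := f y - g y.
have intD : mu.-integrable (torus R) (EFin \o D).
  rewrite (_ : EFin \o D = ((EFin \o f) \- (EFin \o g))%E)//.
  exact: integrableB.
have mD : measurable_fun (torus R) D by apply/measurable_EFinP; case/integrableP: intD.
suff H : forall y1 y2, -1 < y1 -> y1 < y2 -> y2 < 1 -> Int y1 y2 D = 0.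
  by apply: (ae_imp (interval_null intD H)) => y h /h /eqP; rewrite subr_eq0 => /eqP.
move=> y1 y2 a1 a12 a2.
have intM (h : R -> R) : bm h -> mu.-integrable (torus R) (fun y => (D y * h y)%:E).
  move=> [mh [Ch ChP]].
  apply: (@le_integrable _ _ _ mu (torus R) _ _ (fun y => (Ch * D y)%:E)) => //.
  - by apply/measurable_EFinP; apply: measurable_funM => //; exact: measurable_funTS.
  - move=> y _ /=; rewrite lee_fin !normrM mulrC ler_wpM2r//.
    by rewrite (le_trans (ChP y))// ler_norm.
  - rewrite (_ : (fun y => _) = (fun y => Ch%:E * (EFin \o D) y)%E)//; exact: integrableZl.
have : \int[mu]_(y in torus R) (D y * (X y1 n 0%N y - X y2 n 0%N y)) @[n --> \oo]
    --> \int[mu]_(y in torus R) (D y * ((y1 < y)%R%:R - (y2 < y)%R%:R)).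
  have bs : bm (fun y => ((y1 < y)%R%:R - (y2 < y)%R%:R) : R) by apply: bmB; exact: bm_step.
  have [|||||i _] := @dominated_convergence _ _ R mu (torus R) measurable_torus
    (fun n y => (D y * (X y1 n 0%N y - X y2 n 0%N y))%:E)
    (fun y => (D y * ((y1 < y)%R%:R - (y2 < y)%R%:R))%:E) (fun y => (2 * `|D y|)%:E).
  - by move=> n; have /integrableP[] := intM _ (bmB (bm0 y1 n) (bm0 y2 n)).
  - by have /integrableP[] := intM _ bs.
  - apply: aeW => y _; apply: cvg_EFin; first exact: nearW.
    apply: cvgM; first exact: cvg_cst.
    by apply: cvgB; exact: cvg0.
  - apply: (@eq_integrable _ _ _ mu (torus R) _ (fun y => 2%:E * `|(D y)%:E|)%E) => //.
    by apply: integrableZl => //; exact: integrable_abse.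
  - apply: aeW => y n _; rewrite /= lee_fin normrM mulrC ler_wpM2r//.
    by rewrite (le_trans (ler_normB _ _))// -[leRHS]/(1 + 1) lerD.
  move=> h; have := fine_cvg; move=> /(_ R nat \oo _ (fun n => \int[mu]_(y in torus R) (D y * (X y1 n 0%N y - X y2 n 0%N y))%:E)%E).
  by apply; rewrite /Rintegral fineK//; exact: integrable_fin_num i.
set l := (X in _ --> X) => lim.
have -> : Int y1 y2 D = l.
  rewrite /l /Int.
  have -> : `[y1, y2]%classic = torus R `&` `[y1, y2]%classic.
    apply/seteqP; split => y; last by case.
    move=> /= yI; split => //; move: yI; rewrite /= in_itv/= => /andP[u v].
    by apply/set_mem; rewrite mem_torus; apply/andP; split; lra.
  rewrite Rintegral_mkcondr; apply: ae_eq_Rintegral_gen => //.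
  apply: (ae_imp (ae_and (ae_neq y1) (ae_neq y2))) => y [/eqP n1 /eqP n2] _.
  rewrite patchE; case: ifPn => [/set_mem|/negP H].
    rewrite /= in_itv/= => /andP[u v].
    by rewrite (ltNge y2) v lt_neqAle eq_sym n1 u/= subr0 mulr1.
  have [h1|h1] := ltP y1 y; have [h2|h2] := ltP y2 y; rewrite ?subrr ?mulr0//.
    by exfalso; apply: H; rewrite inE/= in_itv/= (ltW h1).
  by exfalso; move: (lt_le_trans (lt_trans a12 h2) h1); rewrite ltxx.
apply: (cvg_unique _ lim); first exact: norm_hausdorff.
apply: cvg_near_cst; near=> n.
have n2 : y2 + n.+1%:R^-1 < 1 by near: n; exact: near_lt.
have [Y pY YE] := interval_tower a1 a12 n2.
have bY : bm (fun y => X y1 n 0%N y - X y2 n 0%N y) by exact: bmB.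
have := E Y pY; rewrite (@eq_Int _ _ _ _ (fun y => g y * (X y1 n 0%N y - X y2 n 0%N y))); last first.
  by move=> y yI; rewrite YE.
rewrite (@eq_Rintegral _ _ _ mu (torus R) (fun y => D y * (X y1 n 0%N y - X y2 n 0%N y)
   + g y * (X y1 n 0%N y - X y2 n 0%N y))); last first.
  by move=> y; rewrite mem_torus => yI; rewrite YE// /D; ring.
rewrite RintegralD//; [|exact: intM|by apply: bm_integrable_itv; exact: bmM].
by rewrite -[X in _ = X]add0r => /addIr.
Unshelve. all: by end_near. Qed.

End with_steps.
End tests.

(** * Weak solutions with values in a compact convex set *)

Section projection.
Context (R : realType) (m : nat).
Local Notation V := 'cV[R]_m.
Local Notation mu := (@lebesgue_measure R).
Implicit Types (K : set V) (a b : V).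

Lemma sqdist_continuous (x : V) : continuous (fun z : V => dot (x - z) (x - z)).
Proof.
move=> z; rewrite /dot; elim: (index_enum _) => [|j l IH].
  rewrite (_ : (fun z : V => _) = cst (0 : R)); first exact: cst_continuous.
  by apply/funext => y; rewrite big_nil.
rewrite (_ : (fun z : V => _) =
    (fun z : V => (x j ord0 - z j ord0) * (x j ord0 - z j ord0)
      + \sum_(k <- l) (x - z) k ord0 * (x - z) k ord0)).
  have C0 : continuous_at z (fun z : V => z j ord0) by exact: coord_continuous.
  have C1 : continuous_at z (fun z : V => (x j ord0 - z j ord0)).
    exact: (cvgB (cvg_cst _) C0).
  exact: (cvgD (cvgM C1 C1) IH).
by apply/funext => y; rewrite big_cons !mxE.
Qed.

Lemma sqdist_line (p q : V) (s : R) : dot (p - s *: q) (p - s *: q) =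
  dot p p - 2 * s * dot q p + s * (s * dot q q).
Proof.
rewrite dotBl !dotBr !dotZl (dotC p (s *: q)) (dotC q (s *: q)) !dotZl; ring.
Qed.

Lemma lipschitz_continuous (f : V -> R) (L : R) :
  (forall x y, `|f x - f y| <= L * `|x - y|) -> continuous f.
Proof.
move=> H x; apply/(@cvgrPdist_le R R V (nbhs x)) => e e0.
have L0 : 0 < `|L| + 1 by rewrite ltr_wpDl.
have : \forall z \near x, `|x - z| <= e / (`|L| + 1).
  have d0 : 0 < e / (`|L| + 1) by rewrite divr_gt0.
  by apply/nbhs_ballP; exists (e / (`|L| + 1)) => // z; rewrite -ball_normE/= => /ltW.
apply: filterS => z h; rewrite (le_trans (H x z))//.
apply: (@le_trans _ _ ((`|L| + 1) * (e / (`|L| + 1)))).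
  apply: (@le_trans _ _ ((`|L| + 1) * `|x - z|)).
    by rewrite ler_wpM2r// (le_trans (ler_norm _))// lerDl.
  by rewrite ler_wpM2l// ltW.
by rewrite mulrCA divff ?mulr1// gt_eqF.
Qed.

(** A point of [K] at minimal distance exists by compactness; moving from it
    towards [l] inside [K] does not decrease the distance. *)
Lemma nearest_point K (x : V) : compact K -> convexK K -> K !=set0 ->
  exists2 k, K k & forall l, K l -> dot (l - k) (x - k) <= 0.
Proof.
move=> cK vK K0.
have [|k /set_mem Kk kmin] := @compact_EVT_min _ R (fun z : V => dot (x - z) (x - z)) K K0 cK.
  by apply: continuous_subspaceT; exact: sqdist_continuous.
exists k => // l Kl; rewrite leNgt; apply/negP => d0.
pose A := dot (l - k) (x - k); pose B := dot (l - k) (l - k).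
have B0 : 0 <= B by exact: dot_ge0.
pose s := Num.min 1 (A / (B + 1)).
have s0 : 0 < s by rewrite lt_min ltr01/= divr_gt0// ltr_pwDr.
have s1 : s <= 1 by rewrite ge_min lexx.
have sA : s * (B + 1) <= A by rewrite -ler_pdivlMr ?ltr_pwDr// ge_min lexx orbT.
have := kmin (k + s *: (l - k)); rewrite inE => /(_ (vK _ _ Kk Kl s _)).
rewrite (ltW s0) s1 => /(_ isT).
rewrite (_ : x - (k + s *: (l - k)) = (x - k) - s *: (l - k)); last first.
  by apply/matrixP => i j; rewrite !mxE; ring.
rewrite sqdist_line -/A -/B => h.
have : s * (2 * A) <= s * (s * B) by lra.
by rewrite ler_pM2l//; move: d0 sA; rewrite -/A mulrDr mulr1; lra.
Qed.

Definition proj K (cK : compact K) (vK : convexK K) (K0 : K !=set0) (x : V) : V :=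
  sval (cid2 (nearest_point x cK vK K0)).

Section proj.
Context (K : set V) (cK : compact K) (vK : convexK K) (K0 : K !=set0).
Local Notation pi := (proj cK vK K0).

Lemma projK x : K (pi x).
Proof. by rewrite /proj; case: cid2. Qed.

Lemma proj_le x l : K l -> dot (l - pi x) (x - pi x) <= 0.
Proof. by rewrite /proj; case: cid2 => k /= _; exact. Qed.

Lemma proj_lip x y : enorm (pi x - pi y) <= enorm (x - y).
Proof.
have h1 := proj_le x (projK y); have h2 := proj_le y (projK x).
have h3 : enorm (pi x - pi y) ^+ 2 <= enorm (pi x - pi y) * enorm (x - y).
  apply: le_trans (dot_le _ _); rewrite enorm_sqr -subr_ge0 -dotBr.
  rewrite (_ : x - y - _ = (x - pi x) - (y - pi y)); last first.
    by apply/matrixP => i j; rewrite !mxE; ring.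
  rewrite dotBr; move: h1 h2.
  rewrite -(opprB (pi x) (pi y)) dotNl; lra.
have [e0|] := eqVneq (enorm (pi x - pi y)) 0; first by rewrite e0 enorm_ge0.
move=> n0; have p0 : 0 < enorm (pi x - pi y) by rewrite lt_neqAle eq_sym n0 enorm_ge0.
by rewrite -(ler_pM2l p0) -expr2.
Qed.

Lemma proj_continuous j : continuous (fun x => pi x j ord0).
Proof.
apply: (@lipschitz_continuous _ m%:R) => x y.
have := le_trans (coord_le_enorm (pi x - pi y) j) (proj_lip x y).
rewrite !mxE => /le_trans; apply; exact: enorm_le_norm.
Qed.

End proj.

Lemma compact_coord_bound K : compact K -> exists C : R, forall y, K y -> enorm y <= C.
Proof.
move=> /compact_bounded[M [_ MH]]; exists (m%:R * (M + 1)) => y Ky.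
rewrite (le_trans (enorm_le_norm _))// ler_wpM2l//.
by apply: (MH (M + 1)) => //; rewrite ltrDl.
Qed.

Lemma Int_null (a b : R) (f : R -> R) : bm f -> (forall y, 0 <= f y) -> Int a b f <= 0 ->
  {ae mu, forall y, a <= y <= b -> f y = 0}.
Proof.
move=> bf f0 I0.
have i0 : Int a b f = 0 by apply/eqP; rewrite eq_le I0 Int_ge0.
have intf := bm_integrable_itv a b bf.
have mf : measurable_fun `[a, b] (EFin \o f) by case/integrableP : intf.
have : (\int[mu]_(x in `[a, b]) `|(f x)%:E| = 0)%E.
  transitivity (\int[mu]_(x in `[a, b]) (f x)%:E)%E.
    by apply: eq_integral => x _; rewrite /= ger0_norm.
  by rewrite -(fineK (integrable_fin_num _ intf))// -[fine _]/(Int a b f) i0.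
have [+ _] := ae_eq_integral_abs mu (measurable_itv `[a, b]) mf.
move=> /[apply] H; apply: (ae_imp H) => y Hy yab.
by have [] := Hy (yab : `[a, b]%classic y).
Qed.

End projection.

Section weak_solutions.
Context (R : realType) (m : nat).
Local Notation V := 'cV[R]_m.
Local Notation mu := (@lebesgue_measure R).
#[local] Hint Resolve measurable_torus : core.
Context (T : R) (T0 : 0 < T) (K : set V) (cK : compact K) (vK : convexK K) (K0 : K !=set0).

Definition vanishes_before (X : nat -> R -> R) := exists2 T', T' < T & forall s, T' <= s -> X 0%N s = 0.

Context (w : R * R -> V) (G : 'I_m -> R * R -> R) (u : R -> R -> V) (u0 : R -> V).
Hypothesis bw : forall j, bm (fun p => w p j ord0).
Hypothesis Kw : forall p, K (w p).
Hypothesis bG : forall j, bm (G j).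
Hypothesis bu : forall t j, bm (fun y => u t y j ord0).
Hypothesis uw : {ae mu, forall s, 0 <= s <= T -> {ae mu, forall y, -1 <= y <= 1 -> u s y = w (s, y)}}.
Hypothesis cu : forall phi : R -> V, (forall j, bm (fun y => phi y j ord0)) ->
  cont_on 0 T (fun s => Int (-1) 1 (fun y => dot (u s y) (phi y))).
Hypothesis iu0 : forall j, mu.-integrable (torus R) (fun y => (u0 y j ord0)%:E).
Hypothesis weak : forall j X Y, tower X -> vanishes_before X -> periodic_tower Y ->
  Int 0 T (fun s => Int (-1) 1 (fun y =>
    w (s, y) j ord0 * (X 1%N s * Y 0%N y) + G j (s, y) * (X 0%N s * Y 1%N y)))
  + \int[mu]_(y in torus R) (u0 y j ord0 * (X 0%N 0 * Y 0%N y)) = 0.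

Let m11 : -1 <= 1 :> R. Proof. lra. Qed.

Lemma bm_dot (f g : R -> V) : (forall j, bm (fun y => f y j ord0)) ->
  (forall j, bm (fun y => g y j ord0)) -> bm (fun y => dot (f y) (g y)).
Proof. by move=> bf bg; apply: bm_sum => j; exact: bmM. Qed.

(** With [p] the projection of [u t] on [K], the half-space inequality
    [dot (u s - p) (u t - p) <= 0] holds for almost all times [s], because
    [u s] has its values in [K]; it is linear in [u s] and hence survives, after
    integration, the weak limit [s --> t], which gives [u t = p]. *)
Lemma values_in_K t : 0 <= t <= T -> {ae mu, forall y, -1 <= y <= 1 -> K (u t y)}.
Proof.
move=> tT; pose p y := proj cK vK K0 (u t y); pose phi y := u t y - p y.
have [CK CKP] := compact_coord_bound cK.
have bp j : bm (fun y => p y j ord0).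
  split; last first.
    by exists CK => y; rewrite (le_trans (coord_le_enorm _ _))// CKP//; exact: projK.
  apply: (@measurable_comp_continuous R m _ _ (u t) (fun z => proj cK vK K0 z j ord0)).
    by move=> i; case: (bu t i).
  by move=> x; exact: proj_continuous.
have bphi j : bm (fun y => phi y j ord0).
  rewrite (_ : (fun y => _) = fun y => u t y j ord0 - p y j ord0); first exact: bmB.
  by apply/funext => y; rewrite !mxE.
have cf : cont_on 0 T (fun s => Int (-1) 1 (fun y => dot (p y) (phi y))
    - Int (-1) 1 (fun y => dot (u s y) (phi y))).
  apply: cont_on_sub; last exact: cu.
  by move=> s _ e e0; exists 1 => // s' _ _; rewrite subrr normr0 ltW.
have H : {ae mu, forall s, 0 < s < T -> 0 <= Int (-1) 1 (fun y => dot (p y) (phi y))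
    - Int (-1) 1 (fun y => dot (u s y) (phi y))}.
  apply: (ae_imp uw) => s /[swap] /andP[s0 sT]; rewrite (ltW s0) (ltW sT) => /(_ isT) us.
  rewrite subr_ge0; apply: ae_le_Int; [exact: bm_dot|exact: bm_dot|].
  apply: (ae_imp us) => y E yI; rewrite -subr_le0 -dotBl E//.
  exact: proj_le.
have := cont_on_ae_ge0 T0 cf H tT.
rewrite -IntB; [|exact: bm_dot|exact: bm_dot] => h.
have bpp : bm (fun y => dot (phi y) (phi y)) by exact: bm_dot.
have : Int (-1) 1 (fun y => dot (phi y) (phi y)) <= 0.
  rewrite -oppr_ge0 -IntN//; apply: (le_trans h); rewrite le_eqVlt; apply/orP; left.
  by apply/eqP/eq_Int => y _; rewrite -dotBl -opprB dotNl.
move=> I0; apply: (ae_imp (Int_null bpp (fun y => dot_ge0 _) I0)) => y E yI.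
have /eqP := dot_eq0 (E yI); rewrite subr_eq0 => /eqP ->; exact: projK.
Qed.

Lemma bm_clamp (a b : R) (f : R -> R) : a <= b -> continuous f ->
  bm (fun y => f (Num.max a (Num.min b y))).
Proof.
move=> ab cf.
have cc : continuous (fun y : R => Num.max a (Num.min b y)).
  move=> y; have c1 : {for y, continuous (fun y : R => Num.min b y)}.
    exact: (continuous_min (f := cst b) (g := id) (@cst_continuous _ _ b y) cvg_id).
  exact: (continuous_max (f := cst a) (@cst_continuous _ _ a y) c1).
have inab y : a <= Num.max a (Num.min b y) <= b.
  by rewrite le_max lexx ge_max ab ge_min lexx.
have [|c1 _ H1] := @EVT_max R f a b ab.
  by apply: continuous_subspaceT.
have [|c2 _ H2] := @EVT_min R f a b ab.
  by apply: continuous_subspaceT.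
apply: (@bm_continuous_bounded _ _ (Num.max `|f c1| `|f c2|)) => [y|y].
  exact: (continuous_comp (cc y) (cf _)).
have h1 := H1 _ (inab y : _ \in `[a, b]); have h2 := H2 _ (inab y : _ \in `[a, b]).
rewrite ler_norml; apply/andP; split.
  rewrite (le_trans _ h2)// lerNl (le_trans _ (_ : `|f c2| <= _))//.
    by rewrite -normrN ler_norm.
  by rewrite le_max lexx orbT.
by rewrite (le_trans h1)// (le_trans (ler_norm _))// le_max lexx.
Qed.

Let clampE (y : R) : -1 <= y <= 1 -> Num.max (-1) (Num.min 1 y) = y.
Proof. by move=> /andP[y0 y1]; rewrite min_r// max_r. Qed.

(** Products of bounded functions with smooth periodic ones can be treated as
    bounded functions, by truncation outside the torus. *)
Let bmt (Y : nat -> R -> R) k := (fun y => Y k (Num.max (-1) (Num.min 1 y))).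

Let bm_bmt Y k : tower Y -> bm (bmt Y k).
Proof. by move=> tY; apply: (bm_clamp m11); exact: tower_continuous. Qed.

Let bmtE Y k f : Int (-1) 1 (fun y => f y * Y k y) = Int (-1) 1 (fun y => f y * bmt Y k y).
Proof. by apply: eq_Int => y yI; rewrite /bmt clampE. Qed.

Let integrable_bmt Y j : periodic_tower Y ->
  mu.-integrable (torus R) (fun y => (u0 y j ord0 * Y 0%N y)%:E).
Proof.
move=> [tY _]; have [mb [Cb CbP]] := bm_bmt 0%N tY.
have mu0 := iu0 j; have mu0' : measurable_fun (torus R) (fun y => u0 y j ord0).
  by apply/measurable_EFinP; case/integrableP: mu0.
apply: (@eq_integrable _ _ _ mu (torus R) _ (fun y => (u0 y j ord0 * bmt Y 0%N y)%:E)).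
- exact: measurable_torus.
- by move=> y; rewrite mem_torus => yI; rewrite /bmt clampE.
apply: (@le_integrable _ _ _ mu (torus R) _ _ (fun y => (Cb%:E * (u0 y j ord0)%:E)%E)).
- exact: measurable_torus.
- by apply/measurable_EFinP; apply: measurable_funM => //; exact: measurable_funTS.
- move=> y _ /=; rewrite lee_fin !normrM mulrC ler_wpM2r//.
  by rewrite (le_trans (CbP y))// ler_norm.
- by apply: integrableZl => //; exact: measurable_torus.
Qed.

(** For a fixed space factor [Y], the weak formulation gives the weak derivative
    in time of the moment of [u] against [Y], and this moment is continuous in
    time by weak-* continuity. *)
Lemma weak_at t j Y : 0 <= t <= T -> periodic_tower Y ->
  Int (-1) 1 (fun y => u t y j ord0 * Y 0%N y)
    - \int[mu]_(y in torus R) (u0 y j ord0 * Y 0%N y) =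
  Int 0 t (fun s => Int (-1) 1 (fun y => G j (s, y) * Y 1%N y)).
Proof.
move=> tT [tY pY]; have [C C0 [X XP]] := step_family R.
have bFA : bm (fun p : R * R => w p j ord0 * bmt Y 0%N p.2).
  by apply: bmM => //; apply: bm_snd; exact: bm_bmt.
have bFB : bm (fun p : R * R => G j p * bmt Y 1%N p.2).
  by apply: bmM => //; apply: bm_snd; exact: bm_bmt.
pose A s := Int (-1) 1 (fun y => w (s, y) j ord0 * bmt Y 0%N y).
pose B s := Int (-1) 1 (fun y => G j (s, y) * bmt Y 1%N y).
have bA : bm A := bm_Int m11 bFA.
have bB : bm B := bm_Int m11 bFB.
pose A0 s := Int (-1) 1 (fun y => u s y j ord0 * bmt Y 0%N y).
have cA : cont_on 0 T A0.
  have := @cu (fun y => bmt Y 0%N y *: basisv R j); rewrite /A0.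
  rewrite (_ : (fun s => Int (-1) 1 (fun y => dot (u s y) (bmt Y 0%N y *: basisv R j))) =
     (fun s => Int (-1) 1 (fun y => u s y j ord0 * bmt Y 0%N y))).
    apply=> i; rewrite (_ : (fun y => _) = fun y => bmt Y 0%N y * basisv R j i ord0).
      by apply: bmM; [exact: bm_bmt|exact: bm_cst].
    by apply/funext => y; rewrite mxE.
  by apply/funext => s; congr Int; apply/funext => y; rewrite dotC dotZl dotC dot_basis mulrC.
have AA0 : {ae mu, forall s, 0 <= s <= T -> A s = A0 s}.
  apply: (ae_imp uw) => s H sT; apply: ae_eq_Int.
  - exact: bm_slice1 bFA.
  - by apply: bmM => //; exact: bm_bmt.
  - by apply: (ae_imp (H sT)) => y E yI; rewrite E.
rewrite bmtE; under [RHS]eq_Int => s _ do rewrite bmtE.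
apply: (weak_time_derivative XP T0 bA bB cA AA0) => // Xt tX vX.
have := weak j tX vX (conj tY pY).
rewrite (_ : \int[mu]_(y in torus R) _ = \int[mu]_(y in torus R) (u0 y j ord0 * Y 0%N y) * Xt 0%N 0); last first.
  rewrite -RintegralZr; [|exact: measurable_torus|exact: integrable_bmt].
  by apply: eq_Rintegral => y _; rewrite (mulrC (Xt _ _)) mulrA.
move=> E; rewrite -[RHS]E; congr (_ + _).
have [T' T'T vX'] := vX.
pose Xc k s := Xt k (Num.max 0 (Num.min T s)).
have bXc k : bm (Xc k) by apply: bm_clamp; [exact: ltW|exact: tower_continuous].
have XcE k s : 0 <= s <= T -> Xt k s = Xc k s.
  by move=> /andP[s0 sT]; rewrite /Xc min_r// max_r.
have [bF1 bF2] : bm (fun s => A s * Xc 1%N s) /\ bm (fun s => B s * Xc 0%N s).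
  by split; apply: bmM.
transitivity (Int 0 T (fun s => A s * Xc 1%N s) + Int 0 T (fun s => B s * Xc 0%N s)).
  by congr (_ + _); apply: eq_Int => s sT; rewrite XcE.
rewrite -IntD//; apply: eq_Int => s sT.
rewrite -(XcE 1%N)// -(XcE 0%N)// /A /B.
have b1 : bm (fun y => w (s, y) j ord0 * bmt Y 0%N y) by exact: bm_slice1 bFA.
have b2 : bm (fun y => G j (s, y) * bmt Y 1%N y) by exact: bm_slice1 bFB.
rewrite mulrC (mulrC _ (Xt 0%N s)) -!IntZ// -IntD; last 2 first.
- by apply: bmM => //; exact: bm_cst.
- by apply: bmM => //; exact: bm_cst.
by apply: eq_Int => y yI; rewrite /bmt clampE//; ring.
Qed.

(** At time 0 the right-hand side of [weak_at] vanishes. *)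
Lemma initial_value j : {ae mu, forall y, -1 < y < 1 -> u0 y j ord0 = u 0 y j ord0}.
Proof.
have [C C0 [X XP]] := step_family R.
apply: (weak_equal XP) => // [|Y pY]; first exact: iu0.
have T00 : 0 <= (0 : R) <= T by rewrite lexx ltW.
have := weak_at j T00 pY; rewrite Int_xx => /eqP; rewrite subr_eq0 => /eqP <-.
by [].
Qed.

(** The entropy variables of the reconstruction are only Lipschitz in space,
    hence the extension from smooth to Lipschitz periodic test functions. *)
Lemma weak_at_lipschitz t j h c : 0 <= t <= T -> bm h -> Int (-1) 1 h = 0 ->
  Int (-1) 1 (fun y => (u t y j ord0 - u 0 y j ord0) * (c + Int (-1) y h)) =
  Int 0 t (fun s => Int (-1) 1 (fun y => G j (s, y) * h y)).
Proof.
move=> tT bh h0; have [C C0 [X XP]] := step_family R.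
have t0 : 0 <= t by case/andP: tT.
pose Gam y := Int 0 t (fun s => G j (s, y)).
have bGam : bm Gam by exact: (bm_Int t0 (bm_swap (bG j))).
have bD : bm (fun y => u t y j ord0 - u 0 y j ord0) by exact: bmB.
have T00 : 0 <= (0 : R) <= T by rewrite lexx ltW.
have swap (f : R -> R) : bm f -> Int 0 t (fun s => Int (-1) 1 (fun y => G j (s, y) * f y)) =
    Int (-1) 1 (fun y => Gam y * f y).
  move=> bf; have bF : bm (fun p : R * R => G j p * f p.2) by apply: bmM => //; exact: bm_snd.
  rewrite (Int_fubini t0 m11 bF); apply: eq_Int => y _ /=.
  rewrite mulrC -IntZ; last exact: bm_slice2.
  by apply: eq_Int => s _; rewrite mulrC.
rewrite swap//; apply: (weak_lipschitz XP bD bGam) => // Y pY.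
have E0 := weak_at j T00 pY; have Et := weak_at j tT pY.
rewrite Int_xx in E0; move: pY Et E0 => [tY pY].
rewrite (bmtE _ 1%N) -(swap (bmt Y 1%N)); last exact: bm_bmt.
under [in X in _ = X -> _]eq_Int => s _ do rewrite bmtE.
move=> Et /eqP; rewrite subr_eq0 => /eqP E0; rewrite -Et -E0 (bmtE Y 0%N (fun y => u t y j ord0))
  (bmtE Y 0%N (fun y => u 0 y j ord0)) (bmtE Y 0%N (fun y => u t y j ord0 - u 0 y j ord0)) -IntB.
- by apply: eq_Int => y _; rewrite mulrBl.
- by apply: bmM => //; exact: bm_bmt.
- by apply: bmM => //; exact: bm_bmt.
Qed.

(** The weak entropy inequality is tested with functions of time only, so that
    the entropy flux drops out. *)
Lemma entropy_decrease (E : R * R -> R) (H0 : R) : bm E ->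
  (forall X, tower X -> (forall s, 0 <= X 0%N s) -> vanishes_before X ->
    0 <= Int 0 T (fun s => Int (-1) 1 (fun y => E (s, y) * X 1%N s)) + H0 * X 0%N 0) ->
  {ae mu, forall t, 0 < t < T -> Int (-1) 1 (fun y => E (t, y)) <= H0}.
Proof.
move=> bE W; have [C C0 [X XP]] := step_family R.
have bA : bm (fun s => Int (-1) 1 (fun y => E (s, y))) by exact: bm_Int.
apply: (weak_time_decrease XP bA) => Xt tX X0 vX.
have := W _ tX X0 vX; congr (0 <= _ + _); apply: eq_Int => s _.
rewrite mulrC -IntZ; last exact: bm_slice1.
by apply: eq_Int => y _; rewrite mulrC.
Qed.

End weak_solutions.

(** * The pointwise relative entropy estimates *)

Section pointwise.
Context (R : realType) (m : nat).
Local Notation V := 'cV[R]_m.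
Context (U K : set V) (g : V -> V) (eta Q : V -> R) (Cg Clo Chi : R).
Hypotheses (oU : open U) (gC : Ck 2 U g) (eC : Ck 2 U eta) (QC : Ck 1 U Q).
Hypothesis pr : forall y, U y -> forall v, 'd eta y ('d g y v) = 'd Q y v.
Hypotheses (cK : compact K) (vK : convexK K) (KU : K `<=` U).
Hypotheses (Cg0 : 0 < Cg) (Clo0 : 0 < Clo) (Clohi : Clo < Chi).
Hypothesis gb : forall v y, K y -> enorm (vec_hessian_form g y v) <= Cg * enorm v ^+ 2.
Hypothesis eb : forall v y, K y ->
  Clo * enorm v ^+ 2 <= qform (hessian eta y) v <= Chi * enorm v ^+ 2.

Definition jac k j (a : V) : R := partial (fun z => g z j ord0) k a.

Definition jac_vec (a v : V) : V := \col_j \sum_k v k ord0 * jac k j a.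

Let gj j : Ck 2 U (fun z => g z j ord0). Proof. exact: Ck_coord. Qed.
Let gj1 j : Ck 1 U (fun z => g z j ord0). Proof. exact: (@Ck_le R V R 2 1 _ _ isT (gj j)). Qed.
Let g1 : Ck 1 U g. Proof. exact: (@Ck_le R V V 2 1 _ _ isT gC). Qed.
Let e1 : Ck 1 U eta. Proof. exact: (@Ck_le R V R 2 1 _ _ isT eC). Qed.
Let p1 j : Ck 1 U (partial eta j). Proof. exact: Ck_partial eC. Qed.

Let symmetrizer_sum (H J : 'I_m -> 'I_m -> R) (vy e : 'I_m -> R) :
  (forall i j, H i j = H j i) ->
  (forall i k, \sum_j H i j * J k j = \sum_j H k j * J i j) ->
  \sum_i \sum_j H i j * vy i * (\sum_k e k * J k j) =
  \sum_i \sum_j H i j * (\sum_k vy k * J k i) * e j.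
Proof.
move=> HC HJ.
transitivity (\sum_i \sum_k vy i * e k * \sum_j H i j * J k j).
  apply: eq_bigr => i _.
  rewrite (eq_bigr (fun j => \sum_k (vy i * e k * (H i j * J k j)))).
    by rewrite exchange_big/=; apply: eq_bigr => k _; rewrite mulr_sumr.
  by move=> j _; rewrite mulr_sumr; apply: eq_bigr => k _; ring.
transitivity (\sum_j \sum_k vy k * e j * \sum_i H j i * J k i).
  rewrite exchange_big/=; apply: eq_bigr => k _; apply: eq_bigr => i _.
  by rewrite HJ.
rewrite [RHS]exchange_big/=; apply: eq_bigr => j _.
rewrite (eq_bigr (fun k => \sum_i (vy k * e j * (H j i * J k i)))).
  rewrite exchange_big/=; apply: eq_bigr => i _.
  rewrite mulr_sumr mulr_suml; apply: eq_bigr => k _; rewrite HC; ring.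
by move=> k _; rewrite mulr_sumr.
Qed.

(** Splitting [g b - g a] into its linear part and the Taylor remainder, the
    linear part is moved onto [vy] by the symmetry of the Hessian times the
    Jacobian, where it completes [vt] to the residual. The residual term is
    bounded by Young's inequality, the remainder by the bound on the Hessian of
    [g]. *)
Lemma entropy_dissipation a b (vt vy : V) : K a -> K b ->
  \sum_j (\sum_k vt k ord0 * hessian eta a k j) * (a - b) j ord0
    - \sum_j (g b j ord0 - g a j ord0) * (\sum_k vy k ord0 * hessian eta a k j)
  <= 2^-1 * enorm (vt + jac_vec a vy) ^+ 2
     + 2^-1 * ((Chi ^+ 2 + Chi * Cg * enorm vy) * enorm (b - a) ^+ 2).
Proof.
move=> Ka Kb; set H := hessian eta a; set e := a - b.
have HC i j : H i j = H j i by apply: hessian_sym oU eC _; exact: KU.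
have bfE (x z : V) : \sum_j (\sum_k x k ord0 * H k j) * z j ord0 = bform H x z.
  rewrite /bform exchange_big/=; apply: eq_bigr => j _; rewrite mulr_suml.
  by apply: eq_bigr => k _; rewrite (mulrC (x _ _)).
have Hle (x z : V) : bform H x z <= Chi * (enorm x * enorm z).
  apply: bform_le => // v; rewrite -qformE; have /andP[h1 h2] := eb v Ka.
  by rewrite h2 andbT (le_trans _ h1)// mulr_ge0 ?sqr_ge0// ltW.
pose rel : V := \col_i relative (fun z => g z i ord0) a b.
have relE : enorm rel <= 2^-1 * (Cg * enorm (b - a) ^+ 2).
  exact: (relative_vec_le oU gC vK KU (ltW Cg0) gb Ka Kb).
have symm : bform H vy (jac_vec a (b - a)) = bform H (jac_vec a vy) (b - a).
  have jE (v : V) j : jac_vec a v j ord0 = \sum_k v k ord0 * jac k j a by rewrite mxE.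
  rewrite /bform.
  under eq_bigr => i _ do under eq_bigr => j _ do rewrite jE.
  under [RHS]eq_bigr => i _ do under eq_bigr => j _ do rewrite jE.
  apply: (@symmetrizer_sum (fun i j => H i j) (fun k j => jac k j a) (fun k => vy k ord0)
    (fun k => (b - a) k ord0) HC) => i k.
  exact: entropy_symmetrizer oU gC eC QC pr (KU Ka).
have E : \sum_j (g b j ord0 - g a j ord0) * (\sum_k vy k ord0 * H k j) =
    bform H vy rel + bform H (jac_vec a vy) (b - a).
  rewrite -symm -bformDr -bfE; apply: eq_bigr => j _; rewrite mulrC; congr (_ * _).
  by rewrite /rel /jac_vec /relative !mxE subrK.
rewrite E bfE opprD addrA addrAC.
have -> : bform H (jac_vec a vy) (b - a) = - bform H (jac_vec a vy) e.
  by rewrite -[b - a]opprB -scaleN1r bformZr mulN1r.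
rewrite opprK -bformDl.
have -> : - bform H vy rel = bform H vy (- rel).
  by rewrite -[- rel]scaleN1r bformZr mulN1r.
have ee : enorm (b - a) = enorm e by rewrite -enormN opprB.
have h1 := Hle (vt + jac_vec a vy) e.
have h2 := Hle vy (- rel); rewrite enormN in h2.
have Chi0 : 0 < Chi by exact: lt_trans Clohi.
rewrite ee in relE *.
have h3 : Chi * (enorm vy * enorm rel) <= Chi * (enorm vy * (2^-1 * (Cg * enorm e ^+ 2))).
  by rewrite ler_wpM2l ?(ltW Chi0)// ler_wpM2l// enorm_ge0.
have h4 : 0 <= (enorm (vt + jac_vec a vy) - Chi * enorm e) ^+ 2 by exact: sqr_ge0.
move: h1 h2 h3 h4; set x := enorm (_ + _); set z := enorm e; set n := enorm vy.
rewrite sqrrB exprMn => h1 h2 h3 h4.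
rewrite [2^-1 * ((_ + _) * _)](_ : _ = 2^-1 * (Chi ^+ 2 * z ^+ 2) +
  Chi * (n * (2^-1 * (Cg * z ^+ 2)))); last by ring.
have h5 : x * (Chi * z) = Chi * (x * z) by ring.
rewrite h5 in h4; lra.
Qed.

Lemma entropy_relative_bounds a b : K a -> K b ->
  2^-1 * (Clo * enorm (b - a) ^+ 2) <= relative eta a b <= 2^-1 * (Chi * enorm (b - a) ^+ 2).
Proof.
move=> Ka Kb; apply/andP; split.
  by apply: (@relative_ge R m U K eta Clo oU eC vK KU a b _ Ka Kb) => v y Ky; have /andP[] := eb v Ky.
by apply: (@relative_le R m U K eta Chi oU eC vK KU a b _ Ka Kb) => v y Ky; have /andP[] := eb v Ky.
Qed.

(** The potential of the flux in the entropy variables: its gradient is the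
    Hessian of the entropy applied to [g], so that the integral of
    [g (v)] against the space derivative of the entropy variables of a periodic
    function [v] vanishes. *)
Definition kruzkov (a : V) : R := \sum_j partial eta j a * g a j ord0 - Q a.

Lemma kruzkov_C1 : Ck 1 U kruzkov.
Proof.
apply: (@Ck_ext R m 1 U (fun a => -1 * Q a + (\sum_j (partial eta j * (fun a => g a j ord0))) a) _ oU).
  by move=> y _; rewrite /kruzkov fct_sumE mulN1r addrC.
apply: (Ck_lincomb _ oU QC); apply: (Ck1_sum _ oU) => j; exact: (Ck1_mul oU (p1 j) (gj1 j)).
Qed.

Lemma kruzkov_partial a k : U a ->
  partial kruzkov k a = \sum_j hessian eta a k j * g a j ord0.
Proof.
move=> Ua.
have D : is_derive a (basisv R k) kruzkov (\sum_j (partial eta j a * jac k j a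
    + g a j ord0 * hessian eta a k j) - partial Q k a).
  rewrite (_ : kruzkov = (\sum_j (partial eta j * (fun z => g z j ord0))) - Q); last first.
    by apply/funext => z; rewrite /kruzkov/= fctE fct_sumE.
  apply: is_deriveB; last first.
    by apply/derivableP; have [_ /(_ (basisv R k))[+ _]] := QC; exact.
  apply: is_derive_sum => j.
  have Dp : is_derive a (basisv R k) (partial eta j) (hessian eta a k j).
    rewrite (hessianE eta a k j).
    by apply/derivableP; have [_ /(_ (basisv R k))[+ _]] := p1 j; exact.
  have Dg : is_derive a (basisv R k) (fun z => g z j ord0) (jac k j a).
    by apply/derivableP; have [_ /(_ (basisv R k))[+ _]] := gj1 j; exact.
  exact: (is_deriveM Dp Dg).
have [_ DE] := D; apply: (eq_trans DE).
rewrite (partial_entropy_flux k oU g1 e1 QC pr Ua) -sumrB; apply: eq_bigr => j _.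
rewrite /jac; ring.
Qed.

Let curve (f : V -> R) (c : R -> V) (dc : V) (x : R) : Ck 1 U f -> K (c x) ->
  (forall j, is_derive x 1 (fun s => c s j ord0) (dc j ord0)) ->
  is_derive x 1 (fun s => f (c s)) (\sum_j dc j ord0 * partial f j (c x)).
Proof. by move=> fC Kc D; exact: Ck1_curve oU fC (KU Kc) D. Qed.

Lemma entropy_variable_curve j (c : R -> V) (dc : V) (x : R) : K (c x) ->
  (forall j, is_derive x 1 (fun s => c s j ord0) (dc j ord0)) ->
  is_derive x 1 (fun s => partial eta j (c s)) (\sum_k dc k ord0 * hessian eta (c x) k j).
Proof.
move=> Kc D; apply: (is_derive_eq (curve (p1 j) Kc D)).
by apply: eq_bigr => k _; congr (_ * _); exact: esym (hessianE eta (c x) k j).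
Qed.

Lemma kruzkov_curve (c : R -> V) (dc : V) (x : R) : K (c x) ->
  (forall j, is_derive x 1 (fun s => c s j ord0) (dc j ord0)) ->
  is_derive x 1 (fun s => kruzkov (c s))
    (\sum_j (\sum_k dc k ord0 * hessian eta (c x) k j) * g (c x) j ord0).
Proof.
move=> Kc D; apply: (is_derive_eq (curve kruzkov_C1 Kc D)).
rewrite (eq_bigr (fun k => \sum_j (dc k ord0 * hessian eta (c x) k j * g (c x) j ord0))).
  by rewrite exchange_big/=; apply: eq_bigr => j _; rewrite mulr_suml.
move=> k _; rewrite kruzkov_partial ?mulr_sumr; last exact: KU.
by apply: eq_bigr => j _; rewrite mulrA.
Qed.

Lemma Klipschitz (f : V -> R) : Ck 1 U f -> exists2 L : R, 0 < L &
  forall a b, K a -> K b -> `|f b - f a| <= L * enorm (b - a).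
Proof. by move=> fC; exact: lipschitz_on_convex oU fC cK vK KU. Qed.

Lemma Kcontinuous (f : V -> R) k : Ck k U f -> forall y, K y -> {for y, continuous f}.
Proof. by move=> fC y /KU Uy; exact: Ck_continuous fC Uy. Qed.

Lemma hessian_Kcontinuous i j y : K y -> {for y, continuous (fun a => hessian eta a i j)}.
Proof.
move=> Ky; have -> : (fun a => hessian eta a i j) = 'D_(basisv R i) (partial eta j).
  by apply/funext => a; exact: hessianE.
exact: (Kcontinuous (Ck_partial i (Ck_partial j eC)) Ky).
Qed.

Lemma jac_Kcontinuous k j y : K y -> {for y, continuous (jac k j)}.
Proof. by move=> Ky; exact: (Kcontinuous (Ck_partial k (gj j)) Ky). Qed.

End pointwise.

(** * The relative entropy in time *)

Section gronwall.
Context (R : realType).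
Local Notation mu := (@lebesgue_measure R).

Lemma lipschitz_wlog (f : R -> R) (a b C : R) :
  (forall s s', a <= s -> s <= s' -> s' <= b -> `|f s' - f s| <= C * (s' - s)) ->
  forall s s', a <= s <= b -> a <= s' <= b -> `|f s - f s'| <= C * `|s - s'|.
Proof.
move=> H s s' /andP[as_ sb] /andP[as' s'b].
have [ss'|/ltW s's] := leP s s'.
  by rewrite distrC [X in _ <= _ * X]distrC [X in _ <= _ * X]ger0_norm ?subr_ge0// H.
by rewrite [X in _ <= _ * X]ger0_norm ?subr_ge0// H.
Qed.

Lemma lipschitz_mul (f h : R -> R) (a b A B A' B' : R) : 0 <= A -> 0 <= B' ->
  (forall s, a <= s <= b -> `|f s| <= A) -> (forall s, a <= s <= b -> `|h s| <= B) ->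
  (forall s s', a <= s <= b -> a <= s' <= b -> `|f s - f s'| <= A' * `|s - s'|) ->
  (forall s s', a <= s <= b -> a <= s' <= b -> `|h s - h s'| <= B' * `|s - s'|) ->
  forall s s', a <= s <= b -> a <= s' <= b ->
    `|f s * h s - f s' * h s'| <= (A * B' + A' * B) * `|s - s'|.
Proof.
move=> A0 B0 fA hB fL hL s s' sI s'I.
rewrite (_ : f s * h s - _ = f s * (h s - h s') + (f s - f s') * h s'); last by ring.
rewrite [leRHS]mulrDl (le_trans (ler_normD _ _))// lerD//; rewrite normrM.
  by rewrite -mulrA ler_pM// ?fA ?hL.
by rewrite mulrAC ler_pM ?fL ?hB.
Qed.

Let factor_step (F G F0 h e k rho : R) : G * F = 1 -> 0 < F -> F <= F0 -> 0 <= rho ->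
  G * (h + F * k * e) <= rho + k * e -> h <= F0 * rho.
Proof.
move=> GF Fpos FF0 rho0 H; apply: (@le_trans _ _ (F * rho)); last exact: ler_wpM2r.
have := ler_wpM2l (ltW Fpos) H.
by rewrite mulrA (mulrC F) GF mul1r mulrDr mulrA lerD2r.
Qed.

(** The integrating factor [F] turns the hypothesis into a bound on the almost
    everywhere derivative of the Lipschitz function [F * e]. *)
Lemma gronwall (T LE : R) (e k rho : R -> R) : 0 < T -> 0 < LE ->
  (forall s s', 0 <= s <= T -> 0 <= s' <= T -> `|e s - e s'| <= LE * `|s - s'|) ->
  bm k -> continuous k -> (forall s, 0 <= k s) -> bm rho -> (forall s, 0 <= rho s) ->
  {ae mu, forall s, 0 < s < T -> forall d : R, is_derive (s : R) (1 : R) e d ->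
     d <= rho s + k s * e s} ->
  forall t, 0 <= t <= T -> e t <= (e 0 + Int 0 t rho) * expR (Int 0 t k).
Proof.
move=> T0 LE0 LEP bk ck k0 brho rho0 De t /andP[t0 tT].
pose E s := Int (-1) s k.
have EC s s' : -1 <= s -> s <= s' -> E s' = E s + Int s s' k.
  by move=> h1 h2; rewrite /E (Int_chasles bk h1 h2).
have DE (s : R) : -1 < s -> is_derive s 1 E (k s) by move=> h; exact: Int_derive.
have [C C0 CP] : exists2 C : R, 0 <= C & forall s, `|k s| <= C.
  by have [C CP] := bk.2; exists C => //; exact: le_trans (normr_ge0 _) (CP 0).
pose F s := expR (- E s).
have F0 s : 0 < F s by exact: expR_gt0.
have DF (s : R) : -1 < s -> is_derive s 1 F (F s * - k s).
  move=> h; exact: (@is_derive_chain _ expR (fun s => - E s) s _ _ (is_derive_expR (- E s)) (is_derive_opp (DE s h))).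
have F1 s : 0 <= s <= T -> `|F s| <= 1.
  move=> /andP[h _]; rewrite ger0_norm ?(ltW (F0 s))// /F -expR0 ler_expR oppr_le0.
  by apply: Int_ge0 => z _.
have FL : forall s s', 0 <= s <= T -> 0 <= s' <= T -> `|F s - F s'| <= C * `|s - s'|.
  apply: lipschitz_wlog => s s' s0 ss' s'T.
  have DF' z : s <= z <= s' -> is_derive z 1 F (F z * - k z).
    by move=> /andP[sz _]; apply: DF; move: s0 sz; lra.
  have [c /andP[sc cs'] ->] := MVT_cc ss' DF'.
  rewrite normrM (ger0_norm (x := s' - s)) ?subr_ge0// ler_wpM2r ?subr_ge0// normrM normrN.
  by rewrite -[leRHS]mul1r ler_pM// F1// (le_trans s0 sc) (le_trans cs').
have [CE CE0 CEP] : exists2 C : R, 0 <= C & forall s, 0 <= s <= T -> `|e s| <= C.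
  exists (`|e 0| + LE * T) => [|s sT]; first by rewrite addr_ge0// mulr_ge0 ?(ltW LE0) ?(ltW T0).
  have T0' : 0 <= (0 : R) <= T by rewrite lexx ltW.
  rewrite -[e s](subrK (e 0)) addrC (le_trans (ler_normD _ _))// lerD2l.
  rewrite (le_trans (LEP _ _ sT T0'))// subr0 ler_wpM2l ?(ltW LE0)// ger0_norm; by case/andP: sT.
pose f s := F s * e s.
have fL := lipschitz_mul (ler01 : 0 <= (1 : R)) (ltW LE0) F1 CEP FL LEP.
have LC0 : 0 < 1 * LE + C * CE by rewrite mul1r ltr_pwDl// mulr_ge0.
have [h [bh _ hE hD]] := @lipschitz_ftc R 0 T (1 * LE + C * CE) f T0 LC0 fL.
have hle : Int 0 t h <= Int 0 t (fun s => F 0 * rho s).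
  apply: ae_le_Int => //; first by apply: bmM => //; exact: bm_cst.
  apply: (ae_imp (ae_and (ae_and hD De) (ae_and (ae_neq 0) (ae_neq T)))).
  move=> s [[hDs gs] [/eqP s0 /eqP sT]] /andP[ls rs].
  have s0T : 0 < s < T.
    by rewrite lt_neqAle eq_sym s0 ls lt_neqAle sT (le_trans rs).
  have Dh := hDs s0T; have s1 : -1 < s by move: ls; lra.
  pose G s := expR (E s).
  have GF z : G z * F z = 1 by rewrite /G /F -expRD subrr expR0.
  have DG : is_derive (s : R) 1 G (G s * k s).
    exact: (@is_derive_chain _ expR E s _ _ (is_derive_expR (E s)) (DE s s1)).
  have DEt : is_derive (s : R) (1 : R) e (G s * (h s + F s * k s * e s)).
    have := is_derive_mul DG Dh.
    rewrite (_ : (fun x => G x * f x) = e); last first.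
      by apply/funext => z; rewrite /f mulrA GF mul1r.
    move=> D; apply: (is_derive_eq D); rewrite /f; ring.
  have FF0 : F s <= F 0.
    rewrite /F ler_expR lerN2 (EC 0 s) ?(ltW ls) ?lerN10 //.
    by rewrite lerDl; apply: Int_ge0 => z _.
  exact: (factor_step (GF s) (F0 s) FF0 (rho0 s) (gs s0T _ DEt)).
have ft : f t <= f 0 + F 0 * Int 0 t rho.
  by rewrite (hE t) ?t0// lerD2l (le_trans hle)// IntZ.
have Et' : E t = E 0 + Int 0 t k by rewrite (EC 0 t)//; lra.
have F0E : F 0 = F t * expR (Int 0 t k).
  by rewrite /F -expRD Et' opprD addrNK.
rewrite -(ler_pM2l (F0 t)) -/(f t) (le_trans ft)// /f F0E.
by rewrite le_eqVlt; apply/orP; left; apply/eqP; ring.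
Qed.

End gronwall.

Section relative_entropy.
Context (R : realType) (m : nat).
Local Notation V := 'cV[R]_m.
Local Notation mu := (@lebesgue_measure R).
Context (T : R) (T0 : 0 < T) (K : set V) (cK : compact K).
Context (eta q : V -> R) (p g : 'I_m -> V -> R) (H J : 'I_m -> 'I_m -> V -> R).
Context (Cg Clo Chi Lp : R).
Hypotheses (Cg0 : 0 < Cg) (Clo0 : 0 < Clo) (Clohi : Clo < Chi) (Lp0 : 0 < Lp).

Definition cont_at_points (f : V -> R) := forall y, K y -> {for y, continuous f}.

Hypotheses (ceta : cont_at_points eta) (cp : forall j, cont_at_points (p j))
  (cg : forall j, cont_at_points (g j)) (cH : forall k j, cont_at_points (H k j))
  (cJ : forall k j, cont_at_points (J k j)).
Hypothesis pL : forall j a b, K a -> K b -> `|p j b - p j a| <= Lp * enorm (b - a).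
Hypothesis qL : forall a b, K a -> K b -> `|q b - q a| <= Lp * enorm (b - a).

Let rel a b := eta b - eta a - \sum_j (b - a) j ord0 * p j a.

Hypothesis relb : forall a b, K a -> K b ->
  2^-1 * (Clo * enorm (b - a) ^+ 2) <= rel a b <= 2^-1 * (Chi * enorm (b - a) ^+ 2).
Let rel_ge0 a b : K a -> K b -> 0 <= rel a b.
Proof.
move=> Ka Kb; have /andP[+ _] := relb Ka Kb; apply: le_trans.
by rewrite mulr_ge0// mulr_ge0 ?sqr_ge0// ltW.
Qed.

Hypothesis p_curve : forall j (c : R -> V) (dc : V) (x : R), K (c x) ->
  (forall j, is_derive x 1 (fun s => c s j ord0) (dc j ord0)) ->
  is_derive x 1 (fun s => p j (c s)) (\sum_k dc k ord0 * H k j (c x)).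
Hypothesis q_curve : forall (c : R -> V) (dc : V) (x : R), K (c x) ->
  (forall j, is_derive x 1 (fun s => c s j ord0) (dc j ord0)) ->
  is_derive x 1 (fun s => q (c s))
    (\sum_j (\sum_k dc k ord0 * H k j (c x)) * g j (c x)).

Let jv a (v : V) : V := \col_j \sum_k v k ord0 * J k j a.

Hypothesis dissipation : forall a b (vt vy : V), K a -> K b ->
  \sum_j (\sum_k vt k ord0 * H k j a) * (a - b) j ord0
    - \sum_j (g j b - g j a) * (\sum_k vy k ord0 * H k j a)
  <= 2^-1 * enorm (vt + jv a vy) ^+ 2
     + 2^-1 * ((Chi ^+ 2 + Chi * Cg * enorm vy) * enorm (b - a) ^+ 2).

(** The approximate solution [v], with its derivatives [vy] in space and [vt] in
    time, and a bound [N] on its slope. *)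
Context (v vy vt : R -> R -> V) (N : R -> R) (L : R).
Hypotheses (L0 : 0 < L) (Kv : forall s y, K (v s y)).
Hypotheses (bv : forall j, bm (fun z : R * R => v z.1 z.2 j ord0))
  (bvy : forall j, bm (fun z : R * R => vy z.1 z.2 j ord0))
  (bvt : forall j, bm (fun z : R * R => vt z.1 z.2 j ord0)).
Hypothesis vLs : forall s s' y, enorm (v s y - v s' y) <= L * `|s - s'|.
Hypothesis vLy : forall s y y', -1 <= y <= 1 -> -1 <= y' <= 1 ->
  enorm (v s y - v s y') <= L * `|y - y'|.
Hypothesis vyLs : forall s s' y, enorm (vy s y - vy s' y) <= L * `|s - s'|.
Hypotheses (vyN : forall s y, enorm (vy s y) <= N s) (bN : bm N) (cN : continuous N).
Hypothesis vper : forall s, v s (-1) = v s 1.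
Hypothesis dvy : forall s, {ae mu, forall y, -1 < y < 1 ->
  forall j, is_derive (y : R) (1 : R) (fun z : R => v s z j ord0) (vy s y j ord0)}.
Hypothesis dvt : {ae mu, forall s, 0 < s < T -> {ae mu, forall y, -1 <= y <= 1 ->
  forall j, is_derive (s : R) (1 : R) (fun z : R => v z y j ord0) (vt s y j ord0)}}.

(** The entropy solution; [w] is its jointly measurable version. *)
Context (u : R -> R -> V) (w : R * R -> V).
Hypotheses (bu : forall t j, bm (fun y => u t y j ord0)) (Ku : forall t y, K (u t y)).
Hypotheses (bw : forall j, bm (fun z => w z j ord0)) (Kw : forall z, K (w z)).
Hypothesis uw : {ae mu, forall s, 0 <= s <= T -> {ae mu, forall y, -1 <= y <= 1 -> u s y = w (s, y)}}.
Hypothesis cu : forall phi : R -> V, (forall j, bm (fun y => phi y j ord0)) ->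
  cont_on 0 T (fun s => Int (-1) 1 (fun y => dot (u s y) (phi y))).
Hypothesis law : forall t j h c, 0 <= t <= T -> bm h -> Int (-1) 1 h = 0 ->
  Int (-1) 1 (fun y => (u t y j ord0 - u 0 y j ord0) * (c + Int (-1) y h)) =
  Int 0 t (fun s => Int (-1) 1 (fun y => g j (w (s, y)) * h y)).
Hypothesis decrease : {ae mu, forall t, 0 < t < T ->
  Int (-1) 1 (fun y => eta (w (t, y))) <= Int (-1) 1 (fun y => eta (u 0 y))}.

Let m11 : -1 <= 1 :> R. Proof. lra. Qed.
Let m11' : -1 < 1 :> R. Proof. lra. Qed.

Lemma bm_on_K d (X : measurableType d) (f : V -> R) (F : X -> V) : cont_at_points f ->
  (forall j, bm (fun x => F x j ord0)) -> (forall x, K (F x)) -> bm (fun x => f (F x)).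
Proof.
move=> cf bF KF; split.
  apply: measurable_comp_continuous; first by move=> i; case: (bF i).
  by move=> x; exact: cf.
by have [C CP] := compact_bounded_on cK cf; exists C => x; exact: CP.
Qed.

Let slice1 s (f : R -> R -> V) j : bm (fun z : R * R => f z.1 z.2 j ord0) ->
  bm (fun y => f s y j ord0).
Proof. exact: (@bm_slice1 R (fun z => f z.1 z.2 j ord0) s). Qed.

Let psiy s y j := \sum_k vy s y k ord0 * H k j (v s y).
Let psit s y j := \sum_k vt s y k ord0 * H k j (v s y).

Let bpsiy2 j : bm (fun z : R * R => psiy z.1 z.2 j).
Proof.
by apply: bm_sum => k; apply: bmM => //; apply: (@bm_on_K _ _ (H k j) (fun z => v z.1 z.2)).
Qed.

Let bpsiy s j : bm (fun y => psiy s y j).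
Proof. exact: (@bm_slice1 R (fun z => psiy z.1 z.2 j) s). Qed.

Let bpsit s j : bm (fun y => psit s y j).
Proof.
apply: (@bm_slice1 R (fun z => psit z.1 z.2 j) s).
by apply: bm_sum => k; apply: bmM => //; apply: (@bm_on_K _ _ (H k j) (fun z => v z.1 z.2)).
Qed.

Let bvs s j : bm (fun y => v s y j ord0). Proof. exact: slice1. Qed.
Let bonv f s : cont_at_points f -> bm (fun y => f (v s y)).
Proof. by move=> cf; exact: bm_on_K. Qed.
Let bonu f s : cont_at_points f -> bm (fun y => f (u s y)).
Proof. by move=> cf; exact: bm_on_K. Qed.
Let bonw f : cont_at_points f -> bm (fun z => f (w z)).
Proof. by move=> cf; exact: bm_on_K. Qed.
Let bonw1 f s : cont_at_points f -> bm (fun y => f (w (s, y))).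
Proof. by move=> cf; exact: bm_slice1 (bonw cf). Qed.

Let space_chain (f : V -> R) (d : R -> R) s : bm d ->
  (forall a b, K a -> K b -> `|f b - f a| <= Lp * enorm (b - a)) ->
  {ae mu, forall y, -1 < y < 1 -> is_derive (y : R) (1 : R) (fun z : R => f (v s z)) (d y)} ->
  forall y, -1 <= y <= 1 -> f (v s y) = f (v s (-1)) + Int (-1) y d.
Proof.
move=> bd fL D y yI.
have [|x y' xI yI'|h [bh _ hE hD]] := @lipschitz_ftc R (-1) 1 (Lp * L) (fun y => f (v s y)) m11'.
- by rewrite mulr_gt0.
- by rewrite (le_trans (fL _ _ (Kv _ _) (Kv _ _)))// -mulrA ler_wpM2l ?(ltW Lp0)// vLy.
rewrite hE//; congr (_ + _); apply: ae_eq_Int => //.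
apply: (ae_imp (ae_and (ae_and D hD) (ae_and (ae_neq (-1)) (ae_neq 1)))).
move=> z [[Dz hz] [/eqP z1 /eqP z2]] /andP[zl zr].
have zI : -1 < z < 1.
  rewrite lt_neqAle eq_sym z1 zl lt_neqAle z2 (le_trans zr)//; by case/andP: yI.
by have [_ <-] := Dz zI; have [_ <-] := hz zI.
Qed.

Let p_space s j y : -1 <= y <= 1 -> p j (v s y) = p j (v s (-1)) + Int (-1) y (fun y => psiy s y j).
Proof.
apply: space_chain => //; first exact: pL.
by apply: (ae_imp (dvy s)) => z Dz zI; apply: (p_curve j (c := v s) (dc := vy s z)) => //; exact: Dz.
Qed.

Let psiy_mean s j : Int (-1) 1 (fun y => psiy s y j) = 0.
Proof.
have I1 : -1 <= (1 : R) <= 1 by apply/andP; split; lra.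
by have := p_space s j I1; rewrite -vper -[X in X = _]addr0 => /addrI.
Qed.

(** The integrand is the space derivative of the periodic function [q (v s)]. *)
Let flux_mean s : Int (-1) 1 (fun y => \sum_j psiy s y j * g j (v s y)) = 0.
Proof.
have I1 : -1 <= (1 : R) <= 1 by apply/andP; split; lra.
have := @space_chain q (fun y => \sum_j psiy s y j * g j (v s y)) s _ qL _ 1 I1.
rewrite -vper -[X in _ -> _ -> X = _]addr0 => E; apply/esym/(addrI (q (v s (-1)))); apply: E.
  by apply: bm_sum => j; apply: bmM => //; exact: bonv.
by apply: (ae_imp (dvy s)) => z Dz zI; apply: (q_curve (c := v s) (dc := vy s z)) => //; exact: Dz.
Qed.

(** The relative entropy, integrated in space, with the entropy of [u] at time
    [s] replaced by its initial value; it is an upper bound of the relative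
    entropy at almost all times. Unlike the latter it depends on [u s] only
    linearly, hence is Lipschitz in time. *)
Let Et s := Int (-1) 1 (fun y => eta (u 0 y))
  - Int (-1) 1 (fun y => eta (v s y) - \sum_j p j (v s y) * v s y j ord0)
  - Int (-1) 1 (fun y => \sum_j p j (v s y) * u s y j ord0).

Let Bx s' s := Int (-1) 1 (fun y => \sum_j g j (w (s, y)) * psiy s' y j).

Let bBx s' : bm (Bx s').
Proof.
apply: (@bm_Int R (fun z => \sum_j g j (w z) * psiy s' z.2 j)) => //.
apply: bm_sum => j; apply: bmM; first exact: bonw.
exact: (@bm_snd R (fun y => psiy s' y j)).
Qed.

(** The time increment of the relative entropy; the conservation law is used
    with the entropy variables at the later time as test function. *)
Let increment s s' : 0 <= s -> s <= s' -> s' <= T ->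
  Et s' - Et s = Int (-1) 1 (fun y => rel (v s' y) (v s y))
    + Int (-1) 1 (fun y => \sum_j (p j (v s' y) - p j (v s y)) * (v s y j ord0 - u s y j ord0))
    - Int s s' (Bx s').
Proof.
move=> s0 ss' s'T.
have sT : 0 <= s <= T by rewrite s0 (le_trans ss').
have s'T' : 0 <= s' <= T by rewrite s'T (le_trans s0).
have E3 : Int s s' (Bx s') =
    Int (-1) 1 (fun y => \sum_j p j (v s' y) * (u s' y j ord0 - u s y j ord0)).
  have E t : 0 <= t <= T -> Int 0 t (Bx s') =
      Int (-1) 1 (fun y => \sum_j p j (v s' y) * (u t y j ord0 - u 0 y j ord0)).
    move=> tT; have t0 : 0 <= t by case/andP: tT.
    rewrite Int_sum//; last first.
      by move=> j; apply: bmM; [exact: bonv|exact: bmB].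
    rewrite (@eq_Int _ 0 t _ (fun s => \sum_j Int (-1) 1 (fun y => g j (w (s, y)) * psiy s' y j))); last first.
      move=> z _; rewrite /Bx Int_sum// => j; apply: bmM => //; exact: bonw1.
    rewrite Int_sum//; last first.
      move=> j; apply: (@bm_Int R (fun z => g j (w z) * psiy s' z.2 j)) => //.
      by apply: bmM; [exact: bonw|exact: (@bm_snd R (fun y => psiy s' y j))].
    apply: eq_bigr => j _.
    rewrite -(law j (p j (v s' (-1))) tT (bpsiy s' j) (psiy_mean s' j)).
    by apply: eq_Int => y yI; rewrite -p_space// mulrC.
  have := Int_chasles (bBx s') s0 ss'; rewrite !E// => /eqP.
  rewrite addrC -subr_eq => /eqP <-; rewrite -IntB.
  - apply: eq_Int => y _; rewrite -sumrB; apply: eq_bigr => j _; ring.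
  - by apply: bm_sum => j; apply: bmM; [exact: bonv|exact: bmB].
  - by apply: bm_sum => j; apply: bmM; [exact: bonv|exact: bmB].
have bA t : bm (fun y => eta (v t y) - \sum_j p j (v t y) * v t y j ord0).
  apply: bmB; first exact: bonv.
  by apply: bm_sum => j; apply: bmM => //; exact: bonv.
have bB t t' : bm (fun y => \sum_j p j (v t y) * u t' y j ord0).
  by apply: bm_sum => j; apply: bmM => //; exact: bonv.
rewrite E3 /Et.
have brel : bm (fun y => rel (v s' y) (v s y)).
  apply: bmB; first by apply: bmB; exact: bonv.
  apply: bm_sum => j; apply: bmM; last exact: bonv.
  rewrite (_ : (fun x => _) = fun y => v s y j ord0 - v s' y j ord0); first exact: bmB.
  by apply/funext => y; rewrite !mxE.
have bC : bm (fun y => \sum_j (p j (v s' y) - p j (v s y)) * (v s y j ord0 - u s y j ord0)).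
  by apply: bm_sum => j; apply: bmM; [apply: bmB; exact: bonv|exact: bmB].
have bD : bm (fun y => \sum_j p j (v s' y) * (u s' y j ord0 - u s y j ord0)).
  by apply: bm_sum => j; apply: bmM; [exact: bonv|exact: bmB].
pose A t := Int (-1) 1 (fun y => eta (v t y) - \sum_j p j (v t y) * v t y j ord0).
pose B t := Int (-1) 1 (fun y => \sum_j p j (v t y) * u t y j ord0).
transitivity (- A s' + A s - B s' + B s); first by rewrite -/(A s) -/(A s') -/(B s) -/(B s'); ring.
rewrite -IntD// -IntB//; last exact: bmD.
rewrite /A /B -!IntN//.
rewrite -IntD//; last exact: bmN.
rewrite -IntD//; [|by apply: bmD => //; exact: bmN|exact: bmN].
rewrite -IntD//; last by apply: bmD; [apply: bmD => //; exact: bmN|exact: bmN].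
apply: eq_Int => y _; rewrite /rel.
have -> : \sum_j (v s y - v s' y) j ord0 * p j (v s' y) =
    \sum_j p j (v s' y) * v s y j ord0 - \sum_j p j (v s' y) * v s' y j ord0.
  by rewrite -sumrB; apply: eq_bigr => j _; rewrite !mxE; ring.
have -> : \sum_j (p j (v s' y) - p j (v s y)) * (v s y j ord0 - u s y j ord0) =
    \sum_j p j (v s' y) * v s y j ord0 - \sum_j p j (v s' y) * u s y j ord0
    - \sum_j p j (v s y) * v s y j ord0 + \sum_j p j (v s y) * u s y j ord0.
  by rewrite -!sumrB -big_split; apply: eq_bigr => j _ /=; ring.
have -> : \sum_j p j (v s' y) * (u s' y j ord0 - u s y j ord0) =
    \sum_j p j (v s' y) * u s' y j ord0 - \sum_j p j (v s' y) * u s y j ord0.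
  by rewrite -sumrB; apply: eq_bigr => j _; ring.
ring.
Qed.

Let brel s : bm (fun y => rel (v s y) (u s y)).
Proof.
apply: bmB; first by apply: bmB; [exact: bonu|exact: bonv].
apply: bm_sum => j; apply: bmM; last exact: bonv.
rewrite (_ : (fun x => _) = fun y => u s y j ord0 - v s y j ord0); first exact: bmB.
by apply/funext => y; rewrite !mxE.
Qed.

Let Et_relative s : Et s = Int (-1) 1 (fun y => eta (u 0 y))
  - Int (-1) 1 (fun y => eta (u s y)) + Int (-1) 1 (fun y => rel (v s y) (u s y)).
Proof.
have bA : bm (fun y => eta (v s y) - \sum_j p j (v s y) * v s y j ord0).
  apply: bmB; first exact: bonv.
  by apply: bm_sum => j; apply: bmM => //; exact: bonv.
have bB : bm (fun y => \sum_j p j (v s y) * u s y j ord0).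
  by apply: bm_sum => j; apply: bmM => //; exact: bonv.
rewrite /Et -!addrA; congr (_ + _).
rewrite -!IntN//; last exact: bonu.
rewrite -IntD; [|exact: bmN|exact: bmN].
rewrite -IntD//; last by apply: bmN; exact: bonu.
apply: eq_Int => y _; rewrite /rel.
have -> : \sum_j (u s y - v s y) j ord0 * p j (v s y) =
    \sum_j p j (v s y) * u s y j ord0 - \sum_j p j (v s y) * v s y j ord0.
  by rewrite -sumrB; apply: eq_bigr => j _; rewrite !mxE; ring.
ring.
Qed.

Let bsq (f h : R -> V) : (forall j, bm (fun y => f y j ord0)) -> (forall j, bm (fun y => h y j ord0)) ->
  bm (fun y => enorm (f y - h y) ^+ 2).
Proof.
move=> bf bh; rewrite (_ : (fun y => _) = fun y => dot (f y - h y) (f y - h y)).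
  by apply: bm_dot => j; (rewrite (_ : (fun y => _) = fun y => f y j ord0 - h y j ord0);
    [exact: bmB|by apply/funext => y; rewrite !mxE]).
by apply/funext => y; rewrite enorm_sqr.
Qed.

Let bsq1 (f : R -> V) : (forall j, bm (fun y => f y j ord0)) -> bm (fun y => enorm (f y) ^+ 2).
Proof.
move=> bf; rewrite (_ : (fun y => _) = fun y => dot (f y) (f y)); first exact: bm_dot.
by apply/funext => y; rewrite enorm_sqr.
Qed.

Let dist2 s := Int (-1) 1 (fun y => enorm (u s y - v s y) ^+ 2).

Let Et_ge s : {ae mu, forall y, -1 <= y <= 1 -> u s y = w (s, y)} ->
  Int (-1) 1 (fun y => eta (w (s, y))) <= Int (-1) 1 (fun y => eta (u 0 y)) ->
  2^-1 * (Clo * dist2 s) <= Et s.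
Proof.
move=> us dec; rewrite Et_relative.
have E : Int (-1) 1 (fun y => eta (w (s, y))) = Int (-1) 1 (fun y => eta (u s y)).
  apply: ae_eq_Int; [exact: bonw1|exact: bonu|].
  by apply: (ae_imp us) => y E yI; rewrite E.
have h : 2^-1 * (Clo * dist2 s) <= Int (-1) 1 (fun y => rel (v s y) (u s y)).
  have b2 := bsq (bu s) (bvs s).
  rewrite /dist2 mulrA -IntZ//; apply: Int_le => //.
  - by apply: bmM => //; exact: bm_cst.
  - by move=> y _; rewrite -mulrA; have /andP[] := relb (Kv s y) (Ku s y).
move: dec; rewrite E; lra.
Qed.

Let Et0_le : Et 0 <= 2^-1 * (Chi * dist2 0).
Proof.
rewrite Et_relative subrr add0r.
have b2 := bsq (bu 0) (bvs 0).
rewrite /dist2 mulrA -IntZ//; apply: Int_le => //.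
- by apply: bmM => //; exact: bm_cst.
- by move=> y _; rewrite -mulrA; have /andP[] := relb (Kv 0 y) (Ku 0 y).
Qed.

Let fin_bound X (F : 'I_m -> X -> R) : (forall j, exists C : R, forall x, `|F j x| <= C) ->
  exists2 C : R, 0 <= C & forall j x, `|F j x| <= C.
Proof.
move=> h; exists (\sum_j `|sval (cid (h j))|); first exact: sumr_ge0.
move=> j x; rewrite (bigD1 j)//=.
have h1 := svalP (cid (h j)) x.
by rewrite (le_trans h1)// (le_trans (ler_norm _))// lerDl sumr_ge0.
Qed.

Let Et_lipschitz : exists2 LE : R, 0 < LE & forall s s', 0 <= s <= T -> 0 <= s' <= T ->
  `|Et s - Et s'| <= LE * `|s - s'|.
Proof.
have [CK CKP] := compact_coord_bound cK.
have CK0 : 0 <= CK by exact: le_trans (enorm_ge0 _) (CKP _ (Kv 0 0)).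
have [Cy Cy0 CyP] : exists2 C : R, 0 <= C & forall j (z : R * R), `|psiy z.1 z.2 j| <= C.
  by apply: fin_bound => j; case: (bpsiy2 j).
have [Cw Cw0 CwP] : exists2 C : R, 0 <= C & forall j (z : R * R), `|g j (w z)| <= C.
  by apply: fin_bound => j; have [_] := bonw (cg (j := j)).
pose C1 := 2^-1 * (Chi * (L ^+ 2 * T)) * (1 - -1).
pose C2 := (\sum_(j < m) Lp * L * (2 * CK)) * (1 - -1).
pose C3 := (\sum_(j < m) Cw * Cy) * (1 - -1).
have Chi0 : 0 < Chi by exact: lt_trans Clohi.
have n11 : (0 : R) <= 1 - -1 by lra.
have C10 : 0 <= C1.
  by rewrite mulr_ge0// mulr_ge0// mulr_ge0 ?(ltW Chi0)// mulr_ge0 ?sqr_ge0// ltW.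
have C20 : 0 <= C2.
  by rewrite mulr_ge0//; apply: sumr_ge0 => j _; rewrite mulr_ge0 ?mulr_ge0// ltW.
have C30 : 0 <= C3.
  by rewrite mulr_ge0//; apply: sumr_ge0 => j _; rewrite mulr_ge0.
exists (C1 + C2 + C3 + 1); first by rewrite ltr_pwDr// !addr_ge0.
move=> s s'; wlog ss' : s s' / s <= s'.
  move=> h h1 h2; have [/h|/ltW /h] := leP s s'; first exact.
  by rewrite distrC (distrC s); exact.
move=> /andP[s0 _] /andP[_ s'T].
rewrite distrC (distrC s) increment// (ger0_norm (x := s' - s)) ?subr_ge0//.
have d0 : 0 <= s' - s by rewrite subr_ge0.
have dT : s' - s <= T by lra.
have vd y : enorm (v s' y - v s y) <= L * (s' - s).
  by rewrite (le_trans (vLs _ _ _))// ger0_norm.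
have h1 : `|Int (-1) 1 (fun y => rel (v s' y) (v s y))| <= C1 * (s' - s).
  rewrite /C1 mulrAC; apply: Int_bound => //.
    apply: bmB; first by apply: bmB; exact: bonv.
    apply: bm_sum => j; apply: bmM; last exact: bonv.
    rewrite (_ : (fun x => _) = fun y => v s y j ord0 - v s' y j ord0); first exact: bmB.
    by apply/funext => y; rewrite !mxE.
  move=> y _; have /andP[r1 r2] := relb (Kv s' y) (Kv s y).
  rewrite ger0_norm ?rel_ge0//.
  rewrite (le_trans r2)// -!mulrA ler_wpM2l// ler_wpM2l ?(ltW Chi0)//.
  have e1 : enorm (v s y - v s' y) <= L * (s' - s) by rewrite -enormN opprB.
  rewrite (@le_trans _ _ ((L * (s' - s)) ^+ 2))//.
    by rewrite lerXn2r ?nnegrE ?enorm_ge0// mulr_ge0// ltW.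
  have -> : (L * (s' - s)) ^+ 2 = L * (L * ((s' - s) * (s' - s))) by ring.
  by rewrite ler_wpM2l ?(ltW L0)// ler_wpM2l ?(ltW L0)// ler_wpM2r.
have h2 : `|Int (-1) 1 (fun y => \sum_j (p j (v s' y) - p j (v s y)) * (v s y j ord0 - u s y j ord0))|
    <= C2 * (s' - s).
  rewrite /C2 mulrAC; apply: Int_bound => //.
    by apply: bm_sum => j; apply: bmM; [apply: bmB; exact: bonv|exact: bmB].
  move=> y _; rewrite mulr_suml (le_trans (ler_norm_sum _ _ _))//; apply: ler_sum => j _.
  rewrite normrM mulrAC ler_pM//.
    by rewrite (le_trans (pL _ (Kv _ _) (Kv _ _)))// -mulrA ler_wpM2l// ltW.
  rewrite (le_trans (ler_normB _ _))// mulr_natl mulr2n lerD//;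
    by rewrite (le_trans (coord_le_enorm _ _))// CKP.
have h3 : `|Int s s' (Bx s')| <= C3 * (s' - s).
  apply: Int_bound => // z _; apply: Int_bound => //.
    by apply: bm_sum => j; apply: bmM; [exact: bonw1|exact: bpsiy].
  move=> y _; rewrite (le_trans (ler_norm_sum _ _ _))//; apply: ler_sum => j _.
  have c1 := CwP j (z, y); have c2 := CyP j (s', y).
  by rewrite normrM ler_pM.
rewrite (le_trans (ler_normB _ _))// mulrDl mul1r.
rewrite (@le_trans _ _ (C1 * (s' - s) + C2 * (s' - s) + C3 * (s' - s)))//.
  by rewrite lerD// (le_trans (ler_normD _ _))// lerD.
by rewrite !mulrDl lerDl.
Qed.

Let K_unif (f : V -> R) (e : R) : cont_at_points f -> 0 < e ->
  \forall d \near 0^'+, forall a b, K a -> K b -> enorm (a - b) < d -> `|f a - f b| <= e.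
Proof.
move=> cf e0; have /compact_near_coveringP cov := cK.
have e2 : 0 < e / 2 by rewrite divr_gt0.
have := cov R 0^'+ (fun d a => forall b, K b -> enorm (a - b) < d -> K a -> `|f a - f b| <= e) _.
move=> /(_ _) h; have {}h : \forall d \near 0^'+, K `<=` (fun a => forall b, K b -> enorm (a - b) < d -> K a -> `|f a - f b| <= e).
  apply: h => x Kx.
  have /cvgrPdist_le/(_ _ e2)/nbhs_ballP[r /= r0 br] := cf x Kx.
  have r2 : 0 < r / 2 by rewrite divr_gt0.
  exists (ball x (r / 2), [set d : R | d < r / 2]) => /=.
    split; first exact: nbhsx_ballx.
    exact: nbhs_right_lt.
  move=> [a d] /= [xa dr] b Kb ab Ka.
  have xa' : ball x r a by apply: le_ball xa; rewrite ler_pdivrMr// ler_peMr ?ltW//; lra.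
  have xb : ball x r b.
    rewrite -ball_normE/= (_ : x - b = (x - a) + (a - b)); last by rewrite subrKA.
    rewrite (le_lt_trans (ler_normD _ _))// (splitr r) ltrD//.
      by move: xa; rewrite -ball_normE.
    exact: le_lt_trans (norm_le_enorm _) (lt_trans ab dr).
  rewrite (_ : f a - f b = (f x - f b) - (f x - f a)); last by ring.
  by rewrite (le_trans (ler_normB _ _))// (splitr e) lerD//; apply: br.
by apply: filterS h => d hd; move=> a b aK bK ab; exact: (hd a aK b bK ab aK).
Qed.

(** On [K] the Hessian of the entropy is uniformly continuous; the slope of [v]
    and [v] itself are Lipschitz in time. This is what allows the test function
    of [increment], taken at the later time, to be replaced by the one at the
    earlier time in the limit. *)
Let psiy_unif (e : R) : 0 < e -> exists2 d : R, 0 < d & forall s s' y j,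
  `|s - s'| < d -> `|psiy s y j - psiy s' y j| <= e.
Proof.
move=> e0.
have [CH CH0 CHP] : exists2 C : R, 0 <= C & forall k (a : 'I_m * (R * R)),
    `|H k a.1 (v a.2.1 a.2.2)| <= C.
  apply: fin_bound => k.
  have [C C0 CP] : exists2 C : R, 0 <= C & forall j (z : R * R), `|H k j (v z.1 z.2)| <= C.
    by apply: fin_bound => j; have [C CP] := compact_bounded_on cK (cH (k := k) (j := j)); exists C => z; exact: CP.
  by exists C => a; exact: CP.
have [Cv Cv0 CvP] : exists2 C : R, 0 <= C & forall k (z : R * R), `|vy z.1 z.2 k ord0| <= C.
  by apply: fin_bound => k; have [_] := bvy k.
pose e1 := e / (2 * (m.+1%:R * (Cv + 1))).
have m0 : 0 < m.+1%:R :> R by rewrite ltr0n.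
have Cv1 : 0 < Cv + 1 by rewrite ltr_pwDr.
have e10 : 0 < e1 by rewrite divr_gt0// !mulr_gt0.
have : \forall d \near 0^'+, forall k, forall j, forall a b, K a -> K b -> enorm (a - b) < d ->
    `|H k j a - H k j b| <= e1.
  apply: (@filter_forall _ 'I_m (fun k d => forall j, forall a b, K a -> K b -> enorm (a - b) < d ->
    `|H k j a - H k j b| <= e1) (0^'+) _) => k.
  apply: (@filter_forall _ 'I_m (fun j d => forall a b, K a -> K b -> enorm (a - b) < d ->
    `|H k j a - H k j b| <= e1) (0^'+) _) => j.
  exact: K_unif.
move=> Hd.
have [d d0 dH] : exists2 d : R, 0 < d & forall k j a b, K a -> K b -> enorm (a - b) < d ->
    `|H k j a - H k j b| <= e1.
  have [d [d0 dH]] := @filter_ex _ (0^'+ : set_system R) _ _ (filterI (nbhs_right_gt (0 : R)) Hd).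
  by exists d => // k j; exact: dH.
pose d2 := e / (2 * (m.+1%:R * (L * (CH + 1)))).
have CH1 : 0 < CH + 1 by rewrite ltr_pwDr.
have d20 : 0 < d2 by rewrite divr_gt0// !mulr_gt0.
exists (Num.min (d / L) d2); first by rewrite lt_min d20 divr_gt0.
move=> s s' y j; rewrite lt_min => /andP[sd sd2].
rewrite /psiy -sumrB.
have bnd k : `|vy s y k ord0 * H k j (v s y) - vy s' y k ord0 * H k j (v s' y)| <=
    e / m.+1%:R.
  rewrite (_ : _ - _ = (vy s y k ord0 - vy s' y k ord0) * H k j (v s y) +
    vy s' y k ord0 * (H k j (v s y) - H k j (v s' y))); last by ring.
  rewrite (le_trans (ler_normD _ _))// !normrM.
  have h1 : `|vy s y k ord0 - vy s' y k ord0| <= L * `|s - s'|.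
    have := le_trans (coord_le_enorm (vy s y - vy s' y) k) (vyLs s s' y).
    by rewrite !mxE.
  have h2 : `|H k j (v s y) - H k j (v s' y)| <= e1.
    apply: dH => //; apply: le_lt_trans (vLs s s' y) _.
    by rewrite mulrC -ltr_pdivlMr.
  have h3 : `|vy s y k ord0 - vy s' y k ord0| * `|H k j (v s y)| <= (L * d2) * (CH + 1).
    rewrite ler_pM//; first by rewrite (le_trans h1)// ler_pM2l// ltW.
    by rewrite (le_trans (CHP k (j, (s, y))))// lerDl.
  have h4 : `|vy s' y k ord0| * `|H k j (v s y) - H k j (v s' y)| <= (Cv + 1) * e1.
    by rewrite ler_pM// (le_trans (CvP k (s', y)))// lerDl.
  rewrite (le_trans (lerD h3 h4))// le_eqVlt; apply/orP; left; apply/eqP.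
  by rewrite /d2 /e1; field; rewrite !gt_eqF.
rewrite (le_trans (ler_norm_sum _ _ _))//.
apply: (@le_trans _ _ (\sum_(k < m) e / m.+1%:R)); first by apply: ler_sum => k _; exact: bnd.
rewrite sumr_const card_ord -[X in X <= _]mulr_natr -mulrA ler_piMr ?(ltW e0)//.
by rewrite mulrC ler_pdivrMr// mul1r ler_nat.
Qed.

Let B0 s := Bx s s.

Let bB0 : bm B0.
Proof.
apply: (@bm_Int R (fun z => \sum_j g j (w z) * psiy z.1 z.2 j)) => //.
by apply: bm_sum => j; apply: bmM; [exact: bonw|exact: bpsiy2].
Qed.

Let rho s := Int (-1) 1 (fun y => enorm (vt s y + jv (v s y) (vy s y)) ^+ 2).
Let kap s := Chi ^+ 2 + Chi * Cg * N s.

Let near_T s : s < T -> \forall n \near \oo, s + n.+1%:R^-1 < T.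
Proof.
move=> sT; have e0 : 0 < T - s by rewrite subr_gt0.
near=> n; rewrite -ltrBrDl; near: n; exact: (near_infty_natSinv_lt (PosNum e0)).
Unshelve. all: by end_near. Qed.

Let lim_flux s : 0 < s < T -> lebesgue_pt B0 s ->
  n.+1%:R * Int s (s + n.+1%:R^-1) (Bx (s + n.+1%:R^-1)) @[n --> \oo] --> B0 s.
Proof.
move=> /andP[s0 sT] Ls.
have [Cw Cw0 CwP] : exists2 C : R, 0 <= C & forall j (z : R * R), `|g j (w z)| <= C.
  by apply: fin_bound => j; have [_] := bonw (cg (j := j)).
have n0 n : 0 < n.+1%:R :> R by rewrite ltr0n.
have ni n : 0 < n.+1%:R^-1 :> R by rewrite invr_gt0.
have ss n : s <= s + n.+1%:R^-1 by rewrite lerDl ltW.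
have lim1 : n.+1%:R * Int s (s + n.+1%:R^-1) B0 @[n --> \oo] --> B0 s.
  have := @lebesgue_pt_cvg R B0 s 1 (fun n _ => n.+1%:R) Ls bB0 (fun n => bm_cst _ _).
  rewrite (_ : (fun n => Int s (s + n.+1%:R^-1) (fun s => n.+1%:R * B0 s)) =
    (fun n => n.+1%:R * Int s (s + n.+1%:R^-1) B0)); last first.
    by apply/funext => n; rewrite IntZ.
  apply=> [n z|n]; first by rewrite mul1r lexx ltW.
  by rewrite Int_cst// addrC addKr divff// gt_eqF.
rewrite -[B0 s]addr0.
rewrite (_ : (fun n => _) = (fun n => n.+1%:R * Int s (s + n.+1%:R^-1) B0 +
    n.+1%:R * Int s (s + n.+1%:R^-1) (fun z => Bx (s + n.+1%:R^-1) z - B0 z))); last first.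
  by apply/funext => n; rewrite IntB// mulrBr [RHS]addrC subrK.
apply: cvgD => //; apply/cvgrPdist_le => e e0.
pose e1 := e / (2 * (m.+1%:R * (Cw + 1))).
have m0 : 0 < m.+1%:R :> R by rewrite ltr0n.
have Cw1 : 0 < Cw + 1 by rewrite ltr_pwDr.
have e10 : 0 < e1 by rewrite divr_gt0// !mulr_gt0.
have [d d0 dP] := psiy_unif e10.
near=> n; rewrite sub0r normrN normrM (ger0_norm (ltW (n0 n))).
rewrite -ler_pdivlMl// mulrC.
have nd : n.+1%:R^-1 < d by near: n; exact: (near_infty_natSinv_lt (PosNum d0)).
rewrite -[X in e * X](addKr s) (addrC (- s)).
apply: Int_bound => //; first exact: bmB.
move=> z /andP[sz zs].
have zd : `|s + n.+1%:R^-1 - z| < d.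
  rewrite ger0_norm ?subr_ge0//; apply: le_lt_trans nd; by rewrite lerBlDr [leRHS]addrC lerD2r.
have b1 s' : bm (fun y => \sum_j g j (w (z, y)) * psiy s' y j).
  by apply: bm_sum => j; apply: bmM; [exact: bonw1|exact: bpsiy].
rewrite /B0 /Bx -IntB//.
have -> : e = (\sum_(j < m.+1) Cw * 0 + (e / 2)) * (1 - -1).
  by rewrite mulr0 sumr_const mul0rn add0r; field.
apply: Int_bound => //; first exact: bmB.
move=> y _; rewrite mulr0 sumr_const mul0rn add0r -sumrB.
rewrite (le_trans (ler_norm_sum _ _ _))//.
apply: (@le_trans _ _ (\sum_(j < m) (Cw + 1) * e1)).
  apply: ler_sum => j _; rewrite -mulrBr normrM ler_pM//.
    by rewrite (le_trans (CwP j (z, y)))// lerDl.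
  exact: dP.
rewrite sumr_const card_ord -[X in X <= _]mulr_natr.
have -> : (Cw + 1) * e1 = (e / 2) / m.+1%:R.
  by rewrite /e1; field; rewrite !gt_eqF.
by rewrite mulrAC ler_pdivrMr// ler_wpM2l ?ler_nat// divr_ge0// ltW.
Unshelve. all: by end_near. Qed.

Let dissipation_at s : {ae mu, forall y, -1 <= y <= 1 -> u s y = w (s, y)} ->
  Int (-1) 1 (fun y => \sum_j psit s y j * (v s y j ord0 - u s y j ord0)) - B0 s
  <= 2^-1 * rho s + 2^-1 * (kap s * dist2 s).
Proof.
move=> us.
have bjv j : bm (fun y => (vt s y + jv (v s y) (vy s y)) j ord0).
  rewrite (_ : (fun y => _) = fun y => vt s y j ord0 + \sum_k vy s y k ord0 * J k j (v s y)).
    apply: bmD; first exact: slice1.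
    by apply: bm_sum => k; apply: bmM; [exact: slice1|exact: bonv].
  by apply/funext => y; rewrite !mxE.
have b1 : bm (fun y => \sum_j psit s y j * (v s y j ord0 - u s y j ord0)).
  by apply: bm_sum => j; apply: bmM => //; exact: bmB.
have b2 : bm (fun y => \sum_j g j (u s y) * psiy s y j).
  by apply: bm_sum => j; apply: bmM; [exact: bonu|exact: bpsiy].
have b3 : bm (fun y => \sum_j psiy s y j * g j (v s y)).
  by apply: bm_sum => j; apply: bmM; [exact: bpsiy|exact: bonv].
have b4 := bsq (bu s) (bvs s).
have b5 := bsq1 bjv.
have -> : B0 s = Int (-1) 1 (fun y => \sum_j g j (u s y) * psiy s y j).
  apply: ae_eq_Int => //.
    by apply: bm_sum => j; apply: bmM; [exact: bonw1|exact: bpsiy].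
  by apply: (ae_imp us) => y E yI; apply: eq_bigr => j _; rewrite E.
rewrite -[X in X <= _]addr0 -[X in _ + X <= _](flux_mean s).
rewrite -IntB// -IntD//; last exact: bmB.
rewrite /rho /dist2 mulrA -!IntZ// -IntD; [|by apply: bmM => //; exact: bm_cst|by apply: bmM => //; exact: bm_cst].
apply: Int_le.
- by apply: bmD => //; exact: bmB.
- by apply: bmD; apply: bmM => //; exact: bm_cst.
move=> y _; have := dissipation (vt s y) (vy s y) (Kv s y) (Ku s y).
have -> : \sum_j (g j (u s y) - g j (v s y)) * (\sum_k vy s y k ord0 * H k j (v s y)) =
    \sum_j g j (u s y) * psiy s y j - \sum_j psiy s y j * g j (v s y).
  by rewrite -sumrB; apply: eq_bigr => j _; rewrite /psiy; ring.
have -> : \sum_j (\sum_k vt s y k ord0 * H k j (v s y)) * (v s y - u s y) j ord0 =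
    \sum_j psit s y j * (v s y j ord0 - u s y j ord0).
  by apply: eq_bigr => j _; rewrite !mxE.
have h : 2^-1 * ((Chi ^+ 2 + Chi * Cg * enorm (vy s y)) * enorm (u s y - v s y) ^+ 2) <=
    2^-1 * kap s * enorm (u s y - v s y) ^+ 2.
  rewrite -[leRHS]mulrA ler_wpM2l// ler_wpM2r ?sqr_ge0// lerD2l ler_wpM2l//.
  by rewrite mulr_ge0// ltW//; exact: lt_trans Clohi.
lra.
Qed.

Let cvg_sumr (r : seq 'I_m) (F : 'I_m -> nat -> R) (l : 'I_m -> R) :
  (forall j, F j n @[n --> \oo] --> l j) ->
  \sum_(j <- r) F j n @[n --> \oo] --> \sum_(j <- r) l j.
Proof.
move=> Fl; elim: r => [|j r IH].
  rewrite big_nil (_ : (fun n => _) = fun=> 0); first exact: cvg_cst.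
  by apply/funext => n; rewrite big_nil.
rewrite big_cons (_ : (fun n => _) = fun n => F j n + \sum_(j <- r) F j n).
  exact: cvgD.
by apply/funext => n; rewrite big_cons.
Qed.

Let lim_entropy_variables s : 0 < s < T ->
  {ae mu, forall y, -1 <= y <= 1 -> forall j, is_derive (s : R) (1 : R) (fun z : R => v z y j ord0) (vt s y j ord0)} ->
  Int (-1) 1 (fun y => \sum_j ((p j (v (s + n.+1%:R^-1) y) - p j (v s y)) * n.+1%:R)
    * (v s y j ord0 - u s y j ord0)) @[n --> \oo] -->
  Int (-1) 1 (fun y => \sum_j psit s y j * (v s y j ord0 - u s y j ord0)).
Proof.
move=> s0T Ds; have [CK CKP] := compact_coord_bound cK.
have CK0 : 0 <= CK by exact: le_trans (enorm_ge0 _) (CKP _ (Kv 0 0)).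
have n0 n : 0 < n.+1%:R :> R by rewrite ltr0n.
apply: (@Int_dct _ _ _ (\sum_(j < m) Lp * L * (2 * CK))).
- by apply: bm_sum => j; apply: bmM => //; exact: bmB.
- move=> n; apply: bm_sum => j; apply: bmM; last exact: bmB.
  by apply: bmM; [apply: bmB; exact: bonv|exact: bm_cst].
- move=> n y _; rewrite (le_trans (ler_norm_sum _ _ _))//; apply: ler_sum => j _.
  rewrite normrM ler_pM//.
    rewrite normrM (ger0_norm (ltW (n0 n))) -ler_pdivlMr//.
    rewrite (le_trans (pL _ (Kv _ _) (Kv _ _)))// -mulrA ler_wpM2l ?(ltW Lp0)//.
    rewrite (le_trans (vLs _ _ _))// addrC addKr ger0_norm// invr_ge0 ltW//.
  rewrite (le_trans (ler_normB _ _))// mulr_natl mulr2n lerD//;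
    by rewrite (le_trans (coord_le_enorm _ _))// CKP.
- apply: (ae_imp Ds) => y Dy yI; apply: cvg_sumr => j.
  apply: cvgMr_tmp.
  exact: is_derive_cvg_seq (p_curve j (c := fun z => v z y) (dc := vt s y) (Kv s y) (Dy yI)).
Qed.

Let lim_relative s : 0 < s < T ->
  n.+1%:R * Int (-1) 1 (fun y => rel (v (s + n.+1%:R^-1) y) (v s y)) @[n --> \oo] --> (0 : R).
Proof.
move=> s0T; have Chi0 : 0 < Chi by exact: lt_trans Clohi.
have n0 n : 0 < n.+1%:R :> R by rewrite ltr0n.
pose C1 := 2^-1 * (Chi * L ^+ 2).
have bnd n : 0 <= Int (-1) 1 (fun y => rel (v (s + n.+1%:R^-1) y) (v s y)) <=
    C1 * (1 - -1) * (n.+1%:R^-1 * n.+1%:R^-1).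
  apply/andP; split.
    by apply: Int_ge0 => y _; exact: rel_ge0.
  rewrite (le_trans (ler_norm _))// mulrAC; apply: Int_bound => //.
    apply: bmB; first by apply: bmB; exact: bonv.
    apply: bm_sum => j; apply: bmM; last exact: bonv.
    rewrite (_ : (fun x => _) = fun y => v s y j ord0 - v (s + n.+1%:R^-1) y j ord0); first exact: bmB.
    by apply/funext => y; rewrite !mxE.
  move=> y _; have /andP[r1 r2] := relb (Kv (s + n.+1%:R^-1) y) (Kv s y).
  rewrite ger0_norm ?rel_ge0//.
  rewrite (le_trans r2)// /C1 -!mulrA ler_wpM2l// ler_wpM2l ?(ltW Chi0)//.
  have e1 : enorm (v s y - v (s + n.+1%:R^-1) y) <= L * n.+1%:R^-1.
    by rewrite (le_trans (vLs _ _ _))// distrC addrC addKr ger0_norm// invr_ge0 ltW.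
  rewrite (@le_trans _ _ ((L * n.+1%:R^-1) ^+ 2))//.
    by rewrite lerXn2r ?nnegrE ?enorm_ge0// mulr_ge0 ?invr_ge0// ltW.
  by rewrite expr2 -mulrA ler_wpM2l ?(ltW L0)// mulrCA.
have C10 : 0 <= C1 * (1 - -1).
  have n11 : (0 : R) <= 1 - -1 by lra.
  rewrite mulr_ge0//.
  by rewrite !mulr_ge0 ?sqr_ge0// ltW.
have lim0 : (0 : R) @[n --> \oo] --> (0 : R) by exact: cvg_cst.
have limh : C1 * (1 - -1) * n.+1%:R^-1 @[n --> \oo] --> (0 : R).
  rewrite -[X in _ --> X](mulr0 (C1 * (1 - -1))); apply: cvgM; first exact: cvg_cst.
  exact: cvg_harmonic.
apply: (squeeze_cvgr _ lim0 limh); near=> n.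
have /andP[h1 h2] := bnd n; rewrite mulr_ge0 ?(ltW (n0 n))//=.
by rewrite mulrC -ler_pdivlMr// (le_trans h2)// mulrA.
Unshelve. all: by end_near. Qed.

(** Divide [increment] by the time step: the relative term is quadratic in the
    step, the entropy variables converge to their time derivatives by dominated
    convergence, and the flux term converges at Lebesgue points of [B0]. *)
Let Et_derive s d : 0 < s < T -> is_derive s 1 Et d -> lebesgue_pt B0 s ->
  {ae mu, forall y, -1 <= y <= 1 -> forall j, is_derive (s : R) (1 : R) (fun z : R => v z y j ord0) (vt s y j ord0)} ->
  {ae mu, forall y, -1 <= y <= 1 -> u s y = w (s, y)} ->
  Int (-1) 1 (fun y => eta (w (s, y))) <= Int (-1) 1 (fun y => eta (u 0 y)) ->
  d <= 2^-1 * rho s + kap s / Clo * Et s.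
Proof.
move=> s0T dE Ls Ds us dec; have /andP[s0 sT] := s0T.
have lim : (n.+1%:R * Int (-1) 1 (fun y => rel (v (s + n.+1%:R^-1) y) (v s y))
    + Int (-1) 1 (fun y => \sum_j ((p j (v (s + n.+1%:R^-1) y) - p j (v s y)) * n.+1%:R)
    * (v s y j ord0 - u s y j ord0))
    - n.+1%:R * Int s (s + n.+1%:R^-1) (Bx (s + n.+1%:R^-1))) @[n --> \oo] -->
  0 + Int (-1) 1 (fun y => \sum_j psit s y j * (v s y j ord0 - u s y j ord0)) - B0 s.
  apply: cvgB; last exact: lim_flux.
  by apply: cvgD; [exact: lim_relative|exact: lim_entropy_variables].
have dlim := is_derive_cvg_seq dE.
have -> : d = 0 + Int (-1) 1 (fun y => \sum_j psit s y j * (v s y j ord0 - u s y j ord0)) - B0 s.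
  apply: (cvg_unique _ dlim); first exact: norm_hausdorff.
  apply: cvg_trans lim; apply: near_eq_cvg; near=> n.
  have snT : s + n.+1%:R^-1 < T by near: n; exact: near_T.
  have n0 : 0 < n.+1%:R^-1 :> R by rewrite invr_gt0 ltr0n.
  rewrite increment ?(ltW s0) ?(ltW snT) ?lerDl ?(ltW n0)//.
  rewrite mulrBl mulrDl !(mulrC _ n.+1%:R); congr (_ + _ - _).
  rewrite -IntZ; last by apply: bm_sum => j; apply: bmM; [apply: bmB; exact: bonv|exact: bmB].
  apply: eq_Int => y _; rewrite mulr_sumr; apply: eq_bigr => j _; ring.
rewrite add0r (le_trans (dissipation_at us))// lerD2l.
have h := Et_ge us dec.
have kap0 : 0 <= kap s.
  rewrite addr_ge0 ?sqr_ge0// mulr_ge0 ?mulr_ge0 ?(ltW Cg0)//.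
    by rewrite ltW//; exact: lt_trans Clohi.
  exact: le_trans (enorm_ge0 _) (vyN s 0).
rewrite -mulrA mulrCA ler_wpM2l//.
by rewrite ler_pdivlMl// mulrCA.
Unshelve. all: by end_near. Qed.

Let bkap : bm kap.
Proof. by apply: bmD; [exact: bm_cst|apply: bmM => //; exact: bm_cst]. Qed.

Let kap_continuous : continuous kap.
Proof.
move=> s; apply: cvgD; first exact: cvg_cst.
by apply: cvgM; [exact: cvg_cst|exact: cN].
Qed.

Let kap_ge0 s : 0 <= kap s.
Proof.
rewrite addr_ge0 ?sqr_ge0// mulr_ge0 ?mulr_ge0 ?(ltW Cg0)//.
  by rewrite ltW//; exact: lt_trans Clohi.
exact: le_trans (enorm_ge0 _) (vyN s 0).
Qed.

Let rho_ge0 s : 0 <= rho s.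
Proof. by apply: Int_ge0 => y _; exact: sqr_ge0. Qed.

Let brho : bm rho.
Proof.
have bj j : bm (fun z : R * R => (vt z.1 z.2 + jv (v z.1 z.2) (vy z.1 z.2)) j ord0).
  rewrite (_ : (fun z => _) = fun z : R * R => vt z.1 z.2 j ord0 +
     \sum_k vy z.1 z.2 k ord0 * J k j (v z.1 z.2)).
    apply: bmD => //; apply: bm_sum => k; apply: bmM => //.
    exact: (@bm_on_K _ _ (J k j) (fun z => v z.1 z.2)).
  by apply/funext => z; rewrite !mxE.
apply: (@bm_Int R (fun z => enorm (vt z.1 z.2 + jv (v z.1 z.2) (vy z.1 z.2)) ^+ 2)) => //.
rewrite (_ : (fun z => _) = fun z : R * R => \sum_j
    (vt z.1 z.2 + jv (v z.1 z.2) (vy z.1 z.2)) j ord0 *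
    (vt z.1 z.2 + jv (v z.1 z.2) (vy z.1 z.2)) j ord0).
  by apply: bm_sum => j; apply: bmM.
by apply/funext => z; rewrite enorm_sqr.
Qed.

Let good_times : {ae mu, forall s, 0 < s < T -> [/\ lebesgue_pt B0 s,
  {ae mu, forall y, -1 <= y <= 1 -> forall j, is_derive (s : R) (1 : R) (fun z : R => v z y j ord0) (vt s y j ord0)},
  {ae mu, forall y, -1 <= y <= 1 -> u s y = w (s, y)} &
  Int (-1) 1 (fun y => eta (w (s, y))) <= Int (-1) 1 (fun y => eta (u 0 y))]}.
Proof.
apply: (ae_imp (ae_and (ae_and (bm_lebesgue_pt bB0) dvt) (ae_and uw decrease))).
move=> s [[h1 h2] [h3 h4]] sT; split => //; [exact: h2|apply: h3|exact: h4].
by case/andP: sT => s0 sT; rewrite !ltW.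
Qed.

Let Et_gronwall t : 0 <= t <= T ->
  Et t <= (Et 0 + 2^-1 * Int 0 t rho) * expR (Int 0 t (fun s => kap s / Clo)).
Proof.
move=> tT; have [LE LE0 LEP] := Et_lipschitz.
rewrite -IntZ//; apply: (gronwall T0 LE0 LEP) => //.
- by apply: bmM => //; exact: bm_cst.
- by move=> s; apply: cvgM; [exact: kap_continuous|exact: cvg_cst].
- by move=> s; rewrite divr_ge0 ?(ltW Clo0).
- by apply: bmM => //; exact: bm_cst.
- by move=> s; rewrite mulr_ge0.
apply: (ae_imp good_times) => s gs sT d Dd.
by have [g1 g2 g3 g4] := gs sT; exact: Et_derive.
Qed.

Let two_dot_le (a b : V) : 2 * dot a b <= enorm a ^+ 2 + enorm b ^+ 2.
Proof.
have := dot_ge0 (a - b).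
rewrite dotBl !dotBr (dotC b a) !enorm_sqr; lra.
Qed.

Let dist_arith (c X Ds Dt e : R) : 0 < c -> 2^-1 * (c * Ds) <= e ->
  2 * X <= Ds + Dt -> 0 <= e - (c * X - 2^-1 * (c * Dt)).
Proof.
move=> c0 h1 h2; have : c * (2 * X) <= c * (Ds + Dt) by rewrite ler_wpM2l// ltW.
by rewrite mulrDr mulrCA; lra.
Qed.

(** The bound holds at almost all times. It passes to all times through the
    lower bound of the squared distance at [s] by its linearization at [t],
    which is continuous in [s] by weak-* continuity. *)
Let dist2_le t : 0 <= t <= T -> 2^-1 * (Clo * dist2 t) <= Et t.
Proof.
move=> tT; pose phi y := u t y - v t y.
have bphi j : bm (fun y => phi y j ord0).
  rewrite (_ : (fun y => _) = fun y => u t y j ord0 - v t y j ord0); first exact: bmB.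
  by apply/funext => y; rewrite !mxE.
pose Iu s := Int (-1) 1 (fun y => dot (u s y) (phi y)).
pose Iv s := Int (-1) 1 (fun y => dot (v s y) (phi y)).
have bu' s : bm (fun y => dot (u s y) (phi y)) by exact: bm_dot.
have bv' s : bm (fun y => dot (v s y) (phi y)) by exact: bm_dot.
pose F s := Et s - (Clo * (Iu s - Iv s) - 2^-1 * (Clo * dist2 t)).
have [LE LE0 LEP] := Et_lipschitz.
have [Cp CpP] : exists C : R, forall y, enorm (phi y) <= C.
  have [CK CKP] := compact_coord_bound cK; exists (CK + CK) => y.
  by rewrite (le_trans (ler_enormD _ _))// enormN lerD// CKP.
have cF : cont_on 0 T F.
  apply: cont_on_sub; first exact: (cont_on_lip LEP).
  apply: cont_on_sub; last by move=> s _ e e0; exists 1 => // s' _ _; rewrite subrr normr0 ltW.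
  rewrite (_ : (fun s => _) = fun s => Clo * Iu s - Clo * Iv s); last first.
    by apply/funext => s; rewrite mulrBr.
  apply: cont_on_sub.
    have := @cu (fun y => Clo *: phi y) _; rewrite (_ : (fun s => Int _ _ _) = fun s => Clo * Iu s).
      apply=> j; rewrite (_ : (fun y => _) = fun y => Clo * phi y j ord0).
        by apply: bmM => //; exact: bm_cst.
      by apply/funext => y; rewrite mxE.
    apply/funext => s; rewrite /Iu -IntZ//; congr Int; apply/funext => y.
    by rewrite dotC dotZl dotC.
  apply: (@cont_on_lip _ _ _ (Clo * (L * Cp * (1 - -1)))) => s s' _ _.
  rewrite -mulrBr normrM (gtr0_norm Clo0) -mulrA ler_wpM2l ?(ltW Clo0)// /Iv -IntB//.
  rewrite mulrAC; apply: Int_bound => //; first exact: bmB.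
  move=> y _; rewrite -dotBl.
  have dle (a b : V) : `|dot a b| <= enorm a * enorm b.
    by rewrite ler_norml dot_le andbT lerNl -dotNl (le_trans (dot_le _ _))// enormN.
  rewrite (le_trans (dle _ _))// mulrAC ler_pM ?enorm_ge0//.
have F0 : {ae mu, forall s, 0 < s < T -> 0 <= F s}.
  apply: (ae_imp good_times) => s gs sT; have [_ _ g3 g4] := gs sT.
  rewrite /F; apply: (dist_arith Clo0 (Et_ge g3 g4)).
  rewrite /Iu /Iv -IntB// -IntZ; last exact: bmB.
  have b4 := bsq (bu s) (bvs s); have b5 := bsq (bu t) (bvs t).
  rewrite /dist2 -IntD//; apply: Int_le.
  - by apply: bmM; [exact: bm_cst|exact: bmB].
  - exact: bmD.
  by move=> y _; rewrite -dotBl; exact: two_dot_le.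
have := cont_on_ae_ge0 T0 cF F0 tT; rewrite /F subr_ge0; apply: le_trans.
have -> : Iu t - Iv t = dist2 t.
  rewrite /Iu /Iv -IntB//; apply: eq_Int => y _.
  by rewrite -dotBl enorm_sqr.
lra.
Qed.

Theorem relative_entropy_bound t : 0 <= t <= T ->
  Int (-1) 1 (fun y => enorm (u t y - v t y) ^+ 2) <=
  Clo^-1 * (Int 0 t (fun s => Int (-1) 1 (fun y => enorm (vt s y + jv (v s y) (vy s y)) ^+ 2))
    + Chi * Int (-1) 1 (fun y => enorm (u 0 y - v 0 y) ^+ 2))
  * expR (Int 0 t (fun s => (Chi ^+ 2 + Chi * Cg * N s) / Clo)).
Proof.
move=> tT; rewrite -/(dist2 t) -/(dist2 0) -/(rho _).
have h1 := dist2_le tT; have h2 := Et_gronwall tT; have h3 := Et0_le.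
set X := expR _ in h2 *.
have X0 : 0 < X by exact: expR_gt0.
have h4 : (Et 0 + 2^-1 * Int 0 t rho) * X <= (2^-1 * (Chi * dist2 0) + 2^-1 * Int 0 t rho) * X.
  by rewrite ler_wpM2r ?(ltW X0)// lerD2r.
have h5 := le_trans h1 (le_trans h2 h4).
rewrite -(ler_pM2l Clo0) !mulrA divff ?gt_eqF// mul1r.
move: h5; rewrite -mulrDr -mulrA ler_pM2l//.
by rewrite [X in _ <= X * _ -> _]addrC.
Qed.

End relative_entropy.

(** * Piecewise polynomials with time-dependent coefficients *)

Section combinations.
Context (R : realType) (m : nat) (A : finType).
Local Notation V := 'cV[R]_m.
Local Notation mu := (@lebesgue_measure R).

Lemma enorm_le_coord (a : V) (c : R) : 0 <= c -> (forall j, `|a j ord0| <= c) ->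
  enorm a <= m%:R * c.
Proof.
move=> c0 h; rewrite (le_trans (enorm_le_norm _))// ler_wpM2l//.
exact: norm_le_coord.
Qed.

Lemma real_lipschitz_continuous (f : R -> R) (C : R) :
  (forall x y, `|f x - f y| <= C * `|x - y|) -> continuous f.
Proof.
move=> fL x; apply/(@cvgrPdist_lt R R R (nbhs x)) => e e0.
have C1 : 0 < `|C| + 1 by rewrite ltr_wpDl.
have eC : 0 < e / (`|C| + 1) by exact: divr_gt0.
near=> y; have h : `|x - y| < e / (`|C| + 1).
  by near: y; apply/nbhs_ballP; exists (e / (`|C| + 1)).
rewrite (le_lt_trans (fL _ _))//.
apply: (@le_lt_trans _ _ ((`|C| + 1) * `|x - y|)).
  by rewrite ler_wpM2r// (le_trans (ler_norm _))// lerDl.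
by rewrite mulrC -ltr_pdivlMr.
Unshelve. all: by end_near. Qed.

(** All the functions built from the coefficients have this form, with space
    factors that are monomials cut off outside a cell. *)
Definition combination (e : A -> R -> R) (d : A -> 'I_m -> R -> R) (s y : R) : V :=
  \col_j \sum_a e a y * d a j s.

Context (e : A -> R -> R) (d : A -> 'I_m -> R -> R) (E C : R).
Hypotheses (be : forall a, bm (e a)) (eE : forall a y, `|e a y| <= E) (E0 : 0 <= E) (C0 : 0 <= C).
Local Notation f := (combination e d).
Local Notation L0 := (m%:R * (#|A|%:R * (E * C))).

Lemma combination_lipschitz s s' y :
  (forall a j s s', `|d a j s - d a j s'| <= C * `|s - s'|) ->
  enorm (f s y - f s' y) <= L0 * `|s - s'|.
Proof.
move=> dL; rewrite -mulrA; apply: enorm_le_coord.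
  by rewrite !mulr_ge0.
move=> j; rewrite !mxE -sumrB (le_trans (ler_norm_sum _ _ _))// -mulrA mulr_natl -[X in _ <= X]sumr_const.
apply: ler_sum => a _; rewrite -mulrBr normrM -mulrA ler_pM//.
Qed.

Lemma combination_bounded s y : (forall a j s, `|d a j s| <= C) -> enorm (f s y) <= L0.
Proof.
move=> dB; apply: enorm_le_coord; first by rewrite !mulr_ge0.
move=> j; rewrite !mxE (le_trans (ler_norm_sum _ _ _))// mulr_natl -sumr_const.
by apply: ler_sum => a _; rewrite normrM ler_pM.
Qed.

Lemma combination_bm j : (forall a, bm (d a j)) -> bm (fun z : R * R => f z.1 z.2 j ord0).
Proof.
move=> bd; rewrite (_ : (fun z => _) = fun z => \sum_a e a z.2 * d a j z.1); last first.
  by apply/funext => z; rewrite mxE.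
by apply: bm_sum => a; apply: bmM; [exact: bm_snd|exact: bm_fst].
Qed.

End combinations.

Lemma is_derive_bigsum (R : realType) (I : Type) (s : R) (r : seq I) (h : I -> R -> R)
    (dh : I -> R) : (forall a, is_derive (s : R) (1 : R) (h a) (dh a)) ->
  is_derive (s : R) (1 : R) (fun z => \sum_(a <- r) h a z) (\sum_(a <- r) dh a).
Proof.
move=> hd; elim: r => [|a r IH].
  have -> : (fun z => \sum_(a <- [::]) h a z) = cst 0.
    by apply/funext => z; rewrite big_nil.
  by rewrite big_nil; exact: is_derive_cst.
have -> : (fun z => \sum_(a <- a :: r) h a z) = fun z => h a z + \sum_(a <- r) h a z.
  by apply/funext => z; rewrite big_cons.
by rewrite big_cons; exact: is_derive_add.
Qed.

(** Lipschitz coefficients are differentiable outside a null set of times that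
    does not depend on the point in space. *)
Lemma combination_derive (R : realType) m (A : finType) (e : A -> R -> R)
    (d : A -> 'I_m -> R -> R) (T C : R) : 0 < T -> 0 < C ->
  (forall a j s s', `|d a j s - d a j s'| <= C * `|s - s'|) ->
  exists d' : A -> 'I_m -> R -> R, (forall a j, bm (d' a j)) /\
  {ae @lebesgue_measure R, forall s, 0 < s < T -> forall y j,
    is_derive (s : R) (1 : R) (fun z : R => combination e d z y j ord0)
      (combination e d' s y j ord0)}.
Proof.
move=> T0 C0 dL.
have H a j := @lipschitz_ftc R 0 T C (d a j) T0 C0 (fun s s' _ _ => dL a j s s').
exists (fun a j => sval (cid (H a j))); split.
  by move=> a j; case: (svalP (cid (H a j))).
have H' a j : {ae @lebesgue_measure R, forall s, 0 < s < T ->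
    is_derive (s : R) (1 : R) (d a j) (sval (cid (H a j)) s)}.
  by case: (svalP (cid (H a j))).
have : {ae @lebesgue_measure R, forall s, forall aj : A * 'I_m, 0 < s < T ->
    is_derive (s : R) (1 : R) (d aj.1 aj.2) (sval (cid (H aj.1 aj.2)) s)}.
  by apply: filter_forall => aj; exact: H'.
move=> HA; apply: (ae_imp HA) => s Hs sT y j.
have -> : (fun z => combination e d z y j ord0) = fun z => \sum_a e a y * d a j z.
  by apply/funext => z; rewrite mxE.
rewrite mxE.
by apply: is_derive_bigsum => a; apply: is_derive_constl; exact: (Hs (a, j) sT).
Qed.

Section grids.
Context (R : realType) (a b : R) (M : nat) (x : nat -> R).
Hypothesis gx : grid a b M x.

Lemma grid_lt i j : (i < j)%N -> (j <= M)%N -> x i < x j.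
Proof.
case: gx => _ _ xS; elim: j => // j IH; rewrite ltnS leq_eqVlt => /orP[/eqP->|ij] jM.
  exact: xS.
by rewrite (lt_trans (IH ij (ltnW jM)))// xS.
Qed.

Lemma grid_le i j : (i <= j)%N -> (j <= M)%N -> x i <= x j.
Proof.
by rewrite leq_eqVlt => /orP[/eqP->//|ij] jM; apply: ltW; exact: grid_lt.
Qed.

Lemma grid_ge i : (i <= M)%N -> a <= x i.
Proof. by case: gx => <- _ _ iM; exact: grid_le. Qed.

Lemma grid_le1 i : (i <= M)%N -> x i <= b.
Proof. by case: gx => _ <- _ iM; exact: grid_le. Qed.

Lemma grid_gt0 : a < b -> (0 < M)%N.
Proof. by case: gx; case: M => // -> -> _; rewrite ltxx. Qed.

Lemma grid_cell y : a <= y < b -> exists2 i, (i < M)%N & x i <= y < x i.+1.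
Proof.
case: gx => x0 xM _ /andP[y1 y2].
suff H j : (j <= M)%N -> y < x j -> exists2 i, (i < j)%N & x i <= y < x i.+1.
  by apply: (H M) => //; rewrite xM.
elim: j => [_|j IH jM yj]; first by rewrite x0 ltNge y1.
have [yx|xy] := ltP y (x j); first by have [i ij] := IH (ltnW jM) yx; exists i => //; exact: leqW.
by exists j => //; rewrite xy.
Qed.

Lemma grid_unique i j y : (i < M)%N -> (j < M)%N -> x i <= y < x i.+1 -> x j <= y < x j.+1 ->
  i = j.
Proof.
move=> iM jM /andP[a1 a2] /andP[b1 b2]; apply/eqP; rewrite eqn_leq.
have H k l : (k < M)%N -> (l < M)%N -> x k <= y -> y < x l.+1 -> (k <= l)%N.
  move=> kM lM h1 h2; rewrite leqNgt; apply/negP => lk.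
  by have := le_lt_trans (le_trans (grid_le lk (ltnW kM)) h1) h2; rewrite ltxx.
by rewrite (H i j)// (H j i).
Qed.

Lemma grid_closed_cell y : a < b -> a <= y <= b -> exists2 i, (i < M)%N & x i <= y <= x i.+1.
Proof.
move=> ab /andP[ay]; rewrite le_eqVlt => /orP[/eqP ->|yb]; last first.
  have [|i iM /andP[xy yx]] := @grid_cell y; first by rewrite ay.
  by exists i => //; rewrite xy ltW.
have M0 := grid_gt0 ab; have [_ xM xS] := gx.
exists M.-1; rewrite ?ltn_predL// prednK// xM lexx andbT -xM -[in leRHS](prednK M0).
by apply: ltW; apply: xS; rewrite ltn_predL.
Qed.

Lemma ae_cells : {ae @lebesgue_measure R, forall y : R, a <= y <= b -> in_cells M x y}.
Proof.
have H : {ae @lebesgue_measure R, forall y, forall i : 'I_M.+1, y <> x i}.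
  by apply: filter_forall => i; exact: ae_neq.
apply: (ae_imp H) => y ynx /andP[y1 y2].
have y2' : y < b.
  rewrite lt_neqAle y2 andbT; apply/eqP => E.
  by apply: (ynx ord_max); rewrite E /=; case: gx.
have [|i iM /andP[l r]] := @grid_cell y; first by rewrite y1.
exists i => //; rewrite r andbT lt_neqAle l andbT; apply/eqP => E.
by apply: (ynx (Ordinal (leqW iM))); rewrite /= E.
Qed.

Lemma in_cells_torus y : in_cells M x y -> a < y < b.
Proof.
move=> [i iM /andP[l r]]; rewrite (le_lt_trans (grid_ge (ltnW iM)) l).
by rewrite (lt_le_trans r (grid_le1 iM)).
Qed.

End grids.

Lemma pow_lipschitz (R : realType) (k : nat) (y z : R) : -1 <= y <= 1 -> -1 <= z <= 1 ->
  `|y ^+ k - z ^+ k| <= k%:R * `|y - z|.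
Proof.
rewrite -!ler_norml => y1 z1; elim: k => [|k IH]; first by rewrite subrr normr0 mul0r.
have -> : y ^+ k.+1 - z ^+ k.+1 = y * (y ^+ k - z ^+ k) + (y - z) * z ^+ k.
  by rewrite !exprS; ring.
rewrite (le_trans (ler_normD _ _))// -natr1 [leRHS]mulrDl lerD// normrM ?mul1r.
  by rewrite (le_trans _ IH)// ler_piMl.
by rewrite ler_piMr// normrX exprn_ile1.
Qed.

Lemma lipschitz_glue (R : realType) (f : R -> R) (a b c L : R) : a <= b -> b <= c ->
  (forall y z, a <= y <= b -> a <= z <= b -> `|f y - f z| <= L * `|y - z|) ->
  (forall y z, b <= y <= c -> b <= z <= c -> `|f y - f z| <= L * `|y - z|) ->
  forall y z, a <= y <= c -> a <= z <= c -> `|f y - f z| <= L * `|y - z|.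
Proof.
move=> ab bc H1 H2; apply: lipschitz_wlog => y z ay yz zc.
have [zb|/ltW bz] := leP z b.
  rewrite -[X in _ <= _ * X](ger0_norm (x := z - y)) ?subr_ge0// H1// ?ay ?(le_trans yz)//.
  by rewrite (le_trans ay).
have [yb|/ltW yb] := leP b y.
  by rewrite -[X in _ <= _ * X](ger0_norm (x := z - y)) ?subr_ge0// H2// ?yb ?(le_trans yz)// bz.
have h1 : `|f b - f y| <= L * (b - y).
  by rewrite -[X in _ <= _ * X](ger0_norm (x := b - y)) ?subr_ge0// H1// ?ab ?lexx ?ay.
have h2 : `|f z - f b| <= L * (z - b).
  by rewrite -[X in _ <= _ * X](ger0_norm (x := z - b)) ?subr_ge0// H2// ?bz ?lexx.
rewrite (_ : f z - f y = (f z - f b) + (f b - f y)); last by ring.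
by rewrite (le_trans (ler_normD _ _))// (le_trans (lerD h2 h1))// -mulrDr addrA subrK.
Qed.

Section piecewise.
Context (R : realType) (m M n : nat) (x : nat -> R) (T C : R) (c : nat -> nat -> 'I_m -> R -> R).
Local Notation V := 'cV[R]_m.
Local Notation mu := (@lebesgue_measure R).
Hypotheses (gx : grid (-1) 1 M x) (T0 : 0 < T) (C0 : 0 < C).
Hypothesis cC : forall i k j s, `|c i k j s| <= C.
Hypothesis cL : forall i k j s s', `|c i k j s - c i k j s'| <= C * `|s - s'|.

Definition piece i s (y : R) : V := \col_j \sum_(k < n) y ^+ k * c i k j s.
Definition dpiece i s (y : R) : V := \col_j \sum_(k < n) (k%:R * y ^+ k.-1) * c i k j s.

Hypothesis glue : forall i s, (i.+1 < M)%N -> piece i s (x i.+1) = piece i.+1 s (x i.+1).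
Hypothesis periodic : forall s, piece M.-1 s 1 = piece 0 s (-1).

Let I := ('I_M * 'I_n)%type.
(** The fundamental domain is taken half-open, and the value at its left end is
    given to all points outside. *)
Definition wrap (y : R) : R := if -1 <= y < 1 then y else -1.
Let mono (a : I) (y : R) : R := if x a.1 <= wrap y < x a.1.+1 then wrap y ^+ a.2 else 0.
Let dmono (a : I) (y : R) : R := if x a.1 < y < x a.1.+1 then a.2%:R * y ^+ a.2.-1 else 0.
Let coef (a : I) j s := c a.1 a.2 j s.

Definition glued s y := combination mono coef s y.
Definition dglued s y := combination dmono coef s y.

Let wrapP y : -1 <= wrap y < 1.
Proof. by rewrite /wrap; case: ifPn => // _; rewrite lexx /=; lra. Qed.

Let wrap_norm y : `|wrap y| <= 1.
Proof. by rewrite ler_norml; have /andP[-> /ltW ->] := wrapP y. Qed.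

Let mono_bm a : bm (mono a).
Proof.
have mI : measurable [set` Interval (BLeft (x a.1)) (BLeft (x a.1.+1))] by exact: measurable_itv.
have bw : bm (fun y : R => wrap y).
  rewrite (_ : (fun y => _) = fun y : R => if y \in `[(-1)%R, 1%R[%classic
      then Num.max (-1) (Num.min 1 y) else -1).
    apply: bm_if; [exact: measurable_itv| |exact: bm_cst].
    apply: (@bm_clamp R (-1) 1 id); first by lra.
    by move=> ?; exact: cvg_id.
  apply/funext => y; rewrite /wrap mem_setE in_itv/=; case: ifPn => // /andP[y1 y2].
  by rewrite min_r ?(ltW y2)// max_r.
have bp : bm (fun y : R => wrap y ^+ a.2).
  elim: (nat_of_ord a.2) => [|k IH]; first exact: bm_cst.
  rewrite (_ : (fun y => _) = fun y => wrap y * wrap y ^+ k); first exact: bmM bw IH.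
  by apply/funext => y; rewrite exprS.
rewrite (_ : mono a = fun y => wrap y ^+ a.2 * (if y \in
    (wrap @^-1` [set` Interval (BLeft (x a.1)) (BLeft (x a.1.+1))]) then 1 else 0)).
  apply: bmM => //; apply: bm_if; [|exact: bm_cst|exact: bm_cst].
  by rewrite -[X in measurable X]setTI; apply: bw.1.
apply/funext => y; rewrite /mono (_ : (y \in _) = (x a.1 <= wrap y < x a.1.+1)).
  by case: ifP => _; rewrite ?mulr1 ?mulr0.
by apply/idP/idP; rewrite inE /= in_itv.
Qed.

Let dmono_bm a : bm (dmono a).
Proof.
rewrite (_ : dmono a = fun y : R => if y \in `](x a.1), (x a.1.+1)[%classic
    then a.2%:R * (Num.max (-1) (Num.min 1 y)) ^+ a.2.-1 else 0).
  apply: bm_if => //; last exact: bm_cst.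
  apply: bmM; first exact: bm_cst.
  by apply: (@bm_clamp R (-1) 1 (fun y => y ^+ a.2.-1)) => //; exact: exprn_continuous.
apply/funext => y; rewrite /dmono mem_setE in_itv/=; case: ifPn => // /andP[y1 y2].
have h1 := le_lt_trans (grid_ge gx (ltnW (ltn_ord a.1))) y1.
have h2 := lt_le_trans y2 (grid_le1 gx (ltn_ord a.1)).
by rewrite min_r ?(ltW h2)// max_r// ltW.
Qed.

Let mono_le a y : `|mono a y| <= n%:R + 1.
Proof.
rewrite (@le_trans _ _ 1) ?lerDr// /mono; case: ifP => _; last by rewrite normr0.
by rewrite normrX exprn_ile1.
Qed.

Let dmono_le a y : `|dmono a y| <= n%:R + 1.
Proof.
rewrite (@le_trans _ _ n%:R) ?lerDl// /dmono; case: ifPn => [/andP[y1 y2]|_]; last by rewrite normr0.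
have h1 := le_lt_trans (grid_ge gx (ltnW (ltn_ord a.1))) y1.
have h2 := lt_le_trans y2 (grid_le1 gx (ltn_ord a.1)).
rewrite normrM -[leRHS]mulr1 ler_pM// ?normr_nat ?ler_nat ?(ltnW (ltn_ord _))//.
by rewrite normrX exprn_ile1// ler_norml (ltW h1) (ltW h2).
Qed.

Let single_cell i (F : I -> R) : (i < M)%N -> (forall a, nat_of_ord a.1 <> i -> F a = 0) ->
  forall iM : (i < M)%N, \sum_a F a = \sum_(k < n) F (Ordinal iM, k).
Proof.
move=> _ F0 iM.
rewrite (eq_bigr (fun a => F (a.1, a.2))); last by case.
rewrite -(pair_bigA_idem _ (fun i k => F (i, k)))/=; last exact: addr0.
rewrite (bigD1 (Ordinal iM))//= [X in _ + X]big1 ?addr0// => i' ii'.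
apply: big1 => k _; apply: F0 => /= E; move/eqP: ii'; apply; exact: val_inj.
Qed.

Lemma glued_cell i s y : (i < M)%N -> x i <= y < x i.+1 -> glued s y = piece i s y.
Proof.
move=> iM yI; apply/matrixP => j l; rewrite (ord1 l) {l} !mxE.
have yw : wrap y = y.
  have /andP[y1 y2] := yI; rewrite /wrap (le_trans (grid_ge gx (ltnW iM)) y1).
  by rewrite (lt_le_trans y2 (grid_le1 gx iM)).
rewrite (@single_cell i _ iM _ iM)/=.
  by apply: eq_bigr => k _; rewrite /mono /= yw yI.
move=> a ai; rewrite /mono yw; case: ifP => h; rewrite ?mul0r//.
by case: ai; exact: (grid_unique gx (ltn_ord _) iM h yI).
Qed.

Lemma dglued_cell i s y : (i < M)%N -> x i < y < x i.+1 -> dglued s y = dpiece i s y.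
Proof.
move=> iM yI; apply/matrixP => j l; rewrite (ord1 l) {l} !mxE.
rewrite (@single_cell i _ iM _ iM)/=.
  by apply: eq_bigr => k _; rewrite /dmono /= yI.
move=> a ai; rewrite /dmono; case: ifPn => h; rewrite ?mul0r//.
have cl (a0 b0 d0 : R) : a0 < d0 < b0 -> a0 <= d0 < b0 by move=> /andP[/ltW -> ->].
by case: ai; exact: (grid_unique gx (ltn_ord _) iM (cl _ _ _ h) (cl _ _ _ yI)).
Qed.

Lemma glued_wrap s y : glued s y = glued s (wrap y).
Proof.
have E : wrap (wrap y) = wrap y by rewrite {1}/wrap wrapP.
by rewrite /glued /combination; apply/matrixP => j l; rewrite !mxE; apply: eq_bigr => a _; rewrite /mono E.
Qed.

Let wrap1 : wrap 1 = -1. Proof. by rewrite /wrap ltxx andbF. Qed.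

Lemma glued_periodic s : glued s (-1) = glued s 1.
Proof. by rewrite [RHS]glued_wrap wrap1. Qed.

(** The pieces match at the nodes, so that [glued] coincides with them on the
    closed cells. *)
Lemma glued_closed_cell i s y : (i < M)%N -> x i <= y <= x i.+1 -> glued s y = piece i s y.
Proof.
move=> iM /andP[y1]; rewrite le_eqVlt => /orP[/eqP ->|y2]; last by apply: glued_cell; rewrite ?y1.
have [x0 xM xS] := gx; have n11 : (-1 : R) < 1 by lra.
have [iM'|] := boolP (i.+1 < M)%N.
  by rewrite glue// (glued_cell s iM')// lexx xS.
rewrite -leqNgt => Mi; have Ei : i.+1 = M by apply/eqP; rewrite eqn_leq iM Mi.
rewrite Ei xM -glued_periodic (_ : i = M.-1) ?periodic; last by rewrite -Ei.
by apply: glued_cell; [exact: (grid_gt0 gx n11)|rewrite -x0 lexx xS// (grid_gt0 gx n11)].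
Qed.

Let Lt := m%:R * (#|{: I}|%:R * ((n%:R + 1) * C)).
Let n1 : 0 <= (n%:R + 1 : R). Proof. by rewrite addr_ge0. Qed.

Lemma glued_lipschitz_time s s' y : enorm (glued s y - glued s' y) <= Lt * `|s - s'|.
Proof.
by apply: (@combination_lipschitz R m I mono coef _ C mono_le n1 (ltW C0)) => a; exact: cL.
Qed.

Lemma dglued_lipschitz_time s s' y : enorm (dglued s y - dglued s' y) <= Lt * `|s - s'|.
Proof.
by apply: (@combination_lipschitz R m I dmono coef _ C dmono_le n1 (ltW C0)) => a; exact: cL.
Qed.

Lemma dglued_bounded s y : enorm (dglued s y) <= Lt.
Proof.
by apply: (@combination_bounded R m I dmono coef _ C dmono_le n1 (ltW C0)) => a; exact: cC.
Qed.

Let c_bm i k j : bm (c i k j).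
Proof.
apply: (@bm_continuous_bounded R _ C); last exact: cC.
exact: (real_lipschitz_continuous (cL i k j)).
Qed.

Lemma glued_bm j : bm (fun z : R * R => glued z.1 z.2 j ord0).
Proof. exact: (combination_bm mono_bm (fun a => c_bm a.1 a.2 j)). Qed.

Lemma dglued_bm j : bm (fun z : R * R => dglued z.1 z.2 j ord0).
Proof. exact: (combination_bm dmono_bm (fun a => c_bm a.1 a.2 j)). Qed.

Let Ly := m%:R * (n%:R * (n%:R * C)).

Lemma glued_lipschitz_space s y y' : -1 <= y <= 1 -> -1 <= y' <= 1 ->
  enorm (glued s y - glued s y') <= Ly * `|y - y'|.
Proof.
move=> yI yI'; rewrite /Ly -!mulrA; apply: enorm_le_coord.
  by rewrite !mulr_ge0// ltW.
move=> j; rewrite !mulrA mxE [X in _ + X]mxE.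
suff H i : (i <= M)%N -> forall y y', x 0%N <= y <= x i -> x 0%N <= y' <= x i ->
    `|glued s y j ord0 - glued s y' j ord0| <= n%:R * n%:R * C * `|y - y'|.
  by have [x0 xM _] := gx; apply: (H M) => //; rewrite x0 xM.
elim: i => [_ z z'|i IH iM].
  move=> /le_anti <- /le_anti <-; rewrite !subrr normr0 mulr0//.
apply: (@lipschitz_glue _ _ _ (x i)) => //.
- by apply: (grid_le gx) => //; exact: ltnW.
- by apply: (grid_le gx) => //; exact: ltnW.
- by apply: IH; exact: ltnW.
move=> z z' zI zI'; rewrite !(glued_closed_cell s iM)// !mxE -sumrB.
rewrite (le_trans (ler_norm_sum _ _ _))//.
have zz (b : R) : x i <= b <= x i.+1 -> -1 <= b <= 1.
  by move=> /andP[h1 h2]; rewrite (le_trans (grid_ge gx (ltnW iM)) h1) (le_trans h2 (grid_le1 gx iM)).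
rewrite -!mulrA [leRHS]mulr_natl.
have -> : (n%:R * (C * `|z - z'|)) *+ n = \sum_(k < n) (n%:R * (C * `|z - z'|)).
  by rewrite sumr_const card_ord.
apply: ler_sum => k _.
rewrite -mulrBl normrM [C * _]mulrC mulrA ler_pM//.
by rewrite (le_trans (pow_lipschitz k (zz _ zI) (zz _ zI')))// ler_wpM2r// ler_nat ltnW.
Qed.

Lemma dglued_derive i s y : (i < M)%N -> x i < y < x i.+1 -> forall j,
  is_derive (y : R) (1 : R) (fun z : R => glued s z j ord0) (dglued s y j ord0).
Proof.
move=> iM yI j; rewrite (dglued_cell s iM yI).
apply: (@is_derive_near_eq _ _ (fun z => \sum_(k < n) z ^+ k * c i k j s)).
  have : \forall z \near y, z \in `](x i), (x i.+1)[.
    by apply: near_in_itvoo; rewrite in_itv.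
  apply: filterS => z; rewrite in_itv /= => /andP[z1 z2].
  by rewrite (glued_cell s iM) ?mxE// (ltW z1).
rewrite mxE.
have D k : is_derive (y : R) (1 : R) (fun z : R => z ^+ k * c i k j s)
    (k%:R * y ^+ k.-1 * c i k j s).
  rewrite (_ : (fun z => _) = fun z => c i k j s * z ^+ k); last first.
    by apply/funext => z; rewrite mulrC.
  rewrite mulrC; apply: is_derive_constl.
  have := @is_derive_pow R (fun z => z) y 1 k (is_derive_id _ _).
  by rewrite mulr1.
exact: (is_derive_bigsum _ (fun k : 'I_n => D k)).
Qed.

(** Values at the nodes are limits of values in the cells. *)
Lemma glued_in (K : set V) : (forall y, closure K y -> K y) ->
  (forall i s y, (i < M)%N -> x i < y < x i.+1 -> K (piece i s y)) ->
  forall s y, K (glued s y).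
Proof.
move=> cK Kp s y; rewrite glued_wrap.
have [i iM /andP[]] := grid_cell gx (wrapP y).
rewrite le_eqVlt => /orP[/eqP E|y1] y2; last first.
  by rewrite (glued_cell s iM) ?(ltW y1)//; apply: Kp => //; rewrite y1.
have [x0 xM xS] := gx.
apply: cK => B /nbhs_ballP[e /= e0 Be].
have Lp : 0 < Ly + 1 by rewrite ltr_wpDl// !mulr_ge0// ltW.
pose h := Num.min (e / (Ly + 1) / 2) ((x i.+1 - x i) / 2).
have xx : x i < x i.+1 by exact: xS.
have h0 : 0 < h by rewrite lt_min !divr_gt0// subr_gt0.
have h1 : h < x i.+1 - x i by rewrite /h gt_min; apply/orP; right; move: xx; lra.
have h2 : h < e / (Ly + 1).
  rewrite /h gt_min; apply/orP; left; have : 0 < e / (Ly + 1) by exact: divr_gt0.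
  lra.
have hI : x i <= x i + h < x i.+1 by move: h0 h1; lra.
exists (piece i s (x i + h)); split.
  by apply: Kp => //; move: h0 h1; lra.
apply: Be; rewrite -ball_normE /=.
rewrite -(glued_cell s iM hI) (le_lt_trans (norm_le_enorm _))//.
have r1 : x i + h <= 1 by rewrite (le_trans _ (grid_le1 gx iM))//; case/andP: hI => _ /ltW.
have r2 : -1 <= x i by exact: (grid_ge gx (ltnW iM)).
rewrite (le_lt_trans (glued_lipschitz_space _ _ _))//.
- by rewrite -E r2 /=; move: r1 h0; lra.
- by rewrite r1 andbT; move: r2 h0; lra.
rewrite -E opprD addNKr normrN gtr0_norm//.
rewrite (@le_lt_trans _ _ ((Ly + 1) * h))// ?ler_wpM2r ?(ltW h0) ?lerDl//.
by rewrite mulrC -ltr_pdivlMr.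
Qed.

Lemma glued_time_derivative : exists vt : R -> R -> V,
  (forall j, bm (fun z : R * R => vt z.1 z.2 j ord0)) /\
  {ae mu, forall s, 0 < s < T -> forall y j,
    is_derive (s : R) (1 : R) (fun z : R => glued z y j ord0) (vt s y j ord0)}.
Proof.
have [d' [bd Dd]] := @combination_derive R m I mono coef T C T0 C0 (fun a j => cL a.1 a.2 j).
exists (combination mono d'); split => // j.
exact: (combination_bm mono_bm (fun a => bd a j)).
Qed.

(** The L_oo norm in space of the slope at time [s] *)
Definition max_slope s := sup (range (fun y => enorm (dglued s y))).

Let slope_has_sup s : has_ubound (range (fun y => enorm (dglued s y))).
Proof. by exists Lt => _ [y _ <-]; exact: dglued_bounded. Qed.

Lemma max_slopeP s y : enorm (dglued s y) <= max_slope s.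
Proof. by apply: ub_le_sup => //; exists y. Qed.

Lemma max_slope_le s a : (forall y, enorm (dglued s y) <= a) -> max_slope s <= a.
Proof.
move=> h; apply: ge_sup; first by exists (enorm (dglued s 0)), 0.
by move=> _ [y _ <-].
Qed.

Let max_slope_lip s s' : `|max_slope s - max_slope s'| <= Lt * `|s - s'|.
Proof.
have H a b : max_slope a <= max_slope b + Lt * `|a - b|.
  apply: max_slope_le => y.
  rewrite -[dglued a y](subrK (dglued b y)) addrC (le_trans (ler_enormD _ _))// lerD//.
    exact: max_slopeP.
  exact: dglued_lipschitz_time.
rewrite ler_norml; apply/andP; split; last by rewrite lerBlDl.
by rewrite lerNl opprB lerBlDl distrC.
Qed.

Lemma max_slope_continuous : continuous max_slope.
Proof. exact: (real_lipschitz_continuous max_slope_lip). Qed.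

Lemma max_slope_bm : bm max_slope.
Proof.
apply: (@bm_continuous_bounded R _ Lt max_slope_continuous) => s.
rewrite ger0_norm; last exact: le_trans (enorm_ge0 _) (max_slopeP s 0).
by apply: max_slope_le => y; exact: dglued_bounded.
Qed.

(** The cells being open, an almost everywhere bound on the slope is a bound. *)
Lemma max_slope_ae s a : 0 <= a -> {ae mu, forall y, -1 <= y <= 1 -> enorm (dglued s y) <= a} ->
  max_slope s <= a.
Proof.
move=> a0 H; apply: max_slope_le => y.
have [[i iM yI]|ny] := pselect (in_cells M x y); last first.
  rewrite (_ : dglued s y = 0) ?/enorm ?/dot ?big1 ?sqrtr0// => [i _|]; first by rewrite mxE mul0r.
  apply/matrixP => j l; rewrite !mxE big1// => b _; rewrite /dmono; case: ifP => h; rewrite ?mul0r//.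
  by case: ny; exists b.1.
have yT : -1 < y < 1 by apply: (in_cells_torus gx); exists i.
pose Ld := m%:R * (n%:R * (n%:R * n%:R * C)).
have Ld0 : 0 <= Ld by rewrite !mulr_ge0// ltW.
have dL z : x i < z < x i.+1 -> enorm (dglued s y - dglued s z) <= Ld * `|y - z|.
  move=> zI; have zT : -1 < z < 1 by apply: (in_cells_torus gx); exists i.
  rewrite !(dglued_cell s iM)// /Ld -!mulrA; apply: enorm_le_coord.
    by rewrite !mulr_ge0// ltW.
  move=> j; rewrite !mxE -sumrB (le_trans (ler_norm_sum _ _ _))// [leRHS]mulr_natl.
  rewrite (_ : _ *+ n = \sum_(k < n) (n%:R * (n%:R * (C * `|y - z|)))); last by rewrite sumr_const card_ord.
  apply: ler_sum => k _; rewrite -mulrBl -mulrBr normrM [C * _]mulrC !mulrA ler_pM// -mulrA normrM normr_nat.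
  rewrite ler_pM// ?ler_nat ?(ltnW (ltn_ord k))//.
  have cl (b : R) : -1 < b < 1 -> -1 <= b <= 1 by move=> /andP[/ltW -> /ltW ->].
  rewrite (le_trans (pow_lipschitz k.-1 (cl _ yT) (cl _ zT)))// ler_wpM2r// ler_nat.
  by rewrite (leq_trans (leq_pred _))// ltnW.
apply/ler_addgt0Pr => e e0.
have Ld1 : 0 < Ld + 1 by rewrite ltr_wpDl.
pose h := Num.min (x i.+1) (y + e / (Ld + 1)).
have yh : y < h by rewrite lt_min ltrDl divr_gt0// andbT; case/andP: yI.
have [z /andP[yz zh] Hz] := ae_dense H yh.
have zI : x i < z < x i.+1.
  rewrite (lt_trans _ yz) ?(lt_le_trans zh)//; first by rewrite ge_min lexx.
  by case/andP: yI.
have zT : -1 <= z <= 1.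
  have /andP[/ltW -> /ltW ->]// : -1 < z < 1 by apply: (in_cells_torus gx); exists i.
rewrite -[dglued s y](subrK (dglued s z)) addrC (le_trans (ler_enormD _ _))// lerD ?Hz//.
rewrite (le_trans (dL z zI))// distrC gtr0_norm ?subr_gt0//.
rewrite (@le_trans _ _ ((Ld + 1) * (z - y)))// ?ler_wpM2r ?lerDl ?subr_ge0 ?(ltW yz)//.
rewrite mulrC -ler_pdivlMr// lerBlDl (le_trans (ltW zh))// ge_min lexx orbT//.
Qed.

End piecewise.

(** * The reconstruction of the discontinuous Galerkin solution *)

Section lipschitz_functions.
Context (R : realType) (a b : R).

Definition lip_on (f : R -> R) := exists2 C : R, 0 <= C &
  forall s s', a <= s <= b -> a <= s' <= b -> `|f s - f s'| <= C * `|s - s'|.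

Lemma lip_bounded f : lip_on f -> exists2 C : R, 0 <= C & forall s, a <= s <= b -> `|f s| <= C.
Proof.
move=> [C C0 H]; exists (`|f a| + C * `|b - a|) => [|s sI]; first by rewrite addr_ge0// mulr_ge0.
have /andP[as_ sb] := sI; have aI : a <= a <= b by rewrite lexx (le_trans as_).
rewrite -[f s](subrK (f a)) addrC (le_trans (ler_normD _ _))// lerD2l.
rewrite (le_trans (H _ _ sI aI))// ler_wpM2l// !ger0_norm ?subr_ge0// ?lerB//.
by rewrite (le_trans as_).
Qed.

Lemma lip_ext f h : (forall s, a <= s <= b -> f s = h s) -> lip_on f -> lip_on h.
Proof. by move=> E [C C0 H]; exists C => // s s' sI sI'; rewrite -!E// H. Qed.

Lemma lip_cst c : lip_on (fun=> c).
Proof. by exists 0 => // s s' _ _; rewrite subrr normr0 mul0r. Qed.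

Lemma lip_id : lip_on id.
Proof. by exists 1 => // s s' _ _; rewrite mul1r. Qed.

Lemma lipD f h : lip_on f -> lip_on h -> lip_on (fun s => f s + h s).
Proof.
move=> [A A0 fA] [B B0 hB]; exists (A + B) => [|s s' sI sI']; first exact: addr_ge0.
rewrite opprD addrACA (le_trans (ler_normD _ _))// [leRHS]mulrDl lerD//; [exact: fA|exact: hB].
Qed.

Lemma lipM f h : lip_on f -> lip_on h -> lip_on (fun s => f s * h s).
Proof.
move=> fl hl; have [A A0 fA] := lip_bounded fl; have [B B0 hB] := lip_bounded hl.
have [A' A0' fA'] := fl; have [B' B0' hB'] := hl.
exists (A * B' + A' * B); first by rewrite addr_ge0// mulr_ge0.
exact: (lipschitz_mul A0 B0' fA hB fA' hB').
Qed.

Lemma lip_sum (I : Type) (r : seq I) (P : pred I) (F : I -> R -> R) :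
  (forall i, lip_on (F i)) -> lip_on (fun s => \sum_(i <- r | P i) F i s).
Proof.
move=> HF; elim: r => [|i r IH].
  by apply: (lip_ext _ (lip_cst 0)) => s _; rewrite big_nil.
apply: (lip_ext _ (lipD (if P i as p return lip_on (fun s => if p then F i s else 0)
  then HF i else lip_cst 0) IH)) => s _.
by rewrite big_cons; case: ifP => _; rewrite ?add0r.
Qed.

Lemma lipX f k : lip_on f -> lip_on (fun s => f s ^+ k).
Proof.
move=> fl; elim: k => [|k IH]; first by apply: (lip_ext _ (lip_cst 1)) => s _; rewrite expr0.
by apply: (lip_ext _ (lipM fl IH)) => s _; rewrite exprS.
Qed.

End lipschitz_functions.

Lemma lip_glue (R : realType) (a b c : R) f : a <= b -> b <= c ->
  lip_on a b f -> lip_on b c f -> lip_on a c f.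
Proof.
move=> ab bc [C C0 H] [D D0 H']; exists (C + D); first exact: addr_ge0.
apply: (lipschitz_glue ab bc) => y z yI zI.
  by rewrite (le_trans (H _ _ yI zI))// ler_wpM2r// lerDl.
by rewrite (le_trans (H' _ _ yI zI))// ler_wpM2r// lerDr.
Qed.

Lemma lip_sub (R : realType) (a b a' b' : R) f : a <= a' -> b' <= b -> lip_on a b f -> lip_on a' b' f.
Proof.
move=> aa bb [C C0 H]; exists C => // s s' /andP[h1 h2] /andP[h3 h4].
by apply: H; rewrite ?(le_trans aa)// (le_trans _ bb).
Qed.

(** On a segment, being locally Lipschitz implies being Lipschitz: the supremum
    of the points up to which the function is Lipschitz is the right end. *)
Lemma locally_lip (R : realType) (a b : R) (f : R -> R) : a <= b ->
  (forall s, a <= s <= b -> exists2 r : R, 0 < r &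
     lip_on (Num.max a (s - r)) (Num.min b (s + r)) f) -> lip_on a b f.
Proof.
move=> ab loc.
pose A := [set s | a <= s <= b /\ lip_on a s f].
have Aa : A a.
  split; first by rewrite lexx.
  by exists 0 => // s s' /le_anti <- /le_anti <-; rewrite !subrr normr0 mulr0.
have Aub : has_ubound A by exists b => s [/andP[]].
pose S := sup A.
have aS : a <= S by exact: ub_le_sup.
have Sb : S <= b by apply: ge_sup; [exists a|move=> s [/andP[]]].
have [r r0 lr] := loc S (introT andP (conj aS Sb)).
have [s [/andP[as_ sb] ls] Ss] : exists2 s, A s & S - r < s.
  by apply: sup_adherent => //; split => //; exists a.
have sS : s <= S by apply: ub_le_sup => //; split => //; rewrite as_.
pose e := Num.min b (S + r).
have ae : a <= e by rewrite le_min ab (le_trans aS)// lerDl ltW.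
have se : s <= e by rewrite le_min sb (le_trans sS)// lerDl ltW.
have le : lip_on a e f.
  apply: (lip_glue as_ se ls); apply: (lip_sub _ _ lr) => //.
  by rewrite ge_max as_ ltW.
have Ae : A e by split => //; rewrite ae ge_min lexx.
have eS : e <= S by apply: ub_le_sup.
suff eb : e = b by rewrite -eb.
apply/eqP; rewrite /e eq_minl leNgt; apply/negP => h.
by move: eS; rewrite /e min_r ?(ltW h)// leNgt ltrDl r0.
Qed.

Lemma dual_basis (R : realType) n (B : 'M[R]_n) :
  (forall c : 'rV_n, c *m B = 0 -> c = 0) ->
  exists A : 'M[R]_n, forall c : 'rV_n, c = c *m B *m A.
Proof.
move=> inj; have u : B \in unitmx by rewrite -row_free_unit; exact: inj_row_free.
by exists (invmx B) => c; rewrite mulmxK.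
Qed.

Section polynomial_functionals.
Context (R : realType) (n : nat).

(** A polynomial of degree less than [n] is determined, linearly, by [n]
    functionals whose only common zero is the zero polynomial. *)
Lemma coefficients_from_functionals (l : 'I_n -> nat -> R) :
  (forall p : {poly R}, (size p <= n)%N ->
     (forall i, \sum_(k < n) p`_k * l i k = 0) -> p = 0) ->
  exists A : 'I_n -> nat -> R, forall p : {poly R}, (size p <= n)%N ->
    forall k, (k < n)%N -> p`_k = \sum_i (\sum_(k < n) p`_k * l i k) * A i k.
Proof.
move=> inj.
pose B : 'M[R]_n := \matrix_(k, i) l i k.
pose P (c : 'rV[R]_n) : {poly R} := \poly_(k < n) (if insub k is Some k' then c ord0 k' else 0).
have Pk c (k : 'I_n) : (P c)`_k = c ord0 k.
  rewrite coef_poly ltn_ord; case: insubP => [k' _ E|]; last by rewrite ltn_ord.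
  by congr (c _ _); exact: val_inj.
have [|A AP] := @dual_basis R n B.
  move=> c cB; apply/rowP => k; rewrite mxE -Pk (inj (P c)) ?coef0 ?size_poly// => i.
  have := congr1 (fun M : 'rV_n => M ord0 i) cB; rewrite !mxE => E; rewrite -[RHS]E.
  by apply: eq_bigr => k' _; rewrite Pk mxE.
exists (fun i k => if insub k is Some k' then A i k' else 0) => p sp k kn.
have := AP (\row_k p`_k) => /(congr1 (fun M : 'rV_n => M ord0 (Ordinal kn))).
rewrite !mxE /= => ->; apply: eq_bigr => i _; rewrite mxE insubT.
by congr (_ * _); apply: eq_bigr => k' _; rewrite !mxE.
Qed.

End polynomial_functionals.

Lemma small_poly_eval (R : realType) n (p : {poly R}) y : (size p <= n)%N ->
  p.[y] = \sum_(k < n) y ^+ k * p`_k.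
Proof.
by move=> sp; rewrite (horner_coef_wide _ sp); apply: eq_bigr => k _; rewrite mulrC.
Qed.

(** The functionals are the values at equally spaced points, as a polynomial of
    size at most [n] with [n] roots is zero. *)
Lemma coefficients_from_values (R : realType) n (a b : R) : a < b ->
  exists (y : 'I_n -> R) (A : 'I_n -> nat -> R), (forall i, a < y i < b) /\
  forall p : {poly R}, (size p <= n)%N -> forall k, (k < n)%N -> p`_k = \sum_i p.[y i] * A i k.
Proof.
move=> ab; pose z k := a + (b - a) * (k.+1%:R / n.+1%:R).
have zI k : (k < n)%N -> a < z k < b.
  move=> kn; rewrite /z ltrDl mulr_gt0 ?subr_gt0 ?divr_gt0//= -ltrBrDl.
  by rewrite gtr_pMr ?subr_gt0// ltr_pdivrMr// mul1r ltr_nat ltnS.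
have zinj i k : z i = z k -> i = k.
  have ba : b - a != 0 by rewrite subr_eq0 gt_eqF.
  move=> /addrI /(mulfI ba) /mulIf; rewrite invr_eq0 pnatr_eq0 => /(_ isT) /eqP.
  by rewrite eqr_nat => /eqP[].
have [p sp H|A AP] := @coefficients_from_functionals R n (fun i k => z i ^+ k).
  apply/eqP/negPn/negP => p0.
  have := @max_poly_roots _ p [seq z k | k <- iota 0 n] p0.
  rewrite size_map size_iota map_inj_uniq ?iota_uniq//= => /(_ _ isT) H1.
  have : (n < size p)%N.
    apply: H1; apply/allP => y /mapP[k]; rewrite mem_iota add0n /= => kn ->.
    rewrite /root (small_poly_eval _ sp) -[X in _ == X](H (Ordinal kn)).
    by apply/eqP/eq_bigr => l _; rewrite mulrC.
  by rewrite ltnNge sp.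
exists (fun i => z i), A; split => [i|p sp k kn]; first exact: zI.
rewrite (AP p sp k kn); apply: eq_bigr => i _; congr (_ * _).
by rewrite (small_poly_eval _ sp); apply: eq_bigr => l _; rewrite mulrC.
Qed.

Section moments.
Context (R : realType) (a b : R).
Hypothesis ab : a < b.
Local Notation clamp y := (Num.max a (Num.min b y)).

Let clampE y : a <= y <= b -> clamp y = y.
Proof. by move=> /andP[ay yb]; rewrite min_r// max_r. Qed.

Let clampP y : a <= clamp y <= b.
Proof. by rewrite le_max lexx ge_max ge_min lexx (ltW ab). Qed.

Let bm_poly (p : {poly R}) : bm (fun y => p.[clamp y]).
Proof. by apply: (@bm_clamp R a b (fun y => p.[y]) (ltW ab)); exact: continuous_horner. Qed.

Let IntE (p : {poly R}) : Int a b (fun y => p.[y]) = Int a b (fun y => p.[clamp y]).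
Proof. by apply: eq_Int => y yI; rewrite clampE. Qed.

Definition moment k l := Int a b (fun y => ('X^k * 'X^l : {poly R}).[y]).

Lemma Int_poly_mul n n' (p r : {poly R}) : (size p <= n)%N -> (size r <= n')%N ->
  Int a b (fun y => p.[y] * r.[y]) = \sum_(l < n') r`_l * \sum_(k < n) p`_k * moment k l.
Proof.
move=> sp sr.
have E y : clamp y = clamp y -> p.[clamp y] * r.[clamp y] = \sum_(l < n') \sum_(k < n)
    (r`_l * p`_k) * ('X^k * 'X^l : {poly R}).[clamp y].
  move=> _; rewrite (small_poly_eval _ sp) (small_poly_eval _ sr) mulrC mulr_suml.
  apply: eq_bigr => l _; rewrite mulr_sumr; apply: eq_bigr => k _.
  by rewrite hornerM !hornerXn; ring.
rewrite (@eq_Int _ a b _ (fun y => \sum_(l < n') \sum_(k < n)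
    (r`_l * p`_k) * ('X^k * 'X^l : {poly R}).[clamp y])); last first.
  by move=> y yI; rewrite -E// clampE.
rewrite Int_sum ?ltW//; last by move=> l; apply: bm_sum => k; apply: bmM; [exact: bm_cst|exact: bm_poly].
apply: eq_bigr => l _; rewrite Int_sum ?ltW//; last by move=> k; apply: bmM; [exact: bm_cst|exact: bm_poly].
rewrite mulr_sumr; apply: eq_bigr => k _; rewrite IntZ; last exact: bm_poly.
by rewrite /moment IntE mulrA.
Qed.

Lemma lip_poly (p : {poly R}) : lip_on a b (fun y => p.[y]).
Proof.
apply: (lip_ext _ (lip_sum (index_enum 'I_(size p)) xpredT
  (fun k : 'I_(size p) => lipM (lipX k (lip_id a b)) (lip_cst a b p`_k)))) => y _.
by rewrite [RHS](@small_poly_eval _ (size p)).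
Qed.

Lemma poly_ae_zero (p : {poly R}) :
  {ae @lebesgue_measure R, forall y, a <= y <= b -> p.[y] = 0} -> p = 0.
Proof.
move=> H.
have N0 (r : {poly R}) : {ae @lebesgue_measure R, forall y, a <= y <= b -> r.[y] = 0} ->
    forall y, a <= y <= b -> 0 <= r.[y].
  move=> Hr; have [C C0 CP] := lip_poly r.
  apply: (cont_on_ae_ge0 ab (cont_on_lip CP)).
  by apply: (ae_imp Hr) => y ry /andP[/ltW ay /ltW yb]; rewrite ry// ay.
have [y [A [yI AP]]] := @coefficients_from_values R (size p) a b ab.
apply/polyP => k; rewrite coef0.
have [ks|ks] := leqP (size p) k; first exact: nth_default.
rewrite (AP p (leqnn _) k ks) big1// => i _.
have yI' : a <= y i <= b by have /andP[/ltW -> /ltW ->] := yI i.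
suff -> : p.[y i] = 0 by rewrite mul0r.
apply/eqP; rewrite eq_le N0// andbT -oppr_ge0 -hornerN; apply: N0 => //.
by apply: (ae_imp H) => z pz zI; rewrite hornerN pz// oppr0.
Qed.

(** If the first [q] moments of a polynomial of degree at most [q + 1] and its
    end point values vanish, it is a multiple of [(X - a) (X - b)], and the
    moment against the cofactor has a sign. *)
Lemma moments_unisolvent q (p : {poly R}) : (size p <= q.+2)%N ->
  (forall l, (l < q)%N -> \sum_(k < q.+2) p`_k * moment k l = 0) ->
  p.[a] = 0 -> p.[b] = 0 -> p = 0.
Proof.
move=> sp pm /eqP pa /eqP pb.
have /factor_theorem[r1 E1] : root p a by exact: pa.
have : root r1 b.
  by move: pb; rewrite E1 !hornerE mulf_eq0 subr_eq0 (gt_eqF ab) orbF.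
move=> /factor_theorem[r E2].
have [->//|p0] := eqVneq p 0.
have r0 : r != 0 by apply: contraNneq p0 => r0; rewrite E1 E2 r0 !mul0r.
have sr : (size r <= q)%N.
  have : (size r).+2 = size p.
    by rewrite E1 E2 !size_Mmonic ?monicXsubC ?mulf_neq0 ?polyXsubC_eq0// !size_XsubC !addn2.
  by move=> sE; move: sp; rewrite -sE.
have Hm : Int a b (fun y => p.[y] * r.[y]) = 0.
  by rewrite (Int_poly_mul sp sr) big1// => l _; rewrite pm ?mulr0.
have : {ae @lebesgue_measure R, forall y, a <= y <= b -> - (p * r).[clamp y] = 0}.
  apply: Int_null.
  - by apply: bmN; exact: bm_poly.
  - move=> y; have /andP[ay yb] := clampP y.
    rewrite E1 E2 !hornerE -mulNr -!mulNr mulrAC -mulrA.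
    rewrite (_ : _ * _ = r.[clamp y] ^+ 2 * ((b - clamp y) * (clamp y - a))); last by ring.
    by rewrite mulr_ge0 ?sqr_ge0// mulr_ge0// subr_ge0.
  - rewrite IntN; last exact: bm_poly.
    rewrite -IntE (_ : Int _ _ _ = 0) ?oppr0//.
    by rewrite -[RHS]Hm; apply: eq_Int => y _; rewrite hornerM.
move=> H; have : p * r = 0.
  apply: poly_ae_zero; apply: (ae_imp H) => y hy yI.
  by have := hy yI; rewrite clampE// => /eqP; rewrite oppr_eq0 => /eqP.
by move/eqP; rewrite mulf_eq0 (negbTE p0) (negbTE r0).
Qed.

Lemma coefficients_from_moments q : exists A : nat -> nat -> R, exists A1 A2 : nat -> R,
  forall p : {poly R}, (size p <= q.+2)%N -> forall k, (k < q.+2)%N ->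
  p`_k = \sum_(l < q) (\sum_(k < q.+2) p`_k * moment k l) * A l k + p.[a] * A1 k + p.[b] * A2 k.
Proof.
pose l (i : 'I_q.+2) k := if (i < q)%N then moment k i else if i == q :> nat then a ^+ k else b ^+ k.
have eval (p : {poly R}) y : (size p <= q.+2)%N -> \sum_(k < q.+2) p`_k * y ^+ k = p.[y].
  by move=> sp; rewrite (small_poly_eval _ sp); apply: eq_bigr => k _; rewrite mulrC.
have [p sp H|A AP] := @coefficients_from_functionals R q.+2 l.
  apply: (moments_unisolvent sp).
  - move=> i iq; have iq2 : (i < q.+2)%N by rewrite ltnS ltnW// ltnS ltnW.
    by have := H (Ordinal iq2); rewrite /l /= iq.
  - have q1 : (q < q.+2)%N by [].
    by have := H (Ordinal q1); rewrite /l /= ltnn eqxx eval.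
  - have q1 : (q.+1 < q.+2)%N by [].
    by have := H (Ordinal q1); rewrite /l /= ltnNge leqnSn /= eqn_leq ltnn /= eval.
exists (fun i k => if insub i is Some i' then A i' k else 0), (A (inord q)), (A (inord q.+1)).
move=> p sp k kq; rewrite (AP p sp k kq).
pose F i := (\sum_(k0 < q.+2) p`_k0 * l i k0) * A i k.
rewrite -[LHS]/(\sum_i F i) !big_ord_recr /= /F.
congr (_ + _ + _).
- apply: eq_bigr => i _; rewrite /l /= ltn_ord insubT; first by rewrite ltnS ltnW// ltnS ltnW.
  move=> h; congr (_ * A _ _); exact: val_inj.
- rewrite /l /= ltnn eqxx eval//; by congr (_ * A _ _); apply: val_inj; rewrite /= inordK.
- rewrite /l /= ltnNge leqnSn /= eqn_leq ltnn /= eval//; by congr (_ * A _ _); apply: val_inj; rewrite /= inordK.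
Qed.

End moments.

Section traces.
Context (R : realType) (m M : nat) (x : nat -> R).
Local Notation V := 'cV[R]_m.
Hypothesis gx : grid (-1) 1 M x.

Lemma pwpoly_cell n (v : R -> V) i : pwpoly M x n v -> (i < M)%N ->
  exists P : 'I_m -> {poly R}, (forall j, (size (P j) <= n)%N) /\
    forall y, x i < y < x i.+1 -> forall j, v y j ord0 = (P j).[y].
Proof.
move=> pv iM; have H j : exists P : {poly R}, (size P <= n)%N /\
    forall y, x i < y < x i.+1 -> v y j ord0 = P.[y].
  by have [P sP PE] := pv i iM j; exists P.
exists (fun j => sval (cid (H j))); split => [j|y yI j]; case: (svalP (cid (H j))) => //.
by move=> _; apply.
Qed.

Let poly_cvg (G : set_system R) {FG : Filter G} (v : R -> V) (P : 'I_m -> {poly R}) (z : R) :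
  G `=>` nbhs z -> (\forall y \near G, forall j, v y j ord0 = (P j).[y]) ->
  v y @[y --> G] --> (\col_j (P j).[z] : V).
Proof.
move=> Gz vP; apply/(@cvgrPdist_le R V R G) => e e0.
have H : \forall y \near G, forall j, `|(P j).[z] - (P j).[y]| <= e.
  apply: filter_forall => j; apply: Gz.
  have c := @continuous_horner R (P j) z.
  by move/(@cvgrPdist_le R R R (nbhs z)): c; apply.
apply: filterS2 vP H => y vy Hy; apply: norm_le_coord; first exact: ltW.
by move=> j; rewrite !mxE vy.
Qed.

Lemma cvg_trace_right (v : R -> V) i (P : 'I_m -> {poly R}) : (i < M)%N ->
  (forall y, x i < y < x i.+1 -> forall j, v y j ord0 = (P j).[y]) ->
  v y @[y --> (x i)^'+] --> (\col_j (P j).[x i] : V).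
Proof.
move=> iM vP; have xx : x i < x i.+1 by case: gx => _ _; apply.
apply: poly_cvg; first exact: cvg_within.
near=> y; apply: vP; apply/andP; split; near: y; [exact: nbhs_right_gt|exact: nbhs_right_lt].
Unshelve. all: by end_near. Qed.

Lemma cvg_trace_left (v : R -> V) i (P : 'I_m -> {poly R}) : (i < M)%N ->
  (forall y, x i < y < x i.+1 -> forall j, v y j ord0 = (P j).[y]) ->
  v y @[y --> (x i.+1)^'-] --> (\col_j (P j).[x i.+1] : V).
Proof.
move=> iM vP; have xx : x i < x i.+1 by case: gx => _ _; apply.
apply: poly_cvg; first exact: cvg_within.
near=> y; apply: vP; apply/andP; split; near: y; [exact: nbhs_left_gt|exact: nbhs_left_lt].
Unshelve. all: by end_near. Qed.

Lemma near_right_cell (K : set V) (v : R -> V) i : (i < M)%N ->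
  (forall y, in_cells M x y -> K (v y)) -> \forall y \near (x i)^'+, K (v y).
Proof.
move=> iM Kv; have xx : x i < x i.+1 by case: gx => _ _; apply.
near=> y; apply: Kv; exists i => //; apply/andP; split; near: y; [exact: nbhs_right_gt|exact: nbhs_right_lt].
Unshelve. all: by end_near. Qed.

Lemma near_left_cell (K : set V) (v : R -> V) i : (i < M)%N ->
  (forall y, in_cells M x y -> K (v y)) -> \forall y \near (x i.+1)^'-, K (v y).
Proof.
move=> iM Kv; have xx : x i < x i.+1 by case: gx => _ _; apply.
near=> y; apply: Kv; exists i => //; apply/andP; split; near: y; [exact: nbhs_left_gt|exact: nbhs_left_lt].
Unshelve. all: by end_near. Qed.

End traces.

(** The intermediate state is only locally Lipschitz, but the traces to which it
    is applied stay on a Lipschitz curve over a compact time interval. *)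
Lemma intermediate_state_lip (R : realType) m (U : set 'cV[R]_m) w (a b : R) (l r : R -> 'cV[R]_m) :
  a <= b -> intermediate_state U w ->
  (forall j, lip_on a b (fun s => l s j ord0)) -> (forall j, lip_on a b (fun s => r s j ord0)) ->
  (forall s, a <= s <= b -> U (l s) /\ U (r s)) ->
  forall j, lip_on a b (fun s => w (l s) (r s) j ord0).
Proof.
move=> ab [_ wL _] ll rl lrU.
have vl (f : R -> 'cV[R]_m) : (forall j, lip_on a b (fun s => f s j ord0)) ->
    exists2 C : R, 0 <= C & forall s s', a <= s <= b -> a <= s' <= b ->
      `|f s - f s'| <= C * `|s - s'|.
  move=> fl; have H j : exists C : R, 0 <= C /\ forall s s', a <= s <= b -> a <= s' <= b ->
      `|f s j ord0 - f s' j ord0| <= C * `|s - s'|.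
    by have [C C0 CP] := fl j; exists C.
  exists (\sum_j sval (cid (H j))) => [|s s' sI sI'].
    by apply: sumr_ge0 => j _; case: (svalP (cid (H j))).
  apply: norm_le_coord => [|j].
    by rewrite mulr_ge0// sumr_ge0// => j _; case: (svalP (cid (H j))).
  have [_ h] := svalP (cid (H j)).
  rewrite !mxE (le_trans (h _ _ sI sI'))// ler_wpM2r// (bigD1 j)//= lerDl sumr_ge0// => k _.
  by case: (svalP (cid (H k))).
have [Cl Cl0 ClP] := vl _ ll; have [Cr Cr0 CrP] := vl _ rl.
have pL s s' : a <= s <= b -> a <= s' <= b ->
    `|(l s, r s) - (l s', r s')| <= (Cl + Cr) * `|s - s'|.
  move=> sI sI'; rewrite prod_normE ge_max /= (le_trans (ClP _ _ sI sI')) ?(le_trans (CrP _ _ sI sI'))//.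
    by rewrite ler_wpM2r// lerDr.
  by rewrite ler_wpM2r// lerDl.
move=> j; apply: locally_lip => // s sI.
have [B /nbhs_ballP[e /= e0 Be] Blip] := wL (l s, r s) (lrU s sI).
have C1 : 0 < Cl + Cr + 1 by rewrite ltr_wpDl// addr_ge0.
exists (e / (Cl + Cr + 1) / 2); first by rewrite !divr_gt0.
have BU s' : Num.max a (s - e / (Cl + Cr + 1) / 2) <= s' <= Num.min b (s + e / (Cl + Cr + 1) / 2) ->
    (B `&` (U `*` U)) (l s', r s') /\ a <= s' <= b.
  rewrite ge_max le_min => /andP[/andP[h1 h2] /andP[h3 h4]].
  have sI' : a <= s' <= b by rewrite h1.
  split => //; split; last exact: lrU.
  apply: Be; rewrite -ball_normE /= (le_lt_trans (pL _ _ sI sI'))//.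
  have h5 : `|s - s'| <= e / (Cl + Cr + 1) / 2 by rewrite ler_norml; move: h2 h4; lra.
  apply: (@le_lt_trans _ _ ((Cl + Cr + 1) * (e / (Cl + Cr + 1) / 2))).
    by rewrite ler_pM// ?addr_ge0// lerDl.
  have -> : (Cl + Cr + 1) * (e / (Cl + Cr + 1) / 2) = e / 2 by field; rewrite gt_eqF.
  by move: e0; lra.
have [D [_ DP]] := Blip.
have DP' := DP (`|D| + 1) _.
exists ((`|D| + 1) * (Cl + Cr)); first by rewrite mulr_ge0// addr_ge0.
move=> s1 s2 /BU[b1 i1] /BU[b2 i2].
have := DP' _ ((l s1, r s1), (l s2, r s2)) (conj b1 b2) => /= H.
apply: (@le_trans _ _ `|w (l s1) (r s1) - w (l s2) (r s2)|).
  by have := coord_le_norm (w (l s1) (r s1) - w (l s2) (r s2)) j; rewrite !mxE.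
rewrite (le_trans (H _))//; first by rewrite (le_lt_trans (ler_norm _))// ltrDl.
by rewrite -mulrA ler_wpM2l ?addr_ge0// pL.
Qed.

Lemma lip_uniform (R : realType) (I : finType) (a b : R) (f : I -> R -> R) :
  (forall i, lip_on a b (f i)) -> exists2 C : R, 0 < C & forall i,
    (forall s, a <= s <= b -> `|f i s| <= C) /\
    forall s s', a <= s <= b -> a <= s' <= b -> `|f i s - f i s'| <= C * `|s - s'|.
Proof.
move=> fl; have H i : exists C : R, [/\ 0 <= C, (forall s, a <= s <= b -> `|f i s| <= C) &
    forall s s', a <= s <= b -> a <= s' <= b -> `|f i s - f i s'| <= C * `|s - s'|].
  have [C C0 CP] := fl i; have [D D0 DP] := lip_bounded (fl i).
  exists (C + D); split => [|s sI|s s' sI sI']; first exact: addr_ge0.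
    by rewrite (le_trans (DP _ sI))// lerDr.
  by rewrite (le_trans (CP _ _ sI sI'))// ler_wpM2r// lerDl.
pose c i := sval (cid (H i)).
have c0 i : 0 <= c i by rewrite /c; case: (svalP (cid (H i))).
have cS i : c i <= 1 + \sum_i c i.
  by rewrite (bigD1 i)//= addrCA lerDl addr_ge0// sumr_ge0.
exists (1 + \sum_i c i); first by rewrite ltr_pwDl// sumr_ge0.
move=> i; have [_ h1 h2] := svalP (cid (H i)); split => [s sI|s s' sI sI'].
  by rewrite (le_trans (h1 _ sI))// cS.
by rewrite (le_trans (h2 _ _ sI sI'))// ler_wpM2r// cS.
Qed.

Lemma clamp_lipschitz (R : realType) (T : R) : 0 <= T -> forall s s',
  `|Num.max 0 (Num.min T s) - Num.max 0 (Num.min T s')| <= `|s - s'|.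
Proof.
move=> T0.
have mL (a z z' : R) : `|Num.min a z - Num.min a z'| <= `|z - z'|.
  wlog zz : z z' / z <= z'.
    by move=> H; have [/H//|/ltW/H] := leP z z'; rewrite distrC [leRHS]distrC.
  rewrite distrC [leRHS]distrC [leRHS]ger0_norm ?subr_ge0//.
  by case: (leP a z) => h1; case: (leP a z') => h2; rewrite ler_norml; move: h1 h2 zz; lra.
move=> s s'; have E (z : R) : Num.max 0 z = - Num.min 0 (- z).
  by rewrite -{1}oppr0 -[z in LHS]opprK -oppr_min.
rewrite !E -opprD normrN (le_trans (mL _ _ _))// -opprD normrN; exact: mL.
Qed.

Section reconstruction.
Context (R : realType) (m M N q : nat) (x t : nat -> R) (T : R).
Local Notation V := 'cV[R]_m.
Context (U K : set V) (w : V -> V -> V) (F : (R -> V) -> R -> V) (uh : nat -> R -> V)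
  (p d sigma r : nat) (ut ust : R -> R -> V).
Hypotheses (gx : grid (-1) 1 M x) (gt : grid 0 T N t) (T0 : 0 < T).
Hypotheses (iw : intermediate_state U w) (cK : forall y, closure K y -> K y) (KU : K `<=` U).
Hypothesis tr : temporal_reconstruction M x q N t F uh p d sigma r ut.
Hypothesis st : spacetime_reconstruction M x q T w ut ust.
Hypothesis Kut : forall s y, 0 <= s <= T -> in_cells M x y -> K (ut s y).

Let xx i : (i < M)%N -> x i < x i.+1. Proof. by case: gx => _ _; apply. Qed.

Let slab n : (n < N)%N -> exists2 c : nat -> R -> V, (forall k, pwpoly M x q.+1 (c k)) &
  exists l, forall s y, t n <= s <= t n.+1 -> in_cells M x y -> ut s y = time_poly c l s y.
Proof.
move=> nN; have [mult [P [_ [[c pc PE] _] utP]]] := tr nN.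
by exists c => //; exists (\sum_(j < N.+1) mult j)%N => s y sI yI; rewrite utP// PE.
Qed.

Let time_polyE (c : nat -> R -> V) l s y j :
  time_poly c l s y j ord0 = \sum_(k < l) s ^+ k * c k y j ord0.
Proof. by rewrite summxE; apply: eq_bigr => k _; rewrite mxE. Qed.

Lemma ut_pwpoly s : 0 <= s <= T -> pwpoly M x q.+1 (ut s).
Proof.
move=> sT i iM j; have [n nN sn] := grid_closed_cell gt T0 sT.
have [c pc [l utE]] := slab nN.
have H k : exists P : {poly R}, (size P <= q.+1)%N /\
    forall y, x i < y < x i.+1 -> c k y j ord0 = P.[y].
  by have [P sP PE] := pc k i iM j; exists P.
exists (\sum_(k < l) s ^+ k *: sval (cid (H k))).
  apply: (big_ind (fun P : {poly R} => size P <= q.+1)%N) => [|P Q sP sQ|k _].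
  - by rewrite size_poly0.
  - by rewrite (leq_trans (size_polyD _ _))// geq_max sP.
  - by rewrite (leq_trans (size_scale_leq _ _))//; case: (svalP (cid (H k))).
move=> y yI; rewrite utE//; last by exists i.
rewrite time_polyE horner_sum; apply: eq_bigr => k _; rewrite hornerZ.
by case: (svalP (cid (H k))) => _ ->.
Qed.

Lemma ut_lip y j : in_cells M x y -> lip_on 0 T (fun s => ut s y j ord0).
Proof.
move=> yI; have [t0 tN _] := gt.
suff H n : (n <= N)%N -> lip_on 0 (t n) (fun s => ut s y j ord0) by rewrite -tN; exact: H.
elim: n => [_|n IH nN].
  by rewrite t0; exists 0 => // s s' /le_anti <- /le_anti <-; rewrite !subrr normr0 mulr0.
apply: (@lip_glue _ 0 (t n)) => //.
- by rewrite (grid_ge gt)// ltnW.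
- by rewrite (grid_le gt).
- by apply: IH; exact: ltnW.
have [c pc [l utE]] := slab nN.
apply: (lip_ext _ (lip_sum (index_enum 'I_l) xpredT
  (fun k : 'I_l => lipM (lipX k (lip_id _ _)) (lip_cst _ _ (c k y j ord0))))) => s sI.
by rewrite utE// time_polyE.
Qed.

(** On a cell, the temporal reconstruction is a polynomial whose coefficients
    are Lipschitz in time, being combinations of values at fixed points. *)
Let ut_cell i : (i < M)%N -> exists P : 'I_m -> R -> {poly R},
  [/\ forall j s, (size (P j s) <= q.+2)%N, forall j k, lip_on 0 T (fun s => (P j s)`_k) &
    forall s, 0 <= s <= T -> forall y, x i < y < x i.+1 -> forall j, ut s y j ord0 = (P j s).[y]].
Proof.
move=> iM; have [z [A [zI AP]]] := @coefficients_from_values R q.+1 _ _ (xx iM).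
exists (fun j s => \poly_(k < q.+1) \sum_i ut s (z i) j ord0 * A i k); split.
- by move=> j s; rewrite (leq_trans (size_poly _ _)).
- move=> j k; have [kq|kq] := ltnP k q.+1; last first.
    by apply: (lip_ext _ (lip_cst _ _ 0)) => s _; rewrite coef_poly ltnNge kq.
  apply: (lip_ext _ (lip_sum (index_enum 'I_q.+1) xpredT
    (fun i' : 'I_q.+1 => lipM (@ut_lip (z i') j (ex_intro2 _ _ i iM (zI i'))) (lip_cst _ _ (A i' k))))).
  by move=> s _; rewrite coef_poly kq.
- move=> s sT y yI j; have [Q sQ QE] := ut_pwpoly sT iM j.
  rewrite QE//; congr (_.[y]); apply/polyP => k; rewrite coef_poly.
  case: ltnP => kq; last by rewrite nth_default// (leq_trans sQ).
  by rewrite (AP Q sQ k kq); apply: eq_bigr => i' _; rewrite QE.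
Qed.

Let eval_lip (P : R -> {poly R}) n z : (forall s, (size (P s) <= n)%N) ->
  (forall k, lip_on 0 T (fun s => (P s)`_k)) -> lip_on 0 T (fun s => (P s).[z]).
Proof.
move=> sP PL; apply: (lip_ext _ (lip_sum (index_enum 'I_n) xpredT
  (fun k : 'I_n => lipM (lip_cst 0 T (z ^+ k)) (PL k)))) => s _.
by rewrite (small_poly_eval _ (sP s)).
Qed.

Let node k := if k == M then 0%N else k.
Let W k s := w (trace_left M x (ut s) (node k)) (trace_right x (ut s) (node k)).

Let node_lt k : (k <= M)%N -> (node k < M)%N.
Proof.
have M0 : (0 < M)%N by apply: (grid_gt0 gx); lra.
by move=> kM; rewrite /node; case: eqP => // /eqP kM'; rewrite ltn_neqAle kM'.
Qed.

Let closed_near (G : set_system R) {PG : ProperFilter G} (v : R -> V) (l : V) :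
  (\forall y \near G, K (v y)) -> v y @[y --> G] --> l -> K l.
Proof.
move=> Kv vl; apply: cK => B nB; have := vl B nB => vB.
by have [y [Ky By]] := filter_ex (filterI Kv vB); exists (v y).
Qed.

Let W_lip k j : (k <= M)%N -> lip_on 0 T (fun s => W k s j ord0).
Proof.
move=> kM; have kM' := node_lt kM; set n := node k in kM' *.
have [Pr [sPr lPr PrE]] := ut_cell kM'.
pose n' := if n == 0%N then M else n.
have n'0 : (0 < n')%N.
  rewrite lt0n /n'; case: ifP => [_|/negbT//]; rewrite -lt0n.
  by apply: (grid_gt0 gx); lra.
have n'M : (n'.-1 < M)%N by rewrite prednK// /n'; case: ifP => // _; exact: ltnW.
have [Pl [sPl lPl PlE]] := ut_cell n'M.
have cr s (sT : 0 <= s <= T) := cvg_trace_right gx kM' (PrE s sT).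
have cl s : 0 <= s <= T -> ut s y @[y --> (x n')^'-] --> (\col_j (Pl j s).[x n'] : V).
  by move=> sT; have := cvg_trace_left gx n'M (PlE s sT); rewrite prednK.
have tr_r s : 0 <= s <= T -> trace_right x (ut s) n = \col_j (Pr j s).[x n].
  by move=> sT; apply: cvg_lim => //; exact: cr.
have tr_l s : 0 <= s <= T -> trace_left M x (ut s) n = \col_j (Pl j s).[x n'].
  move=> sT; by apply: cvg_lim => //; exact: cl.
apply: (@lip_ext _ _ _ (fun s => w (\col_j (Pl j s).[x n']) (\col_j (Pr j s).[x n]) j ord0)).
  by move=> s sT; rewrite /W -/n tr_r// tr_l.
apply: (intermediate_state_lip (ltW T0) iw).
- move=> j'; apply: (lip_ext _ (eval_lip (x n') (sPl j') (lPl j'))) => s _; by rewrite mxE.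
- move=> j'; apply: (lip_ext _ (eval_lip (x n) (sPr j') (lPr j'))) => s _; by rewrite mxE.
move=> s sT; split; apply: KU.
  apply: (closed_near _ (cl s sT)) => //.
  by have := near_left_cell gx n'M (fun y => @Kut s y sT); rewrite prednK.
apply: (closed_near _ (cr s sT)) => //.
by have := near_right_cell gx kM' (fun y => @Kut s y sT).
Qed.

(** The orthogonality condition is tested with a monomial on one cell and one
    component. *)
Let moments s i l j (P Q : {poly R}) : 0 <= s <= T -> (i < M)%N -> (l < q)%N ->
  (size P <= q.+2)%N -> (size Q <= q.+2)%N ->
  (forall y, x i < y < x i.+1 -> ust s y j ord0 = P.[y]) ->
  (forall y, x i < y < x i.+1 -> ut s y j ord0 = Q.[y]) ->
  \sum_(k < q.+2) P`_k * moment (x i) (x i.+1) k l =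
  \sum_(k < q.+2) Q`_k * moment (x i) (x i.+1) k l.
Proof.
move=> sT iM lq sP sQ PE QE; have [_ orth _] := st sT.
pose psi y : V := (if x i < y < x i.+1 then y ^+ l else 0) *: basisv R j.
have ppsi : pwpoly M x q psi.
  move=> i' i'M j'; have [->|ii'] := eqVneq i' i.
    exists ((j' == j)%:R *: 'X^l) => [|y yI].
      by rewrite (leq_trans (size_scale_leq _ _))// size_polyXn.
    by rewrite !mxE yI eqxx andbT hornerZ hornerXn mulrC.
  exists 0 => [|y yI]; first by rewrite size_poly0.
  have cl (a b c : R) : a < c < b -> a <= c < b by move=> /andP[/ltW -> ->].
  rewrite mxE horner0; case: ifPn => [h|_]; last by rewrite mul0r.
  by move/eqP: ii'; case; exact: (grid_unique gx i'M iM (cl _ _ _ yI) (cl _ _ _ h)).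
have ab := xx iM; set a := x i in ab *; set b := x i.+1 in ab *.
have a1 : -1 <= a by exact: (grid_ge gx (ltnW iM)).
have b1 : b <= 1 by exact: (grid_le1 gx iM).
pose D := P - Q; have sD : (size D <= q.+2)%N.
  by rewrite (leq_trans (size_polyD _ _))// geq_max sP size_polyN.
pose h y := (D * 'X^l).[Num.max a (Num.min b y)].
have bh : bm h.
  by apply: (@bm_clamp R a b (fun y => (D * 'X^l).[y]) (ltW ab)); exact: continuous_horner.
pose f y := if y \in `]a, b[%classic then h y else 0.
have bf : bm f by apply: bm_if => //; exact: bm_cst.
have inE' y : (y \in `]a, b[%classic) = (a < y < b) by rewrite mem_setE in_itv.
have E1 : Int (-1) 1 f = 0.
  rewrite -[RHS](orth psi ppsi); apply: eq_Int => y yI.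
  rewrite /f inE' /psi -/a -/b; case: ifPn => yab.
    rewrite dotC dotZl dotC dot_basis mxE [X in _ + X]mxE PE// QE// /h.
    have /andP[ay yb] := yab.
    by rewrite (min_r (ltW yb)) (max_r (ltW ay)) /D hornerM hornerXn !hornerE mulrC.
  by rewrite scale0r dotC -(scale0r (0 : V)) dotZl mul0r.
have E2 : Int (-1) 1 f = Int a b f.
  rewrite (Int_chasles bf a1 (le_trans (ltW ab) b1)) (Int_chasles bf (ltW ab) b1).
  rewrite (Int_zero (f := f) (a := -1) (b := a)) ?add0r.
    rewrite (Int_zero (f := f) (a := b) (b := 1)) ?addr0// => y /andP[y1 _].
    by rewrite /f inE' [y < b]ltNge y1 andbF.
  by move=> y /andP[_ y1]; rewrite /f inE' [a < y]ltNge y1.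
have E3 : Int a b f = Int a b h.
  apply: ae_eq_Int => //; apply: (ae_imp (ae_and (ae_neq a) (ae_neq b))).
  move=> y [/eqP ya /eqP yb] /andP[ay yb']; rewrite /f inE'.
  have ay' : a < y by rewrite lt_neqAle ay andbT eq_sym.
  have yb'' : y < b by rewrite lt_neqAle yb' andbT.
  by rewrite ay' yb''.
have E4 : Int a b h = Int a b (fun y => D.[y] * ('X^l : {poly R}).[y]).
  by apply: eq_Int => y /andP[ay yb]; rewrite /h min_r// max_r// hornerM.
have sl : (size ('X^l : {poly R}) <= l.+1)%N by rewrite size_polyXn.
have := Int_poly_mul ab sD sl; rewrite -E4 -E3 -E2 E1.
rewrite (bigD1 ord_max)//= [X in _ + X]big1 => [|k kl].
  rewrite coefXn eqxx mul1r addr0 => E; apply/eqP; rewrite -subr_eq0; apply/eqP.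
  by rewrite [RHS]E -sumrB; apply: eq_bigr => k _; rewrite coefB mulrBl.
by rewrite coefXn eqn_leq (ltn_geF (_ : (k < l)%N)) ?andbF ?mul0r// ltn_neqAle kl -ltnS ltn_ord.
Qed.

Let ust_cell i : (i < M)%N -> exists c : nat -> 'I_m -> R -> R,
  (forall k j, lip_on 0 T (c k j)) /\
  forall s, 0 <= s <= T -> forall j,
  [/\ forall y, x i < y < x i.+1 -> ust s y j ord0 = \sum_(k < q.+2) y ^+ k * c k j s,
     \sum_(k < q.+2) x i ^+ k * c k j s = W i s j ord0 &
     \sum_(k < q.+2) x i.+1 ^+ k * c k j s = W i.+1 s j ord0].
Proof.
move=> iM; have ab := xx iM.
have [P [sP lP PE]] := ut_cell iM.
have [A [A1 [A2 AP]]] := @coefficients_from_moments R _ _ ab q.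
pose mo j s l := \sum_(k < q.+2) (P j s)`_k * moment (x i) (x i.+1) k l.
exists (fun k j s => \sum_(l < q) mo j s l * A l k + W i s j ord0 * A1 k + W i.+1 s j ord0 * A2 k).
split=> [k j|s sT j].
  apply: lipD; last by apply: lipM; [apply: W_lip|exact: lip_cst].
  apply: lipD; last by apply: lipM; [apply: W_lip; exact: ltnW|exact: lip_cst].
  apply: lip_sum => l; apply: lipM; last exact: lip_cst.
  by apply: lip_sum => k'; apply: lipM; [exact: lP|exact: lip_cst].
have [pst _ trW] := st sT.
have [Q [sQ QE]] := pwpoly_cell pst iM.
have Wr : (Q j).[x i] = W i s j ord0.
  have iE : node i = i by rewrite /node ltn_eqF.
  have [_ E] := trW i iM; rewrite /W iE -E /trace_right.
  by rewrite (cvg_lim _ (cvg_trace_right gx iM QE))// mxE.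
have Wl : (Q j).[x i.+1] = W i.+1 s j ord0.
  have iE : (if node i.+1 == 0%N then M else node i.+1) = i.+1.
    by rewrite /node; case: (eqVneq i.+1 M) => [->|].
  have [E _] := trW (node i.+1) (node_lt iM); rewrite /W -E /trace_left iE.
  by rewrite (cvg_lim _ (cvg_trace_left gx iM QE))// mxE.
have cE k : (k < q.+2)%N -> \sum_(l < q) mo j s l * A l k + W i s j ord0 * A1 k
    + W i.+1 s j ord0 * A2 k = (Q j)`_k.
  move=> kq; rewrite (AP _ (sQ j) k kq) Wr Wl; congr (_ + _ + _).
  apply: eq_bigr => l _; congr (_ * _).
  by rewrite /mo; apply/esym/(moments sT iM (ltn_ord l) (sQ j) (sP j s)) => y yI; rewrite ?QE ?PE.
have ev y : \sum_(k < q.+2) y ^+ k * (\sum_(l < q) mo j s l * A l k + W i s j ord0 * A1 k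
    + W i.+1 s j ord0 * A2 k) = (Q j).[y].
  by rewrite (small_poly_eval _ (sQ j)); apply: eq_bigr => k _; rewrite cE.
by split => [y yI||]; rewrite ev// QE.
Qed.

(** On each cell the coefficients are fixed linear combinations of moments of
    the temporal reconstruction and of intermediate states, all of which are
    Lipschitz in time. Both traces at a node equal the same intermediate state,
    so that the pieces match. Times outside the interval are projected on it. *)
Theorem reconstruction_coefficients : exists (C : R) (c : nat -> nat -> 'I_m -> R -> R),
  [/\ 0 < C, (forall i k j s, `|c i k j s| <= C) /\
     (forall i k j s s', `|c i k j s - c i k j s'| <= C * `|s - s'|),
     (forall i s, (i.+1 < M)%N -> piece q.+2 c i s (x i.+1) = piece q.+2 c i.+1 s (x i.+1)) /\
     (forall s, piece q.+2 c M.-1 s 1 = piece q.+2 c 0 s (-1)),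
     (forall i s y, 0 <= s <= T -> (i < M)%N -> x i < y < x i.+1 -> ust s y = piece q.+2 c i s y) &
     forall s, exists2 s', 0 <= s' <= T & forall i y, piece q.+2 c i s y = piece q.+2 c i s' y].
Proof.
have H i : exists c : nat -> 'I_m -> R -> R, (i < M)%N ->
  (forall k j, lip_on 0 T (c k j)) /\
  forall s, 0 <= s <= T -> forall j,
  [/\ forall y, x i < y < x i.+1 -> ust s y j ord0 = \sum_(k < q.+2) y ^+ k * c k j s,
     \sum_(k < q.+2) x i ^+ k * c k j s = W i s j ord0 &
     \sum_(k < q.+2) x i.+1 ^+ k * c k j s = W i.+1 s j ord0].
  have [iM|iM] := boolP (i < M)%N; last by exists (fun _ _ _ => 0).
  by have [c cP] := ust_cell iM; exists c.
have [e eP] := choice H.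
have [|C C0 CP] := @lip_uniform R ('I_M * 'I_q.+2 * 'I_m)%type 0 T (fun a => e a.1.1 a.1.2 a.2).
  by move=> a; have [h _] := eP a.1.1 (ltn_ord _); exact: h.
pose clamp s := Num.max 0 (Num.min T s).
have clT s : 0 <= clamp s <= T by rewrite /clamp le_max lexx ge_max ge_min lexx (ltW T0).
have clE s : 0 <= s <= T -> clamp s = s by move=> /andP[h1 h2]; rewrite /clamp min_r// max_r.
have clL := clamp_lipschitz (ltW T0).
pose c i k j s := if ((i < M) && (k < q.+2))%N then e i k j (clamp s) else 0.
have pcE i s y j : (i < M)%N ->
    piece q.+2 c i s y j ord0 = \sum_(k < q.+2) y ^+ k * e i k j (clamp s).
  by move=> iM; rewrite mxE; apply: eq_bigr => k _; rewrite /c iM ltn_ord.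
have M0 : (0 < M)%N by apply: (grid_gt0 gx); lra.
have [x0 xM _] := gx.
exists C, c; split => //.
- split=> [i k j s|i k j s s']; rewrite /c.
    case: ifPn => [/andP[iM kq]|_]; last by rewrite normr0 ltW.
    by have [h _] := CP (Ordinal iM, Ordinal kq, j); exact: h.
  case: ifPn => [/andP[iM kq]|_]; last by rewrite subrr normr0 mulr_ge0// ltW.
  have [_ h] := CP (Ordinal iM, Ordinal kq, j).
  by apply: (le_trans (h _ _ (clT s) (clT s'))); rewrite ler_wpM2l ?(ltW C0)//; exact: clL.
- split=> [i s iM|s]; apply/matrixP => j l; rewrite (ord1 l) {l}.
    have [_ /(_ _ (clT s) j)[_ _ h1]] := eP i (ltnW iM).
    have [_ /(_ _ (clT s) j)[_ h2 _]] := eP i.+1 iM.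
    by rewrite !pcE ?(ltnW iM)// h1 h2.
  have MM : (M.-1 < M)%N by rewrite prednK.
  have [_ /(_ _ (clT s) j)[_ _ h1]] := eP M.-1 MM.
  have [_ /(_ _ (clT s) j)[_ h2 _]] := eP 0%N M0.
  rewrite !pcE// -x0 h2 -xM; move: h1; rewrite prednK// => ->.
  by rewrite /W /node eqxx; case: eqP M0.
- move=> i s y sT iM yI; apply/matrixP => j l; rewrite (ord1 l) {l} pcE// clE//.
  by have [_ /(_ _ sT j)[h _ _]] := eP i iM; exact: h.
- move=> s; exists (clamp s) => // i y; apply/matrixP => j l; rewrite !mxE.
  by apply: eq_bigr => k _; rewrite /c (clE (clamp s)).
Qed.

End reconstruction.

(** * From entropy solutions to representatives with values in the compact set *)

Section product_null_sets.
Context (R : realType).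
Local Notation mu := (@lebesgue_measure R).
Local Notation mu2 := (mu \x mu)%E.

Lemma ae_slices (P : R * R -> Prop) : {ae mu2, forall z, P z} ->
  {ae mu, forall s, {ae mu, forall y, P (s, y)}}.
Proof.
move=> [N [mN N0 sub]].
have mf : measurable_fun setT (mu \o xsection N) by exact: measurable_fun_xsection.
have H : ae_eq mu setT (mu \o xsection N) (cst 0%E).
  apply/(ae_eq_integral_abs mu measurableT mf).
  rewrite -[RHS]N0; apply: eq_integral => s _.
  by rewrite gee0_abs.
apply: (ae_imp H) => s /(_ I) Hs; exists (xsection N s); split => //.
  exact: measurable_xsection.
by move=> y nP; rewrite /xsection /= inE; apply: sub.
Qed.

Lemma ae_fst (P : R -> Prop) : {ae mu, forall s, P s} -> {ae mu2, forall z, P z.1}.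
Proof.
move=> [N [mN N0 sub]]; exists (N `*` setT); split.
- exact: measurableX.
- by rewrite product_measure1E// [X in (X * _)%E]N0 mul0e.
- by move=> [s y] nP; split => //; exact: sub.
Qed.

Lemma ae_snd (P : R -> Prop) : {ae mu, forall s, P s} -> {ae mu2, forall z, P z.2}.
Proof.
move=> [N [mN N0 sub]]; exists (setT `*` N); split.
- exact: measurableX.
- by rewrite product_measure1E// [X in (_ * X)%E]N0 mule0.
- by move=> [s y] nP; split => //; exact: sub.
Qed.

Lemma measurable_spacetime (T : R) : measurable (spacetime T).
Proof. by apply: measurableX; [exact: measurable_itv|exact: measurable_torus]. Qed.

Lemma Rintegral_spacetime (T : R) (F : R * R -> R) : bm F ->
  \int[mu2]_(z in spacetime T) F z = Int 0 T (fun s => Int (-1) 1 (fun y => F (s, y))).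
Proof.
move=> bF; have m11 : (-1 : R) <= 1 by lra.
have oo_lty : (mu `]0%R, T[%classic < +oo)%E.
  by rewrite lebesgue_measure_itv/=; case: ifP => // _; rewrite -EFinD ltry.
rewrite Rintegral_prod//.
- have bI : bm (fun s => \int[mu]_(y in torus R) F (s, y)) by exact: (bm_Int m11 bF).
  rewrite Rintegral_itv_bndo_bndc.
    rewrite Rintegral_itv_obnd_cbnd//.
    by apply: bm_integrable => //; exact: leb_itvoc_lty.
  apply: bm_integrable => //; exact: oo_lty.
- exact: measurable_torus.
- exact: leb_itv_lty.
Qed.

End product_null_sets.

Section representatives.
Context (R : realType) (m : nat) (T : R).
Local Notation V := 'cV[R]_m.
Local Notation mu := (@lebesgue_measure R).
Local Notation mu2 := (mu \x mu)%E.
Context (K U : set V) (g : V -> V) (eta Q : V -> R) (u0 : R -> V) (u : R -> R -> V).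
Hypotheses (T0 : 0 < T) (cK : compact K) (vK : convexK K) (K0 : K !=set0).
Hypotheses (cg : forall j, cont_at_points K (fun a => g a j ord0)) (ceta : cont_at_points K eta).
Hypothesis es : entropy_solution T U g eta Q u0 u.
Hypothesis iu0 : forall j, mu.-integrable (torus R) (fun y => (u0 y j ord0)%:E).
Hypothesis uK : {ae mu2, forall z : R * R, spacetime T z -> K (u z.1 z.2)}.
Local Notation pi := (proj cK vK K0).

Let pi_id a : K a -> pi a = a.
Proof.
move=> Ka; apply/eqP; rewrite eq_sym -subr_eq0; apply/eqP/dot_eq0/eqP.
by rewrite eq_le dot_ge0 andbT; exact: proj_le.
Qed.

Let pi_bm d (X : measurableType d) (F : X -> V) j :
  (forall i, measurable_fun setT (fun x => F x i ord0)) -> bm (fun x => pi (F x) j ord0).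
Proof.
move=> mF; split.
  by apply: (@measurable_comp_continuous R m _ _ F (fun a => pi a j ord0)) => // x; exact: proj_continuous.
have [C CP] := compact_coord_bound cK; exists C => x.
by rewrite (le_trans (coord_le_enorm _ _))// CP//; exact: projK.
Qed.

Let w (z : R * R) : V := pi (if z \in spacetime T then u z.1 z.2 else 0).

Let Kw z : K (w z). Proof. exact: projK. Qed.

Let bw j : bm (fun z => w z j ord0).
Proof.
apply: pi_bm => i; have [[mu_ _] _ _ _] := es.
have := mu_ i => /(measurable_restrictT _ (measurable_spacetime T)).
rewrite (_ : _ \_ _ = fun z => (if z \in spacetime T then u z.1 z.2 else 0) i ord0)//.
by apply/funext => z; rewrite /patch; case: ifP => // _; rewrite mxE.
Qed.

Let uw2 : {ae mu2, forall z : R * R, spacetime T z -> u z.1 z.2 = w z}.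
Proof.
apply: (ae_imp uK) => z Hz zT; rewrite /w mem_set// pi_id//; exact: Hz.
Qed.

Let wsc : weakstar_continuous T u. Proof. by have [[]] := es. Qed.

Let boundT : exists B : R -> R, forall s, 0 <= s <= T ->
  {ae mu, forall y, torus R y -> enorm (u s y) <= B s}.
Proof.
have H s : exists B : R, 0 <= s <= T -> {ae mu, forall y, torus R y -> enorm (u s y) <= B}.
  have [sT|_] := boolP (0 <= s <= T); last by exists 0.
  by have [_ [B BP]] := wsc.1 s sT; exists B.
by have [B BP] := choice H; exists B.
Qed.

(** At each time [u] is essentially bounded, so that truncation at the essential
    bound only changes it on a null set. *)
Let bounded_version : exists u1 : R -> R -> V, (forall s j, bm (fun y => u1 s y j ord0)) /\
  forall s, 0 <= s <= T -> {ae mu, forall y, -1 <= y <= 1 -> u1 s y = u s y}.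
Proof.
have [B BP] := boundT.
pose res s j y : R := if y \in torus R then u s y j ord0 else 0.
pose u1 s y : V := \col_j (if 0 <= s <= T then Num.max (- `|B s|) (Num.min `|B s| (res s j y)) else 0).
exists u1; split => [s j|s sT].
  have [sT|sT] := boolP (0 <= s <= T); last first.
    rewrite (_ : (fun y => _) = cst 0); first exact: bm_cst.
    by apply/funext => y; rewrite mxE (negbTE sT).
  have mres : measurable_fun setT (res s j).
    have := (wsc.1 s sT).1 j => /(measurable_restrictT _ (@measurable_torus R)).
    by rewrite (_ : _ \_ _ = res s j).
  have b1 : bm (fun y : R => Num.max (- `|B s|) (Num.min `|B s| y)).
    apply: (@bm_clamp R _ _ id) => [|?]; last exact: cvg_id.
    by rewrite ge0_cp.
  have := bm_comp b1 mres; rewrite (_ : _ \o _ = fun y => u1 s y j ord0)//.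
  by apply/funext => y; rewrite mxE sT.
apply: (ae_imp (BP s sT)) => y By yI.
have yT : torus R y by rewrite /torus /= in_itv.
apply/matrixP => j l; rewrite (ord1 l) {l} mxE sT /res mem_set//.
have h : `|u s y j ord0| <= `|B s|.
  by rewrite (le_trans (coord_le_enorm _ _))// (le_trans (By yT))// ler_norm.
by move: h; rewrite ler_norml => /andP[h1 h2]; rewrite min_r// max_r.
Qed.

Let spacetimeP s y : 0 < s < T -> -1 <= y <= 1 -> spacetime T (s, y).
Proof. by move=> sT yI; split; rewrite /torus /= in_itv. Qed.

Let uw1 u1 : (forall s, 0 <= s <= T -> {ae mu, forall y, -1 <= y <= 1 -> u1 s y = u s y}) ->
  {ae mu, forall s, 0 <= s <= T -> {ae mu, forall y, -1 <= y <= 1 -> u1 s y = w (s, y)}}.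
Proof.
move=> u1E; apply: (ae_imp (ae_and (ae_slices uw2) (ae_and (ae_neq 0) (ae_neq T)))).
move=> s [Hs [/eqP s0 /eqP sT']] sT.
have sT2 : 0 < s < T.
  by case/andP: sT => h1 h2; rewrite !lt_neqAle h1 h2 sT' eq_sym s0.
apply: (ae_imp (ae_and Hs (u1E s sT))) => y [h1 h2] yI.
by rewrite h2//; apply: h1; exact: spacetimeP.
Qed.

Let cu1 u1 : (forall s, 0 <= s <= T -> {ae mu, forall y, -1 <= y <= 1 -> u1 s y = u s y}) ->
  forall phi : R -> V, (forall j, bm (fun y => phi y j ord0)) ->
  cont_on 0 T (fun s => Int (-1) 1 (fun y => dot (u1 s y) (phi y))).
Proof.
move=> u1E phi bphi.
have Iu s : 0 <= s <= T -> Int (-1) 1 (fun y => dot (u1 s y) (phi y)) =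
    \int[mu]_(y in torus R) dot (u s y) (phi y).
  move=> sT; apply: ae_eq_Rintegral_gen; first exact: measurable_torus.
  apply: (ae_imp (u1E s sT)) => y h yT; congr (dot _ _); apply: h.
  by move: yT; rewrite /torus /= in_itv.
have iphi i : mu.-integrable (torus R) (fun y => (phi y i ord0)%:E).
  by apply: (@bm_integrable _ _ _ mu); [exact: measurable_torus|exact: leb_itv_lty|exact: bphi].
have := wsc.2 phi iphi => /subspace_continuousP H t tT e e0.
have tI : `[0, T]%classic t by rewrite /= in_itv.
have := H t tI => /(@cvgrPdist_le R R R (within _ (nbhs t))) /(_ e e0).
rewrite near_withinE => /nbhs_ballP[d /= d0 Hd]; exists d => // s sT sd.
rewrite !Iu// distrC; apply: Hd; last by rewrite /= in_itv.
by rewrite -ball_normE /= distrC.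
Qed.

Let clamp01 (y : R) := Num.max (-1) (Num.min 1 y).
Let clampT (s : R) := Num.max 0 (Num.min T s).

Let bm_clampT Y k : tower Y -> bm (fun s => Y k (clampT s)).
Proof. by move=> tY; apply: (@bm_clamp R _ _ (Y k)); [exact: ltW|exact: tower_continuous]. Qed.

Let bm_clamp01 Y k : tower Y -> bm (fun s => Y k (clamp01 s)).
Proof. by move=> tY; apply: (@bm_clamp R _ _ (Y k)); [lra|exact: tower_continuous]. Qed.

Let clampTE s : 0 <= s <= T -> clampT s = s.
Proof. by move=> /andP[h1 h2]; rewrite /clampT min_r// max_r. Qed.

Let clamp01E s : -1 <= s <= 1 -> clamp01 s = s.
Proof. by move=> /andP[h1 h2]; rewrite /clamp01 min_r// max_r. Qed.

Let spacetime_clamp (z : R * R) : spacetime T z -> clampT z.1 = z.1 /\ clamp01 z.2 = z.2.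
Proof.
case; rewrite /torus /= !in_itv /= => /andP[/ltW h1 /ltW h2] h3.
by rewrite clampTE ?h1// clamp01E.
Qed.

Let bgw j : bm (fun z => g (w z) j ord0).
Proof. exact: (@bm_on_K R m K cK _ _ (fun a => g a j ord0) w). Qed.

Let weak_tensor j X Y : tower X -> vanishes_before T X -> periodic_tower Y ->
  Int 0 T (fun s => Int (-1) 1 (fun y =>
    w (s, y) j ord0 * (X 1%N s * Y 0%N y) + g (w (s, y)) j ord0 * (X 0%N s * Y 1%N y)))
  + \int[mu]_(y in torus R) (u0 y j ord0 * (X 0%N 0 * Y 0%N y)) = 0.
Proof.
move=> tX [T' T'T X0] [tY pY]; have [_ _ ws _] := es.
pose phi (z : R * R) : V := (X 0%N z.1 * Y 0%N z.2) *: basisv R j.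
have tphi : test_function T phi by exact: (tensor_test_function tX tY _ pY T'T X0).
rewrite -[RHS](ws phi tphi); congr (_ + _); last first.
  by apply: eq_Rintegral => y _; rewrite /phi dotC dotZl dotC dot_basis mulrC.
pose Fz z := w z j ord0 * (X 1%N (clampT z.1) * Y 0%N (clamp01 z.2))
  + g (w z) j ord0 * (X 0%N (clampT z.1) * Y 1%N (clamp01 z.2)).
have bF : bm Fz.
  have b2 k l : bm (fun z : R * R => X k (clampT z.1) * Y l (clamp01 z.2)).
    by apply: bmM; [exact: (bm_fst (bm_clampT k tX))|exact: (bm_snd (bm_clamp01 l tY))].
  by apply: bmD; apply: bmM.
transitivity (\int[mu2]_(z in spacetime T) Fz z).
  rewrite (Rintegral_spacetime T bF); apply: eq_Int => s sT; apply: eq_Int => y yI.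
  by rewrite /Fz /= clampTE// clamp01E.
apply: ae_eq_Rintegral_gen; first exact: measurable_spacetime.
apply: (ae_imp uw2) => z h zT; have [c1 c2] := spacetime_clamp zT.
rewrite /Fz c1 c2 (h zT) /phi (tensor_dt tX tY) (tensor_dx tX tY).
by rewrite ![dot _ (_ *: _)]dotC !dotZl ![dot (basisv R j) _]dotC !dot_basis; congr (_ + _); rewrite mulrC.
Qed.

(** The projection on [K] only changes the solution on null sets, both jointly
    in time and space, which gives [w'], and at each single time, which gives
    [v]. *)
Theorem representative : exists (v : R -> R -> V) (w' : R * R -> V),
  [/\ (forall s y, K (v s y)) /\ (forall z, K (w' z)),
     (forall s j, bm (fun y => v s y j ord0)) /\ (forall j, bm (fun z => w' z j ord0)),
     {ae mu, forall s, 0 <= s <= T -> {ae mu, forall y, -1 <= y <= 1 -> v s y = w' (s, y)}},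
     (forall s, 0 <= s <= T -> {ae mu, forall y, -1 <= y <= 1 -> v s y = u s y}) /\
     {ae mu, forall y, -1 <= y <= 1 -> v 0 y = u0 y} &
     [/\ forall phi : R -> V, (forall j, bm (fun y => phi y j ord0)) ->
           cont_on 0 T (fun s => Int (-1) 1 (fun y => dot (v s y) (phi y))),
         forall t j h c, 0 <= t <= T -> bm h -> Int (-1) 1 h = 0 ->
           Int (-1) 1 (fun y => (v t y j ord0 - v 0 y j ord0) * (c + Int (-1) y h)) =
           Int 0 t (fun s => Int (-1) 1 (fun y => g (w' (s, y)) j ord0 * h y)) &
         {ae mu, forall t, 0 < t < T ->
           Int (-1) 1 (fun y => eta (w' (t, y))) <= Int (-1) 1 (fun y => eta (v 0 y))}]].
Proof.
have [u1 [bu1 u1E]] := bounded_version.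
have uw := uw1 u1E; have cu := cu1 u1E.
have u1K := values_in_K T0 cK vK K0 Kw bu1 uw cu.
have law1 := weak_at_lipschitz T0 bw bgw bu1 uw cu iu0 weak_tensor.
have init := initial_value T0 bw bgw bu1 uw cu iu0 weak_tensor.
have z0T : 0 <= (0 : R) <= T by rewrite lexx ltW.
pose v s y := pi (u1 s y).
have v1 s : 0 <= s <= T -> {ae mu, forall y, -1 <= y <= 1 -> v s y = u1 s y}.
  by move=> sT; apply: (ae_imp (u1K s sT)) => y h yI; rewrite /v pi_id//; exact: h.
have vu s : 0 <= s <= T -> {ae mu, forall y, -1 <= y <= 1 -> v s y = u s y}.
  move=> sT; apply: (ae_imp (ae_and (v1 s sT) (u1E s sT))) => y [h1 h2] yI.
  by rewrite h1// h2.
have bv s j : bm (fun y => v s y j ord0) by apply: pi_bm => i; case: (bu1 s i).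
have v0 : {ae mu, forall y, -1 <= y <= 1 -> v 0 y = u0 y}.
  have Hi : {ae mu, forall y, forall j : 'I_m, -1 < y < 1 -> u0 y j ord0 = u1 0 y j ord0}.
    by apply: filter_forall => j; exact: init.
  apply: (ae_imp (ae_and (v1 0 z0T) (ae_and Hi (ae_and (ae_neq (-1)) (ae_neq 1))))).
  move=> y [h1 [h2 [/eqP n1 /eqP n2]]] yI; rewrite h1//.
  apply/matrixP => j l; rewrite (ord1 l) h2//.
  by case/andP: yI => h3 h4; rewrite !lt_neqAle h3 h4 n2 eq_sym n1.
exists v, w; split => //.
- by split => // s y; exact: projK.
- apply: (ae_imp uw) => s h sT.
  by apply: (ae_imp (ae_and (h sT) (v1 s sT))) => y [h1 h2] yI; rewrite h2// h1.
split.
- exact: cu1 vu.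
- move=> t j h c tT bh h0; rewrite -(law1 t j h c tT bh h0).
  apply: ae_eq_Rintegral_gen; first exact: measurable_itv.
  apply: (ae_imp (ae_and (v1 t tT) (v1 0 z0T))) => y [h1 h2] yI.
  have yI' : -1 <= y <= 1 by move: yI; rewrite /= in_itv.
  by rewrite h1// h2.
apply: (@entropy_decrease R T (fun z => eta (w z))); first exact: (@bm_on_K R m K cK _ _ eta w).
move=> X tX X0 [T' T'T XT]; have [_ _ _ we] := es.
pose Y (k : nat) (_ : R) : R := (k == 0%N)%:R.
have tY : tower Y by move=> k x; exact: is_derive_cst.
pose phi (z : R * R) : R := (X 0%N z.1 * Y 0%N z.2) *: (1 : R).
have pE z : phi z = X 0%N z.1 by rewrite /phi /Y /= mulr1 [_ *: _]mulr1.
have tphi : test_function T phi.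
  exact: (@tensor_test_function R X Y tX tY _ (1 : R) T T').
have phi0 z : 0 <= phi z by rewrite pE.
have dtE z : dt phi z = X 1%N z.1.
  by rewrite /phi (tensor_dt tX tY) /Y /= mulr1 [_ *: _]mulr1.
have dxE z : dx phi z = 0.
  by rewrite /phi (tensor_dx tX tY) /Y /= mulr0 scale0r.
have := we phi tphi phi0; congr (_ <= _ + _).
  pose Fz z := eta (w z) * X 1%N (clampT z.1).
  have bF : bm Fz.
    by apply: bmM; [exact: (@bm_on_K R m K cK _ _ eta w)|exact: (bm_fst (bm_clampT 1 tX))].
  transitivity (\int[mu2]_(z in spacetime T) Fz z).
    apply: ae_eq_Rintegral_gen; first exact: measurable_spacetime.
    apply: (ae_imp uw2) => z h zT; have [c1 c2] := spacetime_clamp zT.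
    by rewrite dtE dxE mulr0 addr0 /Fz c1 (h zT).
  rewrite (Rintegral_spacetime T bF); apply: eq_Int => s sT; apply: eq_Int => y yI.
  by rewrite /Fz /= clampTE.
transitivity (\int[mu]_(y in torus R) (X 0%N 0 * eta (v 0 y))).
  apply: ae_eq_Rintegral_gen; first exact: measurable_torus.
  apply: (ae_imp v0) => y h yT; have yI : -1 <= y <= 1 by move: yT; rewrite /torus /= in_itv.
  by rewrite pE /= h// mulrC.
rewrite mulrC; apply: IntZ.
by apply: (@bm_on_K R m K cK _ _ eta (v 0)) => // y; exact: projK.
Qed.

End representatives.

(** * Norms and residuals *)

Section norms.
Context (R : realType) (m : nat).
Local Notation V := 'cV[R]_m.
Local Notation mu := (@lebesgue_measure R).

Let sqr_poweR (a : \bar R) : (0 <= a -> a ^+ 2 = a `^ 2)%E.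
Proof.
case: a => [r||]//=; last by rewrite pnatr_eq0 /= mulyy.
by rewrite lee_fin => r0; rewrite powR_mulrn.
Qed.

Lemma EFin_Rintegral d (X : measurableType d) (nu : {measure set X -> \bar R}) D (F : X -> R) :
  measurable D -> (nu D < +oo)%E -> bm F ->
  (\int[nu]_(z in D) (F z)%:E)%E = (\int[nu]_(z in D) F z)%:E.
Proof.
move=> mD D1 bF; rewrite fineK//; apply: integrable_fin_num => //.
exact: bm_integrable.
Qed.

Lemma Lnorm2_sqr d (X : measurableType d) (nu : {measure set X -> \bar R}) D (f : X -> V)
    (F : X -> R) : measurable D -> (nu D < +oo)%E -> bm F ->
  {ae nu, forall z, D z -> enorm (f z) ^+ 2 = F z} ->
  ((Lnorm_on nu 2%:E D f) ^+ 2 = (\int[nu]_(z in D) F z)%:E)%E.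
Proof.
move=> mD D1 bF fF; rewrite sqr_poweR ?Lnorm_ge0// /Lnorm_on poweR_Lnorm ?pnatr_eq0//.
rewrite -EFin_Rintegral//.
transitivity (\int[nu]_(z in D) (enorm (f z) ^+ 2)%:E)%E.
  rewrite [RHS]integral_mkcond; apply: eq_integral => z _; rewrite /patch.
  case: ifP => _; last by rewrite /= normr0 powR0// pnatr_eq0.
  by rewrite /= ger0_norm ?enorm_ge0// powR_mulrn ?enorm_ge0.
by apply: ae_eq_integral_gen => //; apply: (ae_imp fF) => z h zD; rewrite h.
Qed.

(** The last hypothesis says that essential bounds are bounds, as holds for
    functions that are continuous on the cells. *)
Lemma Lnorm_oo (D : set R) (f : R -> V) (N : R) : measurable D -> 0 <= N ->
  {ae mu, forall y, D y -> enorm (f y) <= N} ->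
  (forall a, 0 <= a -> {ae mu, forall y, D y -> enorm (f y) <= a} -> N <= a) ->
  Lnorm_on mu +oo%E D f = N%:E.
Proof.
move=> mD N0 fN Nf; rewrite /Lnorm_on unlock.
have mT : (0 < mu [set: R])%E by rewrite -set_itvNyy lebesgue_measure_itv /= addye ?ltry ?lt0y//.
rewrite mT; apply/le_anti/andP; split.
  apply/ess_supP; apply: (ae_imp fN) => y h; rewrite /= /patch; case: ifPn => [yD|_].
    by rewrite /= ger0_norm ?enorm_ge0// lee_fin h//; move: yD; rewrite inE.
  by rewrite /= normr0 lee_fin.
set e := ess_sup _ _.
have e0 : (0 <= e)%E by apply: ess_sup_gee => //; apply/nearW => y /=.
have := @ess_sup_ge _ _ R mu (abse \o (EFin \o (fun z => enorm (f z))) \_ D).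
rewrite -/e; case: e e0 => [r r0 H| |]//; last by move=> _ _; exact: leey.
rewrite lee_fin; apply: Nf; first by rewrite -lee_fin.
apply: (ae_imp H) => y + yD; rewrite /= /patch mem_set//=.
by rewrite ger0_norm ?enorm_ge0.
Qed.

Lemma is_derive_coord (f : R -> V) (df : V) (y : R) :
  (forall j, is_derive (y : R) (1 : R) (fun z : R => f z j ord0) (df j ord0)) ->
  is_derive (y : R) (1 : R) f df.
Proof.
move=> H.
have D j := is_derive_scale_r (basisv R j) (H j).
have := @is_derive_sum R R V m (fun j z => f z j ord0 *: basisv R j) (y : R) (1 : R) _ D.
rewrite -cV_basis (_ : \sum_(i < m) _ = f)//.
by apply/funext => z; rewrite fct_sumE [RHS]cV_basis.
Qed.

Lemma derive1_coord (f : R -> V) (df : V) (y : R) :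
  (forall j, is_derive (y : R) (1 : R) (fun z : R => f z j ord0) (df j ord0)) ->
  derive1 f y = df.
Proof. by move=> /is_derive_coord D; rewrite derive1E; case: D. Qed.

(** Nothing is known of the values at the nodes and outside the torus, where
    zero is taken instead. *)
Lemma pwpoly_bm (M n : nat) (x : nat -> R) (v : R -> V) : grid (-1) 1 M x -> pwpoly M x n v ->
  exists v' : R -> V, (forall j, bm (fun y => v' y j ord0)) /\
    forall y, in_cells M x y -> v' y = v y.
Proof.
move=> gx pv.
have H i : exists P : 'I_m -> {poly R}, (i < M)%N ->
    forall y, x i < y < x i.+1 -> forall j, v y j ord0 = (P j).[y].
  have [iM|iM] := boolP (i < M)%N; last by exists (fun=> 0).
  by have [P [_ PE]] := pwpoly_cell pv iM; exists P.
have [P PE] := choice H.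
pose h i j (y : R) : R := if y \in `](x i), (x i.+1)[%classic
  then (P i j).[Num.max (-1) (Num.min 1 y)] else 0.
have hb i j : bm (h i j).
  apply: bm_if; [exact: measurable_itv| |exact: bm_cst].
  by apply: (@bm_clamp R _ _ (fun y => (P i j).[y])); [lra|exact: continuous_horner].
have hE i j y : h i j y = if x i < y < x i.+1 then (P i j).[Num.max (-1) (Num.min 1 y)] else 0.
  by rewrite /h mem_setE in_itv.
exists (fun y => \col_j \sum_(i < M) h i j y); split => [j|y yI].
  rewrite (_ : (fun y => _) = fun y => \sum_(i < M) h i j y); first exact: bm_sum.
  by apply/funext => y; rewrite mxE.
have [i iM yi] := yI; have /andP[y1 y2] := in_cells_torus gx yI.
apply/matrixP => j l; rewrite (ord1 l) mxE (bigD1 (Ordinal iM))//= big1 => [|k ki].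
  by rewrite addr0 hE yi (min_r (ltW y2)) (max_r (ltW y1)) (PE i iM y yi).
have cl (a b c : R) : a < c < b -> a <= c < b by move=> /andP[/ltW -> ->].
rewrite hE; case: ifPn => // yk; case/eqP: ki; apply: val_inj => /=.
exact: (grid_unique gx (ltn_ord k) iM (cl _ _ _ yk) (cl _ _ _ yi)).
Qed.

Lemma sqr_enorm_bm d (X : measurableType d) (f : X -> V) :
  (forall j, bm (fun z => f z j ord0)) -> bm (fun z => enorm (f z) ^+ 2).
Proof.
move=> bf; rewrite (_ : (fun z => _) = fun z => \sum_j f z j ord0 * f z j ord0).
  by apply: bm_sum => j; apply: bmM.
by apply/funext => z; rewrite enorm_sqr.
Qed.

Lemma sqr_enorm_add (a b : V) : enorm (a + b) ^+ 2 <= 2 * enorm a ^+ 2 + 2 * enorm b ^+ 2.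
Proof.
have h := ler_enormD a b; have a0 := enorm_ge0 a; have b0 := enorm_ge0 b.
have ab0 := enorm_ge0 (a + b).
have : enorm (a + b) ^+ 2 <= (enorm a + enorm b) ^+ 2 by rewrite lerXn2r ?nnegrE ?addr_ge0.
have := sqr_ge0 (enorm a - enorm b).
by rewrite sqrrB sqrrD; lra.
Qed.

End norms.

(** * The error estimate *)

Section estimate.
Context (R : realType) (m : nat).
Local Notation V := 'cV[R]_m.
Local Notation mu := (@lebesgue_measure R).
Local Notation mu2 := (mu \x mu)%E.
Context (U K : set V) (g : V -> V) (eta Q : V -> R) (Cg Clo Chi T : R).
Hypotheses (T0 : 0 < T) (oU : open U) (gC : Ck 2 U g) (eC : Ck 2 U eta) (QC : Ck 1 U Q).
Hypothesis pr : forall y, U y -> forall v, 'd eta y ('d g y v) = 'd Q y v.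
Hypotheses (cK : compact K) (vK : convexK K) (KU : K `<=` U).
Hypotheses (Cg0 : 0 < Cg) (Clo0 : 0 < Clo) (Clohi : Clo < Chi).
Hypothesis gb : forall v y, K y -> enorm (vec_hessian_form g y v) <= Cg * enorm v ^+ 2.
Hypothesis eb : forall v y, K y ->
  Clo * enorm v ^+ 2 <= qform (hessian eta y) v <= Chi * enorm v ^+ 2.
Context (M n : nat) (x : nat -> R) (C : R) (c : nat -> nat -> 'I_m -> R -> R).
Hypotheses (gx : grid (-1) 1 M x) (C0 : 0 < C).
Hypothesis cC : forall i k j s, `|c i k j s| <= C.
Hypothesis cL : forall i k j s s', `|c i k j s - c i k j s'| <= C * `|s - s'|.
Hypothesis glue : forall i s, (i.+1 < M)%N -> piece n c i s (x i.+1) = piece n c i.+1 s (x i.+1).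
Hypothesis periodic : forall s, piece n c M.-1 s 1 = piece n c 0 s (-1).
Hypothesis Kc : forall i s y, (i < M)%N -> x i < y < x i.+1 -> K (piece n c i s y).
Local Notation v := (glued M n x c).
Local Notation vy := (dglued M n x c).
Local Notation slope := (max_slope M n x c).
Context (vt : R -> R -> V).
Hypothesis bvt : forall j, bm (fun z : R * R => vt z.1 z.2 j ord0).
Hypothesis dvt : {ae mu, forall s, 0 < s < T -> forall y j,
    is_derive (s : R) (1 : R) (fun z : R => v z y j ord0) (vt s y j ord0)}.

Let Kclosed : forall y, closure K y -> K y.
Proof. by move=> y; rewrite -(closure_id K).1//; apply: compact_closed => //; exact: norm_hausdorff. Qed.

Lemma glued_states s y : K (v s y).
Proof. exact: (glued_in gx C0 cC glue periodic Kclosed Kc). Qed.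

Lemma residual_bm : bm (fun z : R * R => enorm (vt z.1 z.2 + jac_vec g (v z.1 z.2) (vy z.1 z.2)) ^+ 2).
Proof.
apply: sqr_enorm_bm => j.
rewrite (_ : (fun z => _) = fun z : R * R => vt z.1 z.2 j ord0
    + \sum_k vy z.1 z.2 k ord0 * jac g k j (v z.1 z.2)).
  apply: bmD => //; apply: bm_sum => k; apply: bmM; first exact: (dglued_bm n gx cC cL).
  apply: (@bm_on_K R m K cK _ _ (jac g k j) (fun z => v z.1 z.2)) => [y Ky|i|z].
  - exact: (jac_Kcontinuous oU gC KU).
  - exact: (glued_bm M n x cC cL).
  - exact: glued_states.
by apply/funext => z; rewrite !mxE.
Qed.

Let Cinfinite (F : 'I_m -> V -> R) : (forall j, Ck 1 U (F j)) -> exists2 L : R, 0 < L &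
  forall j a b, K a -> K b -> `|F j b - F j a| <= L * enorm (b - a).
Proof.
move=> FC; have H j : exists L : R, 0 < L /\ forall a b, K a -> K b -> `|F j b - F j a| <= L * enorm (b - a).
  by have [L L0 LP] := Klipschitz oU cK vK KU (FC j); exists L.
have [L LP] := choice H.
have L0 j : 0 <= L j by case: (LP j) => /ltW.
exists (1 + \sum_j L j); first by rewrite ltr_pwDl// sumr_ge0.
move=> j a b Ka Kb; have [_ h] := LP j.
by rewrite (le_trans (h _ _ Ka Kb))// ler_wpM2r ?enorm_ge0// (bigD1 j)//= addrCA lerDl addr_ge0// sumr_ge0.
Qed.

Section spacetime_function.
Context (ust : R -> R -> V).
Hypothesis ustv : forall s y, 0 <= s <= T -> in_cells M x y -> ust s y = v s y.

Let near_cells i y : (i < M)%N -> x i < y < x i.+1 -> \forall z \near y, in_cells M x z.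
Proof.
move=> iM yI; have : \forall z \near y, z \in `](x i), (x i.+1)[.
  by apply: near_in_itvoo; rewrite in_itv.
by apply: filterS => z; rewrite in_itv /= => zI; exists i.
Qed.

Lemma derive1_glued s y : 0 <= s <= T -> in_cells M x y -> derive1 (ust s) y = vy s y.
Proof.
move=> sT [i iM yI]; apply: derive1_coord => j.
apply: (@is_derive_near_eq _ _ (fun z => v s z j ord0)); last exact: (@dglued_derive R m M n x c gx i s y iM yI j).
by apply: filterS (near_cells iM yI) => z zI; rewrite ustv.
Qed.

Lemma slope_norm s : 0 <= s <= T -> Lnorm_on mu +oo%E (torus R) (derive1 (ust s)) = (slope s)%:E.
Proof.
move=> sT; apply: Lnorm_oo; first exact: measurable_torus.
- exact: le_trans (enorm_ge0 _) (max_slopeP n gx C0 cC s 0).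
- apply: (ae_imp (ae_cells gx)) => y yc yT.
  rewrite derive1_glued//; first exact: (max_slopeP n gx C0 cC).
  by apply: yc; move: yT; rewrite /torus /= in_itv.
move=> a a0 H; apply: (@max_slope_ae R m M n x C c gx C0 cC s a a0).
apply: (ae_imp (ae_and H (ae_cells gx))) => y [h yc] yI.
by rewrite -derive1_glued//; [apply: h; rewrite /torus /= in_itv|exact: yc].
Qed.

(** The exceptional set is the union of the nodes and of the times at which some
    coefficient is not differentiable, hence a null set in space-time. *)
Lemma residual_ae t : t <= T -> {ae mu2, forall z : R * R, spacetime t z ->
  residual g ust z = vt z.1 z.2 + jac_vec g (v z.1 z.2) (vy z.1 z.2)}.
Proof.
move=> tT; apply: (ae_imp (ae_and (ae_fst dvt) (ae_snd (ae_cells gx)))).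
move=> [s y] /= [Ds cy] [] /=; rewrite /torus /= !in_itv /= => /andP[s0 st] yI.
have sT : 0 < s < T by rewrite s0 (lt_le_trans st).
have sT' : 0 <= s <= T by case/andP: sT => /ltW -> /ltW ->.
have yc := cy yI; have [i iM yi] := yc.
rewrite /residual /=; congr (_ + _).
  apply: derive1_coord => j; apply: (is_derive_near_eq _ (Ds sT y j)).
  have : \forall z \near s, z \in `]0, T[ by apply: near_in_itvoo; rewrite in_itv.
  by apply: filterS => z; rewrite in_itv /= => /andP[/ltW h1 /ltW h2]; rewrite ustv// h1.
apply: derive1_coord => j; rewrite mxE.
apply: (@is_derive_near_eq _ _ (fun z => g (v s z) j ord0)).
  by apply: filterS (near_cells iM yi) => z zI; rewrite ustv.
have gj := Ck_coord j oU (@Ck_le R V V 2 1 _ _ isT gC).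
apply: (Ck1_curve oU gj (c := v s) (dc := vy s y)); first exact: KU (glued_states _ _).
by move=> k; exact: (@dglued_derive R m M n x c gx i s y iM yi k).
Qed.

End spacetime_function.

Context (u : R -> R -> V) (w : R * R -> V).
Hypotheses (Ku : forall s y, K (u s y)) (Kw : forall z, K (w z)).
Hypotheses (bu : forall s j, bm (fun y => u s y j ord0)) (bw : forall j, bm (fun z => w z j ord0)).
Hypothesis uw : {ae mu, forall s, 0 <= s <= T -> {ae mu, forall y, -1 <= y <= 1 -> u s y = w (s, y)}}.
Hypothesis cu : forall phi : R -> V, (forall j, bm (fun y => phi y j ord0)) ->
  cont_on 0 T (fun s => Int (-1) 1 (fun y => dot (u s y) (phi y))).
Hypothesis law : forall t j h c, 0 <= t <= T -> bm h -> Int (-1) 1 h = 0 ->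
  Int (-1) 1 (fun y => (u t y j ord0 - u 0 y j ord0) * (c + Int (-1) y h)) =
  Int 0 t (fun s => Int (-1) 1 (fun y => g (w (s, y)) j ord0 * h y)).
Hypothesis decrease : {ae mu, forall t, 0 < t < T ->
  Int (-1) 1 (fun y => eta (w (t, y))) <= Int (-1) 1 (fun y => eta (u 0 y))}.

(** The relative entropy bound, for the entropy, the Jacobian and the potential
    at hand. *)
Lemma distance_to_glued t : 0 <= t <= T ->
  Int (-1) 1 (fun y => enorm (u t y - v t y) ^+ 2) <=
  Clo^-1 * (Int 0 t (fun s => Int (-1) 1 (fun y =>
      enorm (vt s y + jac_vec g (v s y) (vy s y)) ^+ 2))
    + Chi * Int (-1) 1 (fun y => enorm (u 0 y - v 0 y) ^+ 2))
  * expR (Int 0 t (fun s => (Chi ^+ 2 + Chi * Cg * slope s) / Clo)).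
Proof.
move=> tT.
have pC j : Ck 1 U (partial eta j) by exact: Ck_partial eC.
have [Lp Lp0 LpP] := Cinfinite pC.
have [Lq Lq0 LqP] := Klipschitz oU cK vK KU (kruzkov_C1 oU gC eC QC).
pose L := Lp + Lq.
have LL0 : 0 < L by rewrite addr_gt0.
pose Lt : R := m%:R * (#|{: 'I_M * 'I_n}|%:R * ((n%:R + 1) * C)).
pose Ly : R := m%:R * (n%:R * (n%:R * C)).
have Lt0 : 0 <= Lt by rewrite /Lt !mulr_ge0 ?addr_ge0// ltW.
have Ly0 : 0 <= Ly by rewrite /Ly !mulr_ge0// ltW.
pose D := 1 + Lt + Ly.
have D0 : 0 < D by rewrite /D -addrA ltr_pwDl// addr_ge0.
have LtD : Lt <= D by rewrite /D; move: Ly0; lra.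
have LyD : Ly <= D by rewrite /D; move: Lt0; lra.
have K2 (f : V -> R) k : Ck k U f -> cont_at_points K f.
  by move=> fC y Ky; exact: (Kcontinuous KU fC).
apply: (@relative_entropy_bound R m T T0 K cK eta (kruzkov g eta Q) (partial eta)
  (fun j a => g a j ord0) (fun k j a => hessian eta a k j) (jac g) Cg Clo Chi L
  Cg0 Clo0 Clohi LL0 _ _ _ _ _ _ _ _ _ _ _ v vy vt slope D D0 _ _ _ _ _ _ _ _ _ _ _ _ _ u w
  bu Ku bw Kw uw cu law decrease t tT).
- exact: K2 eC.
- by move=> j; exact: K2 (pC j).
- by move=> j; exact: K2 (Ck_coord j oU gC).
- by move=> k j y Ky; exact: (hessian_Kcontinuous eC KU).
- by move=> k j y Ky; exact: (jac_Kcontinuous oU gC KU).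
- by move=> j a b Ka Kb; rewrite (le_trans (LpP j a b Ka Kb))// ler_wpM2r ?enorm_ge0// lerDl ltW.
- by move=> a b Ka Kb; rewrite (le_trans (LqP a b Ka Kb))// ler_wpM2r ?enorm_ge0// lerDr ltW.
- by move=> a b Ka Kb; exact: (entropy_relative_bounds oU eC vK KU eb Ka Kb).
- by move=> j e de z; exact: (entropy_variable_curve oU eC KU).
- by move=> e de z; exact: (kruzkov_curve oU gC eC QC pr KU).
- by move=> a b et ey Ka Kb; exact: (entropy_dissipation oU gC eC QC pr vK KU Cg0 Clo0 Clohi gb eb).
- exact: glued_states.
- exact: (glued_bm M n x cC cL).
- exact: (dglued_bm n gx cC cL).
- exact: bvt.
- move=> s s' y; rewrite (le_trans (glued_lipschitz_time M n x C0 cL s s' y))//.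
  by rewrite ler_wpM2r.
- move=> s y y' yI yI'.
  rewrite (le_trans (glued_lipschitz_space gx C0 cC glue periodic s yI yI'))//.
  by rewrite ler_wpM2r.
- move=> s s' y; rewrite (le_trans (dglued_lipschitz_time n gx C0 cL s s' y))//.
  by rewrite ler_wpM2r.
- exact: (max_slopeP n gx C0 cC).
- exact: (max_slope_bm n gx C0 cC cL).
- exact: (@max_slope_continuous R m M n x C c gx C0 cC cL).
- exact: glued_periodic.
- move=> s; apply: (ae_imp (ae_cells gx)) => y yc /andP[/ltW y1 /ltW y2] j.
  have [|i iM yI] := yc; first by rewrite y1.
  exact: (@dglued_derive R m M n x c gx i s y iM yI j).
- by apply: (ae_imp dvt) => s h sT; apply/nearW => y _ j; exact: h.
Qed.

End estimate.

Lemma split_error (R : realFieldType) (a e b lo r X : R) : a <= 2 * e + 2 * b ->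
  e <= lo * r * X -> a <= 2 * b + 2 * lo * r * X.
Proof. by move=> H1 H2; rewrite -!mulrA -mulrDr mulrA; move: H1 H2; lra. Qed.

Theorem theorem3p1 (R : realType) (m : nat)
    (U : set 'cV[R]_m) (g : 'cV[R]_m -> 'cV[R]_m) (eta Q : 'cV[R]_m -> R)
    (T : R) (u0 : R -> 'cV[R]_m) (u : R -> R -> 'cV[R]_m)
    (M N q : nat) (x t : nat -> R)
    (w G : 'cV[R]_m -> 'cV[R]_m -> 'cV[R]_m)
    (f : (R -> 'cV[R]_m) -> R -> 'cV[R]_m)
    (p d sigma r L : nat)
    (Psi : ('I_L.+1 -> R) -> ('I_L -> R -> 'cV[R]_m) -> R -> 'cV[R]_m)
    (uh : nat -> R -> 'cV[R]_m) (ut ust : R -> R -> 'cV[R]_m)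
    (K : set 'cV[R]_m) (Cg Ceta_lo Ceta_hi : R) :
  let F := fun v y => - f v y in
  (* conservation law, entropy and entropy solution *)
  open U -> Ck 2 U g -> entropy_pair U g eta Q -> Ck 2 U eta ->
  0 < T ->
  (forall i, leb.-integrable (torus R) (fun y => (u0 y i ord0)%:E)) ->
  {ae leb, forall y, torus R y -> U (u0 y)} ->
  entropy_solution T U g eta Q u0 u ->
  (* fully discrete DG scheme *)
  grid (-1) 1 M x -> grid 0 T N t ->
  intermediate_state U w ->
  numerical_flux U g w (mesh_size M x) G ->
  dg_operator M x q U g G f ->
  (0 < L)%N -> time_stepping_order M x q U F r Psi ->
  computed_by M x q N t Psi uh ->
  (* reconstructions *)
  r = ((d + 2) * (p + 1) + sigma + 1)%N ->
  temporal_reconstruction M x q N t F uh p d sigma r ut ->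
  spacetime_reconstruction M x q T w ut ust ->
  (* compact convex set of states and constants *)
  compact K -> convex_set (K : set (convex_lmodType 'cV[R]_m)) -> K `<=` U ->
  (forall s y, 0 <= s <= T -> in_cells M x y -> K (ut s y)) ->
  (forall s y, 0 <= s <= T -> in_cells M x y -> K (ust s y)) ->
  0 < Cg -> 0 < Ceta_lo -> Ceta_lo < Ceta_hi ->
  (forall v y, K y -> enorm (vec_hessian_form g y v) <= Cg * enorm v ^+ 2) ->
  (forall v y, K y ->
     Ceta_lo * enorm v ^+ 2 <= qform (hessian eta y) v
       <= Ceta_hi * enorm v ^+ 2) ->
  {ae (leb \x leb)%E, forall z : R * R, spacetime T z -> K (u z.1 z.2)} ->
  forall n, (n <= N)%N ->
    ((Lnorm_on leb 2%:E (torus R) (fun y => (u (t n) y - uh n y)%R)) ^+ 2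
     <= 2%:E * (Lnorm_on leb 2%:E (torus R)
                  (fun y => (ust (t n) y - uh n y)%R)) ^+ 2
        + (2 * Ceta_lo^-1)%:E
          * ((Lnorm_on (leb \x leb) 2%:E (spacetime (t n)) (residual g ust)) ^+ 2
             + Ceta_hi%:E
               * (Lnorm_on leb 2%:E (torus R)
                    (fun y => (u0 y - ust 0 y)%R)) ^+ 2)
          * expeR (\int[leb]_(s in `]0%R, t n[)
                     (((Ceta_hi * Cg)%:E
                        * Lnorm_on leb +oo (torus R) (derive1 (ust s))
                       + (Ceta_hi ^+ 2)%:E) * (Ceta_lo^-1)%:E)))%E.
Proof.
move=> F oU gC ep eC T0 iu0 u0U es gx gt iw nf dg L0 tso cb rE tr st cK cvK KU Kut Kust
  Cg0 Clo0 Clohi gb eb uK n nN.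
have [_ QC _ pr] := ep; have vK := convexKE cvK.
have tT : 0 <= t n <= T by rewrite (grid_ge gt nN) (grid_le1 gt nN).
have n11 : (-1 : R) < 1 by lra.
have z0T : 0 <= (0 : R) <= T by rewrite lexx ltW.
have M0 := grid_gt0 gx n11.
have K0 : K !=set0.
  have x01 : x 0%N < x 1%N by case: gx => _ _; apply.
  exists (ut 0 ((x 0%N + x 1%N) / 2)); apply: Kut => //.
  by exists 0%N => //; move: x01; lra.
have Kclosed y : closure K y -> K y.
  by rewrite -(closure_id K).1//; apply: compact_closed => //; exact: norm_hausdorff.
have [C [c [C0 [cC cL] [gl per] ustE cl]]] :=
  reconstruction_coefficients gx gt T0 iw Kclosed KU tr st Kut.
have Kc i s y : (i < M)%N -> x i < y < x i.+1 -> K (piece q.+2 c i s y).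
  move=> iM yI; have [s' s'T E] := cl s.
  by rewrite E -(ustE i s' y s'T iM yI); apply: Kust => //; exists i.
pose v := glued M q.+2 x c.
have ustv s y : 0 <= s <= T -> in_cells M x y -> ust s y = v s y.
  move=> sT [i iM yI]; rewrite (ustE i s y sT iM yI) /v (@glued_cell R m M q.+2 x c gx i s y iM)//.
  by case/andP: yI => /ltW -> ->.
have [vt [bvt dvt]] := glued_time_derivative M q.+2 x T0 C0 cL.
have gj j : cont_at_points K (fun a => g a j ord0).
  by move=> y Ky; exact: (Kcontinuous KU (Ck_coord j oU gC)).
have cE : cont_at_points K eta by move=> y Ky; exact: (Kcontinuous KU eC).
have [u' [w' [[Ku Kw] [bu bw] uw [uu u00] [cu law dec]]]] :=
  representative T0 cK vK K0 gj cE es iu0 uK.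
have main := distance_to_glued T0 oU gC eC QC pr cK vK KU Cg0 Clo0 Clohi gb eb gx C0 cC cL
  gl per Kc bvt dvt Ku Kw bu bw uw cu law dec tT.
have [uh' [buh uhE]] := pwpoly_bm gx (cb.1 n nN).
have cells : {ae @lebesgue_measure R, forall y, torus R y -> in_cells M x y}.
  by apply: (ae_imp (ae_cells gx)) => y h; rewrite /torus /= in_itv; exact: h.
have toT y : torus R y -> -1 <= y <= 1 by rewrite /torus /= in_itv.
have bB (a b : R -> 'cV[R]_m) : (forall j, bm (fun y => a y j ord0)) ->
    (forall j, bm (fun y => b y j ord0)) -> bm (fun y => enorm (a y - b y) ^+ 2).
  move=> ba bb; apply: sqr_enorm_bm => j.
  rewrite (_ : (fun y => _) = fun y => a y j ord0 - b y j ord0); first exact: bmB.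
  by apply/funext => y; rewrite !mxE.
have bv s j : bm (fun y => v s y j ord0).
  exact: (@bm_slice1 R (fun z => v z.1 z.2 j ord0) s (glued_bm M q.+2 x cC cL j)).
have mtor := @measurable_torus R.
have ftor : (@lebesgue_measure R (torus R) < +oo)%E by exact: leb_itv_lty.
have EA f := @Lnorm2_sqr R m _ _ (@lebesgue_measure R) (torus R) f _ mtor ftor (bB (u' (t n)) uh' (bu (t n)) buh).
rewrite (EA (fun y => u (t n) y - uh n y)); last first.
  apply: (ae_imp (ae_and (uu _ tT) cells)) => y [h1 h2] yT.
  by rewrite (h1 (toT _ yT)) (uhE _ (h2 yT)).
have EB f := @Lnorm2_sqr R m _ _ (@lebesgue_measure R) (torus R) f _ mtor ftor (bB (v (t n)) uh' (bv (t n)) buh).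
rewrite (EB (fun y => ust (t n) y - uh n y)); last first.
  by apply: (ae_imp cells) => y h yT; rewrite (ustv _ _ tT (h yT)) (uhE _ (h yT)).
have ED f := @Lnorm2_sqr R m _ _ (@lebesgue_measure R) (torus R) f _ mtor ftor (bB (u' 0) (v 0) (bu 0) (bv 0)).
rewrite (ED (fun y => u0 y - ust 0 y)); last first.
  apply: (ae_imp (ae_and u00 cells)) => y [h1 h2] yT.
  by rewrite (ustv _ _ z0T (h2 yT)) (h1 (toT _ yT)).
have bR := residual_bm oU gC cK KU gx C0 cC cL gl per Kc bvt.
have fst_ : ((leb \x leb)%E (spacetime (t n)) < +oo :> \bar R)%E.
  apply: lebX_lty; [exact: measurable_itv|exact: measurable_torus| |exact: leb_itv_lty].
  by rewrite lebesgue_measure_itv /=; case: ifP => // _; rewrite -EFinD ltry.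
have tT' : t n <= T by case/andP: tT.
have ER := @Lnorm2_sqr R m _ _ (leb \x leb)%E (spacetime (t n)) (residual g ust) _
  (measurable_spacetime (t n)) fst_ bR.
rewrite ER; last first.
  have hr := residual_ae oU gC cK KU gx C0 cC gl per Kc dvt ustv tT'.
  apply: (@ae_imp R _ _ (leb \x leb)%E _ _ hr) => z h zT.
  by rewrite (h zT).
rewrite (Rintegral_spacetime (t n) bR).
pose k s := (Ceta_hi ^+ 2 + Ceta_hi * Cg * max_slope M q.+2 x c s) / Ceta_lo.
have bk : bm k.
  apply: bmM; last exact: bm_cst.
  apply: bmD; first exact: bm_cst.
  by apply: bmM; [exact: bm_cst|exact: (max_slope_bm q.+2 gx C0 cC cL)].
have EX : (\int[leb]_(s in `]0%R, t n[) (((Ceta_hi * Cg)%:E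
    * Lnorm_on leb +oo (torus R) (derive1 (ust s)) + (Ceta_hi ^+ 2)%:E)
    * (Ceta_lo^-1)%:E))%E = (Int 0 (t n) k)%:E.
  transitivity (\int[leb]_(s in `]0%R, t n[) (k s)%:E)%E.
    apply: eq_integral => s; rewrite inE /= in_itv /= => /andP[/ltW s0 /ltW stn].
    have sT : 0 <= s <= T by rewrite s0 (le_trans stn)//; case/andP: tT.
    rewrite (slope_norm gx C0 cC ustv sT) /k [X in X / _]addrC.
    reflexivity.
  have foo : (@lebesgue_measure R `]0%R, t n[%classic < +oo)%E.
    by rewrite lebesgue_measure_itv /=; case: ifP => // _; rewrite -EFinD ltry.
  rewrite EFin_Rintegral//; congr (_%:E).
  rewrite Rintegral_itv_bndo_bndc; last by apply: bm_integrable.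
  rewrite Rintegral_itv_obnd_cbnd//.
  by apply: bm_integrable => //; exact: leb_itvoc_lty.
rewrite EX.
have h1 : Int (-1) 1 (fun y => enorm (u' (t n) y - uh' y) ^+ 2) <=
    2 * Int (-1) 1 (fun y => enorm (u' (t n) y - v (t n) y) ^+ 2)
    + 2 * Int (-1) 1 (fun y => enorm (v (t n) y - uh' y) ^+ 2).
  have b1 := bB _ _ (bu (t n)) (bv (t n)); have b2 := bB _ _ (bv (t n)) buh.
  have b3 := bB _ _ (bu (t n)) buh.
  have c2 : bm (fun _ : R => 2 : R) by exact: bm_cst.
  rewrite -!IntZ// -IntD; [|exact: bmM|exact: bmM].
  apply: Int_le => //; first by apply: bmD; exact: bmM.
  move=> y _; rewrite -[u' (t n) y - uh' y](subrKA (v (t n) y)); exact: sqr_enorm_add.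
by have := split_error h1 main; rewrite -lee_fin; exact.
Qed.
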